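(* Let $K(\alpha)$, $\alpha\in I$, be a $\mathcal{C}^{r,r'}$ billiard deformation with $r,r'\ge2$, and let $\xi\in\Sigma$. Then for every $j\in\mathbb{Z}$, $u_j(\xi,\alpha)$ is $\mathcal{C}^{\min\{r-1,\,r'-1\}}$ with respect to $\alpha$, and all of its derivatives are bounded by the same constants as for periodic trajectories: if $1\le q\le\min\{r-1,r'-1\}$ and $C^{(q)}_u$ is a constant (possibly depending on $\alpha$) such that $\left|\frac{\partial^q}{\partial\alpha^q}u_i(\eta,\alpha)\right|\le C_u^{(q)}$ for all periodic $\eta\in\Sigma$ and all $i$, then $\left|\frac{d^q}{d\alpha^q}u_j(\xi,\alpha)\right|\le C^{(q)}_u$.
   Context: Deformations. A function $f(x,y)$ is $\mathcal{C}^{A,B}$ if $\partial^{a+b}f/\partial x^a\partial y^b$ is continuous for all $a\le A$, $b\le B$. Let $m\ge3$ and let $I\subseteq[-\infty,\infty]$ be a closed interval. $K(\alpha)=\bigcup_{i=1}^m K_i(\alpha)\subset\mathbb{R}^2$, $\alpha\in I$, is a $\mathcal{C}^{r,r'}$ billiard deformation if for each $\alpha$: the $K_i(\alpha)$ are pairwise disjoint, compact, strictly convex (boundary curvature everywhere positive) with $\mathcal{C}^r$ boundary of length $L_i(\alpha)$; the no-eclipse condition holds (for distinct $i,j,k$ the convex hull of $K_i(\alpha)\cup K_j(\alpha)$ is disjoint from $K_k(\alpha)$); $\partial K_i(\alpha)$ is parametrized counterclockwise by arclength by a $\mathcal{C}^{r,r'}$ function $\tilde\varphi_i(\tilde u,\alpha)$,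 $\tilde u\in[0,L_i(\alpha)]$; and for all $0\le q\le r$, $0\le q'\le r'$, $(q,q')\ne(0,0)$, there are constants $C^{(q,q')}_\varphi$ (depending on $\alpha$) with $\left\|\partial^{q+q'}\tilde\varphi_i/\partial\tilde u^q\partial\alpha^{q'}\right\|\le C^{(q,q')}_\varphi$ for all $i$. Only one of the obstacles depends on $\alpha$. The parametrizations are extended $L_i(\alpha)$-periodically in $\tilde u$; smoothness of a parameter $u_j$ refers to a continuous choice of representative, and its derivatives at $\alpha_0$ are those of the local branch whose value at $\alpha_0$ lies in $[0,L_{\xi_j}(\alpha_0)]$. Non-wandering set and coding. A particle moves at unit speed in $\overline{\mathbb{R}^2\setminus K(\alpha)}$ and reflects elastically at $\partial K(\alpha)$. $M_0(\alpha)$ is the set of $x=(q,v)$, $q\in\partial K(\alpha)$, $v$ a unit (post-reflection) velocity, whose trajectory has infinitely many reflections forward and backward in time; $B:M_0(\alpha)\to M_0(\alpha)$ is the map to the next reflection, $\pi(q,v)=q$. $\Sigma=\{\xi=(\xi_j)_{j\in\mathbb{Z}}:\xi_j\in\{1,\dots,m\},\ \xi_j\ne\xi_{j+1}\}$. For $\xi\in\Sigma$ there is a unique $x=\chi_\alpha(\xi)\in M_0(\alpha)$ with $\pi B^jx\in\partial K_{\xi_j}(\alpha)$ for all $j\in\mathbb{Z}$; $u_j(\xi,\alpha)$ is the arclength parameter with $\tilde\varphi_{\xi_j}(u_j(\xi,\alpha),\alpha)=\pi B^j\chi_\alpha(\xi)$. If $\xi$ is periodic this is a periodic billiard trajectory.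 *)

(* Defs.v *)
From HB Require Import structures.
From mathcomp Require Import all_boot all_order all_algebra.
From mathcomp Require Import all_classical all_reals all_analysis.

Set Implicit Arguments.
Unset Strict Implicit.
Unset Printing Implicit Defensive.

Import Order.TTheory GRing.Theory Num.Theory.
Import numFieldNormedType.Exports.

Local Open Scope classical_set_scope.
Local Open Scope ring_scope.

(** Calculus relative to a set: derivatives are taken through points of the
    set only, hence are one-sided at the end points of an interval. *)
Section calculus.
Variables (R : realType) (V : normedModType R).

Definition diff_quotient (f : R -> V) (x y : R) : V :=
  (y - x)^-1 *: (f y - f x).

Definition derivable_on (I : set R) (f : R -> V) (x : R) : Prop :=
  cvg (diff_quotient f x y @[y --> within I x^']).

Definition derive_on (I : set R) (f : R -> V) (x : R) : V :=
  lim (diff_quotient f x y @[y --> within I x^']).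

Definition deriven_on (I : set R) (n : nat) (f : R -> V) : R -> V :=
  iter n (derive_on I) f.

Definition Cn_on (I : set R) (n : nat) (f : R -> V) : Prop :=
  (forall k x, (k < n)%N -> I x -> derivable_on I (deriven_on I k f) x) /\
  (forall k, (k <= n)%N -> {within I, continuous (deriven_on I k f)}).

(** [f x y] is of class C^{A,B} on [D], and [d a b] is its partial derivative
    of order [a] in [x] and [b] in [y] (the [y]-derivatives being taken first).
    [D] need not be open or a product: each partial derivative is taken along
    the slice of [D] through the point.  Where a slice is isolated (which can
    happen at boundary points of a region with curved boundary) the derivative
    condition is void and [d a b] is the continuous extension from the rest of
    [D]. *)
Definition is_CAB_jet (A B : nat) (D : set (R * R)) (f : R -> R -> V)
    (d : nat -> nat -> R -> R -> V) : Prop :=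
  [/\ forall x y, D (x, y) -> d 0%N 0%N x y = f x y,
      forall a b, (a <= A)%N -> (b <= B)%N ->
        {within D, continuous (fun z : R * R => d a b z.1 z.2)},
      forall b x y, (b < B)%N -> D (x, y) ->
        diff_quotient (d 0%N b x) y t @[t --> within [set t | D (x, t)] y^']
          --> d 0%N b.+1 x y
    & forall a b x y, (a < A)%N -> (b <= B)%N -> D (x, y) ->
        diff_quotient (d a b ^~ y) x s @[s --> within [set s | D (s, y)] x^']
          --> d a.+1 b x y].

End calculus.

Section plane.
Variable R : realType.
Local Notation plane := 'rV[R]_2.

Definition dotp (v w : plane) : R := \sum_k v 0 k * w 0 k.

(** The library norm on ['rV[R]_2] is the sup norm; lengths are Euclidean. *)
Definition enorm (v : plane) : R := Num.sqrt (dotp v v).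

Definition det2 (v w : plane) : R := v 0 0 * w 0 1 - v 0 1 * w 0 0.

(** Rotation by a right angle, counterclockwise. *)
Definition rot90 (v : plane) : plane :=
  \row_(k < 2) if k == 0 then - v 0 1 else v 0 0.

Definition bdry (A : set plane) : set plane := closure A `\` A°.

Definition convex_hull (A : set plane) : set plane :=
  smallest [set C : set plane | convex_set C] A.

End plane.

Section billiards.
Variables (R : realType) (m : nat).
Local Notation plane := 'rV[R]_2.
Local Notation state := (plane * plane)%type.

(** [param i u a] is the [len i a]-periodic extension in [u] of the
    parametrization of the boundary of [obst i a]. *)
Record billiard_family := BilliardFamily {
  obst : 'I_m -> R -> set plane;
  len : 'I_m -> R -> R;
  param : 'I_m -> R -> R -> plane }.

Variable K : billiard_family.

Definition tangent (i : 'I_m) (u a : R) : plane := derive1 (param K i ^~ a) u.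

(** The boundaries are run counterclockwise, so the interior is on the left. *)
Definition outer_normal (i : 'I_m) (u a : R) : plane := - rot90 (tangent i u a).

(** Counterclockwise [C^r] parametrization by arclength, of period [len i a]. *)
Definition is_arclength_param (r : nat) (i : 'I_m) (a : R) : Prop :=
  let g := param K i ^~ a in
  let l := len K i a in
  [/\ (0 < l) /\ (forall u, g (u + l) = g u),
      g @` setT = bdry (obst K i a) /\
        (forall u v, 0 <= u < l -> 0 <= v < l -> g u = g v -> u = v),
      (forall k u, (k < r)%N -> derivable (derive1n k g) u 1) /\
        (forall k, (k <= r)%N -> continuous (derive1n k g)),
      forall u, enorm (tangent i u a) = 1
    & forall u, \forall t \near 0^'+,
        (obst K i a)° (g u - t *: outer_normal i u a)].

Definition strictly_convex (i : 'I_m) (a : R) : Prop :=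
  convex_set (obst K i a) /\
  forall u, 0 < det2 (derive1n 1 (param K i ^~ a) u)
                     (derive1n 2 (param K i ^~ a) u).

Definition no_eclipse (a : R) : Prop :=
  forall i j k : 'I_m, i != j -> j != k -> i != k ->
    convex_hull (obst K i a `|` obst K j a) `&` obst K k a = set0.

(** The domain on which smoothness of the parametrization is required.  It is
    one period only: as [len i] may vary, the periodic extension of a C^{A,B}
    function need not be C^{A,B}. *)
Definition param_domain (I : set R) (i : 'I_m) : set (R * R) :=
  [set z | I z.2 /\ 0 <= z.1 <= len K i z.2].

Definition billiard_deformation (r r' : nat) (I : set R) : Prop :=
  [/\ forall a, I a ->
        [/\ forall i j, i != j -> obst K i a `&` obst K j a = set0,
            forall i, compact (obst K i a),
            forall i, strictly_convex i a,
            forall i, is_arclength_param r i a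
          & no_eclipse a],
      exists d : 'I_m -> nat -> nat -> R -> R -> plane,
        (forall i, is_CAB_jet r r' (param_domain I i) (param K i) (d i)) /\
        (forall q q', (q <= r)%N -> (q' <= r')%N -> (0 < q + q')%N ->
          exists C : R -> R, forall i u a, param_domain I i (u, a) ->
            enorm (d i q q' u a) <= C a)
    & exists i0, forall i, i != i0 ->
        forall a a', I a -> I a' -> obst K i a = obst K i a'].

(** A state is a point of the boundary with a post-reflection velocity. *)
Definition phase_space (a : R) : set state :=
  [set x | enorm x.2 = 1 /\
    exists i u, x.1 = param K i u a /\ 0 <= dotp x.2 (outer_normal i u a)].

Definition next_reflection (a : R) (x y : state) : Prop :=
  [/\ phase_space a x, phase_space a y &
    exists tau i u,
      [/\ 0 < tau,
          forall t, 0 < t < tau -> ~ (\bigcup_k obst K k a) (x.1 + t *: x.2),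
          y.1 = x.1 + tau *: x.2,
          y.1 = param K i u a
        & y.2 = x.2 - (2 * dotp x.2 (outer_normal i u a))
                        *: outer_normal i u a]].

Definition nonwandering (a : R) : set state :=
  [set x | exists o : int -> state,
    o 0 = x /\ forall j, next_reflection a (o j) (o (j + 1))].

Definition billiard_map (a : R) (x : state) : state :=
  xget x [set y | nonwandering a y /\ next_reflection a x y].

Definition billiard_map_inv (a : R) (x : state) : state :=
  xget x [set y | nonwandering a y /\ next_reflection a y x].

Definition billiard_iter (a : R) (j : int) (x : state) : state :=
  match j with
  | Posz n => iter n (billiard_map a) x
  | Negz n => iter n.+1 (billiard_map_inv a) x
  end.

Definition admissible_code (xi : int -> 'I_m) : Prop :=
  forall j, xi j != xi (j + 1).

Definition periodic_code (xi : int -> 'I_m) : Prop :=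
  exists n : nat, (0 < n)%N /\ forall j, xi (j + n%:Z) = xi j.

(** The unique nonwandering state with itinerary [xi]. *)
Definition coded_state (a : R) (xi : int -> 'I_m) : state :=
  xget (0, 0) [set x | nonwandering a x /\
    forall j, bdry (obst K (xi j) a) (billiard_iter a j x).1].

Definition coded_point (xi : int -> 'I_m) (j : int) (a : R) : plane :=
  (billiard_iter a j (coded_state a xi)).1.

(** [u] is a continuous choice over [I] of the arclength parameter [u_j(xi, .)],
    which is determined modulo [len (xi j)] only. *)
Definition is_arclength_coord (I : set R) (xi : int -> 'I_m) (j : int)
    (u : R -> R) : Prop :=
  {within I, continuous u} /\
  forall a, I a -> param K (xi j) (u a) a = coded_point xi j a.

(** The derivative of order [q] at [a] of [u_j(xi, .)] is bounded by [c].  It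
    is computed on the branch whose value at [a] is in [0, len (xi j) a].  This
    branch is unique, except when the point is the origin of the
    parametrization: then the branches with values [0] and [len (xi j) a], which
    differ by the function [len (xi j)], are both allowed. *)
Definition coord_derive_le (I : set R) (xi : int -> 'I_m) (j : int) (q : nat)
    (a c : R) : Prop :=
  exists u, [/\ is_arclength_coord I xi j u, 0 <= u a <= len K (xi j) a
              & `|deriven_on I q u a| <= c].

End billiards.

(* Main.v *)
Require Import Defs.
From HB Require Import structures.
From mathcomp Require Import all_boot all_order all_algebra.
From mathcomp Require Import all_classical all_reals all_analysis.
From mathcomp Require Import ring lra zify.

Set Implicit Arguments.
Unset Strict Implicit.
Unset Printing Implicit Defensive.

Import Order.TTheory GRing.Theory Num.Theory.
Import numFieldNormedType.Exports.

Local Open Scope classical_set_scope.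
Local Open Scope ring_scope.

(** An orbit with code [xi] is the same thing as a sequence of points [X j] of the
    obstacles [xi j] such that each [X j] minimizes the length of the broken line
    [X (j - 1)], [X j], [X (j + 1)] over its obstacle; such sequences exist by
    compactness.  For two of them, the inner products of [X j - Y j] with the
    difference of the unit vectors issued from [X j] and [Y j] increase with [j],
    because the gradient of the norm is monotone.  This gives uniqueness, and
    continuity in the deformation parameter and in the code, uniformly over all codes.
    In coordinates in which each boundary curve has period 1, the linearized reflection
    law is an infinite tridiagonal system, diagonally dominant for the weights
    1/(normal component of the velocity).  Hence difference quotients of the
    coordinates are Cauchy, their limits solve tridiagonal systems of the same kind,
    and the regularity improves one order at a time up to [minn r r' - 1].  All
    moduli of continuity are uniform over the codes, so when a code is approximated by
    periodic ones the derivatives of every order converge. *)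

(** * First-order expansions along a filter *)

(** The parametrizations are smooth only on one period [0 <= u <= len i a], a region whose upper
    side moves with [a], and no regularity of [len] is assumed. It has to be extracted from the
    closing of the boundary curves; only then does rescaling to period 1 give curves that are smooth
    on the whole line. Rescaling mixes the two variables, whence the total order [minn r r']. One
    more order is lost afterwards: the coefficients of the linearized reflection law contain second
    derivatives of the curves, while solving a system with coefficients of class k gains one order.
    The codes form an infinite index set, so uniformity is built into the notion of smoothness: all
    estimates concern pairs of points with the same index and hold for all indices at once.
    Coordinates are defined only modulo the period. Branches with value in one closed period do not
    depend continuously on the code, since values near the two ends describe nearby points; the
    limit over periodic codes therefore has to be taken along codes with a constant integer
    offset. *)

Ltac slra := repeat match goal with
  | H : forall _, _ |- _ => clear H
  | H : context[Num.norm _] |- _ => clear H end; lra.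
Ltac clr := repeat match goal with
  | H : is_true (Order.le _ _) |- _ => clear H
  | H : is_true (Order.lt _ _) |- _ => clear H
  | H : is_true (andb _ _) |- _ => clear H
  | H : _ = _ |- _ => clear H end.

Section expansion.
Variables (R : realType) (Y : Type) (F : set_system Y).
Context {FF : Filter F}.
Variable N : Y -> R.
Hypothesis N0 : forall e : R, 0 < e -> \forall y \near F, 0 <= N y <= e.

Lemma ler_normM (x y a b : R) : `|x| <= a -> `|y| <= b -> `|x * y| <= a * b.
Proof. by move=> xa yb; rewrite normrM ler_pM. Qed.

(** A first-order expansion whose base value [g] and linear part [l] vary along the filter too. One
    set of rules thus serves derivatives at a point, strict differentials uniform in an index, and
    increments of several coupled coordinates. *)
Definition expansion (f g l : Y -> R) : Prop :=
  [/\ exists2 M : R, 0 < M & \forall y \near F, `|f y| <= M /\ `|g y| <= M,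
      exists2 M : R, 0 < M & \forall y \near F, `|l y| <= M * N y
    & forall e : R, 0 < e -> \forall y \near F, `|f y - g y - l y| <= e * N y].

Lemma expansion_eq f g l f' g' l' : (f =1 f') -> (g =1 g') -> (l =1 l') ->
  expansion f g l -> expansion f' g' l'.
Proof. by move=> /funext <- /funext <- /funext <-. Qed.

Lemma expansion_lip f g l : expansion f g l ->
  exists2 M : R, 0 < M & \forall y \near F, `|f y - g y| <= M * N y.
Proof.
move=> [_ [M M0 hM] /(_ 1 ltr01) h]; exists (M + 1); first by rewrite addr_gt0.
apply: filterS2 hM h => y h1 h2.
have -> : f y - g y = l y + (f y - g y - l y) by ring.
by rewrite (le_trans (ler_normD _ _))// mulrDl lerD.
Qed.

Lemma expansion_cst c : expansion (cst c) (cst c) (cst 0).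
Proof.
split; first by exists (`|c| + 1); [rewrite ltr_wpDl|apply: nearW => y /=; split; lra].
  exists 1 => //; have := N0 (@ltr01 R); apply: filterS => y /=; rewrite normr0; lra.
move=> e e0; have := N0 (@ltr01 R); apply: filterS => y /=.
by rewrite !subrr normr0 => /andP[? _]; rewrite mulr_ge0// ltW.
Qed.

Lemma expansionD f g l f' g' l' : expansion f g l -> expansion f' g' l' ->
  expansion (fun y => f y + f' y) (fun y => g y + g' y) (fun y => l y + l' y).
Proof.
move=> [[M M0 h1] [L L0 h2] h3] [[M' M'0 h1'] [L' L'0 h2'] h3']; split.
- exists (M + M'); first by rewrite addr_gt0.
  apply: filterS2 h1 h1' => y [? ?] [? ?].
  by split; rewrite (le_trans (ler_normD _ _))// lerD.
- exists (L + L'); first by rewrite addr_gt0.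
  by apply: filterS2 h2 h2' => y ? ?; rewrite (le_trans (ler_normD _ _))// mulrDl lerD.
- move=> e e0; have e2 : 0 < e / 2 by rewrite divr_gt0.
  apply: filterS2 (h3 _ e2) (h3' _ e2) => y h h'.
  have -> : f y + f' y - (g y + g' y) - (l y + l' y) =
    (f y - g y - l y) + (f' y - g' y - l' y) by ring.
  by rewrite (le_trans (ler_normD _ _))//; apply: (le_trans (lerD h h')); lra.
Qed.

Lemma expansionM f g l f' g' l' : expansion f g l -> expansion f' g' l' ->
  expansion (fun y => f y * f' y) (fun y => g y * g' y)
            (fun y => l y * g' y + g y * l' y).
Proof.
move=> E1 E2; have [A A0 hA] := expansion_lip E1; have [B B0 hB] := expansion_lip E2.
case: E1 E2 => [[M M0 h1] [L L0 h2] h3] [[M' M'0 h1'] [L' L'0 h2'] h3']; split.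
- exists (M * M'); first by rewrite mulr_gt0.
  by apply: filterS2 h1 h1' => y [? ?] [? ?]; split; apply: ler_normM.
- exists (L * M' + M * L'); first by rewrite addr_gt0// mulr_gt0.
  have hX := @filterI _ _ FF _ _ h1 h1'; apply: filterS3 h2 h2' hX => y lL lL' [[_ gM] [_ gM']].
  rewrite (le_trans (ler_normD _ _))// mulrDl lerD//.
    by rewrite mulrAC; apply: ler_normM.
  by rewrite -mulrA; apply: ler_normM.
- move=> e e0.
  pose K := M + M' + A * B; have K0 : 0 < K by rewrite !addr_gt0// mulr_gt0.
  have eK : 0 < e / K by rewrite divr_gt0.
  have H1 := @filterI _ _ FF _ _ (h3 _ eK) (h3' _ eK).
  have H2 := @filterI _ _ FF _ _ h1 h1'.
  have H3 := @filterI _ _ FF _ _ hA hB.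
  have hX := @filterI _ _ FF _ _ H3 (N0 eK); apply: filterS3 H1 H2 hX => y [d1 d2] [[_ g1] [_ g2]].
  move=> [[a b] /andP[n0 n1]].
  have -> : f y * f' y - g y * g' y - (l y * g' y + g y * l' y) =
    (f y - g y - l y) * g' y + g y * (f' y - g' y - l' y)
    + (f y - g y) * (f' y - g' y) by ring.
  have -> : e * N y = (e / K * N y) * M' + M * (e / K * N y) + (A * N y) * (B * (e / K)).
    by rewrite /K; field; apply/lt0r_neq0.
  rewrite (le_trans (ler_normD _ _))// lerD//.
    by rewrite (le_trans (ler_normD _ _))// lerD//; apply: ler_normM.
  by apply: ler_normM => //; apply: (le_trans b); rewrite ler_wpM2l// ltW.
Qed.

Lemma expansionZ c f g l : expansion f g l ->
  expansion (fun y => c * f y) (fun y => c * g y) (fun y => c * l y).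
Proof.
move=> /(expansionM (expansion_cst c)); apply: expansion_eq => //= y.
by rewrite mul0r add0r.
Qed.

Lemma expansionN f g l : expansion f g l ->
  expansion (fun y => - f y) (fun y => - g y) (fun y => - l y).
Proof. by move=> /(expansionZ (-1)); apply: expansion_eq => y; rewrite mulN1r. Qed.

Lemma expansionB f g l f' g' l' : expansion f g l -> expansion f' g' l' ->
  expansion (fun y => f y - f' y) (fun y => g y - g' y) (fun y => l y - l' y).
Proof. by move=> E /expansionN; apply: expansionD. Qed.

Lemma expansionV (c : R) (f g l : Y -> R) : 0 < c -> (\forall y \near F, c <= f y /\ c <= g y) ->
  expansion f g l ->
  expansion (fun y => (f y)^-1) (fun y => (g y)^-1)
            (fun y => - ((g y)^-1 * (g y)^-1 * l y)).
Proof.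
move=> c0 hc E1; have [A A0 hA] := expansion_lip E1.
case: E1 => [[M M0 h1] [L L0 h2] h3].
have cV x : c <= x -> `|x^-1| <= c^-1.
  move=> cx; have x0 : 0 < x by apply: lt_le_trans cx.
  by rewrite gtr0_norm ?invr_gt0// lef_pV2.
split.
- exists c^-1; first by rewrite invr_gt0.
  by apply: filterS hc => y [/cV ? /cV ?].
- exists (c^-1 * c^-1 * L); first by rewrite !mulr_gt0 ?invr_gt0.
  apply: filterS2 hc h2 => y [/cV c1 /cV c2] lL.
  rewrite normrN -[X in _ <= X]mulrA; apply: ler_normM => //; exact: ler_normM.
- move=> e e0.
  pose K := c^-1 * c^-1 + c^-1 * c^-1 * c^-1 * A * A.
  have K0 : 0 < K by rewrite addr_gt0// !mulr_gt0// invr_gt0.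
  have eK : 0 < e / K by rewrite divr_gt0.
  have hX := @filterI _ _ FF _ _ hA (N0 eK); apply: filterS3 hc (h3 _ eK) hX => y [cf cg] d [a /andP[n0 n1]].
  have f0 : f y != 0 by apply/lt0r_neq0/(lt_le_trans c0).
  have g0 : g y != 0 by apply/lt0r_neq0/(lt_le_trans c0).
  move/cV: cf => cf; move/cV: cg => cg.
  have -> : (f y)^-1 - (g y)^-1 - - ((g y)^-1 * (g y)^-1 * l y) =
    (f y)^-1 * (g y)^-1 * (g y)^-1 * ((f y - g y) * (f y - g y))
    - (g y)^-1 * (g y)^-1 * (f y - g y - l y) by field; rewrite f0 g0.
  have -> : e * N y = c^-1 * c^-1 * c^-1 * ((A * N y) * (A * (e / K)))
     + c^-1 * c^-1 * (e / K * N y).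
    rewrite /K; field; rewrite (lt0r_neq0 c0) /=.
    by apply: lt0r_neq0; rewrite addr_gt0 ?mulr_gt0.
  rewrite (le_trans (ler_normB _ _))// lerD//.
    do ?[apply: ler_normM => //].
    by apply: (le_trans a); rewrite ler_wpM2l// ltW.
  by do ?[apply: ler_normM => //].
Qed.

Lemma expansion_sqrt (c : R) (f g l : Y -> R) : 0 < c -> (\forall y \near F, c <= f y /\ c <= g y) ->
  expansion f g l ->
  expansion (fun y => Num.sqrt (f y)) (fun y => Num.sqrt (g y))
            (fun y => (2 * Num.sqrt (g y))^-1 * l y).
Proof.
move=> c0 hc E1; have [A A0 hA] := expansion_lip E1.
case: E1 => [[M M0 h1] [L L0 h2] h3].
have sc0 : 0 < Num.sqrt c by rewrite sqrtr_gt0.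
set q := Num.sqrt c in sc0 *.
have cV x : c <= x -> q <= Num.sqrt x by move=> cx; apply: ler_wsqrtr.
split.
- exists (Num.sqrt M); first by rewrite sqrtr_gt0.
  apply: filterS2 h1 hc => y [a b] [? ?]; rewrite !ger0_norm ?sqrtr_ge0//.
  by split; apply: ler_wsqrtr; apply: le_trans (ler_norm _) _.
- exists (q^-1 * L); first by rewrite !mulr_gt0 ?invr_gt0.
  apply: filterS2 hc h2 => y [/cV c1 /cV c2] lL.
  rewrite -mulrA; apply: ler_normM => //.
  rewrite gtr0_norm ?invr_gt0; first by rewrite lef_pV2 ?posrE; lra.
  lra.
- move=> e e0.
  pose K := q^-1 + q^-1 * q^-1 * q^-1 * A * A.
  have K0 : 0 < K by rewrite addr_gt0// ?mulr_gt0// invr_gt0.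
  have eK : 0 < e / K by rewrite divr_gt0.
  have hX := @filterI _ _ FF _ _ hA (N0 eK); apply: filterS3 hc (h3 _ eK) hX => y [cf cg] d [a /andP[n0 n1]].
  have f0 : 0 <= f y by lra.
  have g0 : 0 <= g y by lra.
  move/cV: cf => cf; move/cV: cg => cg.
  move: a d; rewrite -{1 2}(sqr_sqrtr f0) -{1 2}(sqr_sqrtr g0).
  set u := Num.sqrt (f y) in cf *; set v := Num.sqrt (g y) in cg *.
  have u0 : 0 < u by lra.
  have v0 : 0 < v by lra.
  move=> a d.
  have uv0 : u + v != 0 by apply: lt0r_neq0; lra.
  have -> : u - v - (2 * v)^-1 * l y = (2 * v)^-1 * (u ^+ 2 - v ^+ 2 - l y)
   - (2 * v)^-1 * (u + v)^-1 * (u + v)^-1 * ((u ^+ 2 - v ^+ 2) * (u ^+ 2 - v ^+ 2)).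
    by field; rewrite uv0 (lt0r_neq0 v0).
  have -> : e * N y = q^-1 * (e / K * N y) + q^-1 * q^-1 * q^-1 * ((A * N y) * (A * (e / K))).
    rewrite /K; field; rewrite (lt0r_neq0 sc0) /=.
    by apply: lt0r_neq0; rewrite addr_gt0 ?mulr_gt0.
  have V x : q <= x -> `|x^-1| <= q^-1.
    move=> cx; have x0 : 0 < x by apply: lt_le_trans cx.
    by rewrite gtr0_norm ?invr_gt0// lef_pV2.
  have V1 : `|(2 * v)^-1| <= q^-1 by apply: V; lra.
  have V2 : `|(u + v)^-1| <= q^-1 by apply: V; lra.
  rewrite (le_trans (ler_normB _ _))// lerD//.
    by do ?[apply: ler_normM => //].
  do ?[apply: ler_normM => //].
  by apply: (le_trans a); rewrite ler_wpM2l// ltW.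
Qed.

End expansion.

(** * Families of functions smooth uniformly in an index *)

Section smooth_families.
Variables (R : realType) (I : set R).

Section domain.
Variables (T : Type) (E : T -> R -> R -> Prop).

(** Only [a] is localized: [t] and [s] range over everything and the two points of a pair are merely
    close to each other. A property that holds near [a0] is therefore uniform in the index and along
    the whole fibre. *)
Definition fibre_near (a0 : R) : set_system (T * (R * R) * (R * R)) :=
  fun P => exists2 d : R, 0 < d & forall t s a s' a', E t s a -> E t s' a' ->
    `|a - a0| < d -> `|a' - a0| < d -> `|s' - s| < d -> P (t, (s, a), (s', a')).

Global Instance fibre_near_filter a0 : Filter (fibre_near a0).
Proof.
split; first by exists 1.
  move=> P Q [d d0 hP] [e e0 hQ]; exists (Num.min d e); first by rewrite lt_min d0.
  move=> t s a s' a' E1 E2; rewrite !lt_min => /andP[? ?] /andP[? ?] /andP[? ?].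
  by split; [apply: hP|apply: hQ].
by move=> P Q PQ [d d0 hP]; exists d => // *; apply: PQ; apply: hP.
Qed.

Definition gauge (y : T * (R * R) * (R * R)) : R :=
  `|y.2.1 - y.1.2.1| + `|y.2.2 - y.1.2.2|.
Definition at_old (f : T -> R -> R -> R) (y : T * (R * R) * (R * R)) : R :=
  f y.1.1 y.1.2.1 y.1.2.2.
Definition at_new (f : T -> R -> R -> R) (y : T * (R * R) * (R * R)) : R :=
  f y.1.1 y.2.1 y.2.2.
Definition differential (fs fa : T -> R -> R -> R) (y : T * (R * R) * (R * R)) : R :=
  at_old fs y * (y.2.1 - y.1.2.1) + at_old fa y * (y.2.2 - y.1.2.2).

Lemma gauge_small (a0 e : R) : 0 < e -> \forall y \near fibre_near a0, 0 <= gauge y <= e.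
Proof.
move=> e0; exists (e / 3); first by rewrite divr_gt0.
move=> t s a s' a' _ _; rewrite /gauge/= !ltr_norml => /andP[? ?] /andP[? ?] /andP[? ?].
rewrite addr_ge0//= (_ : e = e / 3 + (e / 3 + e / 3)); last lra.
rewrite lerD// ler_norml; apply/andP; split; lra.
Qed.

Definition fibre_equicont (f : T -> R -> R -> R) := forall a0, I a0 -> forall e : R, 0 < e ->
  \forall y \near fibre_near a0, `|at_new f y - at_old f y| <= e.
Definition fibre_bounded (f : T -> R -> R -> R) := forall a0, I a0 -> exists2 M : R, 0 < M &
  \forall y \near fibre_near a0, `|at_old f y| <= M.
Definition strict_diff (f fs fa : T -> R -> R -> R) := forall a0, I a0 -> forall e : R, 0 < e ->
  \forall y \near fibre_near a0,
    `|at_new f y - at_old f y - differential fs fa y| <= e * gauge y.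

(** Class C^k near each [a0], uniformly in the index. Both points move in the differentiability
    condition, so it makes sense on fibres of any shape. The derivatives are existential: on a thin
    fibre, such as a single [s], they are not determined by [f]. *)
Fixpoint smooth (k : nat) (f : T -> R -> R -> R) : Prop :=
  (fibre_bounded f /\ fibre_equicont f) /\
  (if k is k'.+1 then exists fs fa, [/\ strict_diff f fs fa, smooth k' fs & smooth k' fa]
   else True).

(** No bound on the function itself, only on its derivatives. *)
Definition smooth_mod_cst (k : nat) (f : T -> R -> R -> R) : Prop :=
  fibre_equicont f /\
  (if k is k'.+1 then exists fs fa, [/\ strict_diff f fs fa, smooth k' fs & smooth k' fa]
   else True).

Lemma smooth_bounded k f : smooth k f -> fibre_bounded f.
Proof. by case: k => [|k] [[]]. Qed.

Lemma smooth_equicont k f : smooth k f -> fibre_equicont f.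
Proof. by case: k => [|k] [[]]. Qed.

Lemma smoothW k f : smooth k.+1 f -> smooth k f.
Proof.
elim: k f => [|k IH] f [fc [fs [fa [sd h1 h2]]]]; first by split.
by split=> //; exists fs, fa; split=> //; apply: IH.
Qed.

Lemma smooth_le k l f : (k <= l)%N -> smooth l f -> smooth k f.
Proof.
move=> /subnK <-; elim: (l - k)%N => [//|n IH]; rewrite addSn => /smoothW; exact: IH.
Qed.

Lemma smooth_mod_cstW k f : smooth_mod_cst k.+1 f -> smooth_mod_cst k f.
Proof.
case: k => [|k] [fc [fs [fa [sd h1 h2]]]]; first by split.
by split=> //; exists fs, fa; split=> //; apply: smoothW.
Qed.

Lemma smooth_smooth_mod_cst k f : smooth k f -> smooth_mod_cst k f.
Proof. by case: k => [|k] [[_ ?]]. Qed.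

Lemma smooth_mod_cst_smooth k f : fibre_bounded f -> smooth_mod_cst k f -> smooth k f.
Proof. by case: k => [|k] fb []. Qed.

Lemma fibre_near_old a0 P : (\forall y \near fibre_near a0, P y.1) ->
  \forall y \near fibre_near a0, P (y.1.1, y.2).
Proof.
move=> [d d0 h]; exists d => // t s a s' a' E1 E2 h1 h2 h3 /=.
by apply: (h t s' a' s' a') => //; rewrite subrr normr0.
Qed.

Lemma fibre_bounded_new f a0 : I a0 -> fibre_bounded f -> exists2 M : R, 0 < M &
  \forall y \near fibre_near a0, `|at_new f y| <= M /\ `|at_old f y| <= M.
Proof.
move=> Ia /(_ _ Ia) [M M0 h]; exists M => //.
exact: filterI (@fibre_near_old a0 (fun x => `|f x.1 x.2.1 x.2.2| <= M) h) h.
Qed.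

Lemma strict_diff_expansion f fs fa a0 : I a0 ->
  fibre_bounded f -> fibre_bounded fs -> fibre_bounded fa -> strict_diff f fs fa ->
  expansion (fibre_near a0) gauge (at_new f) (at_old f) (differential fs fa).
Proof.
move=> Ia bf bs ba sd; split; [exact: fibre_bounded_new| |exact: sd].
case: (bs _ Ia) => M M0 hM; case: (ba _ Ia) => L L0 hL.
exists (M + L); first by rewrite addr_gt0.
apply: filterS2 hM hL => y h1 h2.
rewrite (le_trans (ler_normD _ _))// mulrDl lerD//; apply: ler_normM => //.
  by rewrite /gauge lerDl.
by rewrite /gauge lerDr.
Qed.

Lemma expansion_strict_diff f fs fa :
  (forall a0, I a0 -> expansion (fibre_near a0) gauge (at_new f) (at_old f) (differential fs fa)) ->
  strict_diff f fs fa.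
Proof. by move=> h a0 /h[]. Qed.

Lemma smooth_strict_diff_expansion k f fs fa a0 : I a0 -> smooth k f -> smooth k fs ->
  smooth k fa -> strict_diff f fs fa ->
  expansion (fibre_near a0) gauge (at_new f) (at_old f) (differential fs fa).
Proof. by move=> Ia /smooth_bounded ? /smooth_bounded ? /smooth_bounded ?; apply: strict_diff_expansion. Qed.

Lemma smooth_ext k f g : (forall t s a, E t s a -> f t s a = g t s a) -> smooth k f -> smooth k g.
Proof.
move=> fg.
have near_ext a0 (P Q : T * (R * R) * (R * R) -> Prop) :
    (forall y, at_old f y = at_old g y -> at_new f y = at_new g y -> P y -> Q y) ->
    (\forall y \near fibre_near a0, P y) -> \forall y \near fibre_near a0, Q y.
  move=> PQ [d d0 h]; exists d => // t s a s' a' E1 E2 *.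
  by apply: PQ; [exact: fg|exact: fg|apply: h].
have b : fibre_bounded f -> fibre_bounded g.
  move=> h a0 /h[M M0 hM]; exists M => //; apply: near_ext hM => y e1 e2.
  by rewrite e1.
have c : fibre_equicont f -> fibre_equicont g.
  move=> h a0 Ia e e0; apply: near_ext (h _ Ia _ e0) => y e1 e2.
  by rewrite e1 e2.
have d fs fa : strict_diff f fs fa -> strict_diff g fs fa.
  move=> h a0 Ia e e0; apply: near_ext (h _ Ia _ e0) => y e1 e2.
  by rewrite e1 e2.
case: k => [|k] [[h1 h2] h3]; split=> //; first by split; auto.
  by split; auto.
by case: h3 => fs [fa [? ? ?]]; exists fs, fa; split; auto.
Qed.

Lemma smooth_cst k c : smooth k (fun _ _ _ => c).
Proof.
have h c' : fibre_bounded (fun _ _ _ => c') /\ fibre_equicont (fun _ _ _ => c').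
  split=> a0 _; first by exists (`|c'| + 1); [rewrite ltr_wpDl|apply: nearW => y; rewrite /at_old; lra].
  by move=> e e0; apply: nearW => y; rewrite /at_new /at_old subrr normr0 ltW.
elim: k c => [|k IH] c; first by split.
split=> //; exists (fun _ _ _ => 0), (fun _ _ _ => 0); split=> // a0 Ia e e0.
apply: nearW => y; rewrite /at_new /at_old /differential /at_old !mul0r addr0 !subrr normr0.
by rewrite mulr_ge0 ?addr_ge0// ltW.
Qed.

(** Equicontinuity comes for free: bounded derivatives make [f] Lipschitz along the filter. *)
Lemma smooth_intro k f fs fa : fibre_bounded f -> strict_diff f fs fa ->
  smooth k fs -> smooth k fa -> smooth k.+1 f.
Proof.
move=> bf sd hs ha; split; last by exists fs, fa.
split=> // a0 Ia e e0.
have := strict_diff_expansion Ia bf (smooth_bounded hs) (smooth_bounded ha) sd.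
move=> /expansion_lip [M M0 hM].
have eM : 0 < e / M by rewrite divr_gt0.
apply: filterS2 hM (gauge_small a0 eM) => y h1 /andP[_ h2].
by apply: (le_trans h1); rewrite mulrC -ler_pdivlMr.
Qed.

Lemma fibre_boundedD f g : fibre_bounded f -> fibre_bounded g ->
  fibre_bounded (fun t s a => f t s a + g t s a).
Proof.
move=> hf hg a0 Ia; case: (hf _ Ia) => M M0 h; case: (hg _ Ia) => L L0 h'.
exists (M + L); first by rewrite addr_gt0.
by apply: filterS2 h h' => y ? ?; rewrite (le_trans (ler_normD _ _))// lerD.
Qed.

Lemma fibre_boundedM f g : fibre_bounded f -> fibre_bounded g ->
  fibre_bounded (fun t s a => f t s a * g t s a).
Proof.
move=> hf hg a0 Ia; case: (hf _ Ia) => M M0 h; case: (hg _ Ia) => L L0 h'.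
exists (M * L); first by rewrite mulr_gt0.
by apply: filterS2 h h' => y ? ?; apply: ler_normM.
Qed.

Lemma smoothD k f g : smooth k f -> smooth k g -> smooth k (fun t s a => f t s a + g t s a).
Proof.
elim: k f g => [|k IH] f g hf hg.
  split=> //; split; first exact: fibre_boundedD (smooth_bounded hf) (smooth_bounded hg).
  move=> a0 Ia e e0; have e2 : 0 < e / 2 by rewrite divr_gt0.
  apply: filterS2 (smooth_equicont hf Ia e2) (smooth_equicont hg Ia e2) => y h1 h2.
  rewrite /at_new/at_old.
  rewrite (_ : _ - _ = (at_new f y - at_old f y) + (at_new g y - at_old g y)); last first.
    by rewrite /at_new/at_old; ring.
  by rewrite (le_trans (ler_normD _ _))// (le_trans (lerD h1 h2))//; lra.
have fk := smoothW hf; have gk := smoothW hg.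
case: hf hg => [[bf _] [fs [fa [sf hfs hfa]]]] [[bg _] [gs [ga [sg hgs hga]]]].
apply: (@smooth_intro _ _ (fun t s a => fs t s a + gs t s a) (fun t s a => fa t s a + ga t s a)); [exact: fibre_boundedD| |exact: IH|exact: IH].
apply: expansion_strict_diff => a0 Ia.
have := expansionD (FF := fibre_near_filter a0) (smooth_strict_diff_expansion Ia fk hfs hfa sf) (smooth_strict_diff_expansion Ia gk hgs hga sg).
by apply: expansion_eq => // y; rewrite /differential/at_old; ring.
Qed.

Lemma smoothM k f g : smooth k f -> smooth k g -> smooth k (fun t s a => f t s a * g t s a).
Proof.
elim: k f g => [|k IH] f g hf hg.
  split=> //; split; first exact: fibre_boundedM (smooth_bounded hf) (smooth_bounded hg).
  move=> a0 Ia e e0.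
  case: (smooth_bounded hf Ia) => M M0 hM; case: (fibre_bounded_new Ia (smooth_bounded hg)) => L L0 hL.
  have e2 : 0 < e / (M + L) by rewrite divr_gt0// addr_gt0.
  have hX := @filterI _ _ (fibre_near_filter a0) _ _ (smooth_equicont hf Ia e2) (smooth_equicont hg Ia e2).
  apply: filterS3 hM hL hX => y h1 [h2 _] [h3 h4].
  rewrite (_ : _ - _ = (at_new f y - at_old f y) * at_new g y + at_old f y * (at_new g y - at_old g y)); last first.
    by rewrite /at_new/at_old; ring.
  rewrite (le_trans (ler_normD _ _))//.
  have -> : e = e / (M + L) * L + M * (e / (M + L)) by field; rewrite lt0r_neq0// addr_gt0.
  by rewrite lerD//; apply: ler_normM.
have fk := smoothW hf; have gk := smoothW hg.
case: hf hg => [[bf _] [fs [fa [sf hfs hfa]]]] [[bg _] [gs [ga [sg hgs hga]]]].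
apply: (@smooth_intro _ _ (fun t s a => fs t s a * g t s a + f t s a * gs t s a)
  (fun t s a => fa t s a * g t s a + f t s a * ga t s a)); [exact: fibre_boundedM| |by apply: smoothD; apply: IH..].
apply: expansion_strict_diff => a0 Ia.
have := expansionM (FF := fibre_near_filter a0) (gauge_small a0) (smooth_strict_diff_expansion Ia fk hfs hfa sf) (smooth_strict_diff_expansion Ia gk hgs hga sg).
by apply: expansion_eq => // y; rewrite /differential/at_old; ring.
Qed.

Lemma smoothN k f : smooth k f -> smooth k (fun t s a => - f t s a).
Proof.
move=> h; apply: (@smooth_ext _ (fun t s a => -1 * f t s a)); first by move=> *; rewrite mulN1r.
by apply: smoothM => //; exact: smooth_cst.
Qed.

Lemma smoothB k f g : smooth k f -> smooth k g -> smooth k (fun t s a => f t s a - g t s a).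
Proof. by move=> ? ?; apply: smoothD => //; apply: smoothN. Qed.

Lemma smoothX k f n : smooth k f -> smooth k (fun t s a => f t s a ^+ n).
Proof.
move=> h; elim: n => [|n IH]; first exact: (@smooth_ext _ (fun _ _ _ => 1)) (smooth_cst _ _).
apply: (@smooth_ext _ (fun t s a => f t s a * f t s a ^+ n)); first by move=> *; rewrite exprS.
exact: smoothM.
Qed.

Definition fibre_pos (f : T -> R -> R -> R) := forall a0, I a0 -> exists2 c : R, 0 < c &
  \forall y \near fibre_near a0, c <= at_old f y.

Lemma fibre_pos_new f a0 : I a0 -> fibre_pos f -> exists2 c : R, 0 < c &
  \forall y \near fibre_near a0, c <= at_new f y /\ c <= at_old f y.
Proof.
move=> Ia /(_ _ Ia) [M M0 h]; exists M => //.
exact: filterI (@fibre_near_old a0 (fun x => M <= f x.1 x.2.1 x.2.2) h) h.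
Qed.

Lemma smoothV k f : fibre_pos f -> smooth k f -> smooth k (fun t s a => (f t s a)^-1).
Proof.
move=> pf; have bV : fibre_bounded (fun t s a => (f t s a)^-1).
  move=> a0 /pf [c c0 h]; exists c^-1; first by rewrite invr_gt0.
  apply: filterS h => y cy; have y0 : 0 < at_old f y by lra.
  by rewrite {1}/at_old gtr0_norm ?invr_gt0// lef_pV2.
elim: k => [|k IH] hf.
  split=> //; split=> // a0 Ia e e0; case: (fibre_pos_new Ia pf) => c c0 h.
  have e2 : 0 < e * (c * c) by rewrite !mulr_gt0.
  apply: filterS2 h (smooth_equicont hf Ia e2) => y [c1 c2] h1.
  have y1 : 0 < at_old f y by lra.
  have y2 : 0 < at_new f y by lra.
  rewrite (_ : _ - _ = (at_new f y)^-1 * ((at_old f y)^-1 * (at_old f y - at_new f y))); last first.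
    by rewrite /at_new/at_old in y1 y2 *; field; rewrite !lt0r_neq0.
  rewrite distrC in h1.
  have -> : e = c^-1 * (c^-1 * (e * (c * c))) by field; rewrite lt0r_neq0.
  by do 2 (apply: ler_normM; first by rewrite gtr0_norm ?invr_gt0// lef_pV2).
have fk := smoothW hf.
case: hf => [[bf _] [fs [fa [sf hfs hfa]]]].
apply: (@smooth_intro _ _ (fun t s a => - ((f t s a)^-1 * (f t s a)^-1 * fs t s a))
   (fun t s a => - ((f t s a)^-1 * (f t s a)^-1 * fa t s a))) => //; last 2 first.
- by apply: smoothN; do 2?apply: smoothM => //; apply: IH.
- by apply: smoothN; do 2?apply: smoothM => //; apply: IH.
apply: expansion_strict_diff => a0 Ia; case: (fibre_pos_new Ia pf) => c c0 h.
have := expansionV (FF := fibre_near_filter a0) (gauge_small a0) c0 h (smooth_strict_diff_expansion Ia fk hfs hfa sf).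
by apply: expansion_eq => // y; rewrite /differential/at_old; ring.
Qed.

Lemma smooth_sqrt k f : fibre_pos f -> smooth k f -> smooth k (fun t s a => Num.sqrt (f t s a)).
Proof.
move=> pf hf0; have bV : fibre_bounded (fun t s a => Num.sqrt (f t s a)).
  move=> a0 Ia; case: (smooth_bounded hf0 Ia) => M M0 h.
  exists (Num.sqrt M); first by rewrite sqrtr_gt0.
  apply: filterS h => y cy; rewrite {1}/at_old ger0_norm ?sqrtr_ge0//.
  by apply: ler_wsqrtr; apply: le_trans (ler_norm _) _.
have pV : fibre_pos (fun t s a => 2 * Num.sqrt (f t s a)).
  move=> a0 /pf [c c0 h]; exists (Num.sqrt c); first by rewrite sqrtr_gt0.
  apply: filterS h => y /ler_wsqrtr; have := sqrtr_ge0 c; rewrite /at_old; lra.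
elim: k hf0 => [|k IH] hf.
  split=> //; split=> // a0 Ia e e0; case: (fibre_pos_new Ia pf) => c c0 h.
  have c'0 : 0 < Num.sqrt c by rewrite sqrtr_gt0.
  have e2 : 0 < e * Num.sqrt c by rewrite !mulr_gt0.
  apply: filterS2 h (smooth_equicont hf Ia e2) => y [c1 c2] h1.
  have y1 : 0 <= at_old f y by lra.
  have y2 : 0 <= at_new f y by lra.
  move: h1 (ler_wsqrtr c1) (ler_wsqrtr c2); rewrite -(sqr_sqrtr y1) -(sqr_sqrtr y2) !sqrtr_sqr.
  rewrite subr_sqr (ger0_norm (sqrtr_ge0 (at_new f y))) (ger0_norm (sqrtr_ge0 (at_old f y))) /at_new /at_old.
  set u := Num.sqrt _; set v := Num.sqrt (f _ _ _) => h1 h2 h3.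
  have uv : 0 < u + v by lra.
  move: h1; rewrite normrM (gtr0_norm uv) => h1.
  rewrite -(ler_pM2r uv); apply: (le_trans h1); rewrite ler_wpM2l ?(ltW e0)//; lra.
have fk := smoothW hf; have IHf := IH fk.
case: hf => [[bf _] [fs [fa [sf hfs hfa]]]].
have vk : smooth k (fun t s a => (2 * Num.sqrt (f t s a))^-1).
  by apply: smoothV => //; apply: smoothM => //; exact: smooth_cst.
apply: (@smooth_intro _ _ (fun t s a => (2 * Num.sqrt (f t s a))^-1 * fs t s a)
   (fun t s a => (2 * Num.sqrt (f t s a))^-1 * fa t s a)) => //; last 2 first.
- exact: smoothM.
- exact: smoothM.
apply: expansion_strict_diff => a0 Ia; case: (fibre_pos_new Ia pf) => c c0 h.
have := expansion_sqrt (FF := fibre_near_filter a0) (gauge_small a0) c0 h (smooth_strict_diff_expansion Ia fk hfs hfa sf).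
by apply: expansion_eq => // y; rewrite /differential/at_old; ring.
Qed.

End domain.
End smooth_families.

Section composition.
Variables (R : realType) (I : set R) (T0 T : Type).
Variables (E0 : T0 -> R -> R -> Prop) (E : T -> R -> R -> Prop).
Variables (tau : T -> T0) (w : T -> R -> R -> R).
Hypothesis Ew : forall t s a, E t s a -> E0 (tau t) (w t s a) a.

Lemma fibre_near_comp a0 (P : set (T0 * (R * R) * (R * R))) : I a0 -> fibre_equicont I E w ->
  (\forall y \near fibre_near E0 a0, P y) -> \forall y \near fibre_near E a0,
  P (tau y.1.1, (at_old w y, y.1.2.2), (at_new w y, y.2.2)).
Proof.
move=> Ia hw [d d0 hP]; have d2 : 0 < d / 2 by rewrite divr_gt0.
have [c c0 hc] := hw _ Ia _ d2.
exists (Num.min c d); first by rewrite lt_min c0.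
move=> t s a s' a' E1 E2; rewrite !lt_min => /andP[? ?] /andP[? ?] /andP[? ?].
apply: hP => //=; try by apply: Ew.
have := hc t s a s' a' E1 E2; rewrite /at_new/at_old/= => /(_ _ _ _)h.
apply: (le_lt_trans (h _ _ _)) => //; lra.
Qed.

Lemma strict_diff_lip (w' ws wa : T -> R -> R -> R) k a0 : I a0 -> strict_diff I E w' ws wa ->
  smooth I E k ws -> smooth I E k wa ->
  exists2 L : R, 0 < L & \forall y \near fibre_near E a0, `|at_new w' y - at_old w' y| <= L * gauge y.
Proof.
move=> Ia sd /smooth_bounded hs /smooth_bounded ha.
case: (hs _ Ia) => M M0 hM; case: (ha _ Ia) => A A0 hA.
exists (M + A + 1); first by rewrite !addr_gt0.
apply: (filterS3 _ _ hM hA (sd _ Ia _ (@ltr01 R))) => y h1 h2 h3.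
have -> : at_new w' y - at_old w' y = differential ws wa y + (at_new w' y - at_old w' y - differential ws wa y) by ring.
rewrite (le_trans (ler_normD _ _))// [X in _ <= X]mulrDl lerD//.
rewrite (le_trans (ler_normD _ _))// mulrDl lerD//; apply: ler_normM => //.
  by rewrite /gauge lerDl.
by rewrite /gauge lerDr.
Qed.

(** Chain rule for a substitution in [s]. The bound on [F] is uniform in [s], so [w] itself may be
    unbounded; this allows lifts, free up to an integer, to be substituted into periodic
    functions. *)
Lemma smooth_comp k F : smooth I E0 k F -> smooth_mod_cst I E k w ->
  smooth I E k (fun t s a => F (tau t) (w t s a) a).
Proof.
elim: k F => [|k IH] F hF hw.
  have we := hw.1; split=> //; split=> a0 Ia.
    case: (smooth_bounded hF Ia) => M M0 h; exists M => //.
    exact: (fibre_near_comp Ia we h).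
  by move=> e e0; exact: (fibre_near_comp Ia we (smooth_equicont hF Ia e0)).
have we := hw.1; have hwk := smooth_mod_cstW hw; have hFk := smoothW hF.
case: hF => [[bF _] [Fs [Fa [sF hFs hFa]]]].
case: hw => [_ [ws [wa [sw hws hwa]]]].
apply: (@smooth_intro _ _ _ _ _ _ (fun t s a => Fs (tau t) (w t s a) a * ws t s a)
  (fun t s a => Fs (tau t) (w t s a) a * wa t s a + Fa (tau t) (w t s a) a)).
- move=> a0 Ia; case: (bF _ Ia) => M M0 h; exists M => //; exact: (fibre_near_comp Ia we h).
- move=> a0 Ia e e0.
  have [L L0 hL] := strict_diff_lip Ia sw hws hwa.
  case: (smooth_bounded hFs Ia) => M M0 hM0.
  have hM := fibre_near_comp Ia we hM0.
  have e2 : 0 < e / (L + 1 + M) by rewrite divr_gt0// !addr_gt0.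
  have h1 := fibre_near_comp Ia we (sF _ Ia _ e2).
  have hX := @filterI _ _ (fibre_near_filter E a0) _ _ hM (sw _ Ia _ e2).
  apply: (filterS3 _ _ hL h1 hX) => y {}hL {}h1 [{}hM h2].
  move: hM h1; rewrite /gauge /differential {1 2 3 4}/at_new {1 2 3 4 5}/at_old /=.
  set g := gauge y in hL h2 *.
  move=> hM h1; rewrite /differential /at_old/= -/(at_old w y).
  set fs := Fs _ _ _ in hM h1 *; set fa := Fa _ _ _ in h1 *.
  rewrite {1}/at_new -/(at_new w y).
  set X := F _ _ _ in h1 *; set X' := F _ _ _ in h1 *.
  rewrite -/(at_old ws y) -/(at_old wa y).
  set dw := at_new w y - at_old w y in hL h1 h2 *.
  set ds := y.2.1 - y.1.2.1 in h1 h2 *; set da := y.2.2 - y.1.2.2 in h1 h2 *.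
  have -> : X - X' - (fs * at_old ws y * ds + (fs * at_old wa y + fa) * da) =
    (X - X' - (fs * dw + fa * da)) + fs * (dw - (at_old ws y * ds + at_old wa y * da)) by ring.
  set e' := e / _ in e2 h1 h2 *.
  have -> : e = e' * (L + 1) + M * e' by rewrite /e'; field; rewrite lt0r_neq0// !addr_gt0.
  rewrite (le_trans (ler_normD _ _))// mulrDl lerD//.
    apply: (le_trans h1); rewrite -mulrA ler_wpM2l ?(ltW e2)// mulrDl mul1r lerD//.
    by rewrite /g /gauge lerDr.
  by rewrite -[X in _ <= X]mulrA; apply: ler_normM.
- by apply: smoothM (smooth_le _ hws) => //; apply: IH.
- by apply: smoothD; [apply: smoothM hwa|]; apply: IH.
Qed.

End composition.

(** * Uniformity by compactness, and derivatives along a set *)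

Section tools.
Variable R : realType.

Lemma finite_uniform (T : finType) (P : T -> R -> Prop) :
  (forall t d d', 0 < d' <= d -> P t d -> P t d') ->
  (forall t, exists2 d : R, 0 < d & P t d) -> exists2 d : R, 0 < d & forall t, P t d.
Proof.
move=> mono h.
have [f hf] := @choice _ _ (fun t d => 0 < d /\ P t d) (fun t => let: ex_intro2 d d0 p := h t in ex_intro _ d (conj d0 p)).
pose d := \big[Num.min/1]_t f t.
have d0 : 0 < d.
  by rewrite /d; elim/big_ind: _ => // [x y x0 y0|t _]; [rewrite lt_min x0|case: (hf t)].
exists d => // t; apply: mono (hf t).2; rewrite d0 /=; exact: bigmin_le_cond.
Qed.

(** Near-covering compactness for the filter of small positive numbers. No monotonicity in [d] is
    asked, because the local hypothesis already covers every smaller [d]. *)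
Lemma compact_uniform (X : topologicalType) (A : set X) (P : X -> R -> Prop) :
  compact A -> (forall x, A x -> exists2 d0 : R, 0 < d0 & \forall y \near x, forall d : R, 0 < d < d0 -> P y d) ->
  exists2 d0 : R, 0 < d0 & forall d, 0 < d < d0 -> forall y, A y -> P y d.
Proof.
move=> cA h.
pose proof ((compact_near_coveringP A).1 cA R (0^'+) (fun d x => P x d) _) as key.
have H : forall x : X, A x -> \forall x' \near x & i \near 0^'+, P x' i.
  move=> x /h [d0 d00 hd]; exists ([set y | forall d : R, 0 < d < d0 -> P y d], [set d : R | 0 < d < d0]).
    split=> //=; near=> d; apply/andP; split; near: d; [exact: nbhs_right_gt|exact: nbhs_right_lt].
  by move=> [y d] [/= h1 h2]; exact: h1.
have [e /= e0 he] := key H; exists e => // d /andP[d0 de] y Ay.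
by apply: he => //=; rewrite sub0r normrN gtr0_norm.
Unshelve. all: by end_near. Qed.

Lemma compact_pos_lb (X : topologicalType) (A : set X) (h : X -> R) : compact A ->
  (forall x, A x -> {for x, continuous h} /\ 0 < h x) -> exists2 c : R, 0 < c & forall x, A x -> c <= h x.
Proof.
move=> cA hh.
have [|d0 d00 hd] := @compact_uniform X A (fun x d => d <= h x) cA.
  move=> x /hh[ch hx]; exists (h x / 2); first by rewrite divr_gt0.
  have /cvgrPdist_lt /(_ (h x / 2)) := ch; rewrite divr_gt0// => /(_ isT).
  apply: filterS => y; rewrite ltr_norml => /andP[h1 h2] d /andP[_ h3]; lra.
exists (d0 / 2); first by rewrite divr_gt0.
by move=> x Ax; apply: hd => //; lra.
Qed.

(** Multiplying out the difference quotient avoids punctured neighbourhoods. At an isolated point of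
    [S] every [l] qualifies, so uniqueness is a separate lemma that asks for accumulation. *)
Definition has_deriv (S : set R) (f : R -> R) (x l : R) := forall e : R, 0 < e ->
  exists2 d : R, 0 < d & forall y, S y -> `|y - x| < d -> `|f y - f x - l * (y - x)| <= e * `|y - x|.

Lemma has_deriv_sub (S S' : set R) f x l : S' `<=` S -> has_deriv S f x l -> has_deriv S' f x l.
Proof. by move=> SS h e /h[d d0 hd]; exists d => // y /SS; apply: hd. Qed.

Lemma has_deriv_local (S S' : set R) f x l d : 0 < d ->
  (forall y, S' y -> `|y - x| < d -> S y) -> has_deriv S f x l -> has_deriv S' f x l.
Proof.
move=> d0 SS h e /h[c c0 hc]; exists (Num.min c d); first by rewrite lt_min c0.
by move=> y Sy; rewrite lt_min => /andP[? ?]; apply: hc => //; apply: SS.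
Qed.

Lemma has_deriv_eq (S : set R) f g x l : S x -> (forall y, S y -> f y = g y) ->
  has_deriv S f x l -> has_deriv S g x l.
Proof.
move=> Sx fg h e /h[d d0 hd]; exists d => // y Sy yx; rewrite -!fg//; exact: hd.
Qed.

Lemma has_deriv_ext (S : set R) f g x l : f =1 g -> has_deriv S f x l -> has_deriv S g x l.
Proof. by move=> /funext ->. Qed.

Lemma has_deriv_cont S f x l : has_deriv S f x l -> forall e : R, 0 < e ->
  exists2 d : R, 0 < d & forall y, S y -> `|y - x| < d -> `|f y - f x| <= e.
Proof.
move=> h e e0; have [d d0 hd] := h _ (@ltr01 R).
have k0 : 0 < 1 + `|l| by rewrite ltr_pwDl.
exists (Num.min d (e / (1 + `|l|))); first by rewrite lt_min d0 divr_gt0.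
move=> y Sy; rewrite lt_min => /andP[h1 h2].
have -> : f y - f x = (f y - f x - l * (y - x)) + l * (y - x) by ring.
rewrite (le_trans (ler_normD _ _))//.
apply: (@le_trans _ _ ((1 + `|l|) * `|y - x|)).
  by rewrite mulrDl lerD ?hd// normrM.
by rewrite mulrC -ler_pdivlMr// ltW.
Qed.

Lemma withinP (S : set R) (x : R) (P : R -> Prop) :
  (\forall y \near within S (nbhs x), P y) <->
  exists2 d : R, 0 < d & forall y, S y -> `|y - x| < d -> P y.
Proof.
split=> [/nbhs_ballP[d /= d0 h]|[d d0 h]].
  by exists d => // y Sy yx; apply: h => //; rewrite -ball_normE /= distrC.
rewrite /within/=; exists d => //= y xy Sy; apply: h => //; by rewrite distrC.
Qed.

Lemma has_deriv_expansion (S : set R) (f : R -> R) (x l : R) :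
  expansion (within S (nbhs x)) (fun y => `|y - x|) f (cst (f x)) (fun y => l * (y - x))
  <-> has_deriv S f x l.
Proof.
split=> [[_ _ h] e e0|h]; first exact/withinP/h.
split.
- have [d d0 hd] := has_deriv_cont h ltr01.
  exists (1 + `|f x|); first by rewrite ltr_pwDl.
  apply/withinP; exists d => // y Sy /(hd _ Sy) h1; split; last by rewrite /= lerDr.
  by rewrite -[f y](subrK (f x)) (le_trans (ler_normD _ _))// lerD.
- exists (1 + `|l|); first by rewrite ltr_pwDl.
  by apply/withinP; exists 1 => // y _ _; rewrite normrM ler_wpM2r// lerDr.
- by move=> e e0; apply/withinP/h.
Qed.

Lemma within_gauge (S : set R) (x e : R) : 0 < e ->
  \forall y \near within S (nbhs x), 0 <= `|y - x| <= e.
Proof. by move=> e0; apply/withinP; exists e => // y _ /ltW ->; rewrite normr_ge0. Qed.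

Lemma has_deriv_cst (S : set R) (c x : R) : has_deriv S (fun=> c) x 0.
Proof. by move=> e e0; exists 1 => // y _ _; rewrite mul0r !subrr normr0 mulr_ge0// ltW. Qed.

Lemma has_derivD S f g x l k : has_deriv S f x l -> has_deriv S g x k ->
  has_deriv S (fun y => f y + g y) x (l + k).
Proof.
move=> /has_deriv_expansion h1 /has_deriv_expansion h2; apply/has_deriv_expansion.
by pose proof (expansionD h1 h2) as H; move: H; apply: expansion_eq => // y; ring.
Qed.

Lemma has_derivM S f g x l k : has_deriv S f x l -> has_deriv S g x k ->
  has_deriv S (fun y => f y * g y) x (l * g x + f x * k).
Proof.
move=> /has_deriv_expansion h1 /has_deriv_expansion h2; apply/has_deriv_expansion.
pose proof (expansionM (@within_gauge S x) h1 h2) as H; move: H.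
by apply: expansion_eq => // y /=; ring.
Qed.

Lemma has_derivZ S f x l c : has_deriv S f x l -> has_deriv S (fun y => c * f y) x (c * l).
Proof.
by move=> h; have := has_derivM (has_deriv_cst S c x) h; rewrite mul0r add0r.
Qed.

Lemma has_derivB S f g x l k : has_deriv S f x l -> has_deriv S g x k ->
  has_deriv S (fun y => f y - g y) x (l - k).
Proof.
move=> h1 /(has_derivZ (-1)) h2; have := has_derivD h1 h2; rewrite mulN1r.
by apply: has_deriv_ext => y; rewrite mulN1r.
Qed.

Lemma has_deriv_comp S S' f g x l k : (forall y, S y -> S' (f y)) ->
  has_deriv S f x l -> has_deriv S' g (f x) k -> has_deriv S (g \o f) x (k * l).
Proof.
move=> SS hf hg e e0.
pose M := 1 + `|l| + `|k|; have M0 : 0 < M by rewrite ltr_pwDl// ltr_pwDl.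
have M1 : 0 < 1 + `|l| by rewrite ltr_pwDl.
have e1 : 0 < Num.min 1 (e / M) by rewrite lt_min ltr01 divr_gt0.
have [d d0 hd] := hg _ e1; have [d' d'0 hd'] := hf _ e1.
exists (Num.min d' (d / (1 + `|l|))); first by rewrite lt_min d'0 divr_gt0.
move=> y Sy; rewrite lt_min => /andP[y1 y2].
set E := Num.min _ _ in e1 hd hd'.
have [E1 E2] : E <= 1 /\ E <= e / M by rewrite /E !ge_min !lexx orbT.
have h1 := hd' _ Sy y1.
have h2 : `|f y - f x| <= (1 + `|l|) * `|y - x|.
  have -> : f y - f x = (f y - f x - l * (y - x)) + l * (y - x) by ring.
  rewrite (le_trans (ler_normD _ _))// mulrDl lerD// ?normrM//.
  by apply: (le_trans h1); rewrite ler_wpM2r.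
have h3 : `|f y - f x| < d.
  by apply: (le_lt_trans h2); rewrite mulrC -ltr_pdivlMr.
have h4 := hd _ (SS _ Sy) h3.
have -> : (g \o f) y - (g \o f) x - k * l * (y - x) =
  (g (f y) - g (f x) - k * (f y - f x)) + k * (f y - f x - l * (y - x)) by rewrite /=; ring.
have -> : e = e / M * (1 + `|l|) + `|k| * (e / M) by rewrite /M; field; rewrite lt0r_neq0.
rewrite (le_trans (ler_normD _ _))// mulrDl lerD//.
  apply: (le_trans h4); rewrite -mulrA; apply: ler_pM => //; exact: ltW.
by rewrite normrM -mulrA ler_wpM2l// (le_trans h1)// ler_wpM2r.
Qed.

Lemma has_deriv_unique (S : set R) f x l l' :
  (forall d : R, 0 < d -> exists y, [/\ S y, y != x & `|y - x| < d]) ->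
  has_deriv S f x l -> has_deriv S f x l' -> l = l'.
Proof.
move=> acc h h'; apply/eqP; rewrite -subr_eq0 -normr_le0.
apply/ler_addgt0Pr => e e0; rewrite add0r; have e2 : 0 < e / 2 by rewrite divr_gt0.
have [d d0 hd] := h _ e2; have [d' d'0 hd'] := h' _ e2.
have [|y [Sy yx]] := acc (Num.min d d'); first by rewrite lt_min d0.
rewrite lt_min => /andP[y1 y2].
have yx0 : 0 < `|y - x| by rewrite normr_gt0 subr_eq0.
rewrite -(ler_pM2r yx0) -normrM.
have -> : (l - l') * (y - x) = (f y - f x - l' * (y - x)) - (f y - f x - l * (y - x)) by ring.
rewrite (le_trans (ler_normB _ _))//; apply: (le_trans (lerD (hd' _ Sy y2) (hd _ Sy y1))); lra.
Qed.

Lemma has_deriv_within_continuous (S : set R) f f' :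
  (forall x, S x -> has_deriv S f x (f' x)) -> {within S, continuous f}.
Proof.
move=> h; apply/subspace_continuousP => x Sx.
apply/cvgrPdist_le => e e0; have [d d0 hd] := has_deriv_cont (h _ Sx) e0.
rewrite /within/=; exists d => //= y xy Sy; have := hd y Sy; rewrite distrC (distrC (f y)); exact.
Qed.

Lemma has_deriv_is_derive (S : set R) f x l : (\forall y \near x, S y) ->
  has_deriv S f x l -> is_derive x 1 f l.
Proof.
move=> [r /= r0 hr] h.
have H : h^-1 *: (f (h *: 1 + x) - f x) @[h --> 0^'] --> l.
  apply/cvgrPdist_le => e e0; have [d d0 hd] := h _ e0.
  exists (Num.min d r) => /=; first by rewrite lt_min d0.
  move=> y; rewrite /= sub0r normrN lt_min => /andP[y1 y2] y0.
  have y3 : 0 < `|y| by rewrite normr_gt0.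
  have xy : y *: (1:R) + x = x + y by rewrite scaler1 addrC.
  have Sy : S (x + y) by apply: hr => /=; rewrite opprD addrA subrr sub0r normrN.
  have := hd _ Sy; rewrite (addrC x) addrK => /(_ y1).
  rewrite xy (addrC x) => hd'; rewrite -(ler_pM2r y3) -normrM.
  apply: le_trans hd'; rewrite distrC mulrBl [_ *: _]/(_ * _) mulrAC mulVf// mul1r.
  by rewrite distrC mulrC distrC.
split; last by apply: cvg_lim H.
by apply/cvg_ex; exists l.
Qed.

Lemma mvt_has_deriv (f f' : R -> R) (a b : R) : a <= b ->
  (forall x, a <= x <= b -> has_deriv [set y | a <= y <= b] f x (f' x)) ->
  exists2 c : R, a <= c <= b & f b - f a = f' c * (b - a).
Proof.
move=> ab h; have [] := @MVT_segment R f f' a b ab.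
- move=> x; rewrite in_itv/= => /andP[ax xb].
  apply: (has_deriv_is_derive _ (h _ _)); last by rewrite !ltW.
  exists (Num.min (x - a) (b - x)) => /=; first by rewrite lt_min !subr_gt0 ax.
  by move=> y; rewrite /= lt_min !ltr_norml => /andP[/andP[? ?] /andP[? ?]]; lra.
- rewrite (_ : [set` _] = [set y | a <= y <= b]); last by apply/seteqP; split=> y /=; rewrite in_itv.
  exact: has_deriv_within_continuous h.
- by move=> c; rewrite in_itv/= => ? ?; exists c.
Qed.

Lemma mvt_le (f f' : R -> R) (a b g e : R) : a <= b ->
  (forall x, a <= x <= b -> has_deriv [set y | a <= y <= b] f x (f' x)) ->
  (forall x, a <= x <= b -> `|f' x - g| <= e) ->
  `|f b - f a - g * (b - a)| <= e * (b - a).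
Proof.
move=> ab h he; have [c hc ->] := mvt_has_deriv ab h.
by rewrite -mulrBl normrM (ger0_norm (_ : 0 <= b - a)) ?subr_ge0// ler_wpM2r ?subr_ge0// he.
Qed.

End tools.

(** * Convex sets and their boundary curves *)

Section plane_lemmas.
Variable R : realType.
Local Notation plane := 'rV[R]_2.
Implicit Types x y z : plane.

Lemma ord2P (P : 'I_2 -> Prop) : P 0 -> P 1 -> forall c, P c.
Proof.
move=> p0 p1 [[|[|//]] i]; [apply: (eq_ind _ P p0)|apply: (eq_ind _ P p1)]; exact/val_inj.
Qed.

Lemma planeP x y : x 0 0 = y 0 0 -> x 0 1 = y 0 1 -> x = y.
Proof. by move=> h0 h1; apply/rowP; apply: ord2P. Qed.

Lemma dotpE x y : dotp x y = x 0 0 * y 0 0 + x 0 1 * y 0 1.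
Proof.
rewrite /dotp big_ord_recl big_ord1; congr (_ + x 0 _ * y 0 _); exact/val_inj.
Qed.

Lemma rot90E0 x : rot90 x 0 0 = - x 0 1. Proof. by rewrite /rot90 mxE. Qed.
Lemma rot90E1 x : rot90 x 0 1 = x 0 0. Proof. by rewrite /rot90 mxE. Qed.
Definition rot90E := (rot90E0, rot90E1).

Lemma enorm_ge0 x : 0 <= enorm x. Proof. exact: sqrtr_ge0. Qed.

Lemma dotp_ge0 x : 0 <= dotp x x.
Proof. by rewrite dotpE -!expr2 addr_ge0// sqr_ge0. Qed.

Lemma enorm_sqr x : enorm x ^+ 2 = x 0 0 ^+ 2 + x 0 1 ^+ 2.
Proof. by rewrite sqr_sqrtr ?dotp_ge0// dotpE !expr2. Qed.

Lemma enorm_gt0 x : (0 < enorm x) = (x != 0).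
Proof.
rewrite sqrtr_gt0 dotpE -!expr2; apply/idP/idP; last first.
  apply: contraNT; rewrite -leNgt => h.
  have h0 := sqr_ge0 (x 0 0); have h1 := sqr_ge0 (x 0 1).
  have /eqP : x 0 0 ^+ 2 = 0 by lra.
  have /eqP : x 0 1 ^+ 2 = 0 by lra.
  rewrite !sqrf_eq0 => /eqP x1 /eqP x0; apply/eqP.
  by apply: planeP; rewrite mxE.
by apply: contraTneq => ->; rewrite !mxE expr0n/= addr0 ltxx.
Qed.

Lemma plane_near x (e : R) : 0 < e -> \forall y \near x, forall c : 'I_2, `|(y : plane) 0 c - x 0 c| < e.
Proof.
move=> e0; have h (c : 'I_2) : \forall y \near x, `|(y : plane) 0 c - x 0 c| < e.
  have /cvgrPdist_lt/(_ _ e0) := @coord_continuous R 1 2 0 c x.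
  by apply: filterS => y; rewrite distrC.
by apply: filterS2 (h 0) (h 1) => y h0 h1; apply: ord2P.
Qed.

Lemma plane_nbhsP x (A : set plane) :
  nbhs x A <-> exists2 e : R, 0 < e & forall y, (forall c, `|y 0 c - x 0 c| < e) -> A y.
Proof.
split=> [/nbhs_ballP[e /= e0 he]|[e e0 he]].
  exists e => // y hy; apply: he; rewrite -ball_normE /= /ball_/=.
  rewrite [`|_|]mx_normrE; apply/bigmax_ltP; split => // -[i j] _ /=.
  by rewrite !mxE distrC (ord1 i).
by apply: filterS (plane_near x e0) => y /he.
Qed.

Lemma convex2 (A : set plane) x y t : convex_set A -> A x -> A y -> 0 <= t <= 1 ->
  A (t *: x + (1 - t) *: y).
Proof.
move=> cA Ax Ay /andP[t0 t1].
have := cA x y (Itv01 t0 t1) (mem_set Ax) (mem_set Ay); rewrite inE; congr (A _).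
Qed.

Lemma bdry_closed_sub (A : set plane) : compact A -> bdry A `<=` A.
Proof.
move=> /compact_closed h x [+ _]; suff /h : hausdorff_space plane by apply.
exact: norm_hausdorff.
Qed.

Lemma derivable_has_deriv (f : R -> R) u : derivable f u 1 ->
  has_deriv setT f u (derive1 f u).
Proof.
move=> df e e0; have : h^-1 *: (f (h *: 1 + u) - f u) @[h --> 0^'] --> derive1 f u.
  rewrite derive1E; exact: df.
move=> /cvgrPdist_le/(_ _ e0) [d /= d0 hd]; exists d => // y _ yu.
have [->|yu0] := eqVneq y u; first by rewrite !subrr mulr0 subr0 normr0 mulr0.
have y3 : 0 < `|y - u| by rewrite normr_gt0 subr_eq0.
have := hd (y - u); rewrite /= sub0r normrN subr_eq0 => /(_ yu yu0).
rewrite -(ler_pM2r y3) -normrM; apply: le_trans.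
rewrite distrC /GRing.scale/= mulr1 subrK mulrBl mulrAC mulVf ?mul1r// subr_eq0//.
Qed.

Lemma derivable_coord_has_deriv (g : R -> plane) u c : derivable g u 1 ->
  has_deriv setT (fun v => g v 0 c) u (derive1 g u 0 c).
Proof.
move=> dg; have /derivable_mxP h := dg.
by have := derivable_has_deriv (h 0 c); rewrite !derive1E derive_mx// mxE.
Qed.

End plane_lemmas.

Section convex_curve.
Variable R : realType.
Local Notation plane := 'rV[R]_2.
Variables (A : set plane) (g g1 g2 : R -> plane).
Hypothesis cA : convex_set A.
Hypothesis kA : compact A.
Hypothesis gA : forall u, bdry A (g u).
Hypothesis dg : forall u c, has_deriv setT (fun v => g v 0 c) u (g1 u 0 c).
Hypothesis dg1 : forall u c, has_deriv setT (fun v => g1 v 0 c) u (g2 u 0 c).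
Hypothesis g1n : forall u, enorm (g1 u) = 1.
Hypothesis curv : forall u, 0 < det2 (g1 u) (g2 u).
Hypothesis left : forall u, \forall t \near 0^'+, A° (g u + t *: rot90 (g1 u)).

Lemma curve_mem u : A (g u). Proof. exact: bdry_closed_sub. Qed.

(* If [y] were strictly to the right of the tangent at [g u], the curve would run
   inside the triangle spanned by [g u], [y] and an interior point on the left. *)
Lemma tangent_supporting u y : A y -> 0 <= det2 (g1 u) (y - g u).
Proof.
move=> Ay; rewrite leNgt; apply/negP => q0.
set q := det2 _ _ in q0; pose p := dotp (g1 u) (y - g u).
have [t [t0 /plane_nbhsP[rho rho0 hrho]]] : exists t : R, 0 < t /\ A° (g u + t *: rot90 (g1 u)).
  have h := left u; near (0 : R)^'+ => t; exists t; split; near: t => //; exact: nbhs_right_gt.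
pose e := rho * (- q) / (2 * t).
have e0 : 0 < e by rewrite divr_gt0 ?mulr_gt0// oppr_gt0.
pose M := 1 + `|p|; have M0 : 0 < M by rewrite ltr_pwDl.
have eM : 0 < e / M by rewrite divr_gt0.
have [d0 d00 h0] := @dg u 0 _ eM; have [d1 d10 h1] := @dg u 1 _ eM.
pose k := 1 - q / t; have k0 : 1 <= k by rewrite /k -mulNr lerDl divr_ge0 ?(ltW t0)// oppr_ge0 ltW.
have [h [hp hk hd0 hd1]] : exists h : R, [/\ 0 < h, h * k < 1, h * M < d0 & h * M < d1].
  exists (Num.min (k^-1) (Num.min (d0 / M) (d1 / M)) / 2).
  set m := Num.min _ _.
  have m0 : 0 < m by rewrite !lt_min invr_gt0 !divr_gt0// (lt_le_trans ltr01 k0).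
  have [m1 [m2 m3]] : m <= k^-1 /\ m <= d0 / M /\ m <= d1 / M.
    by rewrite /m !ge_min !lexx !orbT.
  have kp : 0 < k by rewrite (lt_le_trans ltr01 k0).
  move: m1 m2 m3; rewrite !ler_pdivlMr// -[_^-1]mul1r ler_pdivlMr// => m1 m2 m3.
  split; nra.
have [hcl ncl] := gA (u + h * p); apply: ncl.
have u1 : g1 u 0 0 ^+ 2 + g1 u 0 1 ^+ 2 = 1 by rewrite -enorm_sqr g1n expr1n.
(* In the frame of the tangent, [y - g u] has components [p] and [q < 0], and the interior point has
   height [t]. With this weight [h * q + al * t = 0], so the convex combination with weights [al],
   [h] and [1 - al - h] moves along the tangent by [h * p], as the curve does to first order. *)
pose al := h * (- q) / t.
have al0 : 0 < al by rewrite divr_gt0 ?mulr_gt0// oppr_gt0.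
have alh : al + h < 1 by move: hk; rewrite /k /al; lra.
apply/plane_nbhsP; exists (e * h); first exact: mulr_gt0.
move=> w hw.
have hpM : `|h * p| <= h * M.
  by rewrite normrM (gtr0_norm hp) ler_pM2l// /M lerDr.
have key c : `|w 0 c - g u 0 c - h * p * g1 u 0 c| < 2 * e * h.
  have hc : `|g (u + h * p) 0 c - g u 0 c - g1 u 0 c * (h * p)| <= e / M * `|h * p|.
    have E : u + h * p - u = h * p by ring.
    move: c {hw}; apply: ord2P.
      by have := h0 (u + h * p) I; rewrite E; apply; apply: le_lt_trans hd0.
    by have := h1 (u + h * p) I; rewrite E; apply; apply: le_lt_trans hd1.
  have -> : w 0 c - g u 0 c - h * p * g1 u 0 c = (w 0 c - g (u + h * p) 0 c) +
     (g (u + h * p) 0 c - g u 0 c - g1 u 0 c * (h * p)) by ring.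
  rewrite (le_lt_trans (ler_normD _ _))// (_ : 2 * e * h = e * h + e * h); last ring.
  rewrite ltr_leD// (le_trans hc)//.
  rewrite (_ : e * h = e / M * (h * M)); last by field; rewrite lt0r_neq0.
  by rewrite ler_wpM2l// ltW.
have [rt rtE] : exists rt, rt = rot90 (g1 u) by exists (rot90 (g1 u)).
pose z := g u + t *: rt + al^-1 *: (w - g u - (h * p) *: g1 u).
have Az : A z.
  apply: hrho => c; rewrite -rtE /z !mxE.
  set X := (X in `|X|); have -> : X = al^-1 * (w 0 c - g u 0 c - h * p * g1 u 0 c).
    by rewrite /X; ring.
  rewrite normrM gtr0_norm ?invr_gt0// mulrC ltr_pdivrMr//.
  apply: lt_le_trans (key c) _; rewrite /e /al le_eqVlt; apply/orP; left; apply/eqP.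
  by field; rewrite lt0r_neq0.
have al1 : 0 < 1 - al by move: alh hp; clr; lra.
have -> : w = al *: z + (1 - al) *: ((h / (1 - al)) *: y + (1 - h / (1 - al)) *: g u).
  have hq : q * t^-1 * t = q by rewrite mulfVK// lt0r_neq0.
  have E c : h * (y 0 c - g u 0 c) - h * p * g1 u 0 c + al * t * rt 0 c = 0.
    have -> : al * t = - h * q by rewrite /al; field; rewrite lt0r_neq0.
    rewrite rtE /p /q dotpE /det2; move: c; apply: ord2P; rewrite rot90E !mxE.
      set x0 := g1 u 0 0 in u1 *; set x1 := g1 u 0 1 in u1 *.
      transitivity (h * (y 0 0 - g u 0 0) * (1 - (x0 ^+ 2 + x1 ^+ 2))); [ring | by rewrite u1 subrr mulr0].
    set x0 := g1 u 0 0 in u1 *; set x1 := g1 u 0 1 in u1 *.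
    transitivity (h * (y 0 1 - g u 0 1) * (1 - (x0 ^+ 2 + x1 ^+ 2))); [ring | by rewrite u1 subrr mulr0].
  have F c : w 0 c = (al *: z + (1 - al) *: ((h / (1 - al)) *: y + (1 - h / (1 - al)) *: g u)) 0 c.
    rewrite /z !mxE -[LHS]addr0 -(E c).
    by field; rewrite !lt0r_neq0.
  exact: planeP.
apply: convex2 => //; last by move: alh al0 hp; clr; lra.
apply: convex2 => //; first exact: curve_mem.
apply/andP; split; first by rewrite divr_ge0// ltW.
by rewrite ler_pdivrMr//; move: alh; clr; lra.
Unshelve. all: by end_near. Qed.

(* At a contact point the support function of [y] along the tangents changes sign
   because of the curvature. *)
Lemma tangent_strictly_supporting u y : A y -> y != g u -> 0 < det2 (g1 u) (y - g u).
Proof.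
move=> Ay yu; rewrite lt_neqAle tangent_supporting// andbT; apply/eqP => /esym D0.
pose p := dotp (g1 u) (y - g u).
have u1 : g1 u 0 0 ^+ 2 + g1 u 0 1 ^+ 2 = 1 by rewrite -enorm_sqr g1n expr1n.
have yp : y - g u = p *: g1 u.
  move: D0; rewrite /det2 !mxE => D0.
  apply: planeP; rewrite !mxE /p dotpE !mxE.
    rewrite -[LHS]mul1r -u1; rewrite -[LHS]addr0 -[X in _ + X](mulr0 (g1 u 0 1)) -D0; ring.
  rewrite -[LHS]mul1r -u1; rewrite -[LHS]subr0 -[X in _ - X](mulr0 (g1 u 0 0)) -D0; ring.
have p0 : p != 0 by apply: contraNneq yu => p0; rewrite -subr_eq0 yp p0 scale0r.
set k := det2 (g1 u) (g2 u); have k0 : 0 < k by exact: curv.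
pose F v := det2 (g1 v) (y - g v).
have dF : has_deriv setT F u (- p * k).
  have dgy v c : has_deriv setT (fun v => (y - g v) 0 c) v (0 - g1 v 0 c).
    by apply: has_deriv_ext (has_derivB (has_deriv_cst _ (y 0 c) v) (@dg v c)) => z; rewrite !mxE.
  have := has_derivB (has_derivM (@dg1 u 0) (dgy u 1)) (has_derivM (@dg1 u 1) (dgy u 0)).
  set L := (X in has_deriv _ _ _ X); suff -> : L = - p * k by [].
  by rewrite /L /k /det2 yp !mxE; ring.
have F0 : F u = 0 by [].
have pk0 : 0 < `|p| * k by rewrite mulr_gt0 ?normr_gt0.
have [d d0 hd] := dF (`|p| * k / 2) (divr_gt0 pk0 (ltr0Sn R 1)).
(* [F] vanishes at [u] with derivative [- p * k], so a step in the direction of the sign of [p]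
   makes it negative, against the weak inequality. *)
pose v := u + Num.sg p * (d / 2).
have sp : `|Num.sg p| = 1 by rewrite normr_sg p0.
have vu : v - u = Num.sg p * (d / 2) by rewrite /v; ring.
have := hd v I; rewrite vu normrM sp mul1r gtr0_norm ?divr_gt0// => /(_ _)h.
have {h} := h (ltac:(lra)); rewrite F0 subr0.
have -> : - p * k * (Num.sg p * (d / 2)) = - (`|p| * k * (d / 2)) by rewrite [`|p|]normrEsg; ring.
have : 0 <= F v by exact: tangent_supporting.
rewrite opprK ler_norml => Fv /andP[_ h].
have : 0 < `|p| * k * d by rewrite mulr_gt0.
lra.
Qed.
End convex_curve.

(** * Smoothness of the boundary lengths *)

Lemma fibre_boundedP (R : realType) (I : set R) T (E : T -> R -> R -> Prop) f :
  fibre_bounded I E f <-> forall a0, I a0 -> exists2 M : R, 0 < M & exists2 d : R, 0 < d &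
    forall t s a, E t s a -> `|a - a0| < d -> `|f t s a| <= M.
Proof.
split=> h a0 /h [M M0 [d d0 hd]]; exists M => //; exists d => //.
  by move=> t s a Es ad; apply: (hd t s a s a) => //; rewrite subrr normr0.
by move=> t s a s' a' ? ? ? ? ?; apply: hd.
Qed.

Lemma mvt_on (R : realType) (S : set R) (h h' : R -> R) (g e a b : R) :
  (forall x y z, S x -> S y -> x <= z <= y -> S z) ->
  (forall x, S x -> has_deriv S h x (h' x)) -> S a -> S b ->
  (forall x, S x -> Num.min a b <= x <= Num.max a b -> `|h' x - g| <= e) ->
  `|h b - h a - g * (b - a)| <= e * `|b - a|.
Proof.
move=> cS dh; wlog ab : a b / a <= b => [H Sa Sb he|].
  have [ab|/ltW ba] := leP a b; first exact: H.
  have := H _ _ ba Sb Sa; rewrite minC maxC => /(_ he).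
  have -> : h b - h a - g * (b - a) = - (h a - h b - g * (a - b)) by ring.
  by rewrite normrN [`|b - a|]distrC; apply.
move=> Sa Sb he; rewrite (ger0_norm (_ : 0 <= b - a)) ?subr_ge0//.
have SS x : a <= x <= b -> S x by exact: cS.
apply: (@mvt_le _ h h') => // x xab.
  by apply: has_deriv_sub (dh _ (SS _ xab)) => y; exact: SS.
by apply: he; [exact: SS|rewrite min_l// max_r].
Qed.

Section strip_curve_length.
Variables (R : realType) (m : nat) (I : set R).

Definition strip (len : 'I_m -> R -> R) (i : 'I_m) (u a : R) : Prop := I a /\ 0 <= u <= len i a.

(** [f k l] stands for the derivative of order [k] in the arclength and [l] in the deformation
    parameter, by coordinates. No regularity of [len] is included: it will follow from the closing
    of the curves, their unit speed and strict convexity. *)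
Record strip_curve (len : 'I_m -> R -> R) (A B : nat)
    (f : nat -> nat -> 'I_2 -> 'I_m -> R -> R -> R) : Prop := StripCurve {
  sc_conv : forall a b c, I a -> I b -> a <= c <= b -> I c;
  sc_A : (2 <= A)%N;
  sc_B : (1 <= B)%N;
  sc_cont : forall k l c i u0 a0, (k <= A)%N -> (l <= B)%N -> strip len i u0 a0 ->
    forall e : R, 0 < e -> exists2 d : R, 0 < d & forall u a, strip len i u a ->
    `|u - u0| < d -> `|a - a0| < d -> `|f k l c i u a - f k l c i u0 a0| <= e;
  sc_da : forall l c i u a, (l < B)%N -> strip len i u a ->
    has_deriv [set t | strip len i u t] (f 0 l c i u) a (f 0 l.+1 c i u a);
  sc_du : forall k l c i u a, (k < A)%N -> (l <= B)%N -> strip len i u a ->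
    has_deriv [set s | strip len i s a] (f k l c i ^~ a) u (f k.+1 l c i u a);
  sc_len_gt0 : forall i a, I a -> 0 < len i a;
  sc_closed : forall k c i a, (k <= 1)%N -> I a -> f k 0 c i (len i a) a = f k 0 c i 0 a;
  sc_unit : forall i u a, strip len i u a -> f 1 0 0 i u a ^+ 2 + f 1 0 1 i u a ^+ 2 = 1;
  sc_convex : forall i (a u v : R), I a -> 0 <= u < len i a -> 0 <= v < len i a -> u != v ->
    0 < f 1 0 0 i u a * (f 0 0 1 i v a - f 0 0 1 i u a)
      - f 1 0 1 i u a * (f 0 0 0 i v a - f 0 0 0 i u a) }.
Variables (len : 'I_m -> R -> R) (A B : nat) (f : nat -> nat -> 'I_2 -> 'I_m -> R -> R -> R).
Hypothesis sc : strip_curve len A B f.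
Let I_conv := sc_conv sc.
Let A2 := sc_A sc.
Let A1 : (1 <= A)%N := ltnW A2.
Let B1 := sc_B sc.
Let f_cont := sc_cont sc.
Let f_da := sc_da sc.
Let f_du := sc_du sc.
Let len_gt0 := sc_len_gt0 sc.
Let f_closed := sc_closed sc.
Let f_unit := sc_unit sc.
Let f_convex := sc_convex sc.

Lemma strip_fibre_conv i a x y z : strip len i x a -> strip len i y a -> x <= z <= y -> strip len i z a.
Proof. move=> [Ia /andP[x0 _]] [_ /andP[_ ya]] /andP[xz zy]; split=> //; lra. Qed.

Lemma strip0 i a : I a -> strip len i 0 a.
Proof. by move=> Ia; split=> //; rewrite lexx ltW// len_gt0. Qed.
Lemma strip_len i a : I a -> strip len i (len i a) a.
Proof. by move=> Ia; split=> //; rewrite lexx ltW// len_gt0. Qed.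

Lemma f_unit_le1 c i u a : strip len i u a -> `|f 1 0 c i u a| <= 1.
Proof.
move=> /f_unit h; have h0 := sqr_ge0 (f 1 0 0 i u a); have h1 := sqr_ge0 (f 1 0 1 i u a).
rewrite -(@ler_pXn2r _ 2)// ?nnegrE// real_normK ?num_real// expr1n.
by move: c; apply: ord2P; lra.
Qed.

(** Only [(u0, a0)] is confined to the compact slice at [a0]; [(u, a)] is any nearby point of the
    strip, since nothing is known yet about [len i a]. *)
Lemma fibre_uniform_cont k l c i (a0 e : R) : (k <= A)%N -> (l <= B)%N -> I a0 -> 0 < e ->
  exists2 d : R, 0 < d & forall u0 u a, 0 <= u0 <= len i a0 -> strip len i u a ->
    `|u - u0| < d -> `|a - a0| < d -> `|f k l c i u a - f k l c i u0 a0| <= e.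
Proof.
move=> kA lB Ia e0; have e2 : 0 < e / 2 by rewrite divr_gt0.
have [|d0 d00 h] := @compact_uniform R _ `[0, len i a0] (fun u0 d => forall u a,
   strip len i u a -> 0 <= u0 <= len i a0 -> `|u - u0| < d -> `|a - a0| < d ->
   `|f k l c i u a - f k l c i u0 a0| <= e) (@segment_compact _ _ _).
  move=> u0; rewrite /= in_itv /= => u0P.
  have [d d0 hd] := f_cont c kA lB (conj Ia u0P) e2.
  exists (d / 2); first by rewrite divr_gt0.
  near=> u1 => d' /andP[d'0 d'd] u a uD u1P uu aa.
  have u10 : `|u1 - u0| < d / 2.
    near: u1; exists (d / 2); first by rewrite /= divr_gt0.
    by move=> y /=; rewrite distrC.
  have h1 := hd u1 a0 (conj Ia u1P); rewrite subrr normr0 in h1.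
  have h2 := hd u a uD.
  have uu0 : `|u - u0| < d.
    by have := ler_normD (u - u1) (u1 - u0); rewrite addrA subrK; move: u10 uu d'd; clr; lra.
  have -> : f k l c i u a - f k l c i u1 a0 = (f k l c i u a - f k l c i u0 a0) - (f k l c i u1 a0 - f k l c i u0 a0) by ring.
  rewrite (le_trans (ler_normB _ _))// (_ : e = e / 2 + e / 2); last by clr; lra.
  by rewrite lerD ?h1 ?h2//; move: aa d'd (d0); clr; lra.
exists (d0 / 2); first by rewrite divr_gt0.
move=> u0 u a u0P uD uu aa; apply: (h (d0 / 2)) => //; first by lra.
Unshelve. all: by end_near. Qed.

(* The derivative of the curve in the direction of the tangent at the origin of the
   parametrization stays positive near the ends of the period. *)
Lemma tangent_close i a0 u0 : strip len i u0 a0 -> exists2 d : R, 0 < d & forall u a, strip len i u a ->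
  `|u - u0| < d -> `|a - a0| < d ->
  2^-1 <= f 1 0 0 i u0 a0 * f 1 0 0 i u a + f 1 0 1 i u0 a0 * f 1 0 1 i u a.
Proof.
move=> uD; have e4 : (0 : R) < 4^-1 by [].
have [d d0 h] := f_cont 0 A1 (leq0n _) uD e4.
have [d' d'0 h'] := f_cont 1 A1 (leq0n _) uD e4.
exists (Num.min d d'); first by rewrite lt_min d0.
move=> u a ua; rewrite !lt_min => /andP[? ?] /andP[? ?].
have h0 := h u a ua; have h1 := h' u a ua.
have n0 := f_unit_le1 0 uD; have n1 := f_unit_le1 1 uD; have U := f_unit uD.
set t0 := f 1 0 0 i u0 a0 in h0 n0 U *; set t1 := f 1 0 1 i u0 a0 in h1 n1 U *.
set s0 := f 1 0 0 i u a in h0 *; set s1 := f 1 0 1 i u a in h1 *.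
have -> : t0 * s0 + t1 * s1 = 1 + (t0 * (s0 - t0) + t1 * (s1 - t1)) by rewrite -U; ring.
have k0 : `|t0 * (s0 - t0)| <= 1 * 4^-1 by apply: ler_normM => //; apply: h0.
have k1 : `|t1 * (s1 - t1)| <= 1 * 4^-1 by apply: ler_normM => //; apply: h1.
move: k0 k1; rewrite !ler_norml => /andP[? ?] /andP[? ?]; lra.
Qed.

(** The mean value theorem for the projection of the curve on the direction [(t0, t1)]. *)
Lemma chord_progress i (q a t0 t1 u v : R) : I a -> 0 <= u <= v -> v <= len i a ->
  (forall x, u <= x <= v -> q <= t0 * f 1 0 0 i x a + t1 * f 1 0 1 i x a) ->
  q * (v - u) <= t0 * (f 0 0 0 i v a - f 0 0 0 i u a) + t1 * (f 0 0 1 i v a - f 0 0 1 i u a).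
Proof.
move=> Ia /andP[u0 uv] vl h.
have [x|c hc E] := @mvt_has_deriv R (fun x => t0 * f 0 0 0 i x a + t1 * f 0 0 1 i x a)
  (fun x => t0 * f 1 0 0 i x a + t1 * f 1 0 1 i x a) u v uv.
  move=> /andP[ux xv]; have xD : strip len i x a by split=> //; lra.
  apply: (@has_deriv_sub _ [set s | strip len i s a]).
    by move=> y /= ?; split=> //; lra.
  by apply: has_derivD; apply: has_derivZ; apply: f_du.
have -> : t0 * (f 0 0 0 i v a - f 0 0 0 i u a) + t1 * (f 0 0 1 i v a - f 0 0 1 i u a) =
   (t0 * f 0 0 0 i v a + t1 * f 0 0 1 i v a) - (t0 * f 0 0 0 i u a + t1 * f 0 0 1 i u a) by ring.
rewrite E ler_wpM2r ?subr_ge0//; exact: h.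
Qed.

(** A much shorter curve at a nearby [a] would close up at a parameter where the curve at [a0] is
    still away from its starting point. Lengths close to 0 escape this argument; they are excluded
    because the curve progresses along its initial tangent and could not return. *)
Lemma len_lower i (a0 e : R) : I a0 -> 0 < e -> exists2 d : R, 0 < d & forall a, I a ->
  `|a - a0| < d -> len i a0 - e < len i a.
Proof.
move=> Ia0 e0; set l0 := len i a0.
have [d1 d10 h1] := tangent_close (strip0 i Ia0).
(* Strict convexity makes the curve injective on a period, so on this compact segment it stays away
   from its starting point. *)
have [c c0 hc] : exists2 c : R, 0 < c & forall u, d1 / 2 <= u <= l0 - e ->
    exists k, c <= `|f 0 0 k i u a0 - f 0 0 k i 0 a0|.
  have [|c c0 hc] := @compact_uniform R _ `[d1 / 2, l0 - e] (fun u d => d1 / 2 <= u <= l0 - e ->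
    exists k, d <= `|f 0 0 k i u a0 - f 0 0 k i 0 a0|) (@segment_compact _ _ _); last first.
    exists (c / 2); first by rewrite divr_gt0.
    by move=> u ud; apply: (hc (c / 2)) => //; lra.
  move=> u; rewrite /= in_itv/= => /andP[u1 u2].
  have ul : 0 <= u < len i a0 by rewrite -/l0; lra.
  have uD : strip len i u a0 by split=> //; lra.
  have [k hk] : exists k, f 0 0 k i u a0 != f 0 0 k i 0 a0.
    have /(_ _)h := f_convex Ia0 ul (_ : 0 <= 0 < len i a0).
    have {h} := h (ltac:(by rewrite lexx len_gt0)) (ltac:(by apply: lt0r_neq0; lra)).
    have [E0|] := eqVneq (f 0 0 0 i u a0) (f 0 0 0 i 0 a0); last by exists 0.
    have [E1|] := eqVneq (f 0 0 1 i u a0) (f 0 0 1 i 0 a0); last by exists 1.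
    by rewrite E0 E1; lra.
  set eta := `|f 0 0 k i u a0 - f 0 0 k i 0 a0|.
  have eta0 : 0 < eta by rewrite normr_gt0 subr_eq0.
  have eta2 : 0 < eta / 2 by rewrite divr_gt0.
  have [d d0 hd] := f_cont k (leq0n _) (leq0n _) uD eta2.
  exists (eta / 2) => //; exists d => //= v uv d' /andP[d'0 d'1] vP; exists k.
  have vD : strip len i v a0 by split=> //; rewrite -/l0; move: vP (d10) (e0); clr; lra.
  rewrite /ball_ /= distrC in uv; have := hd v a0 vD uv; rewrite subrr normr0 => /(_ d0) h.
  have := ler_normB (f 0 0 k i v a0 - f 0 0 k i 0 a0) (f 0 0 k i v a0 - f 0 0 k i u a0).
  rewrite (_ : _ - _ - _ = f 0 0 k i u a0 - f 0 0 k i 0 a0) -/eta; [move: h d'1; clr; lra|ring].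
have c4 : 0 < c / 4 by rewrite divr_gt0.
have [d2 d20 h2] := fibre_uniform_cont 0 i (leq0n _) (leq0n _) Ia0 c4.
have [d3 d30 h3] := fibre_uniform_cont 1 i (leq0n _) (leq0n _) Ia0 c4.
exists (Num.min d1 (Num.min d2 d3)); first by rewrite !lt_min d10 d20.
move=> a Ia; rewrite !lt_min => /andP[a1 /andP[a2 a3]]; rewrite ltNge; apply/negP => le.
have la := len_gt0 i Ia.
have [l1|l1] := ltP (len i a) (d1 / 2).
  have := @chord_progress i 2^-1 a (f 1 0 0 i 0 a0) (f 1 0 1 i 0 a0) 0 (len i a) Ia.
  rewrite lexx (ltW la) lexx => /(_ isT isT) h.
  have {h} : 2^-1 * (len i a - 0) <= _ := h _.
  rewrite !f_closed// !subrr !mulr0 addr0 subr0 => h; suff : 2^-1 * len i a <= 0 by move: la; clr; lra.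
  apply: h => x /andP[x0 x1]; apply: h1 => //; [by split=> //; rewrite x0|rewrite subr0 ger0_norm//; lra].
have [|k] := hc (len i a); first by rewrite l1.
have lD : 0 <= len i a <= len i a0 by rewrite -/l0; move: la le e0; clr; lra.
have hk : `|f 0 0 k i (len i a) a - f 0 0 k i (len i a) a0| <= c / 4.
  move: k; apply: ord2P; [apply: h2|apply: h3] => //; rewrite ?subrr ?normr0//; exact: strip_len.
have hk0 : `|f 0 0 k i 0 a - f 0 0 k i 0 a0| <= c / 4.
  move: k {hk}; apply: ord2P; [apply: h2|apply: h3] => //; rewrite ?subrr ?normr0 ?lexx ?ltW ?len_gt0//; exact: strip0.
rewrite f_closed// in hk; rewrite leNgt => /negP; apply.
have := ler_normB (f 0 0 k i 0 a - f 0 0 k i 0 a0) (f 0 0 k i 0 a - f 0 0 k i (len i a) a0).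
rewrite (_ : _ - _ - _ = f 0 0 k i (len i a) a0 - f 0 0 k i 0 a0); [move: hk hk0 (c0); clr; lra|ring].
Qed.


Lemma has_deriv_max (S : set R) (h : R -> R) x l d : 0 < d ->
  (forall y, `|y - x| < d -> S y /\ h y <= h x) -> has_deriv S h x l -> l = 0.
Proof.
move=> d0 hS hd; apply/eqP; apply: contraT => l0.
have l2 : 0 < `|l| / 2 by rewrite divr_gt0 ?normr_gt0.
have [d' d'0 hd'] := hd _ l2.
pose t := Num.min d d' / 2; have t0 : 0 < t by rewrite divr_gt0// lt_min d0.
have [td td'] : t < d /\ t < d'.
  have : Num.min d d' <= d /\ Num.min d d' <= d' by rewrite !ge_min !lexx orbT.
  by rewrite /t; split; lra.
pose y := x + Num.sg l * t.
have yx : y - x = Num.sg l * t by rewrite /y; ring.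
have nyx : `|y - x| = t by rewrite yx normrM normr_sg l0 mul1r gtr0_norm.
have [Sy hy] : S y /\ h y <= h x by apply: hS; rewrite nyx.
have := hd' y Sy; rewrite nyx yx => /(_ td').
have -> : l * (Num.sg l * t) = `|l| * t by rewrite [`|l|]normrEsg; ring.
rewrite ler_norml => /andP[h1 _].
have : 0 < `|l| / 2 * t by rewrite mulr_gt0.
lra.
Qed.

Lemma perp_unit (t0 t1 p0 p1 : R) : t0 ^+ 2 + t1 ^+ 2 = 1 -> p0 ^+ 2 + p1 ^+ 2 = 1 ->
  t0 * p0 + t1 * p1 = 0 -> exists s, [/\ s = 1 \/ s = -1, p0 = - s * t1 & p1 = s * t0].
Proof.
move=> ht hp htp; exists (t0 * p1 - t1 * p0); split.
- have : (t0 * p1 - t1 * p0) ^+ 2 = 1.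
    transitivity ((t0 ^+ 2 + t1 ^+ 2) * (p0 ^+ 2 + p1 ^+ 2) - (t0 * p0 + t1 * p1) ^+ 2); first ring.
    by rewrite ht hp htp; ring.
  by move/eqP; rewrite sqrf_eq1 => /orP[/eqP ->|/eqP ->]; [left|right].
- transitivity (p0 * (t0 ^+ 2 + t1 ^+ 2) - t0 * (t0 * p0 + t1 * p1)); last ring.
  by rewrite ht htp; ring.
- transitivity (p1 * (t0 ^+ 2 + t1 ^+ 2) - t1 * (t0 * p0 + t1 * p1)); last ring.
  by rewrite ht htp; ring.
Qed.

Lemma combo_le (t0 t1 x0 x1 e : R) : `|t0| <= 1 -> `|t1| <= 1 -> `|x0| <= e -> `|x1| <= e ->
  `|t0 * x0 + t1 * x1| <= 2 * e.
Proof.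
move=> ? ? ? ?; rewrite (le_trans (ler_normD _ _))// (_ : 2 * e = 1 * e + 1 * e); last ring.
by rewrite lerD//; apply: ler_normM.
Qed.

(** Position is measured along the tangent at the starting point of the curve at [a0]. This height
    increases at both ends of the period, so its maximum and minimum, selected by [sigma], are
    interior. The margin [eta] keeps them interior for nearby [a], and there the tangent is
    perpendicular to the initial one. *)
Lemma extreme_point i (a0 sigma : R) : I a0 -> sigma = 1 \/ sigma = -1 ->
  let h a u := f 1 0 0 i 0 a0 * f 0 0 0 i u a + f 1 0 1 i 0 a0 * f 0 0 1 i u a in
  exists2 d : R, 0 < d & forall a, I a -> `|a - a0| < d -> len i a0 <= len i a ->
   exists u, [/\ 0 < u < len i a0, forall v, 0 <= v <= len i a0 -> sigma * h a v <= sigma * h a u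
     & f 1 0 0 i 0 a0 * f 1 0 0 i u a + f 1 0 1 i 0 a0 * f 1 0 1 i u a = 0].
Proof.
move=> Ia0 hs; set t0 := f 1 0 0 i 0 a0; set t1 := f 1 0 1 i 0 a0 => h.
have l0 := len_gt0 i Ia0; set l := len i a0 in l0 *.
have s1 : `|sigma| = 1 by case: hs => ->; rewrite ?normrN normr1.
have [u1 [u1l hu1]] : exists u1, 0 < u1 < l /\ sigma * h a0 0 < sigma * h a0 u1.
  case: hs => ->.
  - have [d d0 hd] := tangent_close (strip0 i Ia0).
    pose x := Num.min d l / 2.
    have [x0 [xd xl]] : 0 < x /\ x < d /\ x < l.
      have : 0 < Num.min d l by rewrite lt_min d0.
      have : Num.min d l <= d /\ Num.min d l <= l by rewrite !ge_min !lexx orbT.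
      by rewrite /x; slra.
    exists x; split; first lra.
    have := @chord_progress i 2^-1 a0 t0 t1 0 x Ia0; rewrite lexx (ltW x0) (ltW xl) => /(_ isT isT) H.
    have {H} := H (ltac:(by move=> y /andP[y0 yx]; apply: hd; [split=> //; rewrite -/l; slra|rewrite subr0 ger0_norm//; slra|rewrite subrr normr0])).
    rewrite /h; slra.
  - have [d d0 hd] := tangent_close (strip_len i Ia0).
    rewrite !f_closed// -/l in hd.
    pose x := Num.min d l / 2.
    have [x0 [xd xl]] : 0 < x /\ x < d /\ x < l.
      have : 0 < Num.min d l by rewrite lt_min d0.
      have : Num.min d l <= d /\ Num.min d l <= l by rewrite !ge_min !lexx orbT.
      by rewrite /x; slra.
    exists (l - x); split; first lra.
    have := @chord_progress i 2^-1 a0 t0 t1 (l - x) l Ia0; rewrite lexx => /(_ _ isT) H.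
    have {H} := H (ltac:(slra)) (ltac:(by move=> y /andP[y0 yx]; apply: hd; [split=> //; rewrite -/l; slra|rewrite ler0_norm; slra|rewrite subrr normr0])).
    rewrite /h !f_closed//; slra.
set eta := sigma * h a0 u1 - sigma * h a0 0.
have etaE : eta = sigma * h a0 u1 - sigma * h a0 0 by [].
have eta8 : 0 < eta / 8 by rewrite divr_gt0// subr_gt0.
have [d2 d20 h2] := fibre_uniform_cont 0 i (leq0n _) (leq0n _) Ia0 eta8.
have [d3 d30 h3] := fibre_uniform_cont 1 i (leq0n _) (leq0n _) Ia0 eta8.
exists (Num.min d2 d3); first by rewrite lt_min d20.
move=> a Ia; rewrite lt_min => /andP[a2 a3] la.
have close u : 0 <= u <= l -> `|sigma * h a u - sigma * h a0 u| <= 2 * (eta / 8).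
  move=> ul; rewrite -mulrBr normrM s1 mul1r /h.
  rewrite (_ : _ - _ = t0 * (f 0 0 0 i u a - f 0 0 0 i u a0) + t1 * (f 0 0 1 i u a - f 0 0 1 i u a0)); last ring.
  have uD : strip len i u a by split=> //; slra.
  apply: combo_le; [exact/f_unit_le1/strip0|exact/f_unit_le1/strip0|apply: h2|apply: h3] => //; by rewrite ?subrr ?normr0.
have dh x : 0 <= x <= l -> has_deriv [set y | 0 <= y <= l] (fun u => sigma * h a u) x
   (sigma * (t0 * f 1 0 0 i x a + t1 * f 1 0 1 i x a)).
  move=> xl; have xD : strip len i x a by split=> //; slra.
  apply: (@has_deriv_sub _ [set s | strip len i s a]).
    by move=> y /= ?; split=> //; slra.
  by apply: has_derivZ; apply: has_derivD; apply: has_derivZ; apply: f_du.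
have [|u] := @EVT_max R (fun u => sigma * h a u) 0 l (ltW l0).
  rewrite (_ : [set` _] = [set y | 0 <= y <= l]); last by apply/seteqP; split=> y /=; rewrite in_itv.
  exact: has_deriv_within_continuous dh.
rewrite in_itv/= => ul hmax.
have hmax' v : 0 <= v <= l -> sigma * h a v <= sigma * h a u.
  by move=> vl; apply: hmax; rewrite in_itv.
have c1 := close u1 (ltac:(slra)); have c0 := close 0 (ltac:(slra)); have cl := close l (ltac:(slra)).
have hl : h a0 l = h a0 0 by rewrite /h /l !f_closed.
rewrite hl in cl.
move: c1 c0 cl; rewrite !ler_norml => /andP[? ?] /andP[? ?] /andP[? ?].
have m1 := hmax' u1 (ltac:(slra)).
have u0 : u != 0 by apply/eqP => u0; rewrite u0 in m1; slra.
have unl : u != l by apply/eqP => u0'; rewrite u0' in m1; slra.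
have {}ul : 0 < u < l by rewrite !lt_neqAle eq_sym u0 unl.
exists u; split=> //.
have := @has_deriv_max _ _ u _ (Num.min u (l - u)) _ _ (dh u (ltac:(slra))).
rewrite lt_min => /(_ (ltac:(slra))) H.
have {H} : sigma * (t0 * f 1 0 0 i u a + t1 * f 1 0 1 i u a) = 0.
  apply: H => y; rewrite lt_min !ltr_norml => /andP[/andP[? ?] /andP[? ?]].
  by split; [rewrite /=; slra|apply: hmax'; slra].
by move/eqP; rewrite mulf_eq0 -normr_eq0 s1 oner_eq0 => /eqP.
Qed.

(** A curve longer by [e] would come back near its starting point at the parameter [len i a0], still
    moving forward along the initial tangent, and would have to turn back later in order to close.
    Its tangent would then be perpendicular to the initial one beyond [len i a0], besides the two
    extreme points before it. A strictly convex curve has only two such points. *)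
Lemma len_upper i (a0 e : R) : I a0 -> 0 < e -> exists2 d : R, 0 < d & forall a, I a ->
  `|a - a0| < d -> len i a < len i a0 + e.
Proof.
move=> Ia0 e0; have l0 := len_gt0 i Ia0.
have [d1 d10 hp] := @extreme_point i a0 1 Ia0 (or_introl erefl).
have [d2 d20 hn] := @extreme_point i a0 (-1) Ia0 (or_intror erefl).
have [d3 d30 ht0] := tangent_close (strip0 i Ia0).
have [d4 d40 htl] := tangent_close (strip_len i Ia0).
rewrite !f_closed// in htl.
have := f_unit (strip0 i Ia0).
have n0 := f_unit_le1 0 (strip0 i Ia0); have n1 := f_unit_le1 1 (strip0 i Ia0).
set t0 := f 1 0 0 i 0 a0 in hp hn ht0 htl n0 *; set t1 := f 1 0 1 i 0 a0 in hp hn ht0 htl n1 *.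
move=> tu; set l := len i a0 in l0 hp hn htl *.
pose x := Num.min d4 e / 2.
have [x0 [xd xe]] : 0 < x /\ x < d4 /\ x < e.
  have : 0 < Num.min d4 e by rewrite lt_min d40.
  have : Num.min d4 e <= d4 /\ Num.min d4 e <= e by rewrite !ge_min !lexx orbT.
  by rewrite /x; slra.
have x16 : 0 < x / 16 by rewrite divr_gt0.
have [d5 d50 h5] := fibre_uniform_cont 0 i (leq0n _) (leq0n _) Ia0 x16.
have [d6 d60 h6] := fibre_uniform_cont 1 i (leq0n _) (leq0n _) Ia0 x16.
exists (Num.min (Num.min d1 d2) (Num.min (Num.min d3 d4) (Num.min d5 d6))); first by rewrite !lt_min d10 d20 d30 d40 d50.
move=> a Ia; rewrite !lt_min => /andP[/andP[a1 a2] /andP[/andP[a3 a4] /andP[a5 a6]]].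
rewrite ltNge; apply/negP => le.
have lla : l <= len i a by slra.
pose h u := t0 * f 0 0 0 i u a + t1 * f 0 0 1 i u a.
pose h' u := t0 * f 1 0 0 i u a + t1 * f 1 0 1 i u a.
have la0 := len_gt0 i Ia.
have [us [usl hus]] : exists us, l <= us < len i a /\ h' us = 0.
  have hlen : 2^-1 <= h' (len i a).
    by rewrite /h' !f_closed//; apply: ht0; [exact: strip0|rewrite subrr normr0|].
  have hl : 2^-1 <= h' l.
    by apply: htl; [split=> //; rewrite lla ltW|rewrite subrr normr0|].
  have [[u [ul hu]]|nneg] := pselect (exists u, l <= u <= len i a /\ h' u < 0).
    have [||us] := @IVT R h' l u 0 (ltac:(slra)).
    - rewrite (_ : [set` _] = [set y | l <= y <= u]); last by apply/seteqP; split=> y /=; rewrite in_itv.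
      apply: (@has_deriv_within_continuous _ _ _ (fun u => t0 * f 2 0 0 i u a + t1 * f 2 0 1 i u a)) => y yl.
      have yD : strip len i y a by split=> //; rewrite /= in yl; slra.
      apply: (@has_deriv_sub _ [set s | strip len i s a]).
        by move=> z /= ?; split=> //; slra.
      by apply: has_derivD; apply: has_derivZ; apply: f_du.
    - by rewrite ge_min le_max; apply/andP; split; apply/orP; [right|left]; slra.
    rewrite in_itv/= => usu hus; exists us; split=> //.
    rewrite lt_neqAle; apply/andP; split; first slra; apply/andP; split; last slra.
    by apply/eqP => E; rewrite E in hus; slra.
  exfalso.
  have nn u : l <= u <= len i a -> 0 <= h' u.
    by move=> ul; rewrite leNgt; apply/negP => hu; apply: nneg; exists u.
  have lx : 0 <= l <= l + x by move: l0 x0; clr; lra.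
  have lxa : l + x <= len i a by move: le xe; clr; lra.
  have p1 := @chord_progress i 2^-1 a t0 t1 l (l + x) Ia lx lxa
    (ltac:(by move=> y /andP[y0 yx]; apply: htl; [split=> //; slra|rewrite ger0_norm; slra|])).
  have lx0 : 0 <= l + x <= len i a by move: lx lxa; clr; lra.
  have p2 := @chord_progress i 0 a t0 t1 (l + x) (len i a) Ia lx0 (lexx _)
    (ltac:(by move=> y /andP[y0 yx]; apply: nn; move: y0 yx x0; clr; lra)).
  have lD : strip len i l a by split=> //; move: l0 lla; clr; lra.
  have c0 : `|t0 * (f 0 0 0 i 0 a - f 0 0 0 i 0 a0) + t1 * (f 0 0 1 i 0 a - f 0 0 1 i 0 a0)| <= 2 * (x / 16).
    apply: combo_le => //; [apply: h5|apply: h6] => //; rewrite ?subrr ?normr0 ?lexx ?ltW ?len_gt0//; exact: strip0.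
  have cl : `|t0 * (f 0 0 0 i l a - f 0 0 0 i l a0) + t1 * (f 0 0 1 i l a - f 0 0 1 i l a0)| <= 2 * (x / 16).
    apply: combo_le => //; [apply: h5|apply: h6] => //; rewrite ?subrr ?normr0 ?lexx ?ltW ?len_gt0//.
  rewrite !f_closed// in cl p2.
  move: c0 cl; rewrite !ler_norml => /andP[? ?] /andP[? ?]; slra.
have usD : strip len i us a by split=> //; slra.
have [s [hs P0 P1]] := perp_unit tu (f_unit usD) hus.
have [u [ul umax hu]] : exists u, [/\ 0 < u < l, forall v, 0 <= v <= l -> s * h v <= s * h u & h' u = 0].
  by case: hs => ->; [apply: hp|apply: hn].
have uD : strip len i u a by split=> //; slra.
have [s' [hs' Q0 Q1]] := perp_unit tu (f_unit uD) hu.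
have us01 : 0 <= us < len i a by move: usl l0; clr; lra.
have u01 : 0 <= u < len i a by move: ul lla; clr; lra.
have z01 : 0 <= (0 : R) < len i a by rewrite lexx.
have uus : u < us by move: ul usl; clr; lra.
have u0 : 0 < u by case/andP: ul.
(* The tangents at [us] and [u] are parallel. If they are equal, the supporting inequalities [C1]
   and [C2] exclude each other; if they are opposite, [C3] contradicts the extremality of [u]. *)
have C1 := @f_convex i a us u Ia us01 u01 (ltac:(by rewrite gt_eqF)).
have C2 := @f_convex i a u us Ia u01 us01 (ltac:(by rewrite lt_eqF)).
have C3 := @f_convex i a u 0 Ia u01 z01 (ltac:(by rewrite gt_eqF)).
have := umax 0 (ltac:(by rewrite lexx ltW)).
rewrite P0 P1 in C1; rewrite Q0 Q1 in C2 C3; rewrite /h.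
by case: hs C1 => ->; case: hs' C2 C3 => ->; clr; lra.
Qed.

Lemma len_cont i (a0 e : R) : I a0 -> 0 < e -> exists2 d : R, 0 < d & forall a, I a ->
  `|a - a0| < d -> `|len i a - len i a0| < e.
Proof.
move=> Ia e0; have [d d0 h] := len_lower i Ia e0; have [d' d'0 h'] := len_upper i Ia e0.
exists (Num.min d d'); first by rewrite lt_min d0.
move=> a Ia'; rewrite lt_min => /andP[/h-/(_ Ia') ? /h'-/(_ Ia') ?].
by rewrite ltr_norml; slra.
Qed.


End strip_curve_length.

(** * Uniform bounds on the jets and Lipschitz dependence of the lengths *)

Section strip_smooth.
Variables (R : realType) (m : nat) (I : set R).
Variables (len : 'I_m -> R -> R) (A B : nat) (f : nat -> nat -> 'I_2 -> 'I_m -> R -> R -> R).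
Hypothesis sc : strip_curve I len A B f.
Let I_conv := sc_conv sc.
Let A2 := sc_A sc.
Let A1 : (1 <= A)%N := ltnW A2.
Let B1 := sc_B sc.
Let f_cont := sc_cont sc.
Let f_da := sc_da sc.
Let f_du := sc_du sc.
Let len_gt0 := sc_len_gt0 sc.
Let f_closed := sc_closed sc.
Let f_unit := sc_unit sc.
Let f_convex := sc_convex sc.


Implicit Types (k l : nat) (c : 'I_2) (i : 'I_m) (a b u : R).

Lemma f_equicont k l c : (k <= A)%N -> (l <= B)%N -> fibre_equicont I (strip I len) (f k l c).
Proof.
move=> kA lB a0 Ia0 e e0; have e2 : 0 < e / 2 by rewrite divr_gt0.
have [||d d0 h] := @finite_uniform R _ (fun i d => forall s a s' a', (strip I len) i s a -> (strip I len) i s' a' ->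
   `|a - a0| < d -> `|a' - a0| < d -> `|s' - s| < d ->
   `|f k l c i s' a' - f k l c i s a| <= e); last first.
- by exists d => // t s a s' a' *; apply: h.
- move=> i.
  have [d d0 hd] := fibre_uniform_cont sc c i kA lB Ia0 e2.
  have d2 : 0 < d / 2 by rewrite divr_gt0.
  have [d' d'0 hd'] := len_cont sc i Ia0 d2.
  exists (Num.min (d / 2) d'); first by rewrite lt_min d2.
  move=> s a s' a' sD s'D; rewrite !lt_min => /andP[a1 a2] /andP[a3 a4] /andP[s1 s2].
  have lp := len_gt0 i Ia0.
  (* The slice at [a0] may be shorter than the one at [a]; truncation moves [s] by less than
     [d / 2], by continuity of [len]. *)
  pose u0 := Num.min s (len i a0).
  have u0P : 0 <= u0 <= len i a0.
    by case: sD => _ /andP[? _]; rewrite /u0 le_min ge_min lexx orbT andbT; apply/andP; split=> //; exact: ltW.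
  have su : `|s - u0| < d / 2.
    have := hd' a sD.1 a2; case: sD => _ /andP[s0 sl]; rewrite ltr_norml => /andP[? ?].
    rewrite /u0; case: (leP s (len i a0)) => ?; rewrite ?subrr ?normr0// ltr_norml; lra.
  have h1 : `|f k l c i s a - f k l c i u0 a0| <= e / 2 by apply: hd => //; lra.
  have h2 : `|f k l c i s' a' - f k l c i u0 a0| <= e / 2.
    apply: hd => //; last by move: a3 (d0); clr; lra.
    by have := ler_normD (s' - s) (s - u0); rewrite addrA subrK; move: su s1; clr; lra.
  have -> : f k l c i s' a' - f k l c i s a = (f k l c i s' a' - f k l c i u0 a0) - (f k l c i s a - f k l c i u0 a0) by ring.
  rewrite (le_trans (ler_normB _ _))//; lra.
- move=> i d d' /andP[d'0 d'd] h s a s' a' ? ? ? ? ?; apply: h => //; lra.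
Qed.

Lemma f_bounded k l c : (k <= A)%N -> (l <= B)%N -> fibre_bounded I (strip I len) (f k l c).
Proof.
move=> kA lB; apply/fibre_boundedP => a0 Ia0.
(* The bound is written [d^-1]: it weakens as [d] decreases, so one number serves as radius and as
   bound for all obstacles. *)
have [||d d0 h] := @finite_uniform R _ (fun i d => forall s a, (strip I len) i s a ->
   `|a - a0| < d -> `|f k l c i s a| <= d^-1); last first.
- by exists d^-1; rewrite ?invr_gt0//; exists d.
- move=> i.
  have [d1 d10 hd1] : exists2 d : R, 0 < d & forall u, 0 <= u <= len i a0 -> `|f k l c i u a0| <= d^-1.
    have [|d0 d00 h] := @compact_uniform R _ `[0, len i a0] (fun u d => 0 <= u <= len i a0 ->
        `|f k l c i u a0| <= d^-1) (@segment_compact _ _ _).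
      move=> u; rewrite /= in_itv /= => uP.
      have [d d0 hd] := f_cont c kA lB (conj Ia0 uP) ltr01.
      have p : 0 < `|f k l c i u a0| + 1 by rewrite ltr_wpDl.
      exists (`|f k l c i u a0| + 1)^-1; first by rewrite invr_gt0.
      exists d => //= v uv d' /andP[d'0 d'1] vP.
      apply: (@le_trans _ _ (`|f k l c i u a0| + 1)); last first.
        by rewrite -[X in X <= _]invrK lef_pV2 ?posrE ?invr_gt0// ltW.
      rewrite /ball_ /= distrC in uv; have := hd v a0 (conj Ia0 vP) uv; rewrite subrr normr0 => /(_ d0).
      by have := ler_normD (f k l c i v a0 - f k l c i u a0) (f k l c i u a0); rewrite subrK; lra.
    exists (d0 / 2); first by rewrite divr_gt0.
    by move=> u uP; apply: (h (d0 / 2)) => //; lra.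
  have [d d0 hd] := f_equicont c kA lB Ia0 ltr01.
  have [d2 d20 hd2] := len_cont sc i Ia0 d0.
  have p : 0 < d1^-1 + 1 by rewrite ltr_wpDl// invr_ge0 ltW.
  exists (Num.min (Num.min d d2) (d1^-1 + 1)^-1); first by rewrite !lt_min d0 d20 invr_gt0.
  move=> s a sD; rewrite !lt_min => /andP[/andP[a1 a2] a3].
  apply: (@le_trans _ _ (d1^-1 + 1)); last first.
    rewrite -[X in X <= _]invrK lef_pV2 ?posrE ?invr_gt0 ?lt_min ?d0 ?d20 ?invr_gt0//.
    by rewrite ge_min lexx orbT.
  pose u0 := Num.min s (len i a0).
  have lp := len_gt0 i Ia0.
  have u0P : 0 <= u0 <= len i a0.
    by case: sD => _ /andP[? _]; rewrite /u0 le_min ge_min lexx orbT andbT; apply/andP; split=> //; exact: ltW.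
  have := hd i u0 a0 s a (conj Ia0 u0P) sD; rewrite subrr normr0 => /(_ d0 a1 _) h.
  have : `|f k l c i s a - f k l c i u0 a0| <= 1.
    apply: h; have := hd2 a sD.1 a2; case: sD => _ /andP[s0 sl]; rewrite ltr_norml => /andP[? ?].
    rewrite /u0; case: (leP s (len i a0)) => ?; rewrite ?subrr ?normr0// ltr_norml; lra.
  have := ler_normD (f k l c i s a - f k l c i u0 a0) (f k l c i u0 a0); rewrite subrK.
  have := hd1 _ u0P; clr; lra.
- move=> i d d' /andP[d'0 d'd] h s a ? ?; apply: (@le_trans _ _ d^-1); first by apply: h => //; lra.
  by rewrite lef_pV2 ?posrE//; lra.
Qed.

(** The strip is not a product, but at a height below the least length a segment in the [a]
    direction stays inside it. This makes the mean value theorem in [a] available. *)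
Lemma len_argmin i p q : p <= q -> I p -> I q ->
  exists2 t : R, p <= t <= q & forall s, p <= s <= q -> len i t <= len i s.
Proof.
move=> pq Ip Iq; have [|t] := @EVT_min R (len i) p q pq.
  apply/subspace_continuousP => x /=; rewrite in_itv/= => xpq.
  apply/cvgrPdist_lt => e e0; have [d d0 hd] := len_cont sc i (I_conv Ip Iq xpq) e0.
  exists d => //= y /=; rewrite distrC => yx; rewrite in_itv/= => ypq; rewrite distrC.
  by apply: hd => //; apply: I_conv ypq.
by rewrite in_itv/= => tpq h; exists t => // s spq; apply: h; rewrite in_itv.
Qed.

Lemma seg_dist2 (a b t x : R) : Num.min a b <= t <= Num.max a b -> Num.min a b <= x <= Num.max a b ->
  `|x - t| <= `|a - b|.
Proof.
case: (leP a b) => ab tS xS; first by rewrite [X in _ <= X]ler0_norm ?ler_norml; lra.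
by rewrite [X in _ <= X]ger0_norm ?ler_norml; lra.
Qed.

Lemma seg_near (a b t c d : R) : Num.min a b <= t <= Num.max a b -> `|a - c| < d -> `|b - c| < d ->
  `|t - c| < d.
Proof. by case: (leP a b) => ab; rewrite !ltr_norml; lra. Qed.

Lemma seg_I (a b t : R) : I a -> I b -> Num.min a b <= t <= Num.max a b -> I t.
Proof. by move=> Ia Ib; case: (leP a b) => _; [exact: I_conv|exact: (I_conv Ib Ia)]. Qed.

(** Let [t] minimize the length between [a] and [b]. The piece of the curve at [x] between the
    parameters [len i t] and [len i x] runs roughly along the final tangent at [a0], so half its
    length is at most the projection of its chord. As the curves close, this chord is the difference
    of the displacements of the points [0] and [len i t] when the parameter goes from [t] to [x],
    which the bounds [M0] and [M1] control by coordinates; hence the factor 4. *)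
Lemma len_lip a0 : I a0 -> exists2 L : R, 0 < L & exists2 d : R, 0 < d & forall i a b, I a -> I b ->
  `|a - a0| < d -> `|b - a0| < d -> `|len i a - len i b| <= L * `|a - b|.
Proof.
move=> Ia0.
have /fibre_boundedP/(_ _ Ia0) [M0 M00 [d0 d00 h0]] := f_bounded 0 (leq0n A) B1.
have /fibre_boundedP/(_ _ Ia0) [M1 M10 [d1 d10 h1]] := f_bounded 1 (leq0n A) B1.
pose L := 4 * (M0 + M1); exists L; first by rewrite mulr_gt0// addr_gt0.
have [||d dp h] := @finite_uniform R _ (fun i d => forall a b, I a -> I b ->
   `|a - a0| < d -> `|b - a0| < d -> `|len i a - len i b| <= L * `|a - b|); last first.
- by exists d => // i a b; apply: h.
- move=> i; have [d2 d20 h2] := tangent_close sc (strip_len sc i Ia0).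
  have [d3 d30 h3] := len_cont sc i Ia0 d20.
  set t0 := f 1 0 0 _ _ _ in h2; set t1 := f 1 0 1 _ _ _ in h2.
  have n0 : `|t0| <= 1 by exact/(f_unit_le1 sc)/(strip_len sc).
  have n1 : `|t1| <= 1 by exact/(f_unit_le1 sc)/(strip_len sc).
  exists (Num.min (Num.min d0 d1) (Num.min d2 d3)); first by rewrite !lt_min d00 d10 d20.
  move=> a b Ia Ib; rewrite !lt_min => /andP[/andP[a1 a2] /andP[a3 a4]] /andP[/andP[b1 b2] /andP[b3 b4]].
  have [t tS tmin] : exists2 t : R, Num.min a b <= t <= Num.max a b &
      forall s, Num.min a b <= s <= Num.max a b -> len i t <= len i s.
    by apply: len_argmin; [rewrite ge_min le_max lexx|case: (leP a b)..].
  have It := seg_I Ia Ib tS.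
  have aS : Num.min a b <= a <= Num.max a b by rewrite ge_min le_max lexx.
  have bS : Num.min a b <= b <= Num.max a b by rewrite ge_min le_max lexx !orbT.
  (* both [a] and [b] play the role of [x] *)
  have key x : Num.min a b <= x <= Num.max a b -> len i x - len i t <= L * `|a - b|.
    move=> xS; have Ix := seg_I Ia Ib xS.
    have horiz w c M d' : 0 <= w <= len i t -> 0 < d' -> `|a - a0| < d' -> `|b - a0| < d' ->
      (forall i s a, (strip I len) i s a -> `|a - a0| < d' -> `|f 0 1 c i s a| <= M) ->
      `|f 0 0 c i w x - f 0 0 c i w t| <= M * `|a - b|.
      move=> wt d'0 ad bd hM.
      have SD y : Num.min a b <= y <= Num.max a b -> (strip I len) i w y.
        by move=> yS; split; [exact: seg_I yS|have := tmin _ yS; slra].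
      have := @mvt_on R [set y | Num.min a b <= y <= Num.max a b] (f 0 0 c i w) (f 0 1 c i w) 0 M t x.
      rewrite mul0r subr0 => H; apply: (le_trans (H _ _ tS xS _)).
      - by move=> y z v /= ? ? ?; slra.
      - by move=> y /= yS; apply: has_deriv_sub (f_da c B1 (SD _ yS)) => z; exact: SD.
      - move=> y /= yS _; rewrite subr0; apply: hM; [exact: SD|exact: seg_near yS _ _].
      - apply: ler_wpM2l; first by apply: le_trans (hM i 0 a (strip0 sc i Ia) ad).
        exact: seg_dist2.
    have lt0 := len_gt0 i It.
    have g0 := horiz (len i t) 0 M0 d0 (ltac:(slra)) d00 a1 b1 h0.
    have g1 := horiz (len i t) 1 M1 d1 (ltac:(slra)) d10 a2 b2 h1.
    have k0 := horiz 0 0 M0 d0 (ltac:(slra)) d00 a1 b1 h0.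
    have k1 := horiz 0 1 M1 d1 (ltac:(slra)) d10 a2 b2 h1.
    have ltx := tmin _ xS.
    have := @chord_progress _ _ _ _ _ _ _ sc i 2^-1 x t0 t1 (len i t) (len i x) Ix; rewrite (ltW lt0) ltx lexx => /(_ isT isT) H.
    have {H} : 2^-1 * (len i x - len i t) <= _ := H _.
    rewrite !f_closed// => H.
    have {H} : 2^-1 * (len i x - len i t) <= t0 * (f 0 0 0 i 0 x - f 0 0 0 i (len i t) x) + t1 * (f 0 0 1 i 0 x - f 0 0 1 i (len i t) x).
      apply: H => y /andP[y1 y2]; apply: h2; [by split=> //; slra| |exact: seg_near xS _ _].
      have := h3 t It (seg_near tS a4 b4); have := h3 x Ix (seg_near xS a4 b4).
      by rewrite !ltr_norml; move: y1 y2; clr; lra.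
    move=> H.
    have E0 : f 0 0 0 i 0 x - f 0 0 0 i (len i t) x = (f 0 0 0 i 0 x - f 0 0 0 i 0 t) - (f 0 0 0 i (len i t) x - f 0 0 0 i (len i t) t) by rewrite !f_closed//; ring.
    have E1 : f 0 0 1 i 0 x - f 0 0 1 i (len i t) x = (f 0 0 1 i 0 x - f 0 0 1 i 0 t) - (f 0 0 1 i (len i t) x - f 0 0 1 i (len i t) t) by rewrite !f_closed//; ring.
    have A0 : `|f 0 0 0 i 0 x - f 0 0 0 i (len i t) x| <= 2 * M0 * `|a - b|.
      by rewrite E0 (le_trans (ler_normB _ _))//; move: k0 g0; clr; lra.
    have A1' : `|f 0 0 1 i 0 x - f 0 0 1 i (len i t) x| <= 2 * M1 * `|a - b|.
      by rewrite E1 (le_trans (ler_normB _ _))//; move: k1 g1; clr; lra.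
    have B0 := ler_normM n0 A0; have B1' := ler_normM n1 A1'.
    by move: B0 B1' H; rewrite !ler_norml /L; clr; lra.
  have ka := key a aS; have kb := key b bS; have ta := tmin _ aS; have tb := tmin _ bS.
  by rewrite ler_norml; move: ka kb ta tb; clr; lra.
- move=> i d d' /andP[? ?] h a b ? ? ? ?; apply: h => //; lra.
Qed.

End strip_smooth.

(** * Joint smoothness of the jets on one period, and of the lengths *)

Section strip_jets.
Variables (R : realType) (m : nat) (I : set R).
Variables (len : 'I_m -> R -> R) (A B : nat) (f : nat -> nat -> 'I_2 -> 'I_m -> R -> R -> R).
Hypothesis sc : strip_curve I len A B f.
Let I_conv := sc_conv sc.
Let A2 := sc_A sc.
Let A1 : (1 <= A)%N := ltnW A2.
Let B1 := sc_B sc.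
Let f_cont := sc_cont sc.
Let f_da := sc_da sc.
Let f_du := sc_du sc.
Let len_gt0 := sc_len_gt0 sc.
Let f_closed := sc_closed sc.
Let f_unit := sc_unit sc.
Let f_convex := sc_convex sc.


Implicit Types (k l : nat) (c : 'I_2) (i : 'I_m) (a b u : R).

(* Symmetry of mixed partials: the [u]-increments of [f k l] are integrals of
   [f k.+1 l], and their [a]-derivatives are [u]-increments of [f k l.+1]. *)
Lemma f_da_rect k l c i (p q M : R) : (k <= A)%N -> (l < B)%N -> I p -> I q -> 0 < M ->
  (forall a, p <= a <= q -> M <= len i a) ->
  forall w a, 0 <= w <= M -> p <= a <= q ->
  has_deriv [set t | p <= t <= q] (f k l c i w) a (f k l.+1 c i w a).
Proof.
move=> kA lB Ip Iq M0 hM.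
have SD w a : 0 <= w <= M -> p <= a <= q -> strip I len i w a.
  by move=> wM apq; split; [exact: I_conv apq|have := hM _ apq; slra].
elim: k kA => [|k IH] kA w a wM apq.
  by apply: has_deriv_sub (f_da c lB (SD _ _ wM apq)) => t /= tpq; exact: SD.
move=> e e0; set g := f k.+1 l.+1 c i w a.
have [d d0 hd] := f_cont c kA lB (SD _ _ wM apq) e0.
exists d => // t tpq ta.
suff key : forall e' : R, 0 < e' -> `|f k.+1 l c i w t - f k.+1 l c i w a - g * (t - a)| <= e * `|t - a| + 2 * e'.
  apply/ler_addgt0Pr => e' e'0; have e2 : 0 < e' / 2 by rewrite divr_gt0.
  by have := key _ e2; rewrite mulrCA divff ?mulr1.
move=> e' e'0.
have [d1 d10 h1] := f_du c kA (ltnW lB) (SD _ _ wM apq) e'0.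
have [d2 d20 h2] := f_du c kA (ltnW lB) (SD _ _ wM tpq) e'0.
have [h [h0 hd3 hd1 hd2 whM]] : exists h, [/\ h != 0, `|h| < d, `|h| < d1, `|h| < d2 & 0 <= w + h <= M].
  pose x := Num.min (Num.min d d1) (Num.min d2 M) / 2.
  have [x0 [xd [xd1 [xd2 xM]]]] : 0 < x /\ x < d /\ x < d1 /\ x < d2 /\ x <= M / 2.
    set y := Num.min _ _ in x *.
    have : 0 < y by rewrite !lt_min d0 d10 d20.
    have : y <= d /\ y <= d1 /\ y <= d2 /\ y <= M by rewrite !ge_min !lexx !orbT.
    by rewrite /x; clr; lra.
  case: (leP w (M / 2)) => wM2.
    exists x; rewrite lt0r_neq0// gtr0_norm//; split=> //; move: wM2 wM x0 xM; clr; lra.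
  exists (- x); rewrite oppr_eq0 lt0r_neq0// normrN gtr0_norm//; split=> //; move: wM2 wM x0 xM; clr; lra.
have hp : 0 < `|h| by rewrite normr_gt0.
have E : w + h - w = h by ring.
have {}h1 := h1 (w + h) (SD _ _ whM apq); rewrite E in h1.
have {}h2 := h2 (w + h) (SD _ _ whM tpq); rewrite E in h2.
pose phi s := f k l c i (w + h) s - f k l c i w s.
have phi_mvt : `|phi t - phi a - h * g * (t - a)| <= e * `|h| * `|t - a|.
  apply: (@mvt_on R [set s | p <= s <= q /\ `|s - a| < d] phi (fun s => f k l.+1 c i (w + h) s - f k l.+1 c i w s)) => //.
  - move=> x y z /= [? /ltr_normlP[? ?]] [? /ltr_normlP[? ?]] ?; split; first by slra.
    by rewrite ltr_norml; slra.
  - move=> s /= [spq _]; apply: (@has_deriv_sub _ [set t | p <= t <= q]); first by move=> ? [].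
    by apply: has_derivB; apply: IH => //; exact: ltnW.
  - by split=> //; rewrite subrr normr0.
  - move=> s [spq sa] _.
    have := @mvt_on R [set x | 0 <= x <= M /\ `|x - w| <= `|h|] (f k l.+1 c i ^~ s) (f k.+1 l.+1 c i ^~ s) g e w (w + h).
    rewrite E (mulrC h g); apply.
    + move=> x y z /= [xM xw] [yM yw] xzy; split; first by move: xM yM xzy; clr; lra.
      by move: xw yw xzy; rewrite !ler_norml; clr; lra.
    + move=> x /= [xM _]; apply: (@has_deriv_sub _ [set y | strip I len i y s]).
        by move=> y /= [yM _]; exact: SD.
      by apply: f_du => //; exact: SD.
    + by split=> //; rewrite subrr normr0.
    + by split=> //; rewrite E.
    + move=> x [xM xw] _; apply: hd => //; first exact: SD.
      exact: le_lt_trans hd3.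
have {h1}h1 := h1 hd1; have {h2}h2 := h2 hd2.
rewrite -(ler_pM2l hp) -normrM.
have -> : h * (f k.+1 l c i w t - f k.+1 l c i w a - g * (t - a)) =
  (phi t - phi a - h * g * (t - a)) + ((f k l c i (w + h) a - f k l c i w a - f k.+1 l c i w a * h)
   - (f k l c i (w + h) t - f k l c i w t - f k.+1 l c i w t * h)) by rewrite /phi; ring.
rewrite (le_trans (ler_normD _ _))// (_ : `|h| * (e * _ + _) = e * `|h| * `|t - a| + (e' * `|h| + e' * `|h|)); last ring.
by rewrite lerD// (le_trans (ler_normB _ _))// lerD.
Qed.

(** The two points are joined inside the strip by a path that goes down to the height [w], across at
    this height, and up again. [w] does not exceed the least length between [a] and [a'], and by the
    Lipschitz bound each vertical piece has length at most [|u' - u| + L * |a' - a|]; hence the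
    factor [3 + 2 * L]. *)
Lemma f_strict_diff k l c : (k < A)%N -> (l < B)%N ->
  strict_diff I (strip I len) (f k l c) (f k.+1 l c) (f k l.+1 c).
Proof.
move=> kA lB a0 Ia0 e e0.
have [L L0 [dL dL0 hL]] := len_lip sc Ia0.
pose e1 := e / (3 + 2 * L); have L3 : 0 < 3 + 2 * L by rewrite addr_gt0// mulr_gt0.
have e10 : 0 < e1 by rewrite divr_gt0.
have [d1 d10 h1] := f_equicont sc c kA (ltnW lB) Ia0 e10.
have [d2 d20 h2] := f_equicont sc c (ltnW kA) lB Ia0 e10.
pose d := Num.min dL (Num.min d1 d2).
have dp : 0 < d by rewrite !lt_min dL0 d10.
have [dd1 [dd2 dd3]] : d <= dL /\ d <= d1 /\ d <= d2 by rewrite /d !ge_min !lexx !orbT.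
have KL : 0 < 2 + 2 * L by rewrite addr_gt0// mulr_gt0.
exists (d / (2 + 2 * L)); first by rewrite divr_gt0.
move=> i u a u' a' uD u'D; rewrite !ltr_pdivlMr// => ad a'd ud.
have dK (x : R) : `|x| * (2 + 2 * L) < d -> `|x| < d.
  by apply: le_lt_trans; rewrite ler_peMr//; move: L0; clr; lra.
have {dK}[ad1 a'd1] := (dK _ ad, dK _ a'd).
have [Ia Ia'] := (uD.1, u'D.1).
have adL : `|a - a0| < dL by exact: lt_le_trans dd1.
have a'dL : `|a' - a0| < dL by exact: lt_le_trans dd1.
have aS : Num.min a a' <= a <= Num.max a a' by rewrite ge_min le_max lexx.
have a'S : Num.min a a' <= a' <= Num.max a a' by rewrite ge_min le_max lexx !orbT.
have [t tS tmin] : exists2 t : R, Num.min a a' <= t <= Num.max a a' &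
    forall s, Num.min a a' <= s <= Num.max a a' -> len i t <= len i s.
  by apply: (len_argmin sc); [rewrite ge_min le_max lexx|case: (leP a a')..].
have It := seg_I sc Ia Ia' tS.
have tdL := seg_near tS adL a'dL.
have lt0 := len_gt0 i It.
have at1 : len i a - len i t <= L * `|a' - a|.
  apply: le_trans (ler_norm _) _; apply: (le_trans (hL i a t Ia It adL tdL)).
  by rewrite ler_pM2l// (distrC a' a); exact: seg_dist2 tS aS.
have at2 : len i a' - len i t <= L * `|a' - a|.
  apply: le_trans (ler_norm _) _; apply: (le_trans (hL i a' t Ia' It a'dL tdL)).
  by rewrite ler_pM2l// (distrC a' a); exact: seg_dist2 tS a'S.
pose w := Num.min (Num.min u u') (len i t).
have w0 : 0 <= w.
  by rewrite !le_min (ltW lt0) andbT; case: uD => _ /andP[-> _]; case: u'D => _ /andP[-> _].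
have [wu [wu' wt]] : w <= u /\ w <= u' /\ w <= len i t by rewrite /w !ge_min !lexx !orbT.
have uw : u - w <= `|u' - u| + L * `|a' - a|.
  rewrite lerBlDr -lerBlDl /w !le_min; case: uD => _ /andP[_ ul].
  have n1 := normr_ge0 (u' - u); have n2 : 0 <= L * `|a' - a| by rewrite mulr_ge0// ltW.
  have := ler_norm (u' - u); have := ler_norm (u - u'); rewrite (distrC u).
  by move: n1 n2 ul at1; clr; lra.
have u'w : u' - w <= `|u' - u| + L * `|a' - a|.
  rewrite lerBlDr -lerBlDl /w !le_min; case: u'D => _ /andP[_ ul].
  have n1 := normr_ge0 (u' - u); have n2 : 0 <= L * `|a' - a| by rewrite mulr_ge0// ltW.
  have := ler_norm (u' - u); have := ler_norm (u - u'); rewrite (distrC u).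
  by move: n1 n2 ul at2; clr; lra.
rewrite /differential /at_new /at_old /gauge /=.
set gs := f k.+1 l c i u a; set ga := f k l.+1 c i u a.
set G := `|u' - u| + `|a' - a|.
have small : `|u' - u| + (`|u' - u| + L * `|a' - a|) < d.
  have aa : `|a' - a| * (2 + 2 * L) < 2 * d.
    have -> : a' - a = (a' - a0) - (a - a0) by ring.
    apply: (@le_lt_trans _ _ ((`|a' - a0| + `|a - a0|) * (2 + 2 * L))).
      by rewrite ler_wpM2r ?(ltW KL)// ler_normB.
    by rewrite mulrDl; move: ad a'd; clr; lra.
  have L1 : 0 < 1 + L by rewrite addr_gt0.
  rewrite -(ltr_pM2r L1); have : L * (`|a' - a| * (2 + 2 * L)) < L * (2 * d) by rewrite ltr_pM2l.
  by move: ud; clr; lra.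
have near_uw x y : w <= x -> x <= Num.max u u' -> Num.min a a' <= y <= Num.max a a' -> strip I len i x y ->
   `|f k.+1 l c i x y - gs| <= e1 /\ `|f k l.+1 c i x y - ga| <= e1.
  move=> wx xu yS xyD.
  have yd : `|y - a0| < d by exact: seg_near yS ad1 a'd1.
  have xd : `|x - u| < d.
    apply: le_lt_trans small; rewrite ler_norml.
    have : x <= u + `|u' - u|.
      apply: (le_trans xu); rewrite ge_max; have := ler_norm (u' - u); have := normr_ge0 (u' - u).
      by clr; lra.
    have n2 : 0 <= L * `|a' - a| by rewrite mulr_ge0// ltW.
    have := normr_ge0 (u' - u); move: uw wx n2; clr; lra.
  have l1 z : z < d -> z < d1 by move=> zd; apply: lt_le_trans zd dd2.
  have l2 z : z < d -> z < d2 by move=> zd; apply: lt_le_trans zd dd3.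
  by split; [apply: (h1 i u a x y)|apply: (h2 i u a x y)] => //; auto.
have wD y : Num.min a a' <= y <= Num.max a a' -> strip I len i w y.
  move=> yS; split; [exact: (seg_I sc Ia Ia' yS)|]; have := tmin _ yS; move: w0 wt; clr; lra.
have vert x y : w <= x -> x <= Num.max u u' -> Num.min a a' <= y <= Num.max a a' -> strip I len i x y ->
   `|f k l c i x y - f k l c i w y - gs * (x - w)| <= e1 * (x - w).
  move=> wx xu yS xyD; rewrite -[X in _ <= e1 * X]ger0_norm ?subr_ge0//.
  apply: (@mvt_on R [set z | w <= z <= x] (f k l c i ^~ y) (f k.+1 l c i ^~ y)) => //=; rewrite ?lexx ?wx//.
  - by move=> z1 z2 z3; clr; lra.
  - move=> z wzx; apply: (@has_deriv_sub _ [set z | strip I len i z y]).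
      by move=> z' /= ?; exact: strip_fibre_conv (wD _ yS) xyD _.
    by apply: f_du => //; [exact: ltnW|exact: strip_fibre_conv (wD _ yS) xyD wzx].
  - move=> z /andP[wz zx] _; apply: (near_uw z y _ _ _ _).1 => //; first exact: le_trans zx xu.
    by apply: strip_fibre_conv (wD _ yS) xyD _; rewrite wz.
have V := vert u a wu _ aS uD; have V' := vert u' a' wu' _ a'S u'D.
rewrite !le_max !lexx ?orbT in V V'.
have {}V := V isT; have {}V' := V' isT.
have H : `|f k l c i w a' - f k l c i w a - ga * (a' - a)| <= e1 * `|a' - a|.
  apply: (@mvt_on R [set y | Num.min a a' <= y <= Num.max a a'] (f k l c i w) (f k l.+1 c i w)) => //=.
  - by move=> z1 z2 z3; clr; lra.
  - move=> y yS; apply: (@f_da_rect k l c i _ _ (len i t)) => //; first exact: ltnW.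
    + by case: (leP a a').
    + by case: (leP a a').
    + by rewrite w0.
  - move=> y yS _; apply: (near_uw w y _ _ _ _).2 => //; last exact: wD.
    by rewrite le_max wu.
have -> : f k l c i u' a' - f k l c i u a - (gs * (u' - u) + ga * (a' - a)) =
  (f k l c i u' a' - f k l c i w a' - gs * (u' - w)) + (f k l c i w a' - f k l c i w a - ga * (a' - a))
  - (f k l c i u a - f k l c i w a - gs * (u - w)) by ring.
rewrite (le_trans (ler_normB _ _))//.
have W := ler_normD (f k l c i u' a' - f k l c i w a' - gs * (u' - w)) (f k l c i w a' - f k l c i w a - ga * (a' - a)).
apply: (@le_trans _ _ (e1 * (u' - w) + e1 * `|a' - a| + e1 * (u - w))).
  by move: V V' H W; clr; lra.
rewrite -!mulrDr (_ : e * G = e1 * ((3 + 2 * L) * G)); last by rewrite /e1; field; rewrite lt0r_neq0.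
rewrite ler_pM2l// /G.
have n1 := normr_ge0 (u' - u); have n2 : 0 <= `|a' - a| by [].
have n3 : 0 <= L * `|u' - u| by rewrite mulr_ge0// ltW.
by move: uw u'w n1 n2 n3; clr; lra.
Qed.

Lemma f_smooth n k l c : (k + n <= A)%N -> (l + n <= B)%N -> smooth I (strip I len) n (f k l c).
Proof.
elim: n k l c => [|n IH] k l c; first by rewrite !addn0 => kA lB; split=> //; split; [exact: (f_bounded sc)|exact: (f_equicont sc)].
rewrite !addnS => kA lB.
have kA' := leq_ltn_trans (leq_addr n k) kA; have lB' := leq_ltn_trans (leq_addr n l) lB.
apply: (@smooth_intro _ _ _ _ _ _ (f k.+1 l c) (f k l.+1 c)).
- by apply: (f_bounded sc); exact: ltnW.
- exact: f_strict_diff.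
- by apply: IH; [rewrite addSn|exact: ltnW].
- by apply: IH; [exact: ltnW|rewrite addSn].
Qed.

Section len_smooth.
Variable E : 'I_m -> R -> R -> Prop.
Hypothesis EI : forall i s a, E i s a -> I a.

(** Obtained by differentiating the closing relation in [a] and projecting on the unit tangent at
    the end of the period. *)
Definition len_deriv i (s a : R) : R :=
  f 1 0 0 i (len i a) a * (f 0 1 0 i 0 a - f 0 1 0 i (len i a) a)
  + f 1 0 1 i (len i a) a * (f 0 1 1 i 0 a - f 0 1 1 i (len i a) a).

Lemma len_strict_diff : strict_diff I E (fun i _ a => len i a) (fun _ _ _ => 0) len_deriv.
Proof.
move=> a0 Ia0 e e0.
have [L L0 [dL dL0 hL]] := len_lip sc Ia0.
pose e1 := e / (2 * (2 + L)); have L3 : 0 < 2 * (2 + L) by rewrite mulr_gt0// addr_gt0.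
have e10 : 0 < e1 by rewrite divr_gt0.
have A0 : (0 < A)%N := A1.
have [d0 d00 h0] := f_strict_diff 0 A0 B1 Ia0 e10.
have [d1 d10 h1] := f_strict_diff 1 A0 B1 Ia0 e10.
pose d := Num.min dL (Num.min d0 d1).
have dp : 0 < d by rewrite !lt_min dL0 d00.
have [dd1 [dd2 dd3]] : d <= dL /\ d <= d0 /\ d <= d1 by rewrite /d !ge_min !lexx !orbT.
have L1 : 0 < 1 + 2 * L by rewrite ltr_pwDl// mulr_ge0// ltW.
exists (d / (1 + 2 * L)); first by rewrite divr_gt0.
move=> i s a s' a' /EI Ia /EI Ia'; rewrite !ltr_pdivlMr// => ad a'd _.
have dK (x : R) : `|x| * (1 + 2 * L) < d -> `|x| < d.
  by apply: le_lt_trans; rewrite ler_peMr//; move: L0; clr; lra.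
have [ad1 a'd1] := (dK _ ad, dK _ a'd).
rewrite /differential /at_new /at_old /gauge /= mul0r add0r.
set D := len_deriv i s a.
apply: (@le_trans _ _ (e * `|a' - a|)); last by rewrite ler_wpM2l ?(ltW e0)// lerDr.
have lip : `|len i a' - len i a| <= L * `|a' - a|.
  by apply: hL => //; apply: lt_le_trans dd1.
have lend : `|len i a' - len i a| < d.
  apply: (le_lt_trans lip).
  have -> : a' - a = (a' - a0) - (a - a0) by ring.
  apply: (@le_lt_trans _ _ (L * (`|a' - a0| + `|a - a0|))).
    by rewrite ler_pM2l// ler_normB.
  move: ad a'd (normr_ge0 (a - a0)) (normr_ge0 (a' - a0)); clr; lra.
have main c dc : d <= dc ->
   (forall t s a s' a', strip I len t s a -> strip I len t s' a' -> `|a - a0| < dc -> `|a' - a0| < dc ->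
     `|s' - s| < dc -> `|at_new (f 0 0 c) (t, (s, a), (s', a')) - at_old (f 0 0 c) (t, (s, a), (s', a'))
      - differential (f 1 0 c) (f 0 1 c) (t, (s, a), (s', a'))| <= e1 * gauge (t, (s, a), (s', a'))) ->
   `|f 1 0 c i (len i a) a * (len i a' - len i a) - (f 0 1 c i 0 a - f 0 1 c i (len i a) a) * (a' - a)| <= e1 * (2 + L) * `|a' - a|.
  move=> ddc hc.
  have ltc x : x < d -> x < dc by move=> /lt_le_trans; apply.
  have X := hc i (len i a) a (len i a') a' (strip_len sc i Ia) (strip_len sc i Ia') (ltc _ ad1) (ltc _ a'd1) (ltc _ lend).
  have Y := hc i 0 a 0 a' (strip0 sc i Ia) (strip0 sc i Ia') (ltc _ ad1) (ltc _ a'd1).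
  rewrite subrr normr0 in Y; have {}Y := Y (ltc _ dp).
  rewrite /at_new /at_old /differential /gauge /= in X Y; rewrite !f_closed// in X; rewrite subrr mulr0 !add0r normr0 add0r in Y.
  set l0 := f 0 1 c i (len i a) a in X *; set l1 := f 1 0 c i (len i a) a in X *; set z0 := f 0 1 c i 0 a in Y *.
  have -> : l1 * (len i a' - len i a) - (z0 - l0) * (a' - a) =
    (f 0 0 c i 0 a' - f 0 0 c i 0 a - z0 * (a' - a)) - (f 0 0 c i 0 a' - f 0 0 c i 0 a - (l1 * (len i a' - len i a) + l0 * (a' - a))) by ring.
  apply: (le_trans (ler_normB _ _)); apply: (le_trans (lerD Y X)).
  have : e1 * `|len i a' - len i a| <= e1 * (L * `|a' - a|) by rewrite ler_pM2l.
  by clr; lra.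
have m0 := main 0 d0 dd2 h0; have m1 := main 1 d1 dd3 h1.
have U := f_unit (strip_len sc i Ia).
have n0 := f_unit_le1 sc 0 (strip_len sc i Ia); have n1 := f_unit_le1 sc 1 (strip_len sc i Ia).
move: m0 m1; rewrite /D /len_deriv.
set x0 := f 1 0 0 _ _ _ in U n0 *; set x1 := f 1 0 1 _ _ _ in U n1 *.
set y0 := f 0 1 0 i 0 a - _; set y1 := f 0 1 1 i 0 a - _ => m0 m1.
have -> : len i a' - len i a - (x0 * y0 + x1 * y1) * (a' - a) =
  x0 * (x0 * (len i a' - len i a) - y0 * (a' - a)) + x1 * (x1 * (len i a' - len i a) - y1 * (a' - a)).
  by rewrite -[X in X - _ - _ = _]mul1r -[X in _ - X - _ = _]mul1r -U; ring.
apply: (le_trans (combo_le n0 n1 m0 m1)).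
by rewrite /e1 le_eqVlt; apply/orP; left; apply/eqP; field; rewrite lt0r_neq0// addr_gt0.
Qed.

Lemma len_bounded : fibre_bounded I E (fun i _ a => len i a).
Proof.
move=> a0 Ia0; have [L L0 [dL dL0 hL]] := len_lip sc Ia0.
have [||d d0 h] := @finite_uniform R 'I_m (fun i d => len i a0 <= d^-1); last first.
- exists (d^-1 + L); first by rewrite addr_gt0 ?invr_gt0.
  exists (Num.min dL 1); first by rewrite lt_min dL0 ltr01.
  move=> i s a s' a' /EI Ia _; rewrite lt_min => /andP[a1 a2] _ _; rewrite /at_old /=.
  rewrite ger0_norm ?(ltW (len_gt0 _ Ia))//.
  have := hL i a a0 Ia Ia0 a1; rewrite subrr normr0 => /(_ dL0).
  have : L * `|a - a0| <= L * 1 by rewrite ler_pM2l// ltW.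
  have := ler_norm (len i a - len i a0); have := h i; clr; lra.
- move=> i; exists (len i a0)^-1; first by rewrite invr_gt0 len_gt0.
  by rewrite invrK.
- move=> i d d' /andP[d'0 d'd] h; apply: (le_trans h); rewrite lef_pV2 ?posrE//; move: d'0 d'd; clr; lra.
Qed.

(** A bootstrap: [len_deriv] is built from jets evaluated at [0] and at [len], hence has the class
    already known for [len]. *)
Lemma len_smooth n : (n <= A)%N -> (n <= B)%N -> smooth I E n (fun i _ a => len i a).
Proof.
elim: n => [|n IH] nA nB.
  split=> //; split; first exact: len_bounded.
  move=> a0 Ia0 e e0; have [L L0 [dL dL0 hL]] := len_lip sc Ia0.
  exists (Num.min dL (e / (2 * L))); first by rewrite lt_min dL0 divr_gt0// mulr_gt0.
  move=> i s a s' a' /EI Ia /EI Ia'; rewrite !lt_min => /andP[a1 a2] /andP[a3 a4] _.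
  rewrite /at_new /at_old /=; apply: (le_trans (hL i a' a Ia' Ia a3 a1)).
  move: a2 a4; rewrite !ltr_pdivlMr ?mulr_gt0// => a2 a4.
  have -> : a' - a = (a' - a0) - (a - a0) by ring.
  apply: (@le_trans _ _ (L * (`|a' - a0| + `|a - a0|))).
    by rewrite ler_pM2l// ler_normB.
  move: a2 a4; clr; lra.
have {}IH := IH (ltnW nA) (ltnW nB).
apply: (smooth_intro len_bounded len_strict_diff); first exact: smooth_cst.
have atlen k l c : (k + n <= A)%N -> (l + n <= B)%N -> smooth I E n (fun i s a => f k l c i (len i a) a).
  move=> h1 h2; apply: (@smooth_comp _ _ _ _ (strip I len) E id (fun i _ a => len i a)) (f_smooth c h1 h2) _.
    by move=> t s a /EI; exact: (strip_len sc).
  exact: smooth_smooth_mod_cst.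
have at0 k l c : (k + n <= A)%N -> (l + n <= B)%N -> smooth I E n (fun i s a => f k l c i 0 a).
  move=> h1 h2; apply: (@smooth_comp _ _ _ _ (strip I len) E id (fun i _ a => 0)) (f_smooth c h1 h2) _.
    by move=> t s a /EI; exact: (strip0 sc).
  exact/smooth_smooth_mod_cst/smooth_cst.
have nB' := ltnW nB; have nA' := ltnW nA.
by apply: smoothD; (apply: smoothM; [exact: atlen|by apply: smoothB; [exact: at0|exact: atlen]]).
Qed.
End len_smooth.

End strip_jets.

(** * Periodic extension *)

Section strict_diff_derivatives.
Variables (R : realType) (I : set R) (T : Type) (E : T -> R -> R -> Prop).
Implicit Types f fs fa : T -> R -> R -> R.

Lemma strict_diff_ds f fs fa t s a : I a -> E t s a -> strict_diff I E f fs fa ->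
  has_deriv [set x | E t x a] (f t ^~ a) s (fs t s a).
Proof.
move=> Ia Es sd e e0; have [d d0 hd] := sd _ Ia _ e0; exists d => // y Ey ys.
have := hd t s a y a Es Ey; rewrite subrr normr0 => /(_ d0 d0 ys).
by rewrite /at_new /differential /at_old /gauge /= subrr mulr0 normr0 !addr0.
Qed.

Lemma strict_diff_da f fs fa t s a : I a -> (forall b, I b -> E t s b) -> strict_diff I E f fs fa ->
  has_deriv I (f t s) a (fa t s a).
Proof.
move=> Ia Es sd e e0; have [d d0 hd] := sd _ Ia _ e0; exists d => // y Iy ya.
have := hd t s a s y (Es _ Ia) (Es _ Iy); rewrite !subrr normr0 => /(_ d0 ya d0).
by rewrite /at_new /differential /at_old /gauge /= !subrr mulr0 normr0 !add0r.
Qed.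

Lemma strict_diff_ext f g fs gs fa ga : (forall t s a, E t s a -> f t s a = g t s a) ->
  (forall t s a, E t s a -> fs t s a = gs t s a) -> (forall t s a, E t s a -> fa t s a = ga t s a) ->
  strict_diff I E f fs fa -> strict_diff I E g gs ga.
Proof.
move=> h hs ha sd a0 Ia0 e e0; have [d d0 hd] := sd _ Ia0 _ e0; exists d => // t s a s' a' E1 E2 *.
have := hd t s a s' a' E1 E2; rewrite /at_new /at_old /differential /gauge /at_old /= -!h// -hs// -ha//.
exact.
Qed.

End strict_diff_derivatives.

Lemma itv_acc (R : realType) (p q s : R) : p < q -> p <= s <= q -> forall d : R, 0 < d ->
  exists y, [/\ p <= y <= q, y != s & `|y - s| < d].
Proof.
move=> pq spq d d0; pose x := Num.min d (q - p) / 2.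
have [x0 [xd x2]] : 0 < x /\ x < d /\ x <= (q - p) / 2.
  set y := Num.min _ _ in x *.
  have : 0 < y by rewrite lt_min d0 subr_gt0.
  have : y <= d /\ y <= q - p by rewrite !ge_min !lexx !orbT.
  by rewrite /x; clr; lra.
case: (leP s ((p + q) / 2)) => s2.
  exists (s + x); rewrite addrAC subrr add0r gtr0_norm//; split=> //; first slra.
  by rewrite gt_eqF//; slra.
exists (s - x); rewrite addrAC subrr add0r normrN gtr0_norm//; split=> //; first slra.
by rewrite lt_eqF//; slra.
Qed.

Section periodic_extension.
Variables (R : realType) (I : set R) (T : Type).
Hypothesis I_conv : forall a b c, I a -> I b -> a <= c <= b -> I c.
Hypothesis I_acc : forall a, I a -> forall d : R, 0 < d -> exists y, [/\ I y, y != a & `|y - a| < d].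

Definition unit_cell (t : T) (s a : R) := I a /\ 0 <= s <= 1.
Definition whole (t : T) (s a : R) := I a.

Let cell_conv (s t x y z : R) : 0 <= x <= 1 -> 0 <= y <= 1 -> x <= z <= y -> 0 <= z <= 1.
Proof. clr; lra. Qed.

Lemma cell_acc s : 0 <= s <= 1 -> forall d : R, 0 < d -> exists y, [/\ 0 <= y <= 1, y != s & `|y - s| < d].
Proof. exact: itv_acc ltr01. Qed.

(** Schwarz's theorem up to the boundary of the cell: the second difference over a small rectangle
    with a corner at [(s, a)] approximates either mixed derivative times the area, by the mean value
    theorem taken in either order. *)
Lemma mixed_partials (f fs fa P' P Q Q' : T -> R -> R -> R) t s a :
  strict_diff I unit_cell f fs fa -> strict_diff I unit_cell fs P' P -> strict_diff I unit_cell fa Q Q' ->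
  fibre_equicont I unit_cell P -> fibre_equicont I unit_cell Q -> unit_cell t s a -> P t s a = Q t s a.
Proof.
move=> sf sfs sfa cP cQ [Ia s01]; apply/eqP; rewrite -subr_eq0 -normr_le0; apply/ler_addgt0Pr => e e0.
rewrite add0r; have e4 : 0 < e / 4 by rewrite divr_gt0.
have [d1 d10 h1] := sfs _ Ia _ e4; have [d2 d20 h2] := sfa _ Ia _ e4.
have [d3 d30 h3] := cP _ Ia _ e4; have [d4 d40 h4] := cQ _ Ia _ e4.
pose d := Num.min (Num.min d1 d2) (Num.min d3 d4).
have dp : 0 < d by rewrite !lt_min d10 d20 d30.
have [l1 [l2 [l3 l4]]] : (forall x, x < d -> x < d1) /\ (forall x, x < d -> x < d2)
   /\ (forall x, x < d -> x < d3) /\ (forall x, x < d -> x < d4).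
  by rewrite /d; do !split; move=> x; rewrite !lt_min => /andP[/andP[? ?] /andP[? ?]].
have [s' [s'01 s's s'd]] := cell_acc s01 dp.
have [a' [Ia' a'a a'd]] := I_acc Ia dp.
have hp : 0 < `|s' - s| by rewrite normr_gt0 subr_eq0.
have kp : 0 < `|a' - a| by rewrite normr_gt0 subr_eq0.
have aa0 : `|a - a| < d by rewrite subrr normr0.
have ss0 : `|s - s| < d by rewrite subrr normr0.
pose phi x := f t x a' - f t x a.
pose psi y := f t s' y - f t s y.
have Phi : `|phi s' - phi s - P t s a * (a' - a) * (s' - s)| <= e / 2 * `|a' - a| * `|s' - s|.
  apply: (@mvt_on R [set x | 0 <= x <= 1 /\ `|x - s| <= `|s' - s|] phi (fun x => fs t x a' - fs t x a)) => //.
  - move=> x y z /= [xM xw] [yM yw] xzy; split; first exact: cell_conv xzy.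
    by move: xw yw xzy; rewrite !ler_norml; clr; lra.
  - move=> x /= [x01 _]; apply: (@has_deriv_sub _ [set x | 0 <= x <= 1]); first by move=> ? [].
    apply: has_derivB.
      by apply: has_deriv_sub (strict_diff_ds Ia' (conj Ia' x01) sf) => y /= y01; split.
    by apply: has_deriv_sub (strict_diff_ds Ia (conj Ia x01) sf) => y /= y01; split.
  - by split=> //; rewrite subrr normr0.
  - move=> x [x01 xs] _; have xd : `|x - s| < d by exact: le_lt_trans s'd.
    have X := h1 t x a x a' (conj Ia x01) (conj Ia' x01) (l1 _ aa0) (l1 _ a'd).
    rewrite subrr normr0 in X; have {}X := X (l1 _ dp).
    have Y := h3 t s a x a (conj Ia s01) (conj Ia x01) (l3 _ aa0) (l3 _ aa0) (l3 _ xd).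
    rewrite /at_new /differential /at_old /gauge /= subrr mulr0 normr0 !add0r in X Y.
    have -> : fs t x a' - fs t x a - P t s a * (a' - a) =
      (fs t x a' - fs t x a - P t x a * (a' - a)) + (P t x a - P t s a) * (a' - a) by ring.
    rewrite (le_trans (ler_normD _ _))// (_ : e / 2 = e / 4 + e / 4); last by field.
    by rewrite [X in _ <= X]mulrDl lerD// normrM ler_wpM2r.
have Psi : `|psi a' - psi a - Q t s a * (s' - s) * (a' - a)| <= e / 2 * `|s' - s| * `|a' - a|.
  apply: (@mvt_on R [set y | I y /\ `|y - a| <= `|a' - a|] psi (fun y => fa t s' y - fa t s y)) => //.
  - move=> x y z /= [xM xw] [yM yw] xzy; split; first exact: I_conv xzy.
    by move: xw yw xzy; rewrite !ler_norml; clr; lra.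
  - move=> x /= [Ix _]; apply: (@has_deriv_sub _ I); first by move=> ? [].
    by apply: has_derivB; apply: (strict_diff_da Ix _ sf) => b Ib.
  - by split=> //; rewrite subrr normr0.
  - move=> x [Ix xs] _; have xd : `|x - a| < d by exact: le_lt_trans a'd.
    have X := h2 t s x s' x (conj Ix s01) (conj Ix s'01) (l2 _ xd) (l2 _ xd) (l2 _ s'd).
    have Y := h4 t s a s x (conj Ia s01) (conj Ix s01) (l4 _ aa0) (l4 _ xd) (l4 _ ss0).
    rewrite /at_new /differential /at_old /gauge /= subrr mulr0 normr0 !addr0 in X Y.
    have -> : fa t s' x - fa t s x - Q t s a * (s' - s) =
      (fa t s' x - fa t s x - Q t s x * (s' - s)) + (Q t s x - Q t s a) * (s' - s) by ring.
    rewrite (le_trans (ler_normD _ _))// (_ : e / 2 = e / 4 + e / 4); last by field.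
    by rewrite [X in _ <= X]mulrDl lerD// normrM ler_wpM2r.
have E : phi s' - phi s = psi a' - psi a by rewrite /phi /psi; ring.
rewrite -(ler_pM2r hp) -(ler_pM2r kp) -!normrM.
have -> : (P t s a - Q t s a) * (s' - s) * (a' - a) =
  (psi a' - psi a - Q t s a * (s' - s) * (a' - a)) - (phi s' - phi s - P t s a * (a' - a) * (s' - s)) by rewrite E; ring.
rewrite (le_trans (ler_normB _ _))//.
have -> : e * `|s' - s| * `|a' - a| = e / 2 * `|s' - s| * `|a' - a| + e / 2 * `|a' - a| * `|s' - s| by field.
exact: lerD.
Qed.

(** Closed cells overlap at the integers, so this contains the matching of [g] at [0] and [1]. *)
Definition cell_periodic (h g : T -> R -> R -> R) := forall (n : int) t s a, I a ->
  n%:~R <= s <= n%:~R + 1 -> h t s a = g t (s - n%:~R) a.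

Definition cell_extension (g : T -> R -> R -> R) t s a : R := g t (s - (Num.floor s)%:~R) a.

Lemma cell_extension_periodic g : (forall t a, I a -> g t 0 a = g t 1 a) ->
  cell_periodic (cell_extension g) g.
Proof.
move=> g01 n t s a Ia /andP[ns sn]; rewrite /cell_extension.
have [E|E] := eqVneq s (n%:~R + 1); last first.
  have -> : Num.floor s = n by apply: floor_def; rewrite ns intrD lt_neqAle E sn.
  by [].
have -> : Num.floor s = n + 1 by apply: floor_def; rewrite E !intrD lexx ltrDl ltr01.
by rewrite E intrD subrr addrAC subrr add0r g01.
Qed.

Lemma cell_extension_in g t s a : (forall t a, I a -> g t 0 a = g t 1 a) -> unit_cell t s a ->
  cell_extension g t s a = g t s a.
Proof.
move=> g01 [Ia s01]; have := cell_extension_periodic g01 (n := 0) t Ia (s := s).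
by rewrite add0r subr0; exact.
Qed.

(** A segment shorter than 1 meets at most two cells; [q] is the integer at which it changes cell,
    or its end point. *)
Lemma cell_split (s s' : R) : `|s' - s| < 1 -> exists q (n n' : int),
  [/\ n%:~R <= s <= n%:~R + 1, n%:~R <= q <= n%:~R + 1, n'%:~R <= q <= n'%:~R + 1,
      n'%:~R <= s' <= n'%:~R + 1 & `|q - s| + `|s' - q| = `|s' - s|].
Proof.
move=> ss; have /andP[f1 f2] := floor_itv s; have /andP[g1 g2] := floor_itv s'.
rewrite !intrD in f2 g2; set n := Num.floor s in f1 f2; set n' := Num.floor s' in g1 g2.
have nn : (n' <= n + 1)%R by rewrite -ltzD1 -(ltr_int R) !intrD; move: ss; rewrite ltr_norml; lra.
have nn' : (n <= n' + 1)%R by rewrite -ltzD1 -(ltr_int R) !intrD; move: ss; rewrite ltr_norml; lra.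
have [E|] := eqVneq n n'.
  exists s', n, n; rewrite subrr normr0 addr0; split=> //; rewrite ?E in f1 f2 *; slra.
rewrite neq_lt => /orP[lt|lt].
  have E : n' = n + 1 by apply/le_anti; rewrite nn/= lezD1.
  rewrite E intrD in g1 g2; exists (n%:~R + 1), n, n'; rewrite E intrD; split; [slra..|].
  by rewrite !ger0_norm; slra.
have E : n = n' + 1 by apply/le_anti; rewrite nn'/= lezD1.
rewrite E intrD in f1 f2; exists (n'%:~R + 1), n, n'; rewrite E intrD; split; [slra..|].
by rewrite !ler0_norm; slra.
Qed.

Lemma shift_cell (n : int) (s : R) : n%:~R <= s <= n%:~R + 1 -> 0 <= s - n%:~R <= 1.
Proof. clr; lra. Qed.

Lemma periodic_bounded h g : cell_periodic h g -> fibre_bounded I unit_cell g -> fibre_bounded I whole h.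
Proof.
move=> hg /fibre_boundedP b; apply/fibre_boundedP => a0 /b[M M0 [d d0 hd]].
exists M => //; exists d => // t s a Ia ad.
have /andP[f1 f2] := floor_itv s; rewrite intrD in f2.
rewrite (hg (Num.floor s)) ?f1 ?(ltW f2)//; apply: hd => //; split=> //; apply: shift_cell.
by rewrite f1 ltW.
Qed.

Lemma periodic_equicont h g : cell_periodic h g -> fibre_equicont I unit_cell g -> fibre_equicont I whole h.
Proof.
move=> hg c a0 Ia0 e e0; have e2 : 0 < e / 2 by rewrite divr_gt0.
have [d d0 hd] := c _ Ia0 _ e2.
exists (Num.min d 1); first by rewrite lt_min d0 ltr01.
move=> t s a s' a' Ia Ia'; rewrite !lt_min => /andP[a1 _] /andP[a'1 _] /andP[s1 s2].
have [q [n [n' [q1 q2 q3 q4 q5]]]] := cell_split s2.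
rewrite /at_new /at_old /=.
have X := hd t (s - n%:~R) a (q - n%:~R) a (conj Ia (shift_cell q1)) (conj Ia (shift_cell q2)) a1 a1.
have Y := hd t (q - n'%:~R) a (s' - n'%:~R) a' (conj Ia (shift_cell q3)) (conj Ia' (shift_cell q4)) a1 a'1.
rewrite /at_new /at_old /= !opprB !addrA !subrK -!hg// in X Y.
have qs : `|q - s| < d by apply: le_lt_trans s1; rewrite -q5 lerDl.
have sq : `|s' - q| < d by apply: le_lt_trans s1; rewrite -q5 lerDr.
have -> : h t s' a' - h t s a = (h t s' a' - h t q a) + (h t q a - h t s a) by ring.
rewrite (le_trans (ler_normD _ _))// (_ : e = e / 2 + e / 2); last by field.
by rewrite lerD ?Y ?X.
Qed.

Lemma periodic_strict_diff h g hs gs ha ga : cell_periodic h g -> cell_periodic hs gs -> cell_periodic ha ga ->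
  fibre_equicont I unit_cell gs -> fibre_equicont I unit_cell ga ->
  strict_diff I unit_cell g gs ga -> strict_diff I whole h hs ha.
Proof.
move=> hg hgs hga cs ca sd a0 Ia0 e e0; have e2 : 0 < e / 2 by rewrite divr_gt0.
have [d1 d10 h1] := sd _ Ia0 _ e2.
have [d2 d20 h2] := cs _ Ia0 _ e2.
have [d3 d30 h3] := ca _ Ia0 _ e2.
exists (Num.min 1 (Num.min d1 (Num.min d2 d3))); first by rewrite !lt_min ltr01 d10 d20.
move=> t s a s' a' Ia Ia'; rewrite !lt_min => /andP[_ /andP[a1 /andP[a2 a3]]].
move=> /andP[_ /andP[a'1 /andP[a'2 a'3]]] /andP[s0 /andP[s1 /andP[s2 s3]]].
have [q [n [n' [q1 q2 q3 q4 q5]]]] := cell_split s0.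
have qs x : `|s' - s| < x -> `|q - s| < x by apply: le_lt_trans; rewrite -q5 lerDl.
have sq x : `|s' - s| < x -> `|s' - q| < x by apply: le_lt_trans; rewrite -q5 lerDr.
have X := h1 t (s - n%:~R) a (q - n%:~R) a (conj Ia (shift_cell q1)) (conj Ia (shift_cell q2)) a1 a1.
have Xs := h2 t (s - n%:~R) a (q - n%:~R) a (conj Ia (shift_cell q1)) (conj Ia (shift_cell q2)) a2 a2.
have Xa := h3 t (s - n%:~R) a (q - n%:~R) a (conj Ia (shift_cell q1)) (conj Ia (shift_cell q2)) a3 a3.
have Y := h1 t (q - n'%:~R) a (s' - n'%:~R) a' (conj Ia (shift_cell q3)) (conj Ia' (shift_cell q4)) a1 a'1.
rewrite /at_new /at_old /differential /gauge /at_old /= in X Xs Xa Y *.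
rewrite !opprB !addrA !subrK -?hg -?hgs -?hga// in X Xs Xa Y.
have {}X := X (qs _ s1); have {}Xs := Xs (qs _ s2); have {}Xa := Xa (qs _ s3); have {}Y := Y (sq _ s1).
rewrite subrr normr0 !addr0 mulr0 addr0 in X.
set u0 := hs t s a in X Xs *; set u1 := hs t q a in Xs Y; set v0 := ha t s a in Xa *; set v1 := ha t q a in Xa Y.
have -> : h t s' a' - h t s a - (u0 * (s' - s) + v0 * (a' - a)) =
  ((h t s' a' - h t q a - (u1 * (s' - q) + v1 * (a' - a))) + (h t q a - h t s a - u0 * (q - s)))
  + ((u1 - u0) * (s' - q) + (v1 - v0) * (a' - a)) by ring.
have Z : `|(u1 - u0) * (s' - q) + (v1 - v0) * (a' - a)| <= e / 2 * (`|s' - q| + `|a' - a|).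
  by rewrite (le_trans (ler_normD _ _))// [X in _ <= X]mulrDr lerD// normrM ler_wpM2r.
rewrite (le_trans (ler_normD _ _))//.
have W := ler_normD (h t s' a' - h t q a - (u1 * (s' - q) + v1 * (a' - a))) (h t q a - h t s a - u0 * (q - s)).
rewrite -q5.
have : 0 <= e / 2 * `|q - s| by rewrite mulr_ge0// ltW.
by move: X Y Z W; clr; lra.
Qed.

(* The jump conditions at the ends of the cell are only needed for the derivatives
   in [s]; those of the mixed derivatives follow by differentiating in [a]. *)
Lemma smooth_periodic n (h : nat -> T -> R -> R -> R) :
  (forall k, (k <= n)%N -> cell_periodic (h k) (h k)) ->
  (forall k, (k <= n)%N -> smooth I unit_cell (n - k) (h k)) ->
  (forall k t s a, (k < n)%N -> unit_cell t s a ->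
     has_deriv [set x | 0 <= x <= 1] (h k t ^~ a) s (h k.+1 t s a)) ->
  smooth I whole n (h 0).
Proof.
elim: n h => [|n IH] h hp hsm hd.
  have p0 := hp 0 (leqnn _); have := hsm 0 (leqnn _) => -[[hb hc] _].
  by split=> //; split; [exact: periodic_bounded hb|exact: periodic_equicont hc].
(* The derivative in [a] is the one provided by [smooth]; the derivative in [s] may be taken to be
   [h k.+1], since derivatives along the cell are unique. *)
have W k : exists ga, (k <= n)%N -> strict_diff I unit_cell (h k) (h k.+1) ga /\ smooth I unit_cell (n - k) ga.
  have [kn|] := leqP k n; last by exists (fun _ _ _ => 0).
  have := hsm k (leqW kn); rewrite subSn// => -[_ [gs [ga [sd sms sma]]]].
  exists ga => _; split=> //; apply: strict_diff_ext (sd) => // t s a Es.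
  apply: (has_deriv_unique (cell_acc Es.2)) (hd k t s a _ Es) => //.
  by apply: has_deriv_sub (strict_diff_ds Es.1 Es sd) => x x01; split=> //; exact: Es.1.
have [ga hga] := choice W.
have ga01 k t a : (k <= n)%N -> I a -> ga k t 0 a = ga k t 1 a.
  move=> kn Ia; have [sd _] := hga _ kn.
  have D0 : has_deriv I (h k t 0) a (ga k t 0 a).
    by apply: (strict_diff_da Ia _ sd) => b Ib; split=> //; rewrite lexx ler01.
  have D1 : has_deriv I (h k t 1) a (ga k t 1 a).
    by apply: (strict_diff_da Ia _ sd) => b Ib; split=> //; rewrite lexx ler01.
  apply: (has_deriv_unique (I_acc Ia)) D0 _; apply: has_deriv_eq D1 => // b Ib.
  have := hp k (leqW kn) 1 t 1 b Ib; rewrite subrr => -> //.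
  by rewrite lexx lerDl ler01.
pose h' k := cell_extension (ga k).
have h'E k t s a : (k <= n)%N -> unit_cell t s a -> h' k t s a = ga k t s a.
  by move=> kn; apply: cell_extension_in => ? ? ?; exact: ga01.
have h'p k : (k <= n)%N -> cell_periodic (h' k) (ga k).
  by move=> kn; apply: cell_extension_periodic => ? ? ?; exact: ga01.
have sm' : smooth I whole n (h' 0).
  apply: IH.
  - move=> k kn n' t s a Ia sn; rewrite (h'p _ kn n')// h'E//; split=> //; exact: shift_cell.
  - move=> k kn; apply: smooth_ext (hga _ kn).2 => t s a Es; by rewrite h'E.
  - move=> k t s a kn Es; have [sd sm] := hga _ (ltnW kn).
    move: sm; rewrite -(subnSK kn) => -[_ [P [P' [sdP smP _]]]].
    have [sd1 sm1] := hga _ kn.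
    (* For the extended [a]-derivatives to satisfy the same hypotheses, [h' k.+1] must be the
       [s]-derivative of [h' k]; this is the symmetry of mixed derivatives. *)
    have -> : h' k.+1 t s a = P t s a.
      rewrite h'E//; apply: (mixed_partials sd sd1 sdP) => //; [exact: smooth_equicont sm1|exact: smooth_equicont smP].
    apply: (@has_deriv_eq _ _ (ga k t ^~ a)); first exact: Es.2.
      by move=> y y01; rewrite h'E ?(ltnW kn)//; split=> //; exact: Es.1.
    by apply: has_deriv_sub (strict_diff_ds Es.1 Es sdP) => x x01; split=> //; exact: Es.1.
have sm1 : smooth I whole n (h 1).
  apply: (IH (fun k => h k.+1)) => k.
  - by move=> kn; exact: hp.
  - by move=> kn; have := hsm k.+1 kn; rewrite subSS.
  - by move=> t s a kn; exact: hd.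
have [sd0 sga] := hga 0 (leq0n _).
apply: smooth_intro sm1 sm'.
  by apply: periodic_bounded (hp 0 (leq0n _)) (smooth_bounded (hsm 0 (leq0n _))).
apply: (periodic_strict_diff (hp 0 (leq0n _)) (hp 1 (ltn0Sn _)) (h'p 0 (leq0n _))) sd0.
  exact: smooth_equicont (hsm 1 (ltn0Sn _)).
exact: smooth_equicont sga.
Qed.

End periodic_extension.

(** * Plane-valued jets by coordinates, and periodicity of derivatives *)

Section jets.
Variable R : realType.
Local Notation plane := 'rV[R]_2.

Lemma diff_quotient_has_deriv (S : set R) (f : R -> plane) x (l : plane) c :
  diff_quotient f x y @[y --> within S x^'] --> l -> has_deriv S (fun y => f y 0 c) x (l 0 c).
Proof.
move=> h e e0; have /h := plane_near l e0; rewrite /within/= => -[d /= d0 hd].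
exists d => // y Sy yx; have [->|yx0] := eqVneq y x; first by rewrite !subrr mulr0 subrr normr0 mulr0.
have y3 : 0 < `|y - x| by rewrite normr_gt0 subr_eq0.
have := hd y; rewrite /= distrC => /(_ yx yx0 Sy c).
rewrite /diff_quotient !mxE -(ltr_pM2r y3) -normrM mulrBl mulrAC mulVf ?subr_eq0// mul1r.
exact: ltW.
Qed.

Lemma within_continuous_plane (D : set (R * R)) (f : R * R -> plane) u0 a0 c :
  {within D, continuous f} -> D (u0, a0) -> forall e : R, 0 < e ->
  exists2 d : R, 0 < d & forall u a, D (u, a) -> `|u - u0| < d -> `|a - a0| < d ->
    `|f (u, a) 0 c - f (u0, a0) 0 c| <= e.
Proof.
move=> /subspace_continuousP h D0 e e0; have /(h _ D0) := plane_near (f (u0, a0)) e0.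
rewrite /within/= => /nbhs_ballP[d /= d0 hd]; exists d => // u a Dua ud ad.
by apply/ltW/(hd (u, a)) => //; split; rewrite /= -ball_normE /= distrC.
Qed.

Lemma derive1n_periodic (g : R -> plane) l : (forall u, g (u + l) = g u) ->
  forall k u, derive1n k g (u + l) = derive1n k g u.
Proof.
move=> gp; elim=> [|k IH] u; first exact: gp.
rewrite !derive1nS; set h := derive1n k g in IH *; clearbody h; rewrite /derive1.
have -> // : (fun x => x^-1 *: (h (x + (u + l)) - h (u + l))) = (fun x => x^-1 *: (h (x + u) - h u)).
by apply/funext => x; rewrite addrA !IH.
Qed.

Lemma periodic_int (T : Type) (g : R -> T) l : (forall u, g (u + l) = g u) ->
  forall (n : int) u, g (u + n%:~R * l) = g u.
Proof.
move=> gp; have hn (n : nat) u : g (u + n%:R * l) = g u.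
  by elim: n u => [|n IH] u; rewrite ?mul0r ?addr0// -natr1 mulrDl mul1r addrA gp.
case=> n u; first exact: hn.
rewrite NegzE mulrNz mulNr -[in RHS](subrK (n.+1%:R * l) u).
by rewrite hn.
Qed.

End jets.

(** * The boundary curves of the deformation, rescaled to period 1 *)

Section deformation.
Variables (R : realType) (m : nat) (al ar : \bar R).
Hypothesis hI : (al < ar)%E.
Variable I : set R.
Hypothesis defI : I = [set a : R | (al <= a%:E)%E /\ (a%:E <= ar)%E].
Variables (r r' : nat).
Hypothesis hr : (2 <= r)%N.
Hypothesis hr' : (2 <= r')%N.
Variable K : billiard_family R m.
Hypothesis hK : billiard_deformation K r r' I.
Local Notation plane := 'rV[R]_2.
Local Notation N := (minn r r').

Lemma I_conv a b c : I a -> I b -> a <= c <= b -> I c.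
Proof.
rewrite defI => -[a1 a2] [b1 b2] /andP[ac cb]; split.
  by apply: le_trans a1 _; rewrite lee_fin.
by apply: le_trans _ b2; rewrite lee_fin.
Qed.

Lemma I_acc a : I a -> forall d : R, 0 < d -> exists y, [/\ I y, y != a & `|y - a| < d].
Proof.
move=> Ia d d0.
have [p [q [pq Ip Iq]]] : exists p q, [/\ p < q, I p & I q].
  rewrite defI; case: al ar hI => [x| |] [y| |] //=.
  - by rewrite lte_fin => xy; exists x, y; rewrite !lee_fin !lexx (ltW xy).
  - by move=> _; exists x, (x + 1); rewrite ltrDl ltr01 !lee_fin lexx lerDl ler01 !leey.
  - by move=> _; exists (y - 1), y; rewrite ltrBlDr ltrDl ltr01 !lee_fin lexx lerBlDr lerDl ler01 !leNye.
  - by move=> _; exists 0, 1; rewrite ltr01 !leNye !leey.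
have lt : Num.min a p < Num.max a q by rewrite gt_min !lt_max pq !orbT.
have aS : Num.min a p <= a <= Num.max a q by rewrite ge_min le_max lexx.
have [y [yS ya yd]] := itv_acc lt aS d0; exists y; split=> //.
by apply: I_conv yS; [case: leP|case: leP].
Qed.

Let fixed a (Ia : I a) := let: And3 h _ _ := hK in h a Ia.

Lemma obst_disjoint a i j : I a -> i != j -> obst K i a `&` obst K j a = set0.
Proof. by move=> /fixed[h _ _ _ _]; exact: h. Qed.
Lemma obst_compact a i : I a -> compact (obst K i a).
Proof. by move=> /fixed[_ h _ _ _]. Qed.
Lemma obst_strictly_convex a i : I a -> strictly_convex K i a.
Proof. by move=> /fixed[_ _ h _ _]. Qed.
Lemma obst_param a i : I a -> is_arclength_param K r i a.
Proof. by move=> /fixed[_ _ _ h _]. Qed.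
Lemma obst_no_eclipse a : I a -> no_eclipse K a.
Proof. by move=> /fixed[_ _ _ _ h]. Qed.

Lemma len_gt0 i a : I a -> 0 < len K i a.
Proof. by move=> /(obst_param i)[[]]. Qed.

Lemma param_periodic i a u : I a -> param K i (u + len K i a) a = param K i u a.
Proof. by move=> /(obst_param i)[[_]]. Qed.

Lemma param_bdry i a u : I a -> bdry (obst K i a) (param K i u a).
Proof. by move=> /(obst_param i)[_ [<- _] _ _ _]; exists u. Qed.

Lemma param_surj i a x : I a -> bdry (obst K i a) x -> exists u, x = param K i u a.
Proof. by move=> /(obst_param i)[_ [<- _] _ _ _] [u _ <-]; exists u. Qed.

Lemma param_mem i a u : I a -> obst K i a (param K i u a).
Proof. by move=> Ia; apply: bdry_closed_sub; [exact: obst_compact|exact: param_bdry]. Qed.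

Lemma param_has_deriv k i a u c : (k < r)%N -> I a ->
  has_deriv setT (fun v => derive1n k (param K i ^~ a) v 0 c) u (derive1n k.+1 (param K i ^~ a) u 0 c).
Proof.
move=> kr /(obst_param i)[_ _ [h _] _ _]; rewrite derive1nS.
exact/derivable_coord_has_deriv/h.
Qed.

Lemma tangentE i u a : tangent K i u a = derive1n 1 (param K i ^~ a) u.
Proof. by rewrite /tangent derive1n1. Qed.

Lemma tangent_norm i u a : I a -> enorm (tangent K i u a) = 1.
Proof. by move=> /(obst_param i)[_ _ _]. Qed.

Lemma param_supporting i a u y : I a -> obst K i a y -> y != param K i u a ->
  0 < det2 (tangent K i u a) (y - param K i u a).
Proof.
move=> Ia; have [cv curv] := obst_strictly_convex i Ia.
have [_ _ _ _ left] := obst_param i Ia.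
have r1 : (0 < r)%N by exact: ltnW.
apply: (@tangent_strictly_supporting _ _ (param K i ^~ a) (tangent K i ^~ a) (derive1n 2 (param K i ^~ a)) cv).
- exact: obst_compact.
- by move=> v; exact: param_bdry.
- by move=> v c; rewrite tangentE; exact: (param_has_deriv i v c r1 Ia).
- move=> v c; have := param_has_deriv i v c hr Ia.
  by apply: has_deriv_ext => w; rewrite tangentE.
- by move=> v; exact: tangent_norm.
- by move=> v; rewrite tangentE; exact: curv.
- move=> v; have := left v; apply: filterS => t.
  by rewrite /outer_normal scalerN opprK.
Qed.

Lemma param_inj i a u v : I a -> 0 <= u < len K i a -> 0 <= v < len K i a ->
  param K i u a = param K i v a -> u = v.
Proof. by move=> /(obst_param i)[_ [_ h] _ _ _]; exact: h. Qed.

Lemma param_inj_mod i a u v : I a -> param K i u a = param K i v a ->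
  exists n : int, v = u + n%:~R * len K i a.
Proof.
move=> Ia uv; have l0 := len_gt0 i Ia; set l := len K i a in l0 *.
pose red x := x - (Num.floor (x / l))%:~R * l.
have redP x : 0 <= red x < l.
  have := floor_itv (x / l); rewrite intrD ler_pdivlMr// ltr_pdivrMr// mulrDl mul1r /red.
  by clr; lra.
have redE x : param K i (red x) a = param K i x a.
  rewrite /red -mulNr -mulrNz.
  exact: (@periodic_int _ _ (param K i ^~ a) l (fun u => param_periodic i u Ia)).
have : red u = red v by apply: (param_inj Ia (redP u) (redP v)); rewrite !redE.
rewrite /red => E; exists (Num.floor (v / l) - Num.floor (u / l)).
by rewrite intrD mulrNz mulrDl mulNr; move: E; clr; lra.
Qed.

(** The prescribed jets are taken along slices, one-sided at the ends of the period. They agree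
    there with the derivatives of the periodic curve because the slices in [u] are nondegenerate
    intervals, on which derivatives are unique. *)
Lemma deformation_jets : exists f, strip_curve I (len K) r r' f /\
  forall k c i u a, (k <= r)%N -> strip I (len K) i u a -> f k 0 c i u a = derive1n k (param K i ^~ a) u 0 c.
Proof.
have [_ [d [jets _]] _] := hK.
pose f k l (c : 'I_2) i u a : R := d i k l u a 0 c.
have r1 : (1 <= r)%N by exact: ltnW.
have r'1 : (1 <= r')%N by exact: ltnW.
have fda l c i u a : (l < r')%N -> strip I (len K) i u a ->
    has_deriv [set t | strip I (len K) i u t] (f 0 l c i u) a (f 0 l.+1 c i u a).
  move=> lr' uD; have [_ _ h _] := jets i.
  exact: (diff_quotient_has_deriv c (h _ _ _ lr' uD)).
have fdu k l c i u a : (k < r)%N -> (l <= r')%N -> strip I (len K) i u a ->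
    has_deriv [set s | strip I (len K) i s a] (f k l c i ^~ a) u (f k.+1 l c i u a).
  move=> kr lr' uD; have [_ _ _ h] := jets i.
  exact: (diff_quotient_has_deriv c (h _ _ _ _ kr lr' uD)).
have fE k c i u a : (k <= r)%N -> strip I (len K) i u a -> f k 0 c i u a = derive1n k (param K i ^~ a) u 0 c.
  elim: k u => [|k IH] u kr uD; first by have [h _ _ _] := jets i; rewrite /f h.
  have acc (e : R) : 0 < e -> exists y, [/\ strip I (len K) i y a, y != u & `|y - u| < e].
    case: uD => Ia ul /(itv_acc (len_gt0 i Ia) ul) [y [y1 y2 y3]].
    by exists y; split.
  apply: (has_deriv_unique acc) (fdu _ _ c _ _ _ kr (leq0n _) uD) _.
  apply: (@has_deriv_eq _ (strip I (len K) i ^~ a) (fun v => derive1n k (param K i ^~ a) v 0 c)) => //.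
    by move=> y yD; rewrite IH// ltnW.
  exact: has_deriv_sub (@subsetT _ _) (param_has_deriv i u c kr uD.1).
exists f; split=> //; split=> //.
- exact: I_conv.
- move=> k l c i u0 a0 kr lr' D0 e e0; have [_ h _ _] := jets i.
  by have [dd dd0 hd] := within_continuous_plane c (h _ _ kr lr') D0 e0; exists dd.
- by move=> i a; exact: len_gt0.
- move=> k c i a k1 Ia; have kr : (k <= r)%N by exact: leq_trans r1.
  have l0 := len_gt0 i Ia.
  rewrite !fE//; [|by split=> //; rewrite lexx ltW..].
  rewrite -[X in derive1n _ _ X]add0r (@derive1n_periodic _ (param K i ^~ a))// => u.
  exact: param_periodic.
- move=> i u a uD; rewrite !fE// -tangentE -enorm_sqr tangent_norm ?expr1n//; exact: uD.1.
- move=> i a u v Ia ul vl uv.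
  have uD : strip I (len K) i u a by split=> //; case/andP: ul => ->/ltW.
  have vD : strip I (len K) i v a by split=> //; case/andP: vl => ->/ltW.
  rewrite !fE// -tangentE /=.
  have := param_supporting (u := u) Ia (param_mem i v Ia); rewrite /det2 !mxE; apply.
  by apply: contraNneq uv => /(param_inj Ia vl ul) ->.
Qed.

(** The boundary of [obst i a] with parameter rescaled to period 1, and its
    derivatives in the parameter, by coordinates. *)
Definition unit_param k (c : 'I_2) (i : 'I_m) (s a : R) : R :=
  len K i a ^+ k * derive1n k (param K i ^~ a) (s * len K i a) 0 c.

Lemma unit_param_has_deriv k c i s a : (k < r)%N -> I a ->
  has_deriv setT (unit_param k c i ^~ a) s (unit_param k.+1 c i s a).
Proof.
move=> kr Ia; have h := param_has_deriv i (s * len K i a) c kr Ia.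
have hid : has_deriv setT (fun x : R => x * len K i a) s (len K i a).
  move=> e e0; exists 1 => // y _ _.
  have -> : y * len K i a - s * len K i a - len K i a * (y - s) = 0 by ring.
  by rewrite normr0 mulr_ge0// ltW.
have := has_derivZ (len K i a ^+ k) (has_deriv_comp (fun _ _ => Logic.I) hid h).
have -> // : len K i a ^+ k * (derive1n k.+1 (param K i ^~ a) (s * len K i a) 0 c * len K i a)
  = unit_param k.+1 c i s a.
by rewrite /unit_param exprSr mulrCA mulrC.
Qed.

Lemma unit_param_periodic k c i (s a : R) (n : int) : I a -> unit_param k c i (s + n%:~R) a = unit_param k c i s a.
Proof.
move=> Ia; rewrite /unit_param mulrDl.
rewrite (@periodic_int _ _ (derive1n k (param K i ^~ a)) (len K i a))// => u.
by apply: derive1n_periodic => v; exact: param_periodic.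
Qed.

(** On one cell this is a power of [len] times a jet evaluated at [s * len]. The period no longer
    depends on [a], so the function extends smoothly to the line; the [s]-derivatives match at the
    integers because the original curve is periodic. *)
Lemma unit_param_smooth k n c : (k + n <= N)%N -> smooth I (whole I (T := 'I_m)) n (unit_param k c).
Proof.
rewrite leq_min => /andP[kr kr'].
have [f [sc fE]] := deformation_jets.
apply: (smooth_periodic I_conv I_acc (h := fun l => unit_param (l + k) c)) => [l ln|l ln|l t s a ln [Ia s01]].
- move=> z i s a Ia _; rewrite -[in LHS](subrK z%:~R s); exact: unit_param_periodic.
- pose E := unit_cell I (T := 'I_m).
  have EI i s a : E i s a -> I a by case.
  have nr' : (n - l <= r')%N by rewrite (leq_trans (leq_subr _ _))// (leq_trans (leq_addl k n)).
  have nr : (n - l <= r)%N by rewrite (leq_trans (leq_subr _ _))// (leq_trans (leq_addl k n)).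
  have sl := len_smooth sc EI nr nr'.
  have sid : smooth I E (n - l) (fun _ s _ => s).
    have b : fibre_bounded I E (fun _ s _ => s).
      apply/fibre_boundedP => a0 _; exists 1 => //; exists 1 => // i s a [_ s01] _.
      by move: s01; rewrite ler_norml; clr; lra.
    apply: (@smooth_le _ _ _ _ _ (n - l).+1) => //.
    apply: (smooth_intro b _ (smooth_cst _ _ _ 1) (smooth_cst _ _ _ 0)).
    move=> a0 _ e e0; apply: nearW => -[[i [s a]] [s' a']]; rewrite /at_new /at_old /differential /at_old /gauge /=.
    by rewrite mul1r mul0r addr0 subrr normr0 mulr_ge0 ?addr_ge0// ltW.
  have sf : smooth I (strip I (len K)) (n - l) (f (l + k)%N 0%N c).
    by apply: (f_smooth sc); rewrite ?add0n// addnAC subnKC// addnC.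
  apply: (@smooth_ext _ _ _ _ _ (fun i s a => len K i a ^+ (l + k) * f (l + k)%N 0%N c i (s * len K i a) a)).
    move=> i s a [Ia /andP[s0 s1]]; rewrite /unit_param fE//.
      by rewrite (leq_trans _ kr)// addnC leq_add2l.
    have l0 := len_gt0 i Ia; split=> //; rewrite mulr_ge0 ?(ltW l0)//=.
    by rewrite -[X in _ <= X]mul1r ler_pM2r.
  apply: smoothM; first exact: smoothX.
  apply: (@smooth_comp _ _ _ _ (strip I (len K)) E id (fun i s a => s * len K i a)) sf _.
    move=> i s a [Ia /andP[s0 s1]]; have l0 := len_gt0 i Ia; split=> //; rewrite mulr_ge0 ?(ltW l0)//=.
    by rewrite -[X in _ <= X]mul1r ler_pM2r.
  by apply: smooth_smooth_mod_cst; exact: smoothM.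
- apply: (has_deriv_sub (@subsetT _ _)); apply: unit_param_has_deriv => //.
  by rewrite (leq_trans _ kr)// addnC ltn_add2l.
Qed.

End deformation.

(** * Reflections and orbits *)

Section plane_algebra.
Variable R : realType.
Local Notation plane := 'rV[R]_2.
Implicit Types x y z v w : plane.

Lemma dotpC x y : dotp x y = dotp y x.
Proof. by rewrite !dotpE; ring. Qed.
Lemma dotpDl x y z : dotp (x + y) z = dotp x z + dotp y z.
Proof. by rewrite !dotpE !mxE; ring. Qed.
Lemma dotpNl x z : dotp (- x) z = - dotp x z.
Proof. by rewrite !dotpE !mxE; ring. Qed.
Lemma dotpBl x y z : dotp (x - y) z = dotp x z - dotp y z.
Proof. by rewrite dotpDl dotpNl. Qed.
Lemma dotpZl k x z : dotp (k *: x) z = k * dotp x z.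
Proof. by rewrite !dotpE !mxE; ring. Qed.
Lemma dotpDr x y z : dotp z (x + y) = dotp z x + dotp z y.
Proof. by rewrite !(dotpC z) dotpDl. Qed.
Lemma dotpNr x z : dotp z (- x) = - dotp z x.
Proof. by rewrite !(dotpC z) dotpNl. Qed.
Lemma dotpBr x y z : dotp z (x - y) = dotp z x - dotp z y.
Proof. by rewrite !(dotpC z) dotpBl. Qed.
Lemma dotpZr k x z : dotp z (k *: x) = k * dotp z x.
Proof. by rewrite !(dotpC z) dotpZl. Qed.
Lemma dotp_enorm x : dotp x x = enorm x ^+ 2.
Proof. by rewrite enorm_sqr dotpE !expr2. Qed.

Lemma cauchy_schwarz x y : `|dotp x y| <= enorm x * enorm y.
Proof.
rewrite -(@ler_pXn2r _ 2)// ?nnegrE ?mulr_ge0 ?enorm_ge0//.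
rewrite real_normK ?num_real// exprMn !enorm_sqr dotpE.
have := sqr_ge0 (x 0 0 * y 0 1 - x 0 1 * y 0 0); rewrite -subr_ge0 => h.
rewrite -subr_ge0; move: h; rewrite subr0; congr (0 <= _); ring.
Qed.

Lemma enormZ k x : enorm (k *: x) = `|k| * enorm x.
Proof. by rewrite /enorm dotpZl dotpZr mulrA -expr2 sqrtrM ?sqr_ge0// sqrtr_sqr. Qed.
Lemma enormN x : enorm (- x) = enorm x.
Proof. by rewrite /enorm dotpNl dotpNr opprK. Qed.
Lemma enorm_distC x y : enorm (x - y) = enorm (y - x).
Proof. by rewrite -enormN opprB. Qed.

Lemma enormD x y : enorm (x + y) <= enorm x + enorm y.
Proof.
rewrite -(@ler_pXn2r _ 2)// ?nnegrE ?addr_ge0 ?enorm_ge0//.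
rewrite -dotp_enorm dotpDl !dotpDr (dotpC y x) !dotp_enorm.
by have := le_trans (ler_norm _) (cauchy_schwarz x y); nra.
Qed.

Lemma coord_le_enorm x c : `|x 0 c| <= enorm x.
Proof.
rewrite -(@ler_pXn2r _ 2)// ?nnegrE ?enorm_ge0// real_normK ?num_real// enorm_sqr.
have h0 := sqr_ge0 (x 0 0); have h1 := sqr_ge0 (x 0 1).
by move: c; apply: ord2P; move: h0 h1; clr; lra.
Qed.

Lemma enorm_le_coord x : enorm x <= `|x 0 0| + `|x 0 1|.
Proof.
rewrite -(@ler_pXn2r _ 2)// ?nnegrE ?addr_ge0 ?enorm_ge0// enorm_sqr.
rewrite -(real_normK (num_real (x 0 0))) -(real_normK (num_real (x 0 1))).
by have := normr_ge0 (x 0 0); have := normr_ge0 (x 0 1); nra.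
Qed.

Lemma enorm_eq0 x : enorm x = 0 -> x = 0.
Proof. by move=> h; apply/eqP; apply: contraT; rewrite -enorm_gt0 h ltxx. Qed.

Definition dir x y : plane := (enorm (y - x))^-1 *: (y - x).

Lemma enorm_sub_gt0 x y : x != y -> 0 < enorm (y - x).
Proof. by rewrite enorm_gt0 subr_eq0 eq_sym. Qed.

Lemma dir_norm x y : x != y -> enorm (dir x y) = 1.
Proof.
by move=> /enorm_sub_gt0 h; rewrite /dir enormZ gtr0_norm ?invr_gt0// mulVf// lt0r_neq0.
Qed.

Lemma dirE x y : x != y -> y = x + enorm (y - x) *: dir x y.
Proof.
move=> /enorm_sub_gt0 h; rewrite /dir scalerA divff ?lt0r_neq0// scale1r addrC subrK//.
Qed.

Lemma dir_ray x v tau : 0 < tau -> enorm v = 1 -> dir x (x + tau *: v) = v.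
Proof.
move=> t0 v1; rewrite /dir addrAC subrr add0r enormZ v1 mulr1 gtr0_norm// scalerA mulVf ?scale1r//.
exact: lt0r_neq0.
Qed.

(* The gradient of the norm is monotone. *)
Lemma dir_monotone x y x' y' : x != y -> x' != y' ->
  0 <= dotp (dir x y - dir x' y') ((y - x) - (y' - x')).
Proof.
move=> xy xy'; have e1 := dir_norm xy; have e2 := dir_norm xy'.
have p1 := enorm_sub_gt0 xy; have p2 := enorm_sub_gt0 xy'.
have E1 : y - x = enorm (y - x) *: dir x y by rewrite {1}(dirE xy) addrAC subrr add0r.
have E2 : y' - x' = enorm (y' - x') *: dir x' y' by rewrite {1}(dirE xy') addrAC subrr add0r.
rewrite E1 E2; set p := enorm _ in p1 *; set q := enorm _ in p2 *.
set e := dir x y in e1 *; set f := dir x' y' in e2 *.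
have ef : dotp e f <= 1 by rewrite (le_trans (ler_norm _))// (le_trans (cauchy_schwarz _ _))// e1 e2 mulr1.
clearbody e f p q.
rewrite dotpBl !dotpBr !dotpZr !dotp_enorm e1 e2 (dotpC f e) expr1n.
have : 0 <= (p + q) * (1 - dotp e f) by rewrite mulr_ge0 ?subr_ge0// addr_ge0// ltW.
by clr; lra.
Qed.

End plane_algebra.

(** * Geometry of the table at a fixed parameter *)

Section table.
Variables (R : realType) (m : nat) (K : billiard_family R m) (a : R).
Local Notation plane := 'rV[R]_2.
Local Notation obst i := (obst K i a).
Local Notation n_ i u := (outer_normal K i u a).

(** [tb_fat] will fix the sign of the normal at a reflection; [tb_normal] makes the outer normal a
    function of the boundary point, whose parameter is determined only modulo the period. *)
Record table : Prop := Table {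
  tb_disjoint : forall i j, i != j -> obst i `&` obst j = set0;
  tb_compact : forall i, compact (obst i);
  tb_convex : forall i, convex_set (obst i);
  tb_no_eclipse : no_eclipse K a;
  tb_bdry : forall i u, bdry (obst i) (param K i u a);
  tb_surj : forall i x, bdry (obst i) x -> exists u, x = param K i u a;
  tb_supporting : forall i u y, obst i y -> y != param K i u a ->
    0 < det2 (tangent K i u a) (y - param K i u a);
  tb_norm : forall i u, enorm (tangent K i u a) = 1;
  tb_deriv : forall i u c, has_deriv setT (fun v => param K i v a 0 c) u (tangent K i u a 0 c);
  tb_fat : forall i x, exists2 y, obst i y & y != x;
  tb_normal : forall i u v, param K i u a = param K i v a -> n_ i u = n_ i v }.

Hypothesis tb : table.

Lemma tb_mem i u : obst i (param K i u a).
Proof. by apply: bdry_closed_sub; [exact: tb_compact|exact: tb_bdry]. Qed.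

Lemma tb_index i j x : obst i x -> obst j x -> i = j.
Proof.
move=> ix jx; apply/eqP; apply: contraT => /(tb_disjoint tb) h.
by have : (obst i `&` obst j) x by []; rewrite h.
Qed.

Lemma tb_neq i j x y : i != j -> obst i x -> obst j y -> x != y.
Proof. by move=> ij ix jy; apply: contraNneq ij => xy; rewrite xy in ix; rewrite (tb_index ix jy). Qed.

Lemma normal_norm i u : enorm (n_ i u) = 1.
Proof.
rewrite /outer_normal enormN -(tb_norm tb i u) /enorm; congr Num.sqrt.
by rewrite !dotpE !rot90E; ring.
Qed.

Lemma normal_det i u y : dotp (n_ i u) y = - det2 (tangent K i u a) y.
Proof.
rewrite /outer_normal dotpNl; congr (- _).
by rewrite dotpE /det2 !rot90E; ring.
Qed.

Lemma normal_supporting i u y : obst i y -> y != param K i u a ->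
  dotp (n_ i u) (y - param K i u a) < 0.
Proof. by move=> iy yu; rewrite normal_det oppr_lt0; exact: tb_supporting. Qed.

Lemma normal_supporting_le i u y : obst i y -> dotp (n_ i u) (y - param K i u a) <= 0.
Proof.
move=> iy; have [->|yu] := eqVneq y (param K i u a); last exact/ltW/normal_supporting.
by rewrite subrr dotpE !mxE !mulr0 addr0.
Qed.

Lemma between_in_hull (C : set plane) x y t : convex_set C -> C x -> C y -> 0 <= t <= 1 ->
  C (x + t *: (y - x)).
Proof.
move=> cC Cx Cy t01; have -> : x + t *: (y - x) = t *: y + (1 - t) *: x.
  by apply: planeP; rewrite !mxE; ring.
exact: convex2.
Qed.

(** The case [i = k] is included: the segment then stays in one convex obstacle, which is disjoint
    from the middle one. *)
Lemma eclipse_free i j k x z t : i != j -> j != k -> obst i x -> obst k z -> 0 <= t <= 1 ->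
  ~ obst j (x + t *: (z - x)).
Proof.
move=> ij jk ix kz t01 jy.
have [ik|ik] := eqVneq i k.
  rewrite -ik in kz; have := between_in_hull (tb_convex tb (i:=i)) ix kz t01.
  by move=> iy; move/eqP: ij; apply; exact: tb_index iy jy.
have kj : k != j by rewrite eq_sym.
have := tb_no_eclipse tb ik kj ij.
suff : (convex_hull (obst i `|` obst k) `&` obst j) (x + t *: (z - x)) by move=> + E; rewrite E.
split=> // C [cC sC]; apply: between_in_hull => //; apply: sC; [by left|by right].
Qed.

(** Equal directions would put [y] on the segment from [x] to [z], which is an eclipse. *)
Lemma dir_neq i j k x y z : i != j -> j != k -> obst i x -> obst j y -> obst k z -> dir y z != dir x y.
Proof.
move=> ij jk ix jy kz; apply/eqP => E.
have xy := tb_neq ij ix jy; have yz := tb_neq jk jy kz.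
have p := enorm_sub_gt0 xy; have q := enorm_sub_gt0 yz.
have Y := dirE xy; have Z := dirE yz; rewrite E in Z.
set e := dir x y in Y Z; set s := enorm (y - x) in p Y; set t := enorm (z - y) in q Z.
have st : 0 < s + t by rewrite addr_gt0.
apply: (@eclipse_free i j k x z (s / (s + t)) ij jk ix kz).
  by rewrite (divr_ge0 (ltW p) (ltW st)) /= ler_pdivrMr// mul1r lerDl ltW.
suff -> : x + (s / (s + t)) *: (z - x) = y by [].
have zx c : z 0 c - x 0 c = (s + t) * e 0 c by rewrite Z Y !mxE; ring.
have yx c : y 0 c = x 0 c + s * e 0 c by rewrite Y !mxE.
by apply: planeP; rewrite !mxE zx yx; field; rewrite lt0r_neq0.
Qed.

(** [y] minimizes the length of the broken line [x y z] over the obstacle. *)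
Definition extremal_at i (x y z : plane) :=
  obst i y /\ forall w, obst i w -> dotp (dir y z - dir x y) (w - y) <= 0.

(** Let [N] be the jump of the direction. Extremality says that the linear function [dotp N] is
    maximal at [y] over the obstacle. As [N] is nonzero, [y] is a boundary point; criticality along
    the curve makes [N] normal, and a second point of the obstacle makes it point outwards. The
    halves arise because both directions have norm 1. *)
Lemma extremal_reflection i j k x y z : i != j -> j != k -> obst i x -> obst k z -> extremal_at j x y z ->
  exists u, [/\ y = param K j u a, dir y z - dir x y = enorm (dir y z - dir x y) *: n_ j u,
    0 < enorm (dir y z - dir x y), dotp (dir y z) (n_ j u) = enorm (dir y z - dir x y) / 2
    & dotp (dir x y) (n_ j u) = - (enorm (dir y z - dir x y) / 2)].
Proof.
move=> ij jk ix kz [jy ext]; have N0 := dir_neq ij jk ix jy kz.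
have xy := tb_neq ij ix jy; have yz := tb_neq jk jy kz.
have e1 := dir_norm xy; have f1 := dir_norm yz.
rewrite -subr_eq0 -enorm_gt0 in N0.
set e := dir x y in ext e1 N0 *; set f := dir y z in ext f1 N0 *.
clearbody e f; have [N NfE] : exists N, N = f - e by eexists.
rewrite -NfE in ext N0 *.
have yb : bdry (obst j) y.
  split; first exact: subset_closure.
  move=> /plane_nbhsP[d d0 hd].
  pose t := d / 2 / (1 + enorm N).
  have p : 0 < 1 + enorm N by rewrite addr_gt0.
  have t0 : 0 < t by rewrite !divr_gt0.
  have /ext : obst j (y + t *: N).
    apply: hd => c; rewrite !mxE addrAC subrr add0r normrM gtr0_norm//.
    have tp : t * (1 + enorm N) = d / 2 by rewrite /t mulfVK// lt0r_neq0.
    apply: (@le_lt_trans _ _ (t * (1 + enorm N))); last by rewrite tp; lra.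
    by rewrite ler_pM2l// (le_trans (coord_le_enorm _ _))// lerDr.
  rewrite addrAC subrr add0r dotpZr dotp_enorm => h.
  have : 0 < t * enorm N ^+ 2 by rewrite mulr_gt0// exprn_gt0.
  by rewrite ltNge h.
have [u yu] := tb_surj tb yb.
have Nt : dotp N (tangent K j u a) = 0.
  have dh : has_deriv setT (fun v => dotp N (param K j v a)) u (dotp N (tangent K j u a)).
    rewrite dotpE; apply: (@has_deriv_ext _ _ (fun v => N 0 0 * param K j v a 0 0 + N 0 1 * param K j v a 0 1)).
      by move=> v; rewrite dotpE.
    by apply: has_derivD; apply: has_derivZ; exact: tb_deriv.
  apply: (has_deriv_max ltr01 _ dh) => v _; split=> //.
  by rewrite -subr_le0 -dotpBr -yu; apply/ext/tb_mem.
have U : tangent K j u a 0 0 ^+ 2 + tangent K j u a 0 1 ^+ 2 = 1.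
  by rewrite -enorm_sqr (tb_norm tb) expr1n.
pose lam := dotp N (n_ j u).
have NE : N = lam *: n_ j u.
  rewrite /lam /outer_normal dotpNr.
  move: Nt U; rewrite !dotpE; set t0 := tangent K j u a 0 0; set t1 := tangent K j u a 0 1 => Nt U.
  have [rt rtE] : exists rt, rt = rot90 (tangent K j u a) by eexists.
  rewrite -rtE; have r0 : rt 0 0 = - t1 by rewrite rtE rot90E.
  have r1 : rt 0 1 = t0 by rewrite rtE rot90E.
  have N0c : N 0 0 = (t0 ^+ 2 + t1 ^+ 2) * N 0 0 by rewrite U mul1r.
  have N1c : N 0 1 = (t0 ^+ 2 + t1 ^+ 2) * N 0 1 by rewrite U mul1r.
  apply: planeP; rewrite [RHS]mxE [(- rt) _ _]mxE r0 r1.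
    transitivity ((t0 ^+ 2 + t1 ^+ 2) * N 0 0 - t0 * (N 0 0 * t0 + N 0 1 * t1)); last ring.
    by rewrite Nt -N0c mulr0 subr0.
  transitivity ((t0 ^+ 2 + t1 ^+ 2) * N 0 1 - t1 * (N 0 0 * t0 + N 0 1 * t1)); last ring.
  by rewrite Nt -N1c mulr0 subr0.
have lam0 : 0 <= lam.
  have [w jw wy] := tb_fat tb j y; have := ext _ jw; rewrite NE dotpZl.
  have : dotp (n_ j u) (w - y) < 0 by rewrite yu; apply: normal_supporting; rewrite -?yu.
  move=> h le; rewrite leNgt; apply/negP => l0.
  by move: le; rewrite leNgt nmulr_rgt0// h.
have lamE : lam = enorm N by rewrite NE enormZ normal_norm mulr1 ger0_norm.
have fE : f = e + lam *: n_ j u by rewrite -NE NfE addrC subrK.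
have lamp : 0 < lam by rewrite lamE.
have en : dotp e (n_ j u) = - (lam / 2).
  have : dotp f f = 1 by rewrite dotp_enorm f1 expr1n.
  rewrite fE dotpDl !dotpDr !dotpZr !dotpZl (dotpC (n_ j u) e) !dotp_enorm normal_norm e1 !expr1n => h.
  by apply: (mulfI (lt0r_neq0 lamp)); move: h; clr; lra.
exists u; split=> //; rewrite -?lamE//.
rewrite fE dotpDl dotpZl dotp_enorm normal_norm expr1n en; clr; lra.
Qed.

End table.

(** * Orbits and extremal sequences *)

Section orbits.
Variables (R : realType) (m : nat) (K : billiard_family R m) (a : R).
Local Notation plane := 'rV[R]_2.
Local Notation state := (plane * plane)%type.
Local Notation obst i := (obst K i a).
Local Notation n_ i u := (outer_normal K i u a).
Hypothesis tb : table K a.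

Definition extremal_seq (xi : int -> 'I_m) (X : int -> plane) :=
  forall j, extremal_at K a (xi j) (X (j - 1)) (X j) (X (j + 1)).

Lemma admissible_pred (xi : int -> 'I_m) j : admissible_code xi -> xi (j - 1) != xi j.
Proof. by move=> /(_ (j - 1)); rewrite subrK. Qed.

Section extremal_to_orbit.
Variables (xi : int -> 'I_m) (X : int -> plane).
Hypothesis xiA : admissible_code xi.
Hypothesis XE : extremal_seq xi X.

Lemma extremal_neq j : X j != X (j + 1).
Proof. exact: (tb_neq tb (xiA j) (XE j).1 (XE (j + 1)).1). Qed.

Lemma extremal_seq_reflection j : exists u, [/\ X j = param K (xi j) u a,
   dir (X j) (X (j + 1)) - dir (X (j - 1)) (X j) =
     enorm (dir (X j) (X (j + 1)) - dir (X (j - 1)) (X j)) *: n_ (xi j) u,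
   0 < enorm (dir (X j) (X (j + 1)) - dir (X (j - 1)) (X j)),
   dotp (dir (X j) (X (j + 1))) (n_ (xi j) u) =
      enorm (dir (X j) (X (j + 1)) - dir (X (j - 1)) (X j)) / 2
   & dotp (dir (X (j - 1)) (X j)) (n_ (xi j) u) =
      - (enorm (dir (X j) (X (j + 1)) - dir (X (j - 1)) (X j)) / 2)].
Proof.
apply: (extremal_reflection tb (admissible_pred j xiA) (xiA j)) (XE j).
  exact: (XE (j - 1)).1.
exact: (XE (j + 1)).1.
Qed.

Lemma extremal_phase j : phase_space K a (X j, dir (X j) (X (j + 1))).
Proof.
have [u [Xu _ l0 en _]] := extremal_seq_reflection j.
split=> /=; first exact/dir_norm/extremal_neq.
by exists (xi j), u; split=> //; rewrite en divr_ge0// ltW.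
Qed.

(** The open flight lies strictly outside the supporting lines at its two ends, hence misses both
    obstacles there; it misses every other one by the no-eclipse condition. *)
Lemma extremal_next j :
  next_reflection K a (X j, dir (X j) (X (j + 1))) (X (j + 1), dir (X (j + 1)) (X (j + 1 + 1))).
Proof.
split; [exact: extremal_phase|exact: extremal_phase|].
have nq := extremal_neq j; have p := enorm_sub_gt0 nq; have XX := dirE nq.
have [u [Xu _ l0 en _]] := extremal_seq_reflection j.
have [v [Xv Ev k0 _ em]] := extremal_seq_reflection (j + 1).
rewrite addrK in Ev k0 em.
set tau := enorm (X (j + 1) - X j) in p XX.
set e := dir (X j) (X (j + 1)) in XX en Ev k0 em *; set f := dir (X (j + 1)) _ in Ev k0 em *.
exists tau, (xi (j + 1)), v; split=> //=; last first.
  rewrite em (_ : 2 * _ = - enorm (f - e)); last by clr; lra.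
  by rewrite scaleNr -Ev opprK addrC subrK.
move=> t /andP[t0 ttau] [k _] kp.
have [kj|kj] := eqVneq k (xi j).
  have := normal_supporting_le tb (i := xi j) u (y := X j + t *: e).
  rewrite -kj => /(_ kp); rewrite kj -Xu addrAC subrr add0r dotpZr dotpC en leNgt => /negP; apply.
  exact: mulr_gt0 t0 (divr_gt0 l0 (ltr0Sn _ 1)).
have [kj'|kj'] := eqVneq k (xi (j + 1)).
  have := normal_supporting_le tb (i := xi (j + 1)) v (y := X j + t *: e).
  rewrite -kj' => /(_ kp); rewrite kj' -Xv {1}XX opprD addrACA subrr add0r -scalerBl dotpZr dotpC em leNgt => /negP; apply.
  by rewrite nmulr_lgt0 ?oppr_lt0 ?divr_gt0// subr_lt0.
apply: (eclipse_free tb (_ : xi j != k) (_ : k != xi (j + 1)) (XE j).1 (XE (j + 1)).1 (t := t / tau)) => //.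
- by rewrite eq_sym.
- by rewrite (divr_ge0 (ltW t0) (ltW p)) ler_pdivrMr// mul1r ltW.
- by rewrite {1}XX addrAC subrr add0r scalerA divfK ?lt0r_neq0.
Qed.

End extremal_to_orbit.

Lemma next_reflection_time (x v : plane) t tau i u : 0 < t -> 0 < tau ->
  (forall s, 0 < s < tau -> ~ (\bigcup_k obst k) (x + s *: v)) -> x + t *: v = param K i u a -> tau <= t.
Proof.
move=> t0 tau0 free xt; rewrite leNgt; apply/negP => lt.
by apply: (free t); [rewrite t0|exists i => //; rewrite xt; exact: tb_mem].
Qed.

Lemma param_index i j u v : param K i u a = param K j v a -> i = j.
Proof.
by move=> E; apply: (tb_index tb (x := param K i u a)); [exact: tb_mem|rewrite E; exact: tb_mem].
Qed.

Lemma param_normal i j u v : param K i u a = param K j v a -> n_ i u = n_ j v.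
Proof.
move=> E; have ij := param_index E; rewrite -ij in E *; exact: tb_normal.
Qed.

Lemma next_reflection_det x y y' : next_reflection K a x y -> next_reflection K a x y' -> y = y'.
Proof.
move=> [_ _ [t [i [u [t0 free y1 yu y2]]]]] [_ _ [t' [i' [u' [t'0 free' y1' yu' y2']]]]].
have tt : t = t'.
  apply/le_anti; rewrite (@next_reflection_time x.1 x.2 t' t i' u')//= -?y1'//.
  by rewrite (@next_reflection_time x.1 x.2 t t' i u)//= -?y1.
have yy : y.1 = y'.1 by rewrite y1 y1' tt.
have nn : n_ i u = n_ i' u' by apply: param_normal; rewrite -yu -yu'.
by rewrite (surjective_pairing y) (surjective_pairing y') yy y2 y2' nn.
Qed.

Lemma reflectK (v n : plane) : enorm n = 1 ->
  let w := v - (2 * dotp v n) *: n in v = w - (2 * dotp w n) *: n.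
Proof.
move=> n1 w; have -> : dotp w n = - dotp v n.
  rewrite /w dotpBl dotpZl dotp_enorm n1 expr1n; clr; lra.
by rewrite /w mulrN scaleNr opprK subrK.
Qed.

(** Reversibility. The reflection is an involution, so the incoming velocity can be recovered; of
    two backward flights the shorter one ends at an obstacle point that the longer one would have to
    cross. *)
Lemma next_reflection_inv_det x x' y : next_reflection K a x y -> next_reflection K a x' y -> x = x'.
Proof.
move=> [px _ [t [i [u [t0 free y1 yu y2]]]]] [px' _ [t' [i' [u' [t'0 free' y1' yu' y2']]]]].
have nn : n_ i u = n_ i' u' by apply: param_normal; rewrite -yu -yu'.
have vv : x.2 = x'.2.
  have := reflectK x.2 (normal_norm tb i u); rewrite /= -y2 => ->.
  have := reflectK x'.2 (normal_norm tb i' u'); rewrite /= -y2' => ->.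
  rewrite nn; reflexivity.
have [_ [k [w [xw _]]]] := px; have [_ [k' [w' [xw' _]]]] := px'.
have lem (z z' : state) s s' i1 u1 : 0 < s -> z.2 = z'.2 ->
    (forall r, 0 < r < s' -> ~ (\bigcup_k obst k) (z'.1 + r *: z'.2)) ->
    z.1 + s *: z.2 = z'.1 + s' *: z'.2 -> z.1 = param K i1 u1 a -> s' <= s.
  move=> s0 zz fr E zi; rewrite leNgt; apply/negP => lt.
  apply: (fr (s' - s)); first by rewrite subr_gt0 lt ltrBlDr ltrDl.
  exists i1; [exact: Logic.I|]; have -> : z'.1 + (s' - s) *: z'.2 = z.1.
    by rewrite scalerBl addrA -E -zz addrK.
  by rewrite zi; exact: tb_mem.
have E : x.1 + t *: x.2 = x'.1 + t' *: x'.2 by rewrite -y1 -y1'.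
have tt : t = t'.
  have l1 := lem x' x t' t k' w' t'0 (esym vv) free (esym E) xw'.
  have l2 := lem x x' t t' k w t0 vv free' E xw.
  by apply/le_anti/andP; split.
have xx : x.1 = x'.1 by move: E; rewrite tt vv => /addIr.
by rewrite (surjective_pairing x) (surjective_pairing x') xx vv.
Qed.

(** [billiard_map] and [billiard_map_inv] choose a successor and a predecessor; determinism in both
    directions leaves no choice along an orbit. *)
Lemma orbit_iter (o : int -> state) : (forall j, next_reflection K a (o j) (o (j + 1))) ->
  forall j, billiard_iter K a j (o 0) = o j.
Proof.
move=> oN; have nw j : nonwandering K a (o j).
  exists (fun k => o (j + k)); rewrite addr0; split=> // k.
  by rewrite addrA.
have nxt j : billiard_map K a (o j) = o (j + 1).
  rewrite /billiard_map; set S := (X in xget _ X).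
  have [_ h] : S (xget (o j) S) by apply: xgetPex; exists (o (j + 1)); split.
  exact: next_reflection_det h (oN j).
have prv j : billiard_map_inv K a (o j) = o (j - 1).
  rewrite /billiard_map_inv; set S := (X in xget _ X).
  have hN : next_reflection K a (o (j - 1)) (o j) by have := oN (j - 1); rewrite subrK.
  have [_ h] : S (xget (o j) S) by apply: xgetPex; exists (o (j - 1)); split.
  exact: next_reflection_inv_det h hN.
case=> n.
  by elim: n => [//|n IH]; rewrite /= in IH *; rewrite IH nxt -PoszD addn1.
rewrite /=; elim: n => [|n IH]; first by rewrite /= prv.
by rewrite iterS IH prv; congr o; rewrite !NegzE; rewrite -opprD -PoszD addn1.
Qed.

(** The jump of the velocity is a nonnegative multiple of the outer normal, and the obstacle lies
    behind the supporting line. *)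
Lemma orbit_extremal (o : int -> state) (xi : int -> 'I_m) :
  (forall j, next_reflection K a (o j) (o (j + 1))) ->
  (forall j, bdry (obst (xi j)) (o j).1) -> extremal_seq xi (fun j => (o j).1).
Proof.
move=> oN ob j.
have mem k : obst (xi k) (o k).1 by apply: bdry_closed_sub (ob k); exact: tb_compact.
split; first exact: mem.
have dirN k : dir (o k).1 (o (k + 1)).1 = (o k).2.
  have [[v1 _] _ [t [_ [_ [t0 _ -> _ _]]]]] := oN k; exact: dir_ray.
have dP : dir (o (j - 1)).1 (o j).1 = (o (j - 1)).2 by have := dirN (j - 1); rewrite subrK.
rewrite /= dirN dP => w jw.
have := oN (j - 1); rewrite subrK => -[_ [_ [i' [u' [xu' vn]]]] [t [i [u [_ _ _ xu vE]]]]].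
have ij : i = xi j by apply: (tb_index tb _ (mem j)); rewrite xu; exact: tb_mem.
have nn : n_ i u = n_ i' u' by apply: param_normal; rewrite -xu -xu'.
rewrite -nn in vn.
have vn' : dotp (o j).2 (n_ i u) = - dotp (o (j - 1)).2 (n_ i u).
  rewrite vE dotpBl dotpZl dotp_enorm (normal_norm tb) expr1n; clr; lra.
have -> : (o j).2 - (o (j - 1)).2 = (2 * dotp (o j).2 (n_ i u)) *: n_ i u.
  by rewrite vn' {1}vE addrAC subrr add0r mulrN scaleNr.
have vn2 : 0 <= 2 * dotp (o j).2 (n_ i u) by exact: mulr_ge0 (ler0n _ 2) vn.
rewrite dotpZl; apply: mulr_ge0_le0 vn2 _; rewrite xu; apply: (normal_supporting_le tb); rewrite ij.
exact: jw.
Qed.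

(** The chosen [coded_state] carries some orbit with code [xi]; its positions form an extremal
    sequence, and uniqueness identifies them. *)
Lemma coded_point_extremal (xi : int -> 'I_m) (X : int -> plane) : admissible_code xi ->
  extremal_seq xi X -> (forall Y, extremal_seq xi Y -> Y =1 X) ->
  forall j, coded_point K xi j a = X j.
Proof.
move=> xiA XE uniq j; rewrite /coded_point /coded_state; set S := (Z in xget _ Z).
pose o k := (X k, dir (X k) (X (k + 1))).
have oN k : next_reflection K a (o k) (o (k + 1)) by exact: extremal_next.
have So : S (o 0).
  split; first by exists o.
  move=> k; rewrite orbit_iter//=; have [u [-> _ _ _ _]] := extremal_seq_reflection xiA XE k.
  exact: tb_bdry.
have [[p [<- pN]] hb] : S (xget (0, 0) S) by apply: xgetPex; exists (o 0).
rewrite orbit_iter//; apply: (uniq (fun k => (p k).1)); apply: orbit_extremal => // k.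
by rewrite -(orbit_iter pN).
Qed.

End orbits.

(** * Existence of extremal sequences *)

Section existence.
Variables (R : realType) (m : nat) (K : billiard_family R m) (a : R).
Local Notation plane := 'rV[R]_2.
Local Notation obst i := (obst K i a).
Hypothesis tb : table K a.
Variable xi : int -> 'I_m.
Hypothesis xiA : admissible_code xi.

(** The square root lies below its tangent: with [P] and [S] the norms of [p] and [p + v], this is
    [2 * P * S <= P ^+ 2 + S ^+ 2]. *)
Lemma enorm_quad (p v : plane) : p != 0 ->
  enorm (p + v) <= enorm p + (enorm p)^-1 * dotp p v + enorm v ^+ 2 / (2 * enorm p).
Proof.
rewrite -enorm_gt0 => p0; set P := enorm p in p0 *.
have -> : P + P^-1 * dotp p v + enorm v ^+ 2 / (2 * P) = (enorm (p + v) ^+ 2 + P ^+ 2) / (2 * P).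
  rewrite -(dotp_enorm (p + v)) dotpDl !dotpDr (dotpC v p) !dotp_enorm -/P.
  by field; exact: lt0r_neq0.
rewrite ler_pdivlMr ?mulr_gt0//; have := sqr_ge0 (enorm (p + v) - P).
by clr; nra.
Qed.

Let T := prod_topology (fun _ : int => plane).
Let A : set T := [set f | forall j, obst (xi j) (f j)].

Let compactA : compact A.
Proof.
apply: (@tychonoff int (fun _ => plane) (fun j => obst (xi j))) => j; exact: (tb_compact tb).
Qed.

Let cont_coord (j : int) (c : 'I_2) : continuous (fun g : T => g j 0 c).
Proof.
move=> g; apply: (@cvg_comp _ _ _ (fun g : T => g j) (fun x : plane => x 0 c)).
  exact: (@proj_continuous _ (fun _ : int => plane) j g).
exact: coord_continuous.
Qed.

Let cont_dist (j k : int) : continuous (fun g : T => enorm (g j - g k)).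
Proof.
pose sq (g : T) (c : 'I_2) := (g j 0 c - g k 0 c) * (g j 0 c - g k 0 c).
have cd c : continuous (fun g : T => g j 0 c - g k 0 c).
  by move=> g; exact: (cvgB (@cont_coord j c g) (@cont_coord k c g)).
have csq c : continuous (sq ^~ c) by move=> g; exact: (cvgM (@cd c g) (@cd c g)).
have cs : continuous (fun g : T => sq g 0 + sq g 1) by move=> g; exact: (cvgD (@csq 0 g) (@csq 1 g)).
have -> : (fun g : T => enorm (g j - g k)) = Num.sqrt \o (fun g => sq g 0 + sq g 1).
  by apply/funext => g; rewrite /enorm dotpE !mxE.
move=> g; exact: (@continuous_comp _ _ _ _ (Num.sqrt : R -> R) g (@cs g) (@sqrt_continuous R _)).
Qed.

Let cont_dot (i j k : int) (w : plane) : continuous (fun g : T => dotp (g i - g j) (w - g k)).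
Proof.
pose p (g : T) (c : 'I_2) := (g i 0 c - g j 0 c) * (w 0 c - g k 0 c).
have cp c : continuous (p ^~ c).
  have ch : continuous (fun g : T => w 0 c - g k 0 c).
    by move=> g; exact: (cvgB (cvg_cst (w 0 c)) (@cont_coord k c g)).
  by move=> g; exact: (cvgM (cvgB (@cont_coord i c g) (@cont_coord j c g)) (@ch g)).
have -> : (fun g : T => dotp (g i - g j) (w - g k)) = (fun g => p g 0 + p g 1).
  by apply/funext => g; rewrite dotpE !mxE.
by move=> g; exact: (cvgD (@cp 0 g) (@cp 1 g)).
Qed.

(** The shift makes [len_ n] the length of the broken line through the vertices of index [- n] to
    [n]. *)
Let idx (n i : nat) : int := i%:Z - n%:Z.
Let len_ n (g : T) : R := \sum_(i < n.*2) enorm (g (idx n i + 1) - g (idx n i)).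

Let cont_len n : continuous (len_ n).
Proof.
pose G (r : seq 'I_(n.*2)) (g : T) : R := \sum_(i <- r) enorm (g (idx n i + 1) - g (idx n i)).
suff h r : continuous (G r) by exact: (h (index_enum _)).
elim: r => [|i r IH].
  have -> : G [::] = cst 0 by apply/funext => g; rewrite /G big_nil.
  exact: cst_continuous.
have -> : G (i :: r) = (fun g => enorm (g (idx n i + 1) - g (idx n i)) + G r g).
  by apply/funext => g; rewrite /G big_cons.
by move=> g; exact: (cvgD (@cont_dist _ _ g) (@IH g)).
Qed.

Let minimizer n : exists2 f, A f & forall g, A g -> len_ n f <= len_ n g.
Proof.
have A0 : A !=set0.
  by exists (fun j => param K (xi j) 0 a) => j; exact: tb_mem.
have [f Af fmin] := compact_EVT_min A0 compactA (continuous_subspaceT (@cont_len n)).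
by exists f; [exact: set_mem|move=> g Ag; apply: fmin; exact: mem_set].
Qed.

(** Moving one vertex a fraction [t] of the way to [w] changes two edges only. Their second-order
    bounds leave an error [t * C] after division by [t], and it vanishes with [t]. *)
Lemma minimizer_extremal n f p : A f -> (forall g, A g -> len_ n f <= len_ n g) -> (p.+1 < n.*2)%N ->
  extremal_at K a (xi (idx n p.+1)) (f (idx n p.+1 - 1)) (f (idx n p.+1)) (f (idx n p.+1 + 1)).
Proof.
move=> Af fmin pn; set j := idx n p.+1; split=> // w jw.
have jp : idx n p = j - 1 by rewrite /j /idx -addn1 PoszD; ring.
have xy : f (j - 1) != f j.
  exact: (tb_neq tb (admissible_pred j xiA) (Af (j - 1)) (Af j)).
have yz : f j != f (j + 1) by exact: (tb_neq tb (xiA j) (Af j) (Af (j + 1))).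
set h := w - f j.
pose P := enorm (f j - f (j - 1)); pose Q := enorm (f (j + 1) - f j).
have P0 : 0 < P by exact: enorm_sub_gt0.
have Q0 : 0 < Q by exact: enorm_sub_gt0.
pose C := enorm h ^+ 2 / (2 * P) + enorm h ^+ 2 / (2 * Q).
have key t : 0 < t <= 1 -> dotp (dir (f j) (f (j + 1)) - dir (f (j - 1)) (f j)) h <= t * C.
  move=> /andP[t0 t1].
  pose g : T := fun k => if k == j then f j + t *: h else f k.
  have Ag : A g.
    move=> k; rewrite /g; case: eqP => [->|_]; last exact: Af.
    by apply: between_in_hull => //; [exact: tb_convex|rewrite (ltW t0)].
  have := fmin g Ag; rewrite -subr_ge0 /len_ -sumrB.
  have pn' : (p < n.*2)%N by exact: ltnW.
  rewrite (bigD1 (Ordinal pn')) //= (bigD1 (Ordinal pn)) /=; last by rewrite -val_eqE /= gtn_eqF.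
  rewrite big1 ?addr0; last first.
    move=> i /andP[ip ip1]; rewrite /g.
    have -> : (idx n i == j) = false.
      by apply: contraNF ip1 => /eqP; rewrite /j /idx => /addIr [E]; apply/eqP/val_inj.
    have -> : (idx n i + 1 == j) = false.
      apply: contraNF ip; rewrite -(can_eq (addrK (- 1))) addrK -jp /idx => /eqP /addIr [E].
      exact/eqP/val_inj.
    by rewrite subrr.
  rewrite jp subrK -/j /g eqxx.
  have -> : (j - 1 == j) = false by apply/negbTE; rewrite -subr_eq0 addrAC subrr add0r.
  have -> : (j + 1 == j) = false by apply/negbTE; rewrite -subr_eq0 addrAC subrr add0r.
  have E1 : f j + t *: h - f (j - 1) = (f j - f (j - 1)) + t *: h by rewrite addrAC.
  have E2 : f (j + 1) - (f j + t *: h) = (f (j + 1) - f j) + (- t) *: h by rewrite opprD addrA scaleNr.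
  have nxy : f j - f (j - 1) != 0 by rewrite subr_eq0 eq_sym.
  have nyz : f (j + 1) - f j != 0 by rewrite subr_eq0 eq_sym.
  have q1 := enorm_quad (t *: h) nxy; have q2 := enorm_quad ((- t) *: h) nyz.
  rewrite E1 E2; rewrite -/P -/Q dotpZr enormZ in q1 *; rewrite -/Q dotpZr enormZ normrN in q2.
  rewrite (gtr0_norm t0) in q1 q2 => L.
  rewrite dotpBl /dir !dotpZl -/P -/Q -(ler_pM2l t0).
  have tC : t * (t * C) = (t * enorm h) ^+ 2 / (2 * P) + (t * enorm h) ^+ 2 / (2 * Q).
    by rewrite /C; field; rewrite !lt0r_neq0.
  by rewrite tC; move: q1 q2 L; clr; lra.
have C0 : 0 <= C by rewrite addr_ge0// divr_ge0 ?sqr_ge0// mulr_ge0// ltW.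
apply/ler_addgt0Pr => e e0; rewrite add0r.
have t0 : 0 < Num.min 1 (e / (1 + C)) by rewrite lt_min ltr01 divr_gt0// ltr_pwDl.
have [t1 t2] : Num.min 1 (e / (1 + C)) <= 1 /\ Num.min 1 (e / (1 + C)) <= e / (1 + C).
  by rewrite !ge_min !lexx orbT.
apply: (le_trans (key (Num.min 1 (e / (1 + C))) _)); first by rewrite t0 t1.
apply: (@le_trans _ _ (e / (1 + C) * C)); first by rewrite ler_wpM2r.
by rewrite mulrAC ler_pdivrMr ?ltr_pwDl// ler_pM2l// lerDr.
Qed.

Lemma extremal_exists : exists X, extremal_seq K a xi X.
Proof.
have [f hf] := choice (fun n => let: ex_intro2 g Ag mg := minimizer n in
   ex_intro (fun g => A g /\ forall g', A g' -> len_ n g <= len_ n g') g (conj Ag mg)).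
have FA : (f @ \oo) A by exists 0%N => // n _; exact: (hf n).1.
have [X [AX clX]] := compactA _ FA.
exists X => j; split; first exact: AX.
move=> w jw.
have xy : X (j - 1) != X j by exact: (tb_neq tb (admissible_pred j xiA) (AX (j - 1)) (AX j)).
have yz : X j != X (j + 1) by exact: (tb_neq tb (xiA j) (AX j) (AX (j + 1))).
(* The variational expression times both edge lengths: unlike the directions, it is continuous on
   the whole product, so its sign passes from the minimizers to the cluster point. *)
pose q (g : T) := enorm (g j - g (j - 1)) * dotp (g (j + 1) - g j) (w - g j)
   - enorm (g (j + 1) - g j) * dotp (g j - g (j - 1)) (w - g j).
have qE (g : T) : A g -> q g = enorm (g j - g (j - 1)) * enorm (g (j + 1) - g j) *
   dotp (dir (g j) (g (j + 1)) - dir (g (j - 1)) (g j)) (w - g j).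
  move=> Ag; have p1 : 0 < enorm (g j - g (j - 1)) by apply: enorm_sub_gt0; exact: (tb_neq tb (admissible_pred j xiA) (Ag (j - 1)) (Ag j)).
  have p2 : 0 < enorm (g (j + 1) - g j) by apply: enorm_sub_gt0; exact: (tb_neq tb (xiA j) (Ag j) (Ag (j + 1))).
  rewrite /q [in RHS]dotpBl /dir !dotpZl; field; by rewrite !lt0r_neq0.
have cq : continuous q.
  move=> g; exact: (cvgB (cvgM (@cont_dist j (j - 1) g) (@cont_dot (j + 1) j j w g))
    (cvgM (@cont_dist (j + 1) j g) (@cont_dot j (j - 1) j w g))).
rewrite leNgt; apply/negP => pos.
have qX : 0 < q X by rewrite qE// !mulr_gt0 ?enorm_sub_gt0.
have nq : nbhs X [set g | 0 < q g].
  have /cvgrPdist_lt/(_ _ qX) := cq X; apply: filterS => g /=; rewrite ltr_norml; lra.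
have FN : (f @ \oo) [set g | q g <= 0].
  exists (`|j|.+1) => // n /= jn; have [Afn fmin] := hf n.
  rewrite qE// pmulr_rle0 ?mulr_gt0 ?enorm_sub_gt0//; last 2 first.
  - exact: (tb_neq tb (admissible_pred j xiA) (Afn (j - 1)) (Afn j)).
  - exact: (tb_neq tb (xiA j) (Afn j) (Afn (j + 1))).
  have [p [pn jE]] : exists p, (p.+1 < n.*2)%N /\ j = idx n p.+1.
    have jn' : (`|j| < n%:Z)%R by rewrite -abszE ltz_nat.
    have : (0 < j + n%:Z)%R by move: jn'; rewrite ltr_norml; lia.
    case E : (j + n%:Z) => [[|p]|p]//= _; exists p; split; last by rewrite /idx -E addrK.
    have : (j + n%:Z < n.*2%:Z)%R by rewrite -addnn PoszD; move: jn'; rewrite ltr_norml; lia.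
    by rewrite E ltz_nat.
  have [_ h] := minimizer_extremal Afn fmin pn.
  by rewrite jE in jw *; exact: h.
have [g [/= g1 g2]] := clX _ _ FN nq.
by rewrite ltNge g1 in g2.
Qed.

End existence.

(** * Dependence of orbits on the code and on the parameter *)

Section continuity_at_a_point.
Variables (R : realType) (X : topologicalType) (p : X).
Local Notation plane := 'rV[R]_2.

Definition plane_cont (F : X -> plane) := forall c, {for p, continuous (fun x => F x 0 c)}.

Lemma plane_contB F G : plane_cont F -> plane_cont G -> plane_cont (fun x => F x - G x).
Proof.
move=> hF hG c; have -> : (fun x => (F x - G x) 0 c) = (fun x => F x 0 c - G x 0 c).
  by apply/funext => x; rewrite !mxE.
exact: (cvgB (hF c) (hG c)).
Qed.

Lemma plane_contZ (f : X -> R) F : {for p, continuous f} -> plane_cont F -> plane_cont (fun x => f x *: F x).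
Proof.
move=> hf hF c; have -> : (fun x => (f x *: F x) 0 c) = (fun x => f x * F x 0 c).
  by apply/funext => x; rewrite !mxE.
exact: (cvgM hf (hF c)).
Qed.

Lemma cont_dotp F G : plane_cont F -> plane_cont G -> {for p, continuous (fun x => dotp (F x) (G x))}.
Proof.
move=> hF hG; have -> : (fun x => dotp (F x) (G x)) = (fun x => F x 0 0 * G x 0 0 + F x 0 1 * G x 0 1).
  by apply/funext => x; rewrite dotpE.
exact: (cvgD (cvgM (hF 0) (hG 0)) (cvgM (hF 1) (hG 1))).
Qed.

Lemma cont_enorm F : plane_cont F -> {for p, continuous (fun x => enorm (F x))}.
Proof.
move=> hF; exact: (@continuous_comp _ _ _ _ (Num.sqrt : R -> R) p (cont_dotp hF hF) (@sqrt_continuous R _)).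
Qed.

Lemma plane_cont_dir F G : F p != G p -> plane_cont F -> plane_cont G ->
  plane_cont (fun x => dir (F x) (G x)).
Proof.
move=> FG hF hG; have h := plane_contB hG hF; apply: plane_contZ => //.
apply: cvgV; last exact: cont_enorm h.
by apply: lt0r_neq0; exact: enorm_sub_gt0.
Qed.

Lemma cont_opp (f : X -> R) : {for p, continuous f} -> {for p, continuous (fun x => - f x)}.
Proof. by move=> h; exact: cvgN h. Qed.

Lemma cont_gt (f : X -> R) (c : R) : {for p, continuous f} -> c < f p -> \forall x \near p, c < f x.
Proof.
move=> h cf; have e0 : 0 < f p - c by rewrite subr_gt0.
have /cvgrPdist_lt/(_ _ e0) := h; apply: filterS => x; rewrite ltr_norml; lra.
Qed.

End continuity_at_a_point.

(** * Uniform strict convexity at reflections *)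

Section compactness_of_reflections.
Variables (R : realType) (m : nat) (K : billiard_family R m) (a : R).
Local Notation plane := 'rV[R]_2.
Local Notation obst i := (obst K i a).
Hypothesis tb : table K a.

(** Each such value is positive because the obstacle touches its supporting line only at [y]. The
    uniform bound is compactness of the set of quadruples [(x, y, z, w)], on which extremality and
    [rho <= enorm (w - y)] are closed conditions. *)
Lemma extremal_gap (rho : R) : 0 < rho -> exists2 mu : R, 0 < mu &
  forall i j k x y z w, i != j -> j != k -> obst i x -> obst k z -> extremal_at K a j x y z ->
  obst j w -> rho <= enorm (w - y) -> mu <= - dotp (dir y z - dir x y) (w - y).
Proof.
move=> rho0.
pose P (t : 'I_m * 'I_m * 'I_m) (mu : R) := forall x y z w, t.1.1 != t.1.2 -> t.1.2 != t.2 ->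
  obst t.1.1 x -> obst t.2 z -> extremal_at K a t.1.2 x y z ->
  obst t.1.2 w -> rho <= enorm (w - y) -> mu <= - dotp (dir y z - dir x y) (w - y).
suff [mu mu0 h] : exists2 mu : R, 0 < mu & forall t, P t mu.
  by exists mu => // i j k x y z w; exact: (h (i, j, k)).
apply: finite_uniform => [t d d' /andP[_ dd] h x y z w *|[[i j] k]].
  by apply: (le_trans dd); apply: h.
case: (boolP (i != j)) => ij; last by exists 1 => // x y z w; rewrite /= (negbTE ij).
case: (boolP (j != k)) => jk; last by exists 1 => // x y z w; rewrite /= (negbTE jk).
pose U := ((plane * plane) * (plane * plane))%type.
pose X (u : U) := u.1.1; pose Y (u : U) := u.1.2; pose Z (u : U) := u.2.1; pose W (u : U) := u.2.2.
pose A : set U := ((obst i) `*` (obst j)) `*` ((obst k) `*` (obst j)).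
have cA : compact A by do 2?apply: compact_setX; apply: (tb_compact tb).
pose H (u : U) w := - dotp (dir (Y u) (Z u) - dir (X u) (Y u)) (w - Y u).
pose Q (u : U) d := (forall w, obst j w -> 0 <= H u w) -> rho <= enorm (W u - Y u) -> d <= H u (W u).
have [|d0 d00 hd] := @compact_uniform R _ A Q cA; last first.
  have d2 : 0 < d0 / 2 by rewrite divr_gt0.
  exists (d0 / 2) => // x y z w _ _ ix kz [jy ext] jw; apply: (hd _ _ ((x, y), (z, w))) => //.
    by rewrite d2/=; lra.
  by move=> w' jw'; rewrite /H/= oppr_ge0; exact: ext.
move=> u [[/= ix jy] [/= kz jw]].
have xy : X u != Y u := tb_neq tb ij ix jy.
have yz : Y u != Z u := tb_neq tb jk jy kz.
have cX : plane_cont u X.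
  by move=> c; apply: continuous_comp (@coord_continuous _ _ _ 0 c _); apply: (continuous_comp (@cvg_fst _ _ _ _ _)); exact: cvg_fst.
have cY : plane_cont u Y.
  by move=> c; apply: continuous_comp (@coord_continuous _ _ _ 0 c _); apply: (continuous_comp (@cvg_fst _ _ _ _ _)); exact: cvg_snd.
have cZ : plane_cont u Z.
  by move=> c; apply: continuous_comp (@coord_continuous _ _ _ 0 c _); apply: (continuous_comp (@cvg_snd _ _ _ _ _)); exact: cvg_fst.
have cW : plane_cont u W.
  by move=> c; apply: continuous_comp (@coord_continuous _ _ _ 0 c _); apply: (continuous_comp (@cvg_snd _ _ _ _ _)); exact: cvg_snd.
have cH G : plane_cont u G -> {for u, continuous (fun v => H v (G v))}.
  move=> cG; exact: (cont_opp (cont_dotp (plane_contB (plane_cont_dir yz cY cZ) (plane_cont_dir xy cX cY)) (plane_contB cG cY))).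
(* Where one of the two closed conditions fails it also fails nearby, and nothing has to be bounded;
   elsewhere half of the positive value at [u] is a bound nearby. *)
have [[w [jw' Hw]]|noW] := pselect (exists w, obst j w /\ H u w < 0).
  exists 1 => //; have cw : {for u, continuous (fun v => - H v w)}.
    by apply/cont_opp/(cH (fun=> w)) => c; exact: cvg_cst.
  have : 0 < - H u w by rewrite oppr_gt0.
  move=> /(cont_gt cw); apply: filterS => v Hv d _ /(_ w jw'); rewrite leNgt -oppr_gt0 Hv//.
have [lt|ge] := ltP (enorm (W u - Y u)) rho.
  exists 1 => //; have cw : {for u, continuous (fun v => - enorm (W v - Y v))}.
    exact: (cont_opp (cont_enorm (plane_contB cW cY))).
  have : - rho < - enorm (W u - Y u) by rewrite ltrN2.
  by move=> /(cont_gt cw); apply: filterS => v; rewrite ltrN2 => Hv d _ _; rewrite leNgt Hv.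
have ext : extremal_at K a j (X u) (Y u) (Z u).
  split=> // w jw'; rewrite leNgt; apply/negP => pos; apply: noW; exists w; split=> //.
  by rewrite /H oppr_lt0.
have pos : 0 < H u (W u).
  have [v [yE nE n0 _ _]] := extremal_reflection tb ij jk ix kz ext.
  rewrite /H nE dotpZl -mulrN pmulr_rgt0// oppr_gt0 yE; apply: normal_supporting => //.
  by rewrite -yE -subr_eq0 -enorm_gt0 (lt_le_trans rho0).
exists (H u (W u) / 2); first by rewrite divr_gt0.
have hlt : H u (W u) / 2 < H u (W u) by lra.
have := cont_gt (cH _ cW) hlt.
by apply: filterS => v hv d /andP[_ /ltW dd] _ _; apply: le_trans dd (ltW hv).
Qed.

End compactness_of_reflections.

(** * Uniqueness of orbits and uniform dependence on code and parameter *)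

Section closeness.
Variables (R : realType) (m : nat) (al ar : \bar R).
Hypothesis hI : (al < ar)%E.
Variable I : set R.
Hypothesis defI : I = [set a : R | (al <= a%:E)%E /\ (a%:E <= ar)%E].
Variables (r r' : nat).
Hypothesis hr : (2 <= r)%N.
Hypothesis hr' : (2 <= r')%N.
Variable K : billiard_family R m.
Hypothesis hK : billiard_deformation K r r' I.
Local Notation plane := 'rV[R]_2.

Lemma deformation_table a : I a -> table K a.
Proof.
move=> Ia; split.
- by move=> i j; exact: (obst_disjoint hK).
- by move=> i; exact: (obst_compact hK).
- by move=> i; exact: (obst_strictly_convex hK i Ia).1.
- exact: (obst_no_eclipse hK).
- by move=> i u; exact: (param_bdry hK).
- by move=> i x; exact: (param_surj hK).
- by move=> i u y; exact: (param_supporting hr hK).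
- by move=> i u; exact: (tangent_norm hK).
- move=> i u c; rewrite tangentE; have r0 : (0 < r)%N by exact: ltnW.
  exact: (param_has_deriv hK i u c r0 Ia).
- move=> i x; have l0 := len_gt0 hK i Ia.
  have [E|ne] := eqVneq (param K i 0 a) x; last by exists (param K i 0 a) => //; exact: (param_mem hK).
  exists (param K i (len K i a / 2) a); first exact: (param_mem hK).
  apply/eqP => E'; rewrite -E in E'; have : len K i a / 2 = 0.
    by apply: (param_inj hK Ia _ _ E'); rewrite ?lexx ?l0// divr_ge0 ?(ltW l0)//= ltr_pdivrMr//; lra.
  lra.
- move=> i u v /(param_inj_mod hK Ia)[n ->]; rewrite /outer_normal !tangentE.
  rewrite (periodic_int (l := len K i a)) => [//|w]; apply: derive1n_periodic => z; exact: (param_periodic hK).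
Qed.

Definition boundary_pt (i : 'I_m) (s a : R) : plane := param K i (s * len K i a) a.

Lemma unit_param0 i s a c : unit_param K 0 c i s a = boundary_pt i s a 0 c.
Proof. by rewrite /unit_param expr0 mul1r. Qed.

Lemma pt_param i u a : I a -> param K i u a = boundary_pt i (u / len K i a) a.
Proof. by move=> /(len_gt0 hK i) l0; rewrite /boundary_pt divfK// lt0r_neq0. Qed.

Lemma pt_near a0 (e : R) : I a0 -> 0 < e -> exists2 d : R, 0 < d & forall i s a, I a -> `|a - a0| < d ->
  enorm (boundary_pt i s a - boundary_pt i s a0) <= e.
Proof.
move=> Ia0 e0; have e2 : 0 < e / 2 by rewrite divr_gt0.
have h c := smooth_equicont (unit_param_smooth hI defI hr hr' hK (k := 0) (n := 0) c (leq0n _)) Ia0 e2.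
have [d d0 hd] := @filterI _ _ (fibre_near_filter _ _) _ _ (h 0) (h 1).
exists d => // i s a Ia ad; apply: (le_trans (enorm_le_coord _)); rewrite (_ : e = e / 2 + e / 2); last lra.
have [] := hd i s a0 s a Ia0 Ia; rewrite ?subrr ?normr0// /at_new/at_old/= !unit_param0 => h0 h1.
by rewrite !mxE; apply: lerD.
Qed.

Lemma pt_bounded a0 : I a0 -> exists2 M : R, 0 < M & forall i s, enorm (boundary_pt i s a0) <= M.
Proof.
move=> Ia0.
have h c := smooth_bounded (unit_param_smooth hI defI hr hr' hK (k := 0) (n := 0) c (leq0n _)) Ia0.
have [M0 p0 [d0 d00 h0]] := h 0; have [M1 p1 [d1 d10 h1]] := h 1.
exists (M0 + M1) => [|i s]; first by rewrite addr_gt0.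
apply: (le_trans (enorm_le_coord _)); rewrite -!unit_param0; apply: lerD.
  by apply: (h0 i s a0 s a0); rewrite ?subrr ?normr0//=.
by apply: (h1 i s a0 s a0); rewrite ?subrr ?normr0//=.
Qed.

Lemma extremal_pt a xi X j : I a -> admissible_code xi -> extremal_seq K a xi X ->
  exists s, X j = boundary_pt (xi j) s a.
Proof.
move=> Ia xiA XE; have [u [-> _ _ _ _]] := extremal_seq_reflection (deformation_table Ia) xiA XE j.
by rewrite pt_param//; eexists.
Qed.

Lemma dotp_le (x y : plane) (c d : R) : enorm x <= c -> enorm y <= d -> `|dotp x y| <= c * d.
Proof.
by move=> h1 h2; apply: (le_trans (cauchy_schwarz _ _)); apply: ler_pM => //; exact: enorm_ge0.
Qed.

(* Almost increasing in [j], with increments bounded from below where [X j] and [Y j] are apart. *)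
Definition defect (X Y : int -> plane) (j : int) : R :=
  dotp (dir (X j) (X (j + 1)) - dir (Y j) (Y (j + 1))) (X j - Y j).

Lemma dir_sub_norm (x y z t : plane) : x != y -> z != t -> enorm (dir x y - dir z t) <= 2.
Proof.
by move=> xy zt; apply: (le_trans (enormD _ _)); rewrite enormN !dir_norm.
Qed.

(** Monotonicity of the direction along the edge before [j] reduces the increment to two variational
    inequalities, that of [X] tested at [Y j] and that of [Y] tested at [X j]; the second
    contributes [mu]. The two points lie on obstacles at different parameters, so each is first
    replaced by a companion at distance at most [w]. Direction jumps have norm at most 2, whence the
    loss [4 * w]. *)
Lemma defect_increment a0 a (w mu rho : R) xi eta X Y j : I a0 -> I a ->
  (forall i s, enorm (boundary_pt i s a - boundary_pt i s a0) <= w) ->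
  admissible_code xi -> admissible_code eta -> extremal_seq K a xi X -> extremal_seq K a0 eta Y ->
  (forall i j k x y z w, i != j -> j != k -> obst K i a0 x -> obst K k a0 z -> extremal_at K a0 j x y z ->
    obst K j a0 w -> rho <= enorm (w - y) -> mu <= - dotp (dir y z - dir x y) (w - y)) ->
  xi j = eta j -> rho + w <= enorm (X j - Y j) ->
  defect X Y (j - 1) + mu - 4 * w <= defect X Y j.
Proof.
move=> Ia0 Ia w_pt xiA etaA XE YE gap E far.
have [x [ox Xx]] : exists x, obst K (eta j) a0 x /\ enorm (X j - x) <= w.
  have [s ->] := extremal_pt j Ia xiA XE; rewrite -E.
  by exists (boundary_pt (xi j) s a0); split; [exact: (param_mem hK)|exact: w_pt].
have [y [oy Yy]] : exists y, obst K (xi j) a y /\ enorm (Y j - y) <= w.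
  have [s ->] := extremal_pt j Ia0 etaA YE; rewrite -E.
  by exists (boundary_pt (xi j) s a); split; [exact: (param_mem hK)|rewrite enorm_distC; exact: w_pt].
have XX k := extremal_neq (deformation_table Ia) xiA XE k.
have YY k := extremal_neq (deformation_table Ia0) etaA YE k.
have XX' : X (j - 1) != X j by have := XX (j - 1); rewrite subrK.
have YY' : Y (j - 1) != Y j by have := YY (j - 1); rewrite subrK.
have nX := dir_sub_norm (XX j) XX'; have nY := dir_sub_norm (YY j) YY'.
have mono : 0 <= dotp (dir (X (j - 1)) (X j) - dir (Y (j - 1)) (Y j)) ((X j - X (j - 1)) - (Y j - Y (j - 1))).
  exact: dir_monotone.
have far' : rho <= enorm (x - Y j).
  have := enormD (X j - x) (x - Y j); rewrite addrA subrK; move: far Xx; clr; lra.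
have g := gap _ _ _ _ _ _ _ (admissible_pred j etaA) (etaA j) (YE (j - 1)).1 (YE (j + 1)).1 (YE j) ox far'.
have e1 := (XE j).2 _ oy.
have e2 := dotp_le nX Yy; have e3 := dotp_le nY Xx.
rewrite /defect subrK.
move: mono g e1 e2 e3; rewrite !ler_norml.
set p := dir (X j) _; set q := dir (X _) (X j); set p' := dir (Y j) _; set q' := dir (Y _) (Y j).
have -> : x - Y j = (X j - Y j) - (X j - x) by apply: planeP; rewrite !mxE; ring.
have -> : y - X j = - (X j - Y j) - (Y j - y) by apply: planeP; rewrite !mxE; ring.
have -> : X j - X (j - 1) - (Y j - Y (j - 1)) = (X j - Y j) - (X (j - 1) - Y (j - 1)).
  by apply: planeP; rewrite !mxE; ring.
set z := X j - Y j; set z' := X (j - 1) - _; set b := X j - x; set b' := Y j - y.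
clearbody p q p' q' z z' b b'.
rewrite !dotpBl !dotpBr !dotpNr; clr; lra.
Qed.

(** A gap at index 0 raises the defect by at least [2 * b], so it is at least [b] at 0 or at most
    [- b] at -1. In the first case a large defect at [k] forces a gap at [k + 1], hence a further
    increase by [mu' / 2], and so on forwards; in the second case the same happens backwards. The
    defect is at most [2 * D] in absolute value, so the codes cannot agree for longer than a number
    of steps that depends on [a0] and [e] only. *)
Lemma extremal_close a0 (e : R) : I a0 -> 0 < e -> exists2 d : R, 0 < d & exists n : nat,
  forall a xi eta X Y, I a -> `|a - a0| < d -> admissible_code xi -> admissible_code eta ->
    (forall j : int, (`|j| <= n)%N -> xi j = eta j) ->
    extremal_seq K a xi X -> extremal_seq K a0 eta Y -> enorm (X 0 - Y 0) < e.
Proof.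
move=> Ia0 e0; have tb0 := deformation_table Ia0.
have [M M0 hM] := pt_bounded Ia0.
have e2 : 0 < e / 2 by rewrite divr_gt0.
have [mu mu0 gap] := extremal_gap tb0 e2.
pose b := mu / 4; have b0 : 0 < b by rewrite divr_gt0.
have b4 : 0 < b / 4 by rewrite divr_gt0.
have [mu' mu'0 gap'] := extremal_gap tb0 b4.
pose w := Num.min (Num.min (e / 4) (b / 4)) (Num.min (mu / 8) (mu' / 8)).
have w0 : 0 < w by rewrite !lt_min !divr_gt0.
have [[w1 w2] [w3 w4]] : (w <= e / 4 /\ w <= b / 4) /\ (w <= mu / 8 /\ w <= mu' / 8).
  by rewrite /w !ge_min !lexx !orbT.
have [d d0 hd] := pt_near Ia0 w0.
pose D := 2 * M + w; have D0 : 0 < D by rewrite addr_gt0// mulr_gt0.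
have mu2 : 0 < mu' / 2 by rewrite divr_gt0.
have [n hn] : exists n : nat, 2 * D < n%:R * (mu' / 2).
  exists (Num.trunc (2 * D / (mu' / 2))).+1; rewrite -ltr_pdivrMr//; exact: truncnS_gt.
exists d => //; exists n.+1 => a xi eta X Y Ia ad xiA etaA agree XE YE.
have w_pt i s := hd i s a Ia ad.
have inc j : xi j = eta j -> b / 4 + w <= enorm (X j - Y j) -> defect X Y (j - 1) + mu' / 2 <= defect X Y j.
  move=> E far; have := defect_increment Ia0 Ia w_pt xiA etaA XE YE gap' E far.
  by move: w4; clr; lra.
have XX k := extremal_neq (deformation_table Ia) xiA XE k.
have YY k := extremal_neq tb0 etaA YE k.
have leD j : xi j = eta j -> enorm (X j - Y j) <= D.
  move=> E; have [s Xs] := extremal_pt j Ia xiA XE; have [t Yt] := extremal_pt j Ia0 etaA YE.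
  rewrite (_ : X j - Y j = (X j - boundary_pt (xi j) s a0) + (boundary_pt (xi j) s a0 - Y j)); last by rewrite addrA subrK.
  apply: (le_trans (enormD _ _)); rewrite Xs Yt /D addrC lerD//.
  by apply: (le_trans (enormD _ _)); rewrite enormN mulr_natl mulr2n lerD.
have lb j : `|defect X Y j| <= 2 * enorm (X j - Y j) by apply: dotp_le => //; exact: dir_sub_norm.
have ub j : defect X Y j <= 2 * enorm (X (j + 1) - Y (j + 1)).
  apply: le_trans (dotp_le (dir_sub_norm (XX j) (YY j)) (lexx _)).
  apply: le_trans (ler_norm _); rewrite -subr_ge0 /defect -dotpBr.
  have := dir_monotone (XX j) (YY j).
  by have -> : X (j + 1) - X j - (Y (j + 1) - Y j) = X (j + 1) - Y (j + 1) - (X j - Y j)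
    by apply: planeP; rewrite !mxE; ring.
rewrite ltNge; apply/negP => far.
have big j : xi j = eta j -> `|defect X Y j| <= 2 * D.
  by move=> /leD h; apply: (le_trans (lb j)); rewrite ler_pM2l.
have far0 : e / 2 + w <= enorm (X 0 - Y 0) by move: far w1 e0; clr; lra.
have := defect_increment Ia0 Ia w_pt xiA etaA XE YE gap (agree 0 _) far0; rewrite sub0r => /(_ isT) inc0.
have kS (k : nat) : k.+1%:R * (mu' / 2) = k%:R * (mu' / 2) + mu' / 2 by rewrite -natr1 mulrDl mul1r.
have [pos|neg] : b <= defect X Y 0 \/ defect X Y (- 1) <= - b.
- by case: (lerP b (defect X Y 0)) => h; [left|right; move: inc0 h w3; rewrite /b; clr; lra].
- have up (k : nat) : (k <= n)%N -> b + k%:R * (mu' / 2) <= defect X Y k%:Z.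
    elim: k => [|k IH] kn; first by rewrite mul0r addr0.
    have {}IH := IH (ltnW kn); have k1 : k.+1%:Z = k%:Z + 1 :> int by rewrite -addn1 PoszD.
    have := inc k.+1%:Z (agree k.+1%:Z (leqW kn)); rewrite k1 addrK => h; move: h IH (ub k%:Z).
    have km0 : 0 <= k%:R * (mu' / 2) by rewrite mulr_ge0// ltW.
    rewrite kS => h IH h2; apply: le_trans (h _); first by move: IH; clr; lra.
    by move: IH h2 km0 w2 b0; clr; lra.
  have := up n (leqnn n); have := big n%:Z (agree n%:Z (leqnSn n)); rewrite ler_norml; move: hn b0; clr; lra.
have neg_agree k : (k <= n)%N -> xi (- 1 - k%:Z) = eta (- 1 - k%:Z).
  by move=> kn; rewrite -opprD addrC -PoszD addn1 -NegzE; exact: (agree (Negz k)).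
have up (k : nat) : (k <= n)%N -> defect X Y (- 1 - k%:Z) <= - b - k%:R * (mu' / 2).
  elim: k => [|k IH] kn; first by rewrite mul0r !subr0.
  have {}IH := IH (ltnW kn); have k1 : - 1 - k.+1%:Z = - 1 - k%:Z - 1 :> int by rewrite -addn1 PoszD opprD addrA.
  rewrite k1; have E := neg_agree k (ltnW kn).
  have := inc _ E; have := lb (- 1 - k%:Z); rewrite ler_norml => /andP[h1 _] h2.
  have km0 : 0 <= k%:R * (mu' / 2) by rewrite mulr_ge0// ltW.
  have {}h2 := h2 ltac:(move: h1 IH km0 w2 b0; clr; lra).
  by rewrite kS; move: h2 IH; clr; lra.
have := up n (leqnn n); have := big _ (neg_agree n (leqnn n)); rewrite ler_norml; move: hn b0; clr; lra.
Qed.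

Lemma extremal_seq_shift a xi X k : extremal_seq K a xi X ->
  extremal_seq K a (fun j => xi (j + k)) (fun j => X (j + k)).
Proof. by move=> XE j /=; have := XE (j + k); rewrite (addrAC j k) (addrAC j k). Qed.

Lemma admissible_shift (xi : int -> 'I_m) k : admissible_code xi -> admissible_code (fun j => xi (j + k)).
Proof. by move=> h j; rewrite (addrAC j); exact: h. Qed.

Lemma extremal_unique a xi X Y : I a -> admissible_code xi -> extremal_seq K a xi X ->
  extremal_seq K a xi Y -> Y =1 X.
Proof.
move=> Ia xiA XE YE j; apply/eqP; rewrite -subr_eq0; apply/eqP/enorm_eq0/le_anti.
rewrite enorm_ge0 andbT; apply/ler_addgt0Pr => e e0; rewrite add0r; apply: ltW.
have [d d0 [n h]] := extremal_close Ia e0.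
have := h a _ _ _ _ Ia _ (admissible_shift j xiA) (admissible_shift j xiA) (fun _ _ => erefl)
  (extremal_seq_shift j YE) (extremal_seq_shift j XE).
by rewrite subrr normr0 !add0r; apply.
Qed.

Lemma coded_point_extremal_seq a xi : I a -> admissible_code xi ->
  extremal_seq K a xi (fun j => coded_point K xi j a).
Proof.
move=> Ia xiA; have tb := deformation_table Ia.
have [X XE] := extremal_exists tb xiA.
have -> // : (fun j => coded_point K xi j a) = X.
apply/funext => j; apply: (coded_point_extremal tb xiA XE) => Y; exact: extremal_unique.
Qed.

Lemma coded_point_shift a xi j k : I a -> admissible_code xi ->
  coded_point K (fun i => xi (i + k)) j a = coded_point K xi (j + k) a.
Proof.
move=> Ia xiA; have xkA := admissible_shift k xiA.
have := extremal_unique Ia xkA (extremal_seq_shift k (coded_point_extremal_seq Ia xiA)).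
by move=> /(_ _ (coded_point_extremal_seq Ia xkA)) ->.
Qed.

Lemma coded_point_close a0 (e : R) : I a0 -> 0 < e -> exists2 d : R, 0 < d & exists n : nat,
  forall a xi eta, I a -> `|a - a0| < d -> admissible_code xi -> admissible_code eta ->
    (forall j : int, (`|j| <= n)%N -> xi j = eta j) ->
    enorm (coded_point K xi 0 a - coded_point K eta 0 a0) < e.
Proof.
move=> Ia0 e0; have [d d0 [n h]] := extremal_close Ia0 e0; exists d => //; exists n.
move=> a xi eta Ia ad xiA etaA agree.
exact: (h a xi eta _ _ Ia ad xiA etaA agree (coded_point_extremal_seq Ia xiA) (coded_point_extremal_seq Ia0 etaA)).
Qed.

End closeness.

(** * Tridiagonal systems *)

Section derive_on.
Variables (R : realType) (I : set R).
Hypothesis I_acc : forall a, I a -> forall d : R, 0 < d -> exists y, [/\ I y, y != a & `|y - a| < d].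

Lemma within_punctured_proper a : I a -> ProperFilter (within I (a^')).
Proof.
move=> Ia; apply: Build_ProperFilter_ex => P; rewrite /within/= => -[d /= d0 hd].
have [y [Iy ya yd]] := I_acc Ia d0.
by exists y; apply: hd => //=; rewrite distrC.
Qed.

Lemma within_puncturedP a (P : R -> Prop) :
  (\forall y \near within I (a^'), P y) <->
  exists2 d : R, 0 < d & forall y, I y -> y != a -> `|y - a| < d -> P y.
Proof.
split=> [[d /= d0 hd]|[d d0 hd]].
  by exists d => // y Iy ya yd; apply: hd => //=; rewrite distrC.
by exists d => // y /= yd ya Iy; apply: hd => //; rewrite distrC.
Qed.

Lemma diff_quotientE (f : R -> R) x y : diff_quotient f x y = (f y - f x) / (y - x).
Proof. by rewrite /diff_quotient mulrC. Qed.

Lemma has_deriv_diff_quotient (f : R -> R) a l : has_deriv I f a l ->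
  diff_quotient f a y @[y --> within I (a^')] --> l.
Proof.
move=> h; apply/cvgrPdist_le => e e0; apply/within_puncturedP.
have [d d0 hd] := h _ e0; exists d => // y Iy ya yd.
have ya0 : y - a != 0 by rewrite subr_eq0.
rewrite diff_quotientE distrC -(ler_pM2r (_ : 0 < `|y - a|)) ?normr_gt0//.
by rewrite -normrM mulrBl divfK//; exact: hd.
Qed.

Lemma has_deriv_derive_on (f : R -> R) a l : I a -> has_deriv I f a l ->
  derivable_on I f a /\ derive_on I f a = l.
Proof.
move=> Ia /has_deriv_diff_quotient h; have PF := within_punctured_proper Ia.
split; first by apply/cvg_ex; exists l.
exact: cvg_lim.
Qed.

Lemma derive_on_cauchy (f : R -> R) a : I a ->
  (forall e : R, 0 < e -> exists2 d : R, 0 < d & forall y z, I y -> I z -> y != a -> z != a ->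
     `|y - a| < d -> `|z - a| < d -> `|diff_quotient f a y - diff_quotient f a z| <= e) ->
  has_deriv I f a (derive_on I f a).
Proof.
move=> Ia h; have PF := within_punctured_proper Ia.
have cv : cvg (diff_quotient f a y @[y --> within I (a^')]).
  apply/cauchy_cvgP/cauchy_ballP => e e0; have e2 : 0 < e / 2 by rewrite divr_gt0.
  have [d d0 hd] := h _ e2.
  pose S := [set y | [/\ I y, y != a & `|y - a| < d]].
  exists (diff_quotient f a @` S, diff_quotient f a @` S) => /=.
    by split; apply/within_puncturedP; exists d => // y Iy ya yd; exists y.
  move=> [_ _] /= [[y [Iy ya yd] <-] [z [Iz za zd] <-]]; rewrite -ball_normE /ball_ /=.
  by apply: le_lt_trans (hd y z Iy Iz ya za yd zd) _; rewrite ltr_pdivrMr// ltr_pMr// ltr1n.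
move=> e e0; have e2 : 0 < e / 2 by rewrite divr_gt0.
move/cvgrPdist_le: (cv) => /(_ _ e0) /within_puncturedP[d d0 hd].
exists d => // y Iy yd; have [->|ya] := eqVneq y a.
  by rewrite !subrr mulr0 subrr normr0 mulr0.
have ya0 : y - a != 0 by rewrite subr_eq0.
have := hd y Iy ya yd; rewrite diff_quotientE distrC -(ler_pM2r (_ : 0 < `|y - a|)) ?normr_gt0//.
by rewrite -normrM mulrBl divfK.
Qed.

End derive_on.

(** * A priori estimates and regularity for infinite tridiagonal systems *)

Section linear_systems.
Variables (R : realType) (I : set R).
Hypothesis I_acc : forall a, I a -> forall d : R, 0 < d -> exists y, [/\ I y, y != a & `|y - a| < d].
Variables (T : Type) (D : T -> Prop) (prv nxt : T -> T).
Hypotheses (Dp : forall t, D t -> D (prv t)) (Dn : forall t, D t -> D (nxt t)).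

(** The supremum [S] of [g] satisfies [S <= c + th * S]. The bound [Q], absent from the conclusion,
    makes this supremum finite. *)
Lemma contraction_bound (g : T -> R) (c th Q : R) : th < 1 -> (forall t, D t -> g t <= Q) ->
  (forall S, (forall t, D t -> g t <= S) -> forall t, D t -> g t <= c + th * S) ->
  forall t, D t -> g t <= c / (1 - th).
Proof.
move=> th1 gQ h t Dt; pose G := g @` [set t | D t].
have supG : has_sup G by split; [exists (g t), t|exists Q => _ [u Du <-]; exact: gQ].
have ub u : D u -> g u <= sup G by move=> Du; apply: (ub_le_sup supG.2); exists u.
have S1 : sup G <= c + th * sup G.
  by apply: ge_sup; [exact: supG.1|move=> _ [u Du <-]; exact: h].
apply: (le_trans (ub t Dt)); rewrite ler_pdivlMr ?subr_gt0//; move: S1; clr; lra.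
Qed.

(** Functions of [a] alone enter the calculus of families through the single fibre point [s = 0]. *)
Definition slice (t : T) (s a : R) : Prop := [/\ D t, I a & s = 0].
Definition flat (f : T -> R -> R) : T -> R -> R -> R := fun t _ a => f t a.

Definition near_pairs (a0 : R) (P : T -> R -> R -> Prop) : Prop :=
  exists2 d : R, 0 < d & forall t a a', D t -> I a -> I a' -> `|a - a0| < d -> `|a' - a0| < d -> P t a a'.

Lemma near_pairsP a0 P :
  (\forall y \near fibre_near slice a0, P y.1.1 y.1.2.2 y.2.2) <-> near_pairs a0 P.
Proof.
split=> [[d d0 h]|[d d0 h]]; exists d => //.
  by move=> t a a' Dt Ia Ia' ad ad'; apply: (h t 0 a 0 a'); rewrite // ?subrr ?normr0.
by move=> t s a s' a' [Dt Ia _] [_ Ia' _] ad ad' _; exact: h.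
Qed.

Lemma near_pairs2 a0 (P Q S : T -> R -> R -> Prop) : near_pairs a0 P -> near_pairs a0 Q ->
  (forall t a a', P t a a' -> Q t a a' -> S t a a') -> near_pairs a0 S.
Proof.
move=> [d d0 h] [c c0 h'] PQ; exists (Num.min d c); first by rewrite lt_min d0.
by move=> t a a' Dt Ia Ia'; rewrite !lt_min => /andP[? ?] /andP[? ?]; apply: PQ; auto.
Qed.

Lemma near_pairs_prv a0 P : near_pairs a0 P -> near_pairs a0 (fun t => P (prv t)).
Proof. by move=> [d d0 h]; exists d => // t a a' /Dp; exact: h. Qed.
Lemma near_pairs_nxt a0 P : near_pairs a0 P -> near_pairs a0 (fun t => P (nxt t)).
Proof. by move=> [d d0 h]; exists d => // t a a' /Dn; exact: h. Qed.

Lemma flat_boundedP f : fibre_bounded I slice (flat f) <->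
  (forall a0, I a0 -> exists2 M : R, 0 < M & near_pairs a0 (fun t a _ => `|f t a| <= M)).
Proof.
by split=> h a0 Ia0; have [M M0 hM] := h _ Ia0; exists M => //; exact/(near_pairsP a0 (fun t a _ => `|f t a| <= M)).
Qed.

Lemma flat_equicontP f : fibre_equicont I slice (flat f) <->
  (forall a0, I a0 -> forall e : R, 0 < e -> near_pairs a0 (fun t a a' => `|f t a' - f t a| <= e)).
Proof.
split=> h a0 Ia0 e e0; have he := h _ Ia0 _ e0;
  exact/(near_pairsP a0 (fun t a a' => `|f t a' - f t a| <= e)).
Qed.

Lemma near_pairs_strict a0 e (f v : T -> R -> R) :
  near_pairs a0 (fun t a a' => `|f t a' - f t a - v t a * (a' - a)| <= e * `|a' - a|) ->
  \forall y \near fibre_near slice a0,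
    `|at_new (flat f) y - at_old (flat f) y - differential (fun _ _ _ => 0) (flat v) y| <= e * gauge y.
Proof.
move=> [d d0 h]; exists d => // t s a s' a' [Dt Ia ->] [_ Ia' ->] ad ad' _.
rewrite /at_new /differential /at_old /gauge /= mul0r add0r subrr normr0 add0r; exact: h.
Qed.

Lemma smooth_shift k f (sh : T -> T) : (forall t, D t -> D (sh t)) -> smooth I slice k (flat f) ->
  smooth I slice k (flat (fun t => f (sh t))).
Proof.
move=> Dsh hf.
have hw : smooth_mod_cst I slice k (fun t s a => 0) by apply/smooth_smooth_mod_cst/smooth_cst.
by apply: (@smooth_comp _ _ _ _ slice slice sh _ _ _ _ hf hw) => t s a [Dt Ia _]; split=> //; exact: Dsh.
Qed.

Section operator.
Variables A B C : T -> R -> R.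

Definition tridiag (a : R) (x : T -> R) (t : T) : R :=
  A t a * x (prv t) + B t a * x t + C t a * x (nxt t).

(** A bound for the inverse of the system among bounded sequences, uniform for [a] near [a0]. The
    sequence must be bounded, but its bound [Q] does not enter the estimate. *)
Definition stable : Prop := forall a0, I a0 -> exists2 k : R, 0 < k & exists2 d : R, 0 < d &
  forall a, I a -> `|a - a0| < d -> forall (x : T -> R) (e Q : R), (forall t, D t -> `|x t| <= Q) ->
    (forall t, D t -> `|tridiag a x t| <= e) -> forall t, D t -> `|x t| <= k * e.

(** A maximum principle for [|x| / w]: dominance with margin [k] leaves the contraction factor
    [1 - k / N], where [N] bounds the weighted diagonal. *)
Lemma dominant_stable (w : T -> R -> R) :
  (forall a0, I a0 -> exists c M k : R, [/\ 0 < c, 0 < k & near_pairs a0 (fun t a _ =>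
     [/\ c <= w t a <= M, `|B t a| <= M & k + `|A t a| * w (prv t) a + `|C t a| * w (nxt t) a <= B t a * w t a])]) ->
  stable.
Proof.
move=> h a0 Ia0; have [c [M [k [c0 k0 [d d0 hd]]]]] := h _ Ia0.
pose M' := `|M| + 1; have M'0 : 0 < M' by rewrite ltr_wpDl.
have MM' : M <= M' by rewrite (le_trans (ler_norm _))// lerDl.
exists (M' * (M' * M' / k / k)); first by rewrite !mulr_gt0// invr_gt0.
exists d => // a Ia ad x e Q xQ xe t Dt.
have e0 : 0 <= e by apply: le_trans (normr_ge0 _) (xe t Dt).
have Hd u : D u -> [/\ c <= w u a, w u a <= M', k <= B u a * w u a, B u a * w u a <= M' * M' &
   k + `|A u a| * w (prv u) a + `|C u a| * w (nxt u) a <= B u a * w u a].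
  move=> Du; have [/andP[w1 w2] w3 w4] := hd u a a Du Ia Ia ad ad.
  have [/andP[p1 _] _ _] := hd _ a a (Dp Du) Ia Ia ad ad.
  have [/andP[n1 _] _ _] := hd _ a a (Dn Du) Ia Ia ad ad.
  have w0 : 0 <= w u a by apply: le_trans (ltW c0) w1.
  split=> //; first exact: le_trans w2 MM'.
    apply: le_trans w4; rewrite -addrA lerDl addr_ge0// mulr_ge0//; first exact: le_trans (ltW c0) p1.
    exact: le_trans (ltW c0) n1.
  apply: (@le_trans _ _ (`|B u a| * w u a)); first by rewrite ler_wpM2r// ler_norm.
  by apply: ler_pM => //; [exact: le_trans w3 MM'|exact: le_trans w2 MM'].
pose g u := `|x u| / w u a; pose N := M' * M'.
have N0 : 0 < N by rewrite mulr_gt0.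
have wpos u : D u -> 0 < w u a by move=> /Hd[/(lt_le_trans c0)].
have xg u : D u -> `|x u| = g u * w u a by move=> /wpos w0; rewrite /g divfK// lt0r_neq0.
have Q0 : 0 <= Q by apply: le_trans (normr_ge0 _) (xQ t Dt).
have gQ u : D u -> g u <= Q / c.
  move=> Du; have [w1 _ _ _ _] := Hd _ Du; have w0 := wpos _ Du.
  rewrite /g ler_pdivrMr// mulrAC ler_pdivlMr//; apply: ler_pM => //; [exact: ltW|exact: xQ].
have kN : k <= N by have [_ _ k1 k2 _] := Hd _ Dt; exact: le_trans k1 k2.
have th1 : 1 - k / N < 1 by rewrite ltrBlDr ltrDl divr_gt0.
have key := contraction_bound (c := e / k) th1 gQ.
have {}key : forall u, D u -> g u <= e / k / (1 - (1 - k / N)).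
  apply: key => S gS u Du; have [_ _ k1 k2 k3] := Hd _ Du.
  have S0 : 0 <= S by apply: le_trans (gS u Du); rewrite divr_ge0// ltW// wpos.
  have Sx v : D v -> `|x v| <= S * w v a.
    by move=> Dv; rewrite xg// ler_wpM2r ?gS// ltW// wpos.
  have w0 := wpos _ Du; set b := B u a * w u a in k1 k2 k3.
  have b0 : 0 < b by exact: lt_le_trans k1.
  have B0 : 0 < B u a by rewrite -(pmulr_lgt0 _ w0).
  have bg : b * g u <= e + S * (b - k).
    have -> : b * g u = `|B u a * x u| by rewrite normrM (gtr0_norm B0) xg// /b; ring.
    have -> : B u a * x u = tridiag a x u - A u a * x (prv u) - C u a * x (nxt u) by rewrite /tridiag; ring.
    apply: (le_trans (ler_normB _ _)).
    have h1 := ler_normB (tridiag a x u) (A u a * x (prv u)).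
    have h2 := xe u Du; rewrite !normrM in h1 *.
    have h3 := ler_wpM2l (normr_ge0 (A u a)) (Sx _ (Dp Du)).
    have h4 := ler_wpM2l (normr_ge0 (C u a)) (Sx _ (Dn Du)).
    have h5 := ler_wpM2l S0 k3; move: h1 h2 h3 h4 h5; clr; lra.
  have -> : g u = (b * g u) / b by rewrite mulrAC divff ?mul1r// lt0r_neq0.
  rewrite ler_pdivrMr//; apply: (le_trans bg); rewrite mulrDl; apply: lerD.
    by rewrite mulrAC ler_pdivlMr// ler_wpM2l.
  rewrite mulrAC mulrC ler_wpM2r// mulrBl mul1r lerD2l lerN2 mulrAC ler_pdivrMr// ler_pM2l//.
have E : 1 - (1 - k / N) = k / N by ring.
rewrite E in key; rewrite xg//.
have -> : M' * (M' * M' / k / k) * e = e / k / (k / N) * M' by rewrite /N; field; rewrite !lt0r_neq0.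
have [w1 w2 _ _ _] := Hd _ Dt; apply: ler_pM => //; [by rewrite divr_ge0// ltW// wpos|exact/ltW/wpos|exact: key].
Qed.

Lemma tridiagB a x y t : tridiag a (fun t => x t - y t) t = tridiag a x t - tridiag a y t.
Proof. by rewrite /tridiag; ring. Qed.
Lemma tridiagZ a c x t : tridiag a (fun t => c * x t) t = c * tridiag a x t.
Proof. by rewrite /tridiag; ring. Qed.

Hypothesis stab : stable.

Section increments.
Variables (E f : T -> R -> R).
Local Notation df a a' := (fun t => f t a' - f t a).
Hypothesis f_eqc : fibre_equicont I slice (flat f).
Hypothesis E_bnd : fibre_bounded I slice (flat E).
Hypothesis increment : forall a0, I a0 -> forall e : R, 0 < e -> near_pairs a0 (fun t a a' =>
  `|tridiag a (df a a') t + E t a * (a' - a)| <=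
  e * (`|df a a' (prv t)| + `|df a a' t| + `|df a a' (nxt t)| + `|a' - a|)).

(** The error term involves the increments at three consecutive indices. With [e = 1 / (6 * k)] they
    contribute at most half of their supremum, which the contraction absorbs. *)
Lemma increment_lip a0 : I a0 -> exists2 L : R, 0 < L &
  near_pairs a0 (fun t a a' => `|f t a' - f t a| <= L * `|a' - a|).
Proof.
move=> Ia0; have [k k0 [d1 d10 hk]] := stab Ia0.
have e0 : 0 < 1 / (6 * k) by rewrite divr_gt0// mulr_gt0.
have [M M0 [d2 d20 hM]] := (flat_boundedP E).1 E_bnd _ Ia0.
have [d3 d30 h3] := increment Ia0 e0.
have [d4 d40 h4] := (flat_equicontP f).1 f_eqc _ Ia0 _ (@ltr01 R).
exists (2 * (k * (M + 1 / (6 * k)))); first by rewrite !mulr_gt0// addr_gt0.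
exists (Num.min (Num.min d1 d2) (Num.min d3 d4)); first by rewrite !lt_min d10 d20 d30.
move=> t a a' Dt Ia Ia'; rewrite !lt_min => /andP[/andP[p1 p2] /andP[p3 p4]] /andP[/andP[q1 q2] /andP[q3 q4]].
set e := 1 / (6 * k) in e0 h3 *; set z := `|a' - a|.
have ek : e * k = 6^-1 by rewrite /e; field; rewrite lt0r_neq0.
have hlf : (2^-1 : R) < 1 by rewrite invf_lt1// ltr1n.
have := @contraction_bound (fun u => `|f u a' - f u a|) (k * (M + e) * z) 2^-1 1 hlf.
have -> : k * (M + e) * z / (1 - 2^-1) = 2 * (k * (M + e)) * z.
  have -> : 1 - 2^-1 = 2^-1 :> R by clr; lra.
  by rewrite invrK; ring.
apply=> // [u Du|S hS u Du]; first exact: (h4 u a a').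
have := hk a Ia p1 (df a a') (M * z + e * (3 * S + z)) 1 (fun v Dv => h4 v a a' Dv Ia Ia' p4 q4) _ u Du.
have -> : k * (M * z + e * (3 * S + z)) = k * (M + e) * z + 3 * (e * k) * S by ring.
rewrite ek (_ : 3 * 6^-1 = 2^-1); last by field.
apply=> v Dv; have h5 := h3 v a a' Dv Ia Ia' p3 q3.
have -> : tridiag a (df a a') v = tridiag a (df a a') v + E v a * (a' - a) - E v a * (a' - a) by ring.
apply: (le_trans (ler_normB _ _)); rewrite addrC; apply: lerD.
  by rewrite normrM ler_wpM2r//; exact: (hM v a a).
apply: (le_trans h5); rewrite ler_pM2l// lerD2r.
by have := hS _ Dv; have := hS _ (Dp Dv); have := hS _ (Dn Dv); clr; lra.
Qed.

Lemma increment_residual a0 (e : R) : I a0 -> 0 < e -> near_pairs a0 (fun t a a' =>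
  `|tridiag a (df a a') t + E t a * (a' - a)| <= e * `|a' - a|).
Proof.
move=> Ia0 e0; have [L L0 hL] := increment_lip Ia0.
have e'0 : 0 < e / (3 * L + 1) by rewrite divr_gt0// addr_gt0// mulr_gt0.
have hLp := near_pairs2 hL (near_pairs_prv hL) (fun _ _ _ p q => conj p q).
have hLn := near_pairs2 hLp (near_pairs_nxt hL) (fun _ _ _ p q => conj p q).
apply: (near_pairs2 hLn (increment Ia0 e'0)) => t a a' [[l1 l2] l3] h; apply: (le_trans h).
have -> : e * `|a' - a| = e / (3 * L + 1) * ((3 * L + 1) * `|a' - a|).
  by field; rewrite lt0r_neq0// addr_gt0// mulr_gt0.
by rewrite ler_pM2l//; move: l1 l2 l3; clr; lra.
Qed.

(** Two difference quotients with the same base point nearly solve one system with right side [- E],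
    so stability makes them close. The base point itself is free near [a0], which is what yields
    strict derivatives later. *)
Lemma quotient_cauchy a0 (e : R) : I a0 -> 0 < e -> exists2 d : R, 0 < d & forall t a x y, D t ->
  I a -> I x -> I y -> `|a - a0| < d -> `|x - a0| < d -> `|y - a0| < d -> x != a -> y != a ->
  `|diff_quotient (f t) a x - diff_quotient (f t) a y| <= e.
Proof.
move=> Ia0 e0; have [k k0 [d1 d10 hk]] := stab Ia0.
have e'0 : 0 < e / (2 * k) by rewrite divr_gt0// mulr_gt0.
have [d2 d20 h2] := increment_residual Ia0 e'0; have [L L0 [d3 d30 h3]] := increment_lip Ia0.
exists (Num.min d1 (Num.min d2 d3)); first by rewrite !lt_min d10 d20.
move=> t a x y Dt Ia Ix Iy; rewrite !lt_min => /and3P[a1 a2 a3] /and3P[x1 x2 x3] /and3P[y1 y2 y3] xa ya.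
pose q x u := (x - a)^-1 * (f u x - f u a).
have norm_gt0 z : z != a -> 0 < `|z - a| by rewrite normr_gt0 subr_eq0.
have qL z u : D u -> I z -> `|z - a0| < d3 -> z != a -> `|q z u| <= L.
  move=> Du Iz zd za; rewrite /q normrM normfV mulrC ler_pdivrMr ?norm_gt0//; exact: (h3 u a z).
have qE z u : D u -> I z -> `|z - a0| < d2 -> z != a -> `|tridiag a (q z) u + E u a| <= e / (2 * k).
  move=> Du Iz zd za; rewrite tridiagZ -(ler_pM2r (norm_gt0 _ za)) -normrM.
  have -> : ((z - a)^-1 * tridiag a (df a z) u + E u a) * (z - a) = tridiag a (df a z) u + E u a * (z - a).
    by field; rewrite subr_eq0.
  exact: (h2 u a z).
have -> : e = k * (e / (2 * k) + e / (2 * k)) by field; rewrite lt0r_neq0.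
apply: (hk a Ia a1 (fun u => q x u - q y u) _ (L + L)) => // [u Du|u Du].
  by apply: (le_trans (ler_normB _ _)); apply: lerD; apply: qL.
rewrite tridiagB (_ : _ - _ = (tridiag a (q x) u + E u a) - (tridiag a (q y) u + E u a)); last by ring.
by apply: (le_trans (ler_normB _ _)); apply: lerD; apply: qE.
Qed.

Let v t := derive_on I (f t).

Lemma increment_has_deriv t a : D t -> I a -> has_deriv I (f t) a (v t a).
Proof.
move=> Dt Ia; apply: (derive_on_cauchy I_acc Ia) => e e0.
have [d d0 h] := quotient_cauchy Ia e0; exists d => // y z Iy Iz ya za yd zd.
by apply: h => //; rewrite subrr normr0.
Qed.

Lemma increment_strict a0 (e : R) : I a0 -> 0 < e -> near_pairs a0 (fun t a a' =>
  `|f t a' - f t a - v t a * (a' - a)| <= e * `|a' - a|).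
Proof.
move=> Ia0 e0; have [d d0 h] := quotient_cauchy Ia0 e0.
exists d => // t a x Dt Ia Ix ad xd; have [->|xa] := eqVneq x a.
  by rewrite !subrr mulr0 subrr normr0 mulr0.
have xa0 : 0 < `|x - a| by rewrite normr_gt0 subr_eq0.
have xa1 : x - a != 0 by rewrite subr_eq0.
(* [x] is kept, and the second quotient is replaced by its limit, the derivative at [a]. *)
apply/ler_addgt0Pr => e1 e10.
have e2 : 0 < e1 / `|x - a| by rewrite divr_gt0.
have [c c0 hc] := increment_has_deriv Dt Ia e2.
have c1 : 0 < Num.min c (d - `|a - a0|) by rewrite lt_min c0 subr_gt0.
have [y [Iy ya yd]] := I_acc Ia c1; move: yd; rewrite lt_min => /andP[y1 y2].
have ya0 : 0 < `|y - a| by rewrite normr_gt0 subr_eq0.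
have ya1 : y - a != 0 by rewrite subr_eq0.
have yd : `|y - a0| < d.
  have -> : y - a0 = (y - a) + (a - a0) by ring.
  by apply: le_lt_trans (ler_normD _ _) _; rewrite -ltrBrDr.
have := h t a x y Dt Ia Ix Iy ad xd yd xa ya; rewrite !diff_quotientE => h1.
have h2 : `|(f t y - f t a) / (y - a) - v t a| <= e1 / `|x - a|.
  rewrite -(ler_pM2r ya0) -normrM mulrBl divfK//; exact: hc.
have -> : f t x - f t a - v t a * (x - a) =
   ((f t x - f t a) / (x - a) - (f t y - f t a) / (y - a)) * (x - a) +
   ((f t y - f t a) / (y - a) - v t a) * (x - a) by field; rewrite xa1 ya1.
apply: (le_trans (ler_normD _ _)); rewrite !normrM; apply: lerD; first by rewrite ler_pM2r.
by rewrite -ler_pdivlMr.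
Qed.

Lemma increment_solution t a : D t -> I a -> tridiag a (v^~ a) t + E t a = 0.
Proof.
move=> Dt Ia; apply/eqP; rewrite -normr_le0; apply/ler_addgt0Pr => e e0; rewrite add0r.
pose S := `|A t a| + `|B t a| + `|C t a| + 1.
have S0 : 0 < S by rewrite ltr_wpDl// !addr_ge0.
have e1 : 0 < e / (2 * S) by rewrite divr_gt0// mulr_gt0.
have e2 : 0 < e / 2 by rewrite divr_gt0.
have [d1 d10 h1] := increment_strict Ia e1; have [d2 d20 h2] := increment_residual Ia e2.
have d0 : 0 < Num.min d1 d2 by rewrite lt_min d10.
have [y [Iy ya yd]] := I_acc Ia d0; move: yd; rewrite lt_min => /andP[y1 y2].
have ya0 : 0 < `|y - a| by rewrite normr_gt0 subr_eq0.
have aa c : 0 < c -> `|a - a| < c by rewrite subrr normr0.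
rewrite -(ler_pM2r ya0) -normrM.
pose r u := f u y - f u a - v u a * (y - a).
have -> : (tridiag a (v^~ a) t + E t a) * (y - a) =
  (tridiag a (df a y) t + E t a * (y - a)) - (A t a * r (prv t) + B t a * r t + C t a * r (nxt t)).
  by rewrite /tridiag /r; ring.
apply: (le_trans (ler_normB _ _)).
have rb u : D u -> `|r u| <= e / (2 * S) * `|y - a| by move=> Du; apply: h1 => //; exact: aa.
have h3 := h2 t a y Dt Ia Iy (aa _ d20) y2.
have h4 : `|A t a * r (prv t) + B t a * r t + C t a * r (nxt t)| <= S * (e / (2 * S) * `|y - a|).
  apply: (le_trans (ler_normD _ _)); apply: (le_trans (lerD (ler_normD _ _) (lexx _))); rewrite !normrM.
  have k1 := ler_wpM2l (normr_ge0 (A t a)) (rb _ (Dp Dt)).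
  have k2 := ler_wpM2l (normr_ge0 (B t a)) (rb _ Dt).
  have k3 := ler_wpM2l (normr_ge0 (C t a)) (rb _ (Dn Dt)).
  have k4 : 0 <= e / (2 * S) * `|y - a| by rewrite mulr_ge0// ltW.
  rewrite [in X in _ <= X]/S; set z := e / (2 * S) * `|y - a| in k1 k2 k3 k4 *.
  by rewrite !mulrDl mul1r; apply: ler_wpDr k4 _; apply: lerD => //; exact: lerD.
have E2 : S * (e / (2 * S) * `|y - a|) = e / 2 * `|y - a| by field; rewrite lt0r_neq0.
by move: h3 h4; rewrite E2; clr; lra.
Qed.

Lemma increment_bounded : fibre_bounded I slice (flat v).
Proof.
apply/flat_boundedP => a0 Ia0; have [L L0 [d d0 hL]] := increment_lip Ia0; have [d' d'0 hv] := increment_strict Ia0 (@ltr01 R).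
exists (L + 1); first by rewrite addr_gt0.
exists (Num.min d d'); first by rewrite lt_min d0.
move=> t a a1' Dt Ia _; rewrite lt_min => /andP[a1 a2] _.
have dm0 : 0 < Num.min (d - `|a - a0|) (d' - `|a - a0|) by rewrite lt_min !subr_gt0 a1.
have [y [Iy ya]] := I_acc Ia dm0; rewrite lt_min => /andP[y1 y2].
have tri c : `|y - a| < c - `|a - a0| -> `|y - a0| < c.
  move=> h; have -> : y - a0 = (y - a) + (a - a0) by ring.
  by apply: le_lt_trans (ler_normD _ _) _; rewrite -ltrBrDr.
have ya0 : 0 < `|y - a| by rewrite normr_gt0 subr_eq0.
have l1 := hL t a y Dt Ia Iy a1 (tri _ y1); have l2 := hv t a y Dt Ia Iy a2 (tri _ y2).
rewrite -(ler_pM2r ya0) -normrM.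
have -> : v t a * (y - a) = (f t y - f t a) - (f t y - f t a - v t a * (y - a)) by ring.
by apply: (le_trans (ler_normB _ _)); rewrite mulrDl; apply: lerD.
Qed.

End increments.
End operator.

Lemma smooth_flat_split k f : smooth I slice k.+1 (flat f) -> exists2 fa : T -> R -> R,
  smooth I slice k (flat fa) & forall a0, I a0 -> forall e : R, 0 < e -> near_pairs a0 (fun t a a' =>
    `|f t a' - f t a - fa t a * (a' - a)| <= e * `|a' - a|).
Proof.
move=> [_ [gs [ga [sd _ sa]]]]; exists (fun t a => ga t 0 a).
  by apply: smooth_ext sa => t s a [_ _ ->].
move=> a0 Ia0 e e0; have [d d0 h] := sd _ Ia0 _ e0; exists d => // t a a' Dt Ia Ia' ad ad'.
have := h t 0 a 0 a'; rewrite /at_new /at_old /differential /gauge /= subrr normr0 mulr0 !add0r.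
by apply.
Qed.

Lemma smooth_near k f a0 (e : R) : I a0 -> 0 < e -> smooth I slice k (flat f) ->
  near_pairs a0 (fun t a a' => `|f t a' - f t a| <= e).
Proof. by move=> Ia0 e0 /smooth_equicont /flat_equicontP; apply. Qed.

(** Increments of a solution solve the system at [a] up to increments of the coefficients. This
    gives equicontinuity and, once the coefficients are differentiable, the hypotheses of the
    increment lemmas with source [E']. The derivative of [v] is then a bounded solution with source
    [E'], to which the induction hypothesis applies. *)
Lemma solution_smooth k A B C E v : stable A B C ->
  smooth I slice k (flat A) -> smooth I slice k (flat B) -> smooth I slice k (flat C) ->
  smooth I slice k (flat E) -> fibre_bounded I slice (flat v) ->
  (forall t a, D t -> I a -> tridiag A B C a (v^~ a) t + E t a = 0) ->
  smooth I slice k (flat v).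
Proof.
move=> stab; elim: k E v => [|k IH] E v hA hB hC hE bv sol.
  split=> //; split=> //; apply/flat_equicontP => a0 Ia0 e e0.
  have [k k0 [d1 d10 hk]] := stab _ Ia0.
  have [M M0 [d2 d20 hM]] := (flat_boundedP v).1 bv _ Ia0.
  have M1 : 0 < 3 * M + 1 by rewrite addr_gt0// mulr_gt0.
  have eta0 : 0 < e / k / (3 * M + 1) by rewrite !divr_gt0.
  set eta := e / k / _ in eta0.
  have P4 := near_pairs2 (near_pairs2 (smooth_near Ia0 eta0 hA) (smooth_near Ia0 eta0 hB) (fun _ _ _ p q => conj p q))
    (near_pairs2 (smooth_near Ia0 eta0 hC) (smooth_near Ia0 eta0 hE) (fun _ _ _ p q => conj p q)) (fun _ _ _ p q => conj p q).
  have [d3 d30 h3] := P4.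
  exists (Num.min d1 (Num.min d2 d3)); first by rewrite !lt_min d10 d20.
  move=> t a a' Dt Ia Ia'; rewrite !lt_min => /and3P[a1 a2 a3] /and3P[x1 x2 x3].
  have -> : e = k * ((3 * M + 1) * eta) by rewrite /eta; field; rewrite !lt0r_neq0.
  apply: (hk a Ia a1 (fun u => v u a' - v u a) _ (M + M)) => // [u Du|u Du].
    by apply: (le_trans (ler_normB _ _)); apply: lerD; [apply: (hM u a' a)|apply: (hM u a a)].
  have [[hA' hB'] [hC' hE']] := h3 u a a' Du Ia Ia' a3 x3.
  have := sol u a Du Ia; have := sol u a' Du Ia'; rewrite tridiagB => s1 s2.
  have -> : tridiag A B C a (v^~ a') u - tridiag A B C a (v^~ a) u =
    - (((A u a' - A u a) * v (prv u) a' + (B u a' - B u a) * v u a' + (C u a' - C u a) * v (nxt u) a')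
       + (E u a' - E u a)).
    move: s1 s2 => /(canRL (addrK _)) s1 /(canRL (addrK _)) s2; rewrite s2.
    rewrite [in RHS](_ : E u a' = - tridiag A B C a' (v^~ a') u); last by rewrite s1; ring.
    by rewrite /tridiag; ring.
  rewrite normrN; apply: (le_trans (ler_normD _ _)).
  have -> : (3 * M + 1) * eta = eta * M + eta * M + eta * M + eta by ring.
  apply: lerD => //; apply: (le_trans (ler_normD _ _)); apply: lerD; last first.
    by apply: ler_normM => //; apply: (hM _ a' a') => //; exact: Dn.
  by apply: (le_trans (ler_normD _ _)); apply: lerD; apply: ler_normM => //;
    apply: (hM _ a' a') => //; exact: Dp.
have vk : smooth I slice k (flat v).
  by apply: (IH E) => //; exact: smoothW.
have [Aa sAa hAa] := smooth_flat_split hA; have [Ba sBa hBa] := smooth_flat_split hB.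
have [Ca sCa hCa] := smooth_flat_split hC; have [Ea sEa hEa] := smooth_flat_split hE.
pose E' t a := Aa t a * v (prv t) a + Ba t a * v t a + Ca t a * v (nxt t) a + Ea t a.
have sE' : smooth I slice k (flat E').
  apply: smoothD sEa; apply: smoothD; first apply: smoothD.
  - exact: smoothM sAa (smooth_shift Dp vk).
  - exact: smoothM sBa vk.
  - exact: smoothM sCa (smooth_shift Dn vk).
have incr a0 : I a0 -> forall e : R, 0 < e -> near_pairs a0 (fun t a a' =>
  `|tridiag A B C a (fun u => v u a' - v u a) t + E' t a * (a' - a)| <=
  e * (`|v (prv t) a' - v (prv t) a| + `|v t a' - v t a| + `|v (nxt t) a' - v (nxt t) a| + `|a' - a|)).
  move=> Ia0 e e0.
  have [M M0 [d2 d20 hM]] := (flat_boundedP v).1 bv _ Ia0.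
  have M1 : 0 < 3 * M + 1 by rewrite addr_gt0// mulr_gt0.
  have eta0 : 0 < e / (3 * M + 1) by rewrite divr_gt0.
  have eeta : e = (3 * M + 1) * (e / (3 * M + 1)) by field; rewrite lt0r_neq0.
  set eta := e / (3 * M + 1) in eta0 eeta.
  have mk (P Q : T -> R -> R -> Prop) (p : near_pairs a0 P) (q : near_pairs a0 Q) := near_pairs2 p q (fun _ _ _ p q => conj p q).
  have [d3 d30 h3] := mk _ _ (mk _ _ (smooth_near Ia0 eta0 hA) (smooth_near Ia0 eta0 hB)) (smooth_near Ia0 eta0 hC).
  have [d4 d40 h4] := mk _ _ (mk _ _ (hAa _ Ia0 _ eta0) (hBa _ Ia0 _ eta0)) (mk _ _ (hCa _ Ia0 _ eta0) (hEa _ Ia0 _ eta0)).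
  exists (Num.min d2 (Num.min d3 d4)); first by rewrite !lt_min d20 d30.
  move=> u a a' Du Ia Ia'; rewrite !lt_min => /and3P[a2 a3 a4] /and3P[x2 x3 x4].
  have [[dA dB] dC] := h3 u a a' Du Ia Ia' a3 x3.
  have [[lA lB] [lC lE]] := h4 u a a' Du Ia Ia' a4 x4.
  have vp := hM (prv u) a a (Dp Du) Ia Ia a2 a2.
  have vu := hM u a a Du Ia Ia a2 a2.
  have vn := hM (nxt u) a a (Dn Du) Ia Ia a2 a2.
  have s1 := sol u a' Du Ia'; have s2 := sol u a Du Ia.
  pose z := a' - a.
  have -> : tridiag A B C a (fun w => v w a' - v w a) u + E' u a * (a' - a) =
    - (((A u a' - A u a - Aa u a * z) * v (prv u) a + (B u a' - B u a - Ba u a * z) * v u a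
        + (C u a' - C u a - Ca u a * z) * v (nxt u) a + (E u a' - E u a - Ea u a * z))
     + ((A u a' - A u a) * (v (prv u) a' - v (prv u) a) + (B u a' - B u a) * (v u a' - v u a)
        + (C u a' - C u a) * (v (nxt u) a' - v (nxt u) a))).
    apply/eqP; rewrite -subr_eq0; apply/eqP.
    transitivity ((tridiag A B C a' (v^~ a') u + E u a') - (tridiag A B C a (v^~ a) u + E u a)).
      by rewrite /tridiag /E' /z; ring.
    by rewrite s1 s2 subrr.
  have b1 := ler_normM lA vp; have b2 := ler_normM lB vu; have b3 := ler_normM lC vn.
  rewrite normrN; apply: (le_trans (ler_normD _ _)).
  apply: (@le_trans _ _ ((eta * `|z| * M + eta * `|z| * M + eta * `|z| * M + eta * `|z|) +
    (eta * `|v (prv u) a' - v (prv u) a| + eta * `|v u a' - v u a| + eta * `|v (nxt u) a' - v (nxt u) a|))).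
    apply: lerD; do 3?[apply: (le_trans (ler_normD _ _)); apply: lerD => //]; rewrite normrM ler_wpM2r//.
  have n1 := normr_ge0 (v (prv u) a' - v (prv u) a); have n2 := normr_ge0 (v u a' - v u a).
  have n3 := normr_ge0 (v (nxt u) a' - v (nxt u) a); have n4 := normr_ge0 z.
  rewrite eeta -/z; set y1 := `|v (prv u) a' - _| in n1 *; set y2 := `|v u a' - _| in n2 *.
  set y3 := `|v (nxt u) a' - _| in n3 *; set y4 := `|z| in n4 *.
  have : 0 <= (3 * M * eta) * (y1 + y2 + y3) by have e0' := ltW eta0; have M0' := ltW M0; apply: mulr_ge0; [apply: mulr_ge0 => //; apply: mulr_ge0|rewrite !addr_ge0].
  clearbody y1 y2 y3 y4 eta; clr; lra.
have veq := smooth_equicont vk; have bE' := smooth_bounded sE'.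
apply: (@smooth_intro _ _ _ _ _ _ (fun _ _ _ => 0) (flat (fun t => derive_on I (v t)))) => //.
- move=> a0 Ia0 e e0; apply: near_pairs_strict; exact: (increment_strict stab veq bE' incr Ia0 e0).
- exact: smooth_cst.
apply: (IH E') => //; try exact: smoothW.
- exact: (increment_bounded stab veq bE' incr).
- by move=> t a Dt Ia; exact: (increment_solution stab veq bE' incr Dt Ia).
Qed.

End linear_systems.

(** * Lifts of functions modulo the integers *)

Section lifts.
Variable R : realType.
Implicit Types (S I : set R) (s g : R -> R).

Definition cont_on S s := forall a, S a -> forall e : R, 0 < e ->
  exists2 d : R, 0 < d & forall b, S b -> `|b - a| < d -> `|s b - s a| <= e.

Lemma cont_onP S s : cont_on S s <-> {within S, continuous s}.
Proof.
split=> [h|/subspace_continuousP h].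
  apply/subspace_continuousP => x Sx; apply/cvgrPdist_le => e e0; apply/withinP.
  by have [d d0 hd] := h x Sx e e0; exists d => // y Sy yx; rewrite distrC; exact: hd.
move=> a Sa e e0; have /cvgrPdist_le/(_ _ e0)/withinP[d d0 hd] := h a Sa.
by exists d => // b Sb ba; rewrite distrC; exact: hd.
Qed.

Lemma cont_on_sub S S' s : S' `<=` S -> cont_on S s -> cont_on S' s.
Proof.
move=> SS h a Sa e e0; have [d d0 hd] := h a (SS _ Sa) e e0; exists d => // b /SS; exact: hd.
Qed.

Lemma cont_onB S s s' : cont_on S s -> cont_on S s' -> cont_on S (fun x => s x - s' x).
Proof.
move=> h h' a Sa e e0; have e2 : 0 < e / 2 by rewrite divr_gt0.
have [d d0 hd] := h a Sa _ e2; have [c c0 hc] := h' a Sa _ e2.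
exists (Num.min d c); first by rewrite lt_min d0.
move=> b Sb; rewrite lt_min => /andP[b1 b2].
have -> : s b - s' b - (s a - s' a) = (s b - s a) - (s' b - s' a) by ring.
rewrite (_ : e = e / 2 + e / 2); last lra.
by apply: (le_trans (ler_normB _ _)); apply: lerD; [exact: hd|exact: hc].
Qed.

Lemma near_int_unique (n k : int) (z : R) : `|z - n%:~R| < 1 / 2 -> `|z - k%:~R| <= 1 / 2 -> n = k.
Proof.
rewrite ltr_norml ler_norml => /andP[h1 h2] /andP[h3 h4].
apply/eqP; rewrite eq_le -!ltzD1 -!(ltr_int R) !intrD; apply/andP; split; lra.
Qed.

(** The increment of [s] is continuous, starts at 0, and cannot take the values [1 / 2] and
    [- (1 / 2)], whose distance to every integer exceeds [e]. *)
Lemma no_jump x y s (e : R) : cont_on [set z | Num.min x y <= z <= Num.max x y] s -> e < 1 / 2 ->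
  (forall z, Num.min x y <= z <= Num.max x y -> exists n : int, `|s z - s x - n%:~R| <= e) ->
  `|s y - s x| <= e.
Proof.
move=> cs e2 h.
have half (c : R) : `|c| = 1 / 2 -> forall n : int, ~ `|c - n%:~R| <= e.
  move=> hc n hn; have h0 : n = 0.
    by apply: (@near_int_unique _ _ c); [apply: le_lt_trans e2|rewrite subr0 hc].
  by move: hn; rewrite h0 subr0 hc; apply/negP; rewrite -ltNge.
have ivt (c : R) : `|c| = 1 / 2 -> ~ (Num.min 0 (s y - s x) <= c <= Num.max 0 (s y - s x)).
  move=> hc hy.
  have xy : Num.min x y <= Num.max x y by rewrite ge_min le_max lexx.
  have [| |z hz zE] := @IVT R s (Num.min x y) (Num.max x y) (s x + c) xy.
  - apply/(cont_onP); apply: cont_on_sub cs => z /=; by rewrite in_itv.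
  - by move: hy; rewrite /Num.min /Num.max; case: (ltP x y) => xy'; case: ltP => ?; case: ltP => ?; lra.
  - have [n hn] := h z hz; apply: (half c hc n); move: hn; rewrite zE.
    by have -> : s x + c - s x - n%:~R = c - n%:~R by ring.
have [n hn] : exists n : int, `|s y - s x - n%:~R| <= e by apply: h; rewrite ge_min le_max lexx !orbT.
have lt1 : `|s y - s x| < 1 / 2.
  rewrite ltNge; apply/negP => ge; have [pos|neg] := leP 0 (s y - s x).
    apply: (ivt (1 / 2)); first by rewrite ger0_norm// divr_ge0.
    by move: ge; rewrite ger0_norm// /Num.min /Num.max; case: ltP => h1 h2; move: h1 h2 pos; clr; lra.
  apply: (ivt (- (1 / 2))); first by rewrite normrN ger0_norm// divr_ge0.
  by move: ge; rewrite ltr0_norm// /Num.min /Num.max; case: ltP => h1 h2; move: h1 h2 neg; clr; lra.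
have n0 : 0 = n by apply: (@near_int_unique _ _ (s y - s x)); [rewrite subr0|exact: le_trans hn (ltW e2)].
by move: hn; rewrite -n0 subr0.
Qed.

Definition is_lift S g s := cont_on S s /\ forall z, S z -> exists n : int, s z = g z + n%:~R.

Definition convex_line I := forall a b c, I a -> I b -> a <= c <= b -> I c.

Lemma lift_unique I g s s' p : convex_line I -> I p -> is_lift I g s -> is_lift I g s' -> s p = s' p ->
  forall x, I x -> s x = s' x.
Proof.
move=> cI Ip [cs hs] [cs' hs'] E x Ix.
have sub z : Num.min p x <= z <= Num.max p x -> I z.
  by rewrite /Num.min /Num.max; case: ltP => _; apply: cI.
have := @no_jump p x (fun z => s z - s' z) 0 (cont_on_sub _ (cont_onB cs cs')).
move=> /(_ sub); rewrite divr_gt0// => /(_ isT); rewrite E subrr subr0 normr_le0 subr_eq0.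
have H : forall z, Num.min p x <= z <= Num.max p x -> exists n : int, `|s z - s' z - 0 - n%:~R| <= 0.
  move=> z /sub Iz; have [n ->] := hs z Iz; have [k ->] := hs' z Iz; exists (n - k).
  by rewrite intrB (_ : _ - _ = 0) ?normr0//; ring.
by move=> /(_ H)/eqP.
Qed.

Definition cont_mod_int I g := forall a, I a -> forall e : R, 0 < e -> exists2 d : R, 0 < d &
  forall b, I b -> `|b - a| < d -> exists n : int, `|g b - g a - n%:~R| <= e.

(** The representative modulo 1 in [[-1/2, 1/2)]; it is continuous as long as its argument stays
    near the integers. *)
Definition frac_part (z : R) : R := z - (Num.floor (z + 1 / 2))%:~R.

Lemma frac_partE (z : R) (n : int) : `|z - n%:~R| <= 1 / 4 -> frac_part z = z - n%:~R.
Proof.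
rewrite ler_norml => h; rewrite /frac_part; congr (_ - _%:~R); apply: floor_def.
by rewrite intrD; move: h; clr; lra.
Qed.

Lemma frac_part_cont (z z' e : R) (n n' k : int) : `|z - n%:~R| <= 1 / 4 -> `|z' - n'%:~R| <= 1 / 4 ->
  e <= 1 / 4 -> `|z - z' - k%:~R| <= e -> `|frac_part z - frac_part z'| <= e.
Proof.
move=> h1 h2 e4 h3; rewrite (frac_partE h1) (frac_partE h2).
have kE : n - n' = k.
  apply/eqP; move: h1 h2 h3; rewrite !ler_norml eq_le -!ltzD1 -!(ltr_int R) !intrD !intrN => *.
  apply/andP; split; lra.
by have -> : z - n%:~R - (z' - n'%:~R) = z - z' - k%:~R by rewrite -kE intrB; ring.
Qed.

Lemma min_lip (a b c : R) : `|Num.min b c - Num.min a c| <= `|b - a|.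
Proof.
have h : - `|b - a| <= b - a <= `|b - a| by rewrite -ler_norml.
rewrite /Num.min ler_norml; case: ltP => h1; case: ltP => h2; move: h h1 h2; clr; lra.
Qed.

Lemma max_lip (a b c : R) : `|Num.max b c - Num.max a c| <= `|b - a|.
Proof.
have h : - `|b - a| <= b - a <= `|b - a| by rewrite -ler_norml.
rewrite /Num.max ler_norml; case: ltP => h1; case: ltP => h2; move: h h1 h2; clr; lra.
Qed.

(** Beyond [c] the function [g] moves by at most [1 / 4] modulo integers, so the centred fractional
    part of its increment is continuous. Truncating the argument at [c] glues both formulas. *)
Lemma lift_step g x c y s : x <= c <= y -> cont_mod_int [set z | x <= z <= y] g ->
  (forall z, c <= z <= y -> exists n : int, `|g z - g c - n%:~R| <= 1 / 4) ->
  is_lift [set z | x <= z <= c] g s ->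
  is_lift [set z | x <= z <= y] g (fun a => s (Num.min a c) + frac_part (g (Num.max a c) - g c)).
Proof.
move=> /andP[xc cy] cg near [cs hs]; split.
  move=> a /= ha e e0; have e2 : 0 < Num.min (e / 2) (1 / 4) by rewrite lt_min !divr_gt0.
  have a1 : [set z | x <= z <= c] (Num.min a c) by rewrite /= /Num.min; case: ltP; move: ha xc cy; clr; lra.
  have a2 : c <= Num.max a c <= y by rewrite /Num.max; case: ltP; move: ha xc cy; clr; lra.
  have a3 : [set z | x <= z <= y] (Num.max a c) by move: a2 xc => /=; clr; lra.
  have [d1 d10 h1] := cs _ a1 _ (divr_gt0 e0 (ltr0n _ 2)).
  have [d2 d20 h2] := cg _ a3 _ e2.
  exists (Num.min d1 d2); first by rewrite lt_min d10.
  move=> b /= hb; rewrite lt_min => /andP[b1 b2].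
  have b1' : [set z | x <= z <= c] (Num.min b c) by rewrite /= /Num.min; case: ltP; move: hb xc cy; clr; lra.
  have b2' : c <= Num.max b c <= y by rewrite /Num.max; case: ltP; move: hb xc cy; clr; lra.
  have b3' : [set z | x <= z <= y] (Num.max b c) by move: b2' xc => /=; clr; lra.
  rewrite opprD addrACA (_ : e = e / 2 + e / 2); last lra.
  apply: (le_trans (ler_normD _ _)); apply: lerD.
    by apply: h1 => //; exact: le_lt_trans (min_lip _ _ _) b1.
  have [k hk] := h2 _ b3' (le_lt_trans (max_lip _ _ _) b2).
  have [n hn] := near _ b2'; have [n' hn'] := near _ a2.
  have [m1 m2] : Num.min (e / 2) (1 / 4) <= e / 2 /\ Num.min (e / 2) (1 / 4) <= 1 / 4.
    by rewrite !ge_min !lexx orbT.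
  apply: le_trans m1; apply: (frac_part_cont hn hn' m2 (k := k)).
  by have -> : g (Num.max b c) - g c - (g (Num.max a c) - g c) - k%:~R = g (Num.max b c) - g (Num.max a c) - k%:~R by ring.
move=> a /= ha; have [ac|ca] := leP a c.
  have xac : x <= a <= c by move: ha ac; clr; lra.
  have [n ->] := hs a xac.
  exists n; rewrite subrr (@frac_partE 0 0) subrr ?normr0 ?divr_ge0//; exact: addr0.
have xcc : x <= c <= c by rewrite xc lexx.
have [n ->] := hs c xcc.
exists (n - Num.floor (g a - g c + 1 / 2)); rewrite /frac_part intrB; ring.
Qed.

Lemma lift_segment g x y : x <= y -> cont_mod_int [set z | x <= z <= y] g ->
  exists s, is_lift [set z | x <= z <= y] g s.
Proof.
move=> xy cg; have fourth : 0 < (1 : R) / 4 by rewrite divr_gt0.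
have [d d0 hd] : exists2 d : R, 0 < d & forall a, x <= a <= y -> forall b, x <= b <= y -> `|b - a| < d ->
    exists n : int, `|g b - g a - n%:~R| <= 1 / 4.
  pose P a (d : R) := x <= a <= y -> forall b, x <= b <= y -> `|b - a| < d -> exists n : int, `|g b - g a - n%:~R| <= 1 / 4.
  have cS : compact [set z | x <= z <= y].
    by have := @segment_compact R x y; congr compact; apply/seteqP; split=> z; rewrite /= in_itv.
  have [|d0 d00 h0] := @compact_uniform R _ [set z | x <= z <= y] P cS.
    move=> a ha; have [d d0 hd] := cg a ha _ (divr_gt0 fourth (ltr0n _ 2)).
    have d2 : 0 < d / 2 by rewrite divr_gt0.
    exists (d / 2) => //; exists (d / 2) => //= z za d' /andP[_ dd'] hz b hb bz.
    have {}za : `|a - z| < d / 2 := za.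
    have za' : `|z - a| < d by rewrite distrC (lt_trans za)// ltr_pdivrMr// ltr_pMr// ltr1n.
    have ba : `|b - a| < d.
      rewrite (_ : b - a = (b - z) - (a - z)); last ring.
      by apply: le_lt_trans (ler_normB _ _) _; move: za bz dd'; clr; lra.
    have [n hn] := hd z hz za'; have [k hk] := hd b hb ba; exists (k - n).
    rewrite intrB (_ : _ - _ = (g b - g a - k%:~R) - (g z - g a - n%:~R)); last ring.
    by apply: (le_trans (ler_normB _ _)); move: hn hk; clr; lra.
  have hd0 : 0 < d0 / 2 < d0 by rewrite divr_gt0//= ltr_pdivrMr// ltr_pMr// ltr1n.
  by exists (d0 / 2) => [|a ha b hb]; [case/andP: hd0|exact: (h0 _ hd0 a ha ha)].
have d2 : 0 < d / 2 by rewrite divr_gt0.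
suff H (N : nat) c : x <= c <= y -> c - x <= N%:R * (d / 2) -> exists s, is_lift [set z | x <= z <= c] g s.
  apply: (H (Num.trunc ((y - x) / (d / 2))).+1); first by rewrite xy lexx.
  by rewrite -ler_pdivrMr//; exact/ltW/truncnS_gt.
elim: N c => [|N IH] c hc.
  rewrite mul0r => cx; have {cx}-> : c = x by apply/le_anti; move: hc cx; clr; lra.
  exists g; split=> [a /= ha e e0|z _]; last by exists 0; rewrite addr0.
  exists 1 => // b /= hb _; have -> : b = a by apply/le_anti; move: ha hb; clr; lra.
  by rewrite subrr normr0 ltW.
rewrite -natr1 mulrDl mul1r => cN; pose c' := Num.max x (c - d / 2).
have [c1 c2 c3 c4] : [/\ x <= c' <= c, c' <= y, c' - x <= N%:R * (d / 2) & c - c' <= d / 2].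
  have N0 : 0 <= N%:R * (d / 2) by rewrite mulr_ge0// ltW.
  by rewrite /c' /Num.max; case: ltP; move: hc cN d2 N0; clr; split; lra.
have [|s hs] := IH c' _ c3; first by move: c1 c2; clr; lra.
exists (fun a => s (Num.min a c') + frac_part (g (Num.max a c') - g c')).
apply: lift_step hs => // [a /= ha e e0|z hz].
  have [|e1 e10 he] := cg a _ e e0; first by move: ha hc; rewrite /=; clr; lra.
  by exists e1 => // b /= hb; apply: he; move: hb hc; rewrite /=; clr; lra.
apply: hd; [by move: c1 c2; clr; lra|by move: hz c1 hc; clr; lra|].
by rewrite ger0_norm; move: hz d0 c4; clr; lra.
Qed.

(** Lifts on segments containing [p], normalized at [p], agree on overlaps by uniqueness; gluing
    them covers intervals that need not be bounded. *)
Lemma lift_exists I g p : convex_line I -> I p -> cont_mod_int I g -> exists s, is_lift I g s.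
Proof.
move=> cI Ip cg.
have seg x : I x -> [set z | Num.min p x <= z <= Num.max p x] `<=` I.
  by move=> Ix z /=; rewrite /Num.min /Num.max; case: ltP => _; apply: cI.
have segL x y : I x -> I y -> x <= p <= y -> exists2 s, is_lift [set z | x <= z <= y] g s & s p = g p.
  move=> Ix Iy xpy; have xy : x <= y by move: xpy; clr; lra.
  have sub : [set z | x <= z <= y] `<=` I by move=> z; exact: cI.
  have [|s [cs hs]] := @lift_segment g x y xy.
    by move=> a /sub Ia e /(cg a Ia)[d d0 hd]; exists d => // b /sub; exact: hd.
  have [n hn] := hs p xpy; exists (fun z => s z - n%:~R); last by rewrite hn addrK.
  split=> [a ha e e0|z /hs[k ->]]; last by exists (k - n); rewrite intrB addrA.
  by have [d d0 hd] := cs a ha e e0; exists d => // b hb ba; rewrite opprB addrA subrK; exact: hd.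
pose P x v := exists l r s, [/\ I l, I r, l <= p <= r, l <= x <= r & is_lift [set z | l <= z <= r] g s /\ s p = g p /\ s x = v].
have Pex x : exists v, I x -> P x v.
  have [Ix|nI] := pselect (I x); last by exists 0.
  have [Im IM] : I (Num.min p x) /\ I (Num.max p x) by rewrite /Num.min /Num.max; case: ltP.
  have [|s sL sp] := segL _ _ Im IM; first by rewrite ge_min le_max lexx.
  by exists (s x) => _; exists (Num.min p x), (Num.max p x), s; split; rewrite // ge_min le_max lexx ?orbT.
have [s hs] := choice Pex.
have agree l r s' x : I l -> I r -> l <= p <= r -> is_lift [set z | l <= z <= r] g s' -> s' p = g p ->
    l <= x <= r -> s x = s' x.
  move=> Il Ir lpr sL sp lxr; have Ix := cI _ _ _ Il Ir lxr.
  have [l' [r' [s'' [Il' Ir' lpr' lxr' [sL' [sp' <-]]]]]] := hs x Ix.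
  have conv : convex_line [set z | Num.max l l' <= z <= Num.min r r'].
    by move=> a b c /= /andP[h1 _] /andP[_ h2] /andP[h3 h4]; rewrite (le_trans h1 h3) (le_trans h4 h2).
  have res t l1 r1 : is_lift [set z | l1 <= z <= r1] g t -> [set z | Num.max l l' <= z <= Num.min r r'] `<=` [set z | l1 <= z <= r1] ->
      is_lift [set z | Num.max l l' <= z <= Num.min r r'] g t.
    by move=> [ct ht] sub; split; [exact: cont_on_sub ct|move=> z /sub/ht].
  apply: (lift_unique conv (p := p) _ (res _ _ _ sL' _) (res _ _ _ sL _)).
  - by rewrite /= ge_max le_min; move: lpr lpr' => /andP[-> ->] /andP[-> ->].
  - by move=> z /=; rewrite ge_max le_min => /andP[/andP[_ ->] /andP[_ ->]].
  - by move=> z /=; rewrite ge_max le_min => /andP[/andP[-> _] /andP[-> _]].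
  - by rewrite sp.
  - by rewrite /= ge_max le_min; move: lxr lxr' => /andP[-> ->] /andP[-> ->].
exists s; split=> [a Ia e e0|z Iz].
  (* Continuity at [a] is read on one segment [[l, r]] that contains a neighbourhood of [a] in [I];
     at an end point of [I] that end itself is [l] or [r]. *)
  have [r [Ir ar [d1 d10 hr]]] : exists r, [/\ I r, a <= r & exists2 d : R, 0 < d & forall b, I b -> b < a + d -> b <= r].
    have [[r [Ir ar]]|no] := pselect (exists r, I r /\ a < r).
      by exists r; split=> //; [exact: ltW|exists (r - a) => [|b _]; rewrite ?subr_gt0// addrC subrK => /ltW].
    exists a; split=> //; exists 1 => // b Ib _; rewrite leNgt; apply/negP => ab; apply: no; by exists b.
  have [l [Il la [d2 d20 hl]]] : exists l, [/\ I l, l <= a & exists2 d : R, 0 < d & forall b, I b -> a - d < b -> l <= b].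
    have [[l [Il la]]|no] := pselect (exists l, I l /\ l < a).
      by exists l; split=> //; [exact: ltW|exists (a - l) => [|b _]; rewrite ?subr_gt0// opprB addrC subrK => /ltW].
    exists a; split=> //; exists 1 => // b Ib _; rewrite leNgt; apply/negP => ab; apply: no; by exists b.
  have Il' : I (Num.min p l) by rewrite /Num.min; case: ltP.
  have Ir' : I (Num.max p r) by rewrite /Num.max; case: ltP.
  have lpr : Num.min p l <= p <= Num.max p r by rewrite ge_min le_max lexx.
  have [s' sL sp] := segL _ _ Il' Ir' lpr.
  have inl b : l <= b <= r -> Num.min p l <= b <= Num.max p r.
    by move=> /andP[h1 h2]; rewrite ge_min le_max h1 h2 !orbT.
  have lar : l <= a <= r by rewrite la ar.
  have [d d0 hd] := sL.1 a (inl a lar) e e0.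
  exists (Num.min d (Num.min d1 d2)); first by rewrite !lt_min d0 d10.
  move=> b Ib; rewrite !lt_min => /and3P[b0 b1 b2].
  have lbr : l <= b <= r.
    by move: b1 b2; rewrite !ltr_norml => /andP[_ h1] /andP[h2 _]; rewrite hl ?hr//; move: h1 h2; clr; lra.
  by rewrite (agree _ _ s' b Il' Ir' lpr sL sp (inl _ lbr)) (agree _ _ s' a Il' Ir' lpr sL sp (inl _ lar)); apply: hd => //; exact: inl.
have [l [r [s' [Il Ir lpr lzr [[_ hs'] [_ <-]]]]]] := hs z Iz; exact: hs'.
Qed.

End lifts.

(** * Boundary coordinates of the orbit points and their continuous lifts *)

Section coordinates.
Variables (R : realType) (m : nat) (al ar : \bar R).
Hypothesis hI : (al < ar)%E.
Variable I : set R.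
Hypothesis defI : I = [set a : R | (al <= a%:E)%E /\ (a%:E <= ar)%E].
Variables (r r' : nat).
Hypothesis hr : (2 <= r)%N.
Hypothesis hr' : (2 <= r')%N.
Variable K : billiard_family R m.
Hypothesis hK : billiard_deformation K r r' I.
Local Notation plane := 'rV[R]_2.
Local Notation pt := (boundary_pt K).

Let Iconv := I_conv defI.
Let table_at := deformation_table hr hK.
Let r_gt0 : (0 < r)%N := ltnW hr.

Lemma pt_periodic i (s a : R) (n : int) : I a -> pt i (s + n%:~R) a = pt i s a.
Proof.
move=> Ia; rewrite /boundary_pt mulrDl; apply: (periodic_int (g := param K i ^~ a)) => u.
exact: (param_periodic hK).
Qed.

Lemma pt_cont i a (s : R) : I a -> plane_cont s (fun x => pt i x a).
Proof.
move=> Ia c; have := has_deriv_cont (unit_param_has_deriv hK c i s r_gt0 Ia) => h.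
apply/cvgrPdist_le => e e0; have [d d0 hd] := h e e0; exists d => //= x xs.
by rewrite distrC -!unit_param0; apply: hd; rewrite // distrC.
Qed.

Lemma pt_inj_mod i a s s' : I a -> pt i s a = pt i s' a -> exists n : int, s' = s + n%:~R.
Proof.
move=> Ia /(param_inj_mod hK Ia)[n hn]; exists n; have l0 := len_gt0 hK i Ia.
by apply: (mulIf (lt0r_neq0 l0)); rewrite hn mulrDl.
Qed.

Lemma floor_cell (s : R) : exists n : int, 0 <= s + n%:~R <= 1.
Proof.
exists (- Num.floor s); have := floor_itv s; rewrite intrD intrN => /andP[h1 h2].
by rewrite subr_ge0 h1 lerBlDr addrC ltW.
Qed.

Lemma unit_square_compact : compact ([set s : R | 0 <= s <= 1] `*` [set s : R | 0 <= s <= 1]).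
Proof.
have h : compact [set s : R | 0 <= s <= 1].
  by have := @segment_compact R 0 1; congr compact; apply/seteqP; split=> z; rewrite /= in_itv.
exact: compact_setX.
Qed.

(** Compactness of a square of periods: near a pair with equal images the parameters agree up to one
    integer, and near any other pair the images stay apart. *)
Lemma pt_inverse_at a0 (e : R) : I a0 -> 0 < e -> exists2 rho : R, 0 < rho & forall i s s',
  enorm (pt i s' a0 - pt i s a0) < rho -> exists n : int, `|s' - s - n%:~R| <= e.
Proof.
move=> Ia0 e0.
apply: finite_uniform => [i d d' /andP[_ dd] h s s' hs|i]; first by apply: h; exact: lt_le_trans hs dd.
pose P (p : R * R) rho := enorm (pt i p.2 a0 - pt i p.1 a0) < rho -> exists n : int, `|p.2 - p.1 - n%:~R| <= e.
have [|d d0 hd] := @compact_uniform R _ _ P unit_square_compact; last first.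
  have d2 : 0 < d / 2 < d by rewrite divr_gt0//= ltr_pdivrMr// ltr_pMr// ltr1n.
  exists (d / 2) => [|s s']; first by case/andP: d2.
  have [n hn] := floor_cell s; have [n' hn'] := floor_cell s'.
  rewrite -(pt_periodic i s n Ia0) -(pt_periodic i s' n' Ia0) => /(hd _ d2 (s + n%:~R, s' + n'%:~R) (conj hn hn')) /=.
  move=> [k hk]; exists (k - n' + n); move: hk; rewrite !intrD intrN.
  by have -> : s' + n'%:~R - (s + n%:~R) - k%:~R = s' - s - (k%:~R - n'%:~R + n%:~R) by ring.
move=> p _; have [E|ne] := eqVneq (pt i p.2 a0) (pt i p.1 a0).
  have [n hn] := pt_inj_mod Ia0 (esym E); exists 1 => //.
  have e2 : 0 < e / 2 by rewrite divr_gt0.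
  exists (ball p.1 (e / 2), ball p.2 (e / 2)) => /=; first by split; exact: nbhsx_ballx.
  move=> [s s'] /= [h1 h2] d _ _; exists n; move: h1 h2; rewrite -!ball_normE /ball_ /= hn.
  rewrite (distrC p.1 s) (distrC (p.1 + n%:~R) s') => h1 h2.
  rewrite (_ : _ - _ = (s' - (p.1 + n%:~R)) - (s - p.1)); last ring.
  by apply: (le_trans (ler_normB _ _)); move: h1 h2; clr; lra.
have D0 : 0 < enorm (pt i p.2 a0 - pt i p.1 a0) by apply: enorm_sub_gt0; rewrite eq_sym.
set dist := enorm _ in D0; exists (dist / 2); first by rewrite divr_gt0.
have c1 : plane_cont p (fun q : R * R => pt i q.1 a0).
  by move=> c; apply: (@continuous_comp _ _ _ fst (fun x => pt i x a0 0 c)); [exact: cvg_fst|exact: pt_cont].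
have c2 : plane_cont p (fun q : R * R => pt i q.2 a0).
  by move=> c; apply: (@continuous_comp _ _ _ snd (fun x => pt i x a0 0 c)); [exact: cvg_snd|exact: pt_cont].
have lt : dist / 2 < dist by rewrite ltr_pdivrMr// ltr_pMr// ltr1n.
have := cont_gt (cont_enorm (plane_contB c2 c1)) lt.
apply: filterS => q hq d /andP[_ dd] h; exfalso.
by have := lt_trans (lt_trans hq h) dd; rewrite ltxx.
Qed.

Lemma pt_inverse a0 (e : R) : I a0 -> 0 < e -> exists2 rho : R, 0 < rho & exists2 d : R, 0 < d &
  forall i s s' a a', I a -> I a' -> `|a - a0| < d -> `|a' - a0| < d ->
  enorm (pt i s' a' - pt i s a) < rho -> exists n : int, `|s' - s - n%:~R| <= e.
Proof.
move=> Ia0 e0; have [rho rho0 h] := pt_inverse_at Ia0 e0.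
have rho3 : 0 < rho / 3 by rewrite divr_gt0.
have [d d0 hd] := pt_near hI defI hr hr' hK Ia0 rho3.
exists (rho / 3) => //; exists d => // i s s' a a' Ia Ia' ad ad' lt; apply: (h i).
have -> : pt i s' a0 - pt i s a0 = (pt i s' a' - pt i s a) - (pt i s' a' - pt i s' a0) + (pt i s a - pt i s a0).
  by apply: planeP; rewrite !mxE; ring.
apply: le_lt_trans (enormD _ _) _; have h1 := hd i s a Ia ad; have h2 := hd i s' a' Ia' ad'.
have := enormD (pt i s' a' - pt i s a) (- (pt i s' a' - pt i s' a0)); rewrite enormN.
by move: lt h1 h2; clr; lra.
Qed.

Local Notation code := (int -> 'I_m).

Definition lifts (xi : code) (s : R -> R) : Prop :=
  cont_on I s /\ forall a, I a -> pt (xi 0) (s a) a = coded_point K xi 0 a.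

Let extremal_at_I a xi (Ia : I a) (xiA : admissible_code xi) :=
  coded_point_extremal_seq hI defI hr hr' hK Ia xiA.

Lemma coded_point_pt a xi j : I a -> admissible_code xi -> exists s, coded_point K xi j a = pt (xi j) s a.
Proof. by move=> Ia xiA; exact: (extremal_pt hr hK j Ia xiA (extremal_at_I Ia xiA)). Qed.

Lemma coded_point_equicont a0 (e : R) : I a0 -> 0 < e -> exists2 d : R, 0 < d & forall a a' xi,
  I a -> I a' -> `|a - a0| < d -> `|a' - a0| < d -> admissible_code xi ->
  enorm (coded_point K xi 0 a' - coded_point K xi 0 a) < e.
Proof.
move=> Ia0 e0; have e2 : 0 < e / 2 by rewrite divr_gt0.
have [d d0 [n h]] := coded_point_close hI defI hr hr' hK Ia0 e2.
exists d => // a a' xi Ia Ia' ad ad' xiA.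
have h1 := h a xi xi Ia ad xiA xiA (fun _ _ => erefl).
have h2 := h a' xi xi Ia' ad' xiA xiA (fun _ _ => erefl).
move: h1 h2; set x := coded_point K xi 0 a; set y := coded_point K xi 0 a'; set z := coded_point K xi 0 a0.
clearbody x y z => h1 h2; have := enormD (y - z) (z - x); rewrite addrA subrK (enorm_distC z).
by move: h1 h2; clr; lra.
Qed.

Lemma coord_mod_int a0 (e : R) : I a0 -> 0 < e -> exists2 d : R, 0 < d & forall xi s s' a a',
  I a -> I a' -> `|a - a0| < d -> `|a' - a0| < d -> admissible_code xi ->
  pt (xi 0) s a = coded_point K xi 0 a -> pt (xi 0) s' a' = coded_point K xi 0 a' ->
  exists n : int, `|s' - s - n%:~R| <= e.
Proof.
move=> Ia0 e0; have [rho rho0 [d d0 h]] := pt_inverse Ia0 e0.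
have [c c0 hc] := coded_point_equicont Ia0 rho0.
exists (Num.min d c); first by rewrite lt_min d0.
move=> xi s s' a a' Ia Ia'; rewrite !lt_min => /andP[a1 a2] /andP[b1 b2] xiA E E'.
by apply: (h (xi 0) s s' a a') => //; rewrite E E'; exact: hc.
Qed.

Lemma lifts_exists xi : admissible_code xi -> exists s, lifts xi s.
Proof.
move=> xiA.
have [|g hg] := @choice R R (fun a s => I a -> pt (xi 0) s a = coded_point K xi 0 a).
  move=> a; have [Ia|nI] := pselect (I a); last by exists 0.
  by have [s hs] := coded_point_pt 0 Ia xiA; exists s.
have [p Ip] : exists p, I p.
  move: hI; rewrite defI; case: al => [x| |]; case: ar => [y| |] //= hxy.
  - by exists x; split; [exact: lexx|exact: ltW].
  - by exists x; split; [exact: lexx|exact: leey].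
  - by exists y; split; [exact: leNye|exact: lexx].
  - by exists 0; split; [exact: leNye|exact: leey].
have [|s [cs hs]] := @lift_exists R I g p Iconv Ip.
  move=> a Ia e e0; have [d d0 h] := coord_mod_int Ia e0.
  exists d => // b Ib ba; apply: (h xi (g a) (g b) a b) => //; try exact: hg.
  by rewrite subrr normr0.
by exists s; split=> // a Ia; have [n ->] := hs a Ia; rewrite pt_periodic// hg.
Qed.

(** The estimate that is uniform in the code holds modulo integers only; a continuous lift cannot
    jump from one integer to another between [a] and [a']. *)
Lemma lifts_equicont a0 (e : R) : I a0 -> 0 < e -> exists2 d : R, 0 < d & forall xi s a a',
  admissible_code xi -> lifts xi s -> I a -> I a' -> `|a - a0| < d -> `|a' - a0| < d ->
  `|s a' - s a| <= e.
Proof.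
move=> Ia0 e0; have e4 : 0 < Num.min e (1 / 4) by rewrite lt_min e0 divr_gt0.
have [m1 m2] : Num.min e (1 / 4) <= e /\ Num.min e (1 / 4) < 1 / 2.
  by rewrite ge_min lexx; split=> //; apply: (@le_lt_trans _ _ (1 / 4)); [rewrite ge_min lexx orbT|lra].
have [d d0 h] := coord_mod_int Ia0 e4.
exists d => // xi s a a' xiA [cs hs] Ia Ia' ad ad'; apply: le_trans m1.
have seg z : Num.min a a' <= z <= Num.max a a' -> I z /\ `|z - a0| < d.
  move: ad ad'; rewrite !ltr_norml /Num.min /Num.max; case: (ltP a a') => aa hd hd' hz.
    by split; [exact: (Iconv Ia Ia' hz)|move: hd hd' hz; clr; lra].
  by split; [exact: (Iconv Ia' Ia hz)|move: hd hd' hz; clr; lra].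
apply: no_jump => // [|z /seg[Iz zd]]; first by apply: cont_on_sub cs => z /seg[].
by apply: (h xi (s a) (s z) a z) => //; exact: hs.
Qed.

Lemma obst_dist a0 : I a0 -> exists2 c : R, 0 < c & forall i j x y, i != j ->
  obst K i a0 x -> obst K j a0 y -> c <= enorm (y - x).
Proof.
move=> Ia0; have tb := table_at Ia0.
suff [c c0 h] : exists2 c : R, 0 < c & forall (t : 'I_m * 'I_m), (fun t d => t.1 != t.2 -> forall x y,
    obst K t.1 a0 x -> obst K t.2 a0 y -> d <= enorm (y - x)) t c.
  by exists c => // i j x y ij; exact: (h (i, j) ij).
apply: finite_uniform => [t d d' /andP[_ dd] h ij x y hx hy|[i j]]; first exact: le_trans dd (h ij x y hx hy).
case: (boolP (i != j)) => ij; last by exists 1 => //= h; rewrite h in ij.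
have cA : compact (obst K i a0 `*` obst K j a0) by apply: compact_setX; exact: (tb_compact tb).
have [|c c0 h] := @compact_pos_lb R _ _ (fun p : plane * plane => enorm (p.2 - p.1)) cA.
  move=> p [p1 p2]; split; last by apply: enorm_sub_gt0; exact: (tb_neq tb ij).
  apply: cont_enorm; apply: plane_contB => c.
    by apply: continuous_comp (@coord_continuous _ _ _ 0 c _); exact: cvg_snd.
  by apply: continuous_comp (@coord_continuous _ _ _ 0 c _); exact: cvg_fst.
by exists c => // _ x y hx hy; exact: (h (x, y)).
Qed.

(** Keeps the normal component of the velocity away from 0 for all orbits. The gap estimate requires
    a point of the obstacle far from [y]: since [rho] is at most half the distance between the
    boundary points with parameters [0] and [1 / 2], one of these two will do. *)
Lemma extremal_turn a0 : I a0 -> exists2 c : R, 0 < c & forall i j k x y z, i != j -> j != k ->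
  obst K i a0 x -> obst K k a0 z -> extremal_at K a0 j x y z -> c <= enorm (dir y z - dir x y).
Proof.
move=> Ia0; have tb := table_at Ia0.
have [M M0 hM] := pt_bounded hI defI hr hr' hK Ia0.
have [rho rho0 hrho] : exists2 rho : R, 0 < rho & forall i : 'I_m,
    (fun i d => 2 * d <= enorm (pt i 0 a0 - pt i (1 / 2) a0)) i rho.
  apply: finite_uniform => [i d d' /andP[_ dd] h|i]; first by apply: le_trans h; rewrite ler_pM2l.
  have D : 0 < enorm (pt i 0 a0 - pt i (1 / 2) a0).
    apply: enorm_sub_gt0; apply/eqP => /(pt_inj_mod Ia0)[n hn].
    have nE : n%:~R = - (1 / 2) :> R by apply: (addrI (1 / 2)); rewrite -hn subrr.
    have h0 : 0 = n.
      by apply: (@near_int_unique R _ _ (- (1 / 4))); [rewrite ltr_norml; lra|rewrite nE ler_norml; lra].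
    by move: nE; rewrite -h0; lra.
  by exists (enorm (pt i 0 a0 - pt i (1 / 2) a0) / 2); [rewrite divr_gt0|rewrite mulrC divfK].
have [mu mu0 gap] := extremal_gap tb rho0.
exists (mu / (2 * M)); first by rewrite divr_gt0// mulr_gt0.
move=> i j k x y z ij jk ix kz ext.
have [u [yE _ _ _ _]] := extremal_reflection tb ij jk ix kz ext; rewrite (pt_param hK)// in yE.
have [w [jw far bw]] : exists w, [/\ obst K j a0 w, rho <= enorm (w - y) & enorm (w - y) <= 2 * M].
  have dM t t' : enorm (pt j t a0 - pt j t' a0) <= 2 * M.
    by apply: (le_trans (enormD _ _)); rewrite enormN mulr_natl mulr2n lerD.
  have tri := enormD (pt j 0 a0 - y) (y - pt j (1 / 2) a0).
  rewrite addrA subrK in tri; have := hrho j.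
  have [h1|h1] := leP rho (enorm (pt j 0 a0 - y)) => h2.
    by exists (pt j 0 a0); split=> //; [exact: (param_mem hK)|rewrite yE].
  exists (pt j (1 / 2) a0); split; [exact: (param_mem hK)| |by rewrite yE].
  by rewrite enorm_distC; move: tri h1 h2; clr; lra.
have g := gap _ _ _ _ _ _ _ ij jk ix kz ext jw far.
rewrite ler_pdivrMr ?mulr_gt0//; apply: (le_trans g); apply: (le_trans (ler_norm _)).
by rewrite normrN; exact: dotp_le.
Qed.

(** The curvature times [len ^+ 3], since the rescaled curve has speed [len]. *)
Definition curv (i : 'I_m) (s a : R) : R :=
  unit_param K 1 0 i s a * unit_param K 2 1 i s a - unit_param K 1 1 i s a * unit_param K 2 0 i s a.

Lemma unit_param_smooth0 k c : (k <= 2)%N -> smooth I (whole I (T := 'I_m)) 0 (unit_param K k c).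
Proof.
move=> k2; apply: (unit_param_smooth hI defI hr hr' hK); rewrite addn0 leq_min.
by rewrite (leq_trans k2 hr) (leq_trans k2 hr').
Qed.

Lemma curv_smooth : smooth I (whole I (T := 'I_m)) 0 curv.
Proof. by apply: smoothB; apply: smoothM; exact: unit_param_smooth0. Qed.

Lemma curv_gt0 a0 : I a0 -> exists2 c : R, 0 < c & forall i s, c <= curv i s a0.
Proof.
move=> Ia0.
suff [c c0 h] : exists2 c : R, 0 < c & forall i : 'I_m, (fun i d => forall s, 0 <= s <= 1 -> d <= curv i s a0) i c.
  exists c => // i s; have [n hn] := floor_cell s; have := h i _ hn.
  by rewrite /curv !(unit_param_periodic hK _ _ _ _ _ Ia0).
apply: finite_uniform => [i d d' /andP[_ dd] h s hs|i]; first exact: le_trans dd (h s hs).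
have cA : compact [set s : R | 0 <= s <= 1].
  by have := @segment_compact R 0 1; congr compact; apply/seteqP; split=> z; rewrite /= in_itv.
have [|c c0 h] := @compact_pos_lb R _ _ (curv i ^~ a0) cA; last by exists c => // s; exact: h.
move=> s _; split.
  apply/cvgrPdist_le => e e0; have [d d0 hd] := smooth_equicont curv_smooth Ia0 e0.
  exists d => //= x xs; rewrite distrC; apply: (hd i s a0 x a0) => //; rewrite ?subrr ?normr0//.
  by rewrite distrC.
have l0 := len_gt0 hK i Ia0.
have [_ cv] := obst_strictly_convex hK i Ia0.
have := cv (s * len K i a0); rewrite /det2 /curv /unit_param expr1 => h.
set l := len K i a0 in l0 h *; set g1 := derive1n 1 _ _ in h *; set g2 := derive1n 2 _ _ in h *.
clearbody l g1 g2.
have -> : l * g1 0 0 * (l ^+ 2 * g2 0 1) - l * g1 0 1 * (l ^+ 2 * g2 0 0) = l ^+ 3 * (g1 0 0 * g2 0 1 - g1 0 1 * g2 0 0) by ring.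
by rewrite mulr_gt0// exprn_gt0.
Qed.

End coordinates.

(** * The linearized reflection law *)

(* The differential of [dotp v w / enorm v] in the direction of [(l, k)]. *)
Definition unit_dot_diff (R : realType) (v0 v1 w0 w1 l0 l1 k0 k1 : R) : R :=
  let i := (Num.sqrt (v0 * v0 + v1 * v1))^-1 in
  (l0 * w0 + l1 * w1 + v0 * k0 + v1 * k1) * i
  - (v0 * w0 + v1 * w1) * (v0 * l0 + v1 * l1) * i ^+ 3.

Section unit_dot.
Variables (R : realType) (Y : Type) (F : set_system Y) (FF : Filter F) (N : Y -> R).
Hypothesis N0 : forall e : R, 0 < e -> \forall y \near F, 0 <= N y <= e.
Local Notation expansion := (expansion F N).

Lemma expansion_unit_dot (c : R) (v0 v1 w0 w1 v0' v1' w0' w1' l0 l1 k0 k1 : Y -> R) : 0 < c ->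
  (\forall y \near F, c <= v0' y * v0' y + v1' y * v1' y /\ c <= v0 y * v0 y + v1 y * v1 y) ->
  expansion v0' v0 l0 -> expansion v1' v1 l1 -> expansion w0' w0 k0 -> expansion w1' w1 k1 ->
  expansion (fun y => (v0' y * w0' y + v1' y * w1' y) * (Num.sqrt (v0' y * v0' y + v1' y * v1' y))^-1)
    (fun y => (v0 y * w0 y + v1 y * w1 y) * (Num.sqrt (v0 y * v0 y + v1 y * v1 y))^-1)
    (fun y => unit_dot_diff (v0 y) (v1 y) (w0 y) (w1 y) (l0 y) (l1 y) (k0 y) (k1 y)).
Proof.
move=> c0 hc E1 E2 E3 E4.
pose proof (expansionD (expansionM N0 E1 E3) (expansionM N0 E2 E4)) as P.
pose proof (expansionD (expansionM N0 E1 E1) (expansionM N0 E2 E2)) as Q.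
pose proof (expansion_sqrt N0 c0 hc Q) as S.
have c'0 : 0 < Num.sqrt c by rewrite sqrtr_gt0.
have hS : \forall y \near F, Num.sqrt c <= Num.sqrt (v0' y * v0' y + v1' y * v1' y) /\
    Num.sqrt c <= Num.sqrt (v0 y * v0 y + v1 y * v1 y).
  by apply: filterS hc => y [h1 h2]; split; apply: ler_wsqrtr.
pose proof (expansionM N0 P (expansionV N0 c'0 hS S)) as H; move: H.
apply: expansion_eq => // y /=; rewrite /unit_dot_diff invfM.
set i := (Num.sqrt _)^-1; clearbody i; by field.
Qed.

End unit_dot.

(** The variation of a unit vector is perpendicular to it: the first product pairs the perpendicular
    components of the variation [l] and of [w], the rest is the unit vector against [k]. *)
Lemma unit_dot_diffE (R : realType) (v0 v1 w0 w1 l0 l1 k0 k1 : R) : 0 < v0 * v0 + v1 * v1 ->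
  let i := (Num.sqrt (v0 * v0 + v1 * v1))^-1 in
  unit_dot_diff v0 v1 w0 w1 l0 l1 k0 k1 =
  i * (- (v1 * i) * l0 + v0 * i * l1) * (- (v1 * i) * w0 + v0 * i * w1) + (v0 * i * k0 + v1 * i * k1).
Proof.
move=> q0 i; rewrite /unit_dot_diff -/i.
have h : i * i * (v0 * v0 + v1 * v1) = 1.
  have s0 : 0 < Num.sqrt (v0 * v0 + v1 * v1) by rewrite sqrtr_gt0.
  have := sqr_sqrtr (ltW q0); rewrite /i; set S := Num.sqrt _ in s0 *; clearbody S => <-.
  by field; exact: lt0r_neq0.
clearbody i; transitivity ((l0 * w0 + l1 * w1) * i * (i * i * (v0 * v0 + v1 * v1)) + (v0 * k0 + v1 * k1) * i
   - (v0 * w0 + v1 * w1) * (v0 * l0 + v1 * l1) * i ^+ 3); first by rewrite h; ring.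
ring.
Qed.

(** The left side is the linearized reflection law in the increments [x], [y], [z] of the previous,
    current and next coordinate and [w] of the deformation parameter. The hypotheses evaluate the
    components of the three tangents perpendicular to the adjacent directions, and so produce the
    products of normal components in the coefficients. *)
Lemma tridiag_form (R : realType) (e0 e1 ep0 ep1 W0 W1 Wp0 Wp1 Wn0 Wn1 om omp omn i ip
    b0 b1 bp0 bp1 bn0 bn1 k0 k1 d0 d1 x y z w : R) :
  - ep1 * W0 + ep0 * W1 = - om -> - e1 * W0 + e0 * W1 = om ->
  - ep1 * Wp0 + ep0 * Wp1 = omp -> - e1 * Wn0 + e0 * Wn1 = - omn ->
  ip * (- ep1 * (W0 * y + b0 * w - (Wp0 * x + bp0 * w)) + ep0 * (W1 * y + b1 * w - (Wp1 * x + bp1 * w)))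
     * (- ep1 * W0 + ep0 * W1) + (ep0 * (k0 * y + d0 * w) + ep1 * (k1 * y + d1 * w))
  - (i * (- e1 * (Wn0 * z + bn0 * w - (W0 * y + b0 * w)) + e0 * (Wn1 * z + bn1 * w - (W1 * y + b1 * w)))
     * (- e1 * W0 + e0 * W1) + (e0 * (k0 * y + d0 * w) + e1 * (k1 * y + d1 * w))) =
  omp * om * ip * x + (om * om * (ip + i) + ((ep0 - e0) * k0 + (ep1 - e1) * k1)) * y + omn * om * i * z
  + (- (om * (ip * (- ep1 * (b0 - bp0) + ep0 * (b1 - bp1)) + i * (- e1 * (bn0 - b0) + e0 * (bn1 - b1))))
     + ((ep0 - e0) * d0 + (ep1 - e1) * d1)) * w.
Proof.
move=> h1 h2 h3 h4.
have -> : - ep1 * (W0 * y + b0 * w - (Wp0 * x + bp0 * w)) + ep0 * (W1 * y + b1 * w - (Wp1 * x + bp1 * w)) =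
  (- ep1 * W0 + ep0 * W1) * y - (- ep1 * Wp0 + ep0 * Wp1) * x + (- ep1 * (b0 - bp0) + ep0 * (b1 - bp1)) * w by ring.
have -> : - e1 * (Wn0 * z + bn0 * w - (W0 * y + b0 * w)) + e0 * (Wn1 * z + bn1 * w - (W1 * y + b1 * w)) =
  (- e1 * Wn0 + e0 * Wn1) * z - (- e1 * W0 + e0 * W1) * y + (- e1 * (bn0 - b0) + e0 * (bn1 - b1)) * w by ring.
by rewrite h1 h2 h3 h4; ring.
Qed.

(** With the weights [o^-1] the free-flight part of the diagonal cancels exactly against the two
    neighbours. The surplus is the curvature term, positive because the obstacles are strictly
    convex. *)
Lemma dominance (R : realType) (o op on i ip l2 cv ck co Mo L MB : R) :
  0 < co -> 0 < ck -> co <= o -> co <= op -> co <= on -> o <= Mo -> 0 < MB -> 0 < i -> 0 < ip ->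
  0 < l2 -> l2 <= L -> ck <= cv ->
  Mo^-1 <= o^-1 <= co^-1 + MB /\
  2 * ck / L + `|op * o * ip| * op^-1 + `|on * o * i| * on^-1 <=
    (o * o * (ip + i) + 2 * o / l2 * cv) * o^-1.
Proof.
move=> co0 ck0 w1 w2 w3 oM MB0 i1 i2 l20 lL hc.
have p1 := lt_le_trans co0 w1; have p2 := lt_le_trans co0 w2; have p3 := lt_le_trans co0 w3.
have Mo0 := lt_le_trans p1 oM.
have h1 : Mo^-1 <= o^-1 by rewrite lef_pV2.
have h2 : o^-1 <= co^-1 by rewrite lef_pV2.
split; first by rewrite h1 (le_trans h2)// lerDl ltW.
have e1 : 0 < op * o * ip by rewrite !mulr_gt0.
have e2 : 0 < on * o * i by rewrite !mulr_gt0.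
rewrite (gtr0_norm e1) (gtr0_norm e2).
have -> : (o * o * (ip + i) + 2 * o / l2 * cv) / o = 2 * cv / l2 + op * o * ip / op + on * o * i / on.
  by field; rewrite !lt0r_neq0.
rewrite -!addrA lerD2r.
have ck2 : 0 <= 2 * ck by rewrite mulr_ge0// ltW.
have L0 := lt_le_trans l20 lL.
have Li : 0 <= L^-1 by rewrite invr_ge0 ltW.
apply: ler_pM ck2 Li _ _; first by rewrite ler_pM2l.
by rewrite lef_pV2.
Qed.

(** * Regularity of the lifts, uniformly over the codes *)

Section smoothness.
Variables (R : realType) (m : nat) (al ar : \bar R).
Hypothesis hI : (al < ar)%E.
Variable I : set R.
Hypothesis defI : I = [set a : R | (al <= a%:E)%E /\ (a%:E <= ar)%E].
Variables (r r' : nat).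
Hypothesis hr : (2 <= r)%N.
Hypothesis hr' : (2 <= r')%N.
Variable K : billiard_family R m.
Hypothesis hK : billiard_deformation K r r' I.
Local Notation plane := 'rV[R]_2.
Local Notation N := (minn r r').
Local Notation code := (int -> 'I_m).

Let N2 : (2 <= N)%N. Proof. by rewrite leq_min hr hr'. Qed.

(** Names the derivatives in [a]. The [s]-derivatives provided by smoothness coincide with
    [unit_param K k.+1], by uniqueness along the line. *)
Lemma unit_param_strict : exists ua : nat -> 'I_2 -> 'I_m -> R -> R -> R, forall k c, (k <= 1)%N ->
  strict_diff I (whole I (T := 'I_m)) (unit_param K k c) (unit_param K k.+1 c) (ua k c) /\
  forall n, (k.+1 + n <= N)%N -> smooth I (whole I (T := 'I_m)) n (ua k c).
Proof.
suff h k c : exists u : 'I_m -> R -> R -> R, (k <= 1)%N ->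
  strict_diff I (whole I (T := 'I_m)) (unit_param K k c) (unit_param K k.+1 c) u /\
  forall n, (k.+1 + n <= N)%N -> smooth I (whole I (T := 'I_m)) n u.
  pose f k c := projT1 (cid (h k c)); exists f => k c; exact: (projT2 (cid (h k c))).
have [k1|k1] := leqP k 1; last by exists (fun _ _ _ => 0).
have kN : (k + (N - k.+1).+1 <= N)%N by rewrite addnS -addSn subnKC// (leq_trans _ N2).
have [_ [fs [fa [sd _ sa]]]] := unit_param_smooth hI defI hr hr' hK c kN.
exists fa => _; split=> [|n hn]; last by apply: smooth_le sa; rewrite -(leq_add2l k.+1) subnKC// (leq_trans _ N2).
apply: (strict_diff_ext _ _ _ (sd)) => // i s a Ia.
have h1 := @strict_diff_ds _ _ _ _ _ _ _ i s a Ia Ia sd.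
have kr : (k < r)%N by apply: leq_trans hr.
apply: has_deriv_unique (unit_param_has_deriv hK c i s kr Ia); last first.
  by apply: has_deriv_sub h1 => x _.
by move=> d d0; exists (s + d / 2); split=> //; [rewrite -subr_eq0 addrC addKr; lra|rewrite addrC addKr gtr0_norm; lra].
Qed.

Variable ua : nat -> 'I_2 -> 'I_m -> R -> R -> R.
Hypothesis ua_strict : forall k c, (k <= 1)%N ->
  strict_diff I (whole I (T := 'I_m)) (unit_param K k c) (unit_param K k.+1 c) (ua k c) /\
  forall n, (k.+1 + n <= N)%N -> smooth I (whole I (T := 'I_m)) n (ua k c).

Variable sl : code -> R -> R.
Hypothesis hsl : forall xi, admissible_code xi -> lifts I K xi (sl xi).

Let D : code -> Prop := @admissible_code m.
Definition prv (t : code) : code := fun j => t (j + - 1).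
Definition nxt (t : code) : code := fun j => t (j + 1).

Let Dp t : D t -> D (prv t). Proof. exact: admissible_shift. Qed.
Let Dn t : D t -> D (nxt t). Proof. exact: admissible_shift. Qed.
Lemma nxt_prv t : nxt (prv t) = t. Proof. by apply/funext => j; rewrite /nxt /prv addrK. Qed.
Lemma prv_nxt t : prv (nxt t) = t. Proof. by apply/funext => j; rewrite /nxt /prv subrK. Qed.

Local Notation E := (slice I D).

(** For the orbit with code [t]: [U k] and [Ua k] are the [k]-th derivative of the boundary curve at
    the point of index 0 and the [a]-derivative of this jet, [V] is the step to the next point, [il]
    its inverse length, [e] its direction, and [om] the boundary length times the normal component
    of the velocity. Only index 0 occurs: other points are reached by shifting the code. *)
Let U k c (t : code) a := unit_param K k c (t 0) (sl t a) a.
Let Ua k c (t : code) a := ua k c (t 0) (sl t a) a.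
Let V c (t : code) a := U 0 c (nxt t) a - U 0 c t a.
Let Q (t : code) a := V 0 t a * V 0 t a + V 1 t a * V 1 t a.
Let il (t : code) a := (Num.sqrt (Q t a))^-1.
Let e c (t : code) a := V c t a * il t a.
Let om (t : code) a := - e 1 t a * U 1 0 t a + e 0 t a * U 1 1 t a.

Lemma U0_coded c t a : D t -> I a -> U 0 c t a = coded_point K t 0 a 0 c.
Proof. by move=> Dt Ia; rewrite /U unit_param0 (hsl Dt).2. Qed.

Lemma V_coded c t a : D t -> I a -> V c t a = (coded_point K t 1 a - coded_point K t 0 a) 0 c.
Proof.
move=> Dt Ia; rewrite /V !U0_coded//; last exact: Dn.
by rewrite (coded_point_shift hI defI hr hr' hK 0 1 Ia Dt) add0r !mxE.
Qed.

Lemma Q_coded t a : D t -> I a -> Q t a = enorm (coded_point K t 1 a - coded_point K t 0 a) ^+ 2.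
Proof. by move=> Dt Ia; rewrite enorm_sqr -!V_coded// !expr2. Qed.

Lemma e_coded c t a : D t -> I a -> e c t a = dir (coded_point K t 0 a) (coded_point K t 1 a) 0 c.
Proof.
move=> Dt Ia; rewrite /e /il Q_coded// V_coded// sqrtr_sqr ger0_norm ?enorm_ge0// /dir.
by move: (coded_point K t 1 a) (coded_point K t 0 a) => x y; rewrite [RHS]mxE mulrC.
Qed.

Lemma coded_prv t j a : D t -> I a -> coded_point K (prv t) j a = coded_point K t (j - 1) a.
Proof. by move=> Dt Ia; exact: (coded_point_shift hI defI hr hr' hK j (-1) Ia Dt). Qed.

(** [lam / 2] is the normal component of the outgoing velocity. The last clause expresses the jump
    of the direction through the rescaled tangent: applied to this tangent it gives the scalar
    reflection law, applied to the second derivatives the curvature term of the diagonal. *)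
Lemma reflection_law t a : D t -> I a -> exists lam : R,
  [/\ 0 < lam, om t a = len K (t 0) a * lam / 2,
      lam = enorm (dir (coded_point K t 0 a) (coded_point K t 1 a) - dir (coded_point K t (-1) a) (coded_point K t 0 a)),
      - e 1 (prv t) a * U 1 0 t a + e 0 (prv t) a * U 1 1 t a = - om t a &
      [/\ U 1 0 t a ^+ 2 + U 1 1 t a ^+ 2 = len K (t 0) a ^+ 2 &
        forall q0 q1, (e 0 (prv t) a - e 0 t a) * q0 + (e 1 (prv t) a - e 1 t a) * q1 =
        2 * om t a / len K (t 0) a ^+ 2 * (U 1 0 t a * q1 - U 1 1 t a * q0)]].
Proof.
move=> Dt Ia; have tb := deformation_table hr hK Ia.
have [u [yE nE lam0 en epn]] := extremal_seq_reflection tb Dt (coded_point_extremal_seq hI defI hr hr' hK Ia Dt) 0.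
rewrite add0r in nE lam0 en epn; rewrite sub0r in nE lam0 en epn.
have E0 := e_coded 0 Dt Ia; have E1 := e_coded 1 Dt Ia.
have F0 := e_coded 0 (Dp Dt) Ia; have F1 := e_coded 1 (Dp Dt) Ia.
rewrite !coded_prv// sub0r subrr in F0 F1.
have [lam lamE] : exists l, l = enorm (dir (coded_point K t 0 a) (coded_point K t 1 a) - dir (coded_point K t (-1) a) (coded_point K t 0 a)) by eexists.
rewrite -lamE in nE lam0 en epn.
have nn : outer_normal K (t 0) u a = outer_normal K (t 0) (sl t a * len K (t 0) a) a.
  by apply: (tb_normal tb); rewrite -yE -(hsl Dt).2.
have l0 := len_gt0 hK (t 0) Ia.
have UT c : U 1 c t a = len K (t 0) a * tangent K (t 0) (sl t a * len K (t 0) a) a 0 c.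
  by rewrite /U /unit_param expr1 tangentE.
have T1 := tangent_norm hK (t 0) (sl t a * len K (t 0) a) Ia.
rewrite nn /outer_normal in nE en epn.
move: T1 nE en epn E0 E1 F0 F1 lamE; rewrite /om !UT.
move: (dir _ _) (dir _ _) (tangent _ _ _ _) => f g T T1 nE en epn E0 E1 F0 F1 lamE; rewrite E0 E1 F0 F1.
rewrite !dotpE !mxE /= in en epn.
have n0 := congr1 (fun v : plane => v 0 0) nE; have n1 := congr1 (fun v : plane => v 0 1) nE.
rewrite !mxE /= in n0 n1.
move: l0; set l := len K (t 0) a => l0; set T0 := T 0 0 in n0 n1 en epn *; set T1' := T 0 1 in n0 n1 en epn *.
have TT : T0 ^+ 2 + T1' ^+ 2 = 1 by rewrite -enorm_sqr T1 expr1n.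
exists lam; move: n0 n1 en epn TT.
set f0 := f 0 0; set f1 := f 0 1; set g0 := g 0 0; set g1 := g 0 1.
rewrite -lamE.
clearbody T0 T1' f0 f1 g0 g1 l; rewrite opprK => n0 n1 en epn TT.
have om' : - g1 * (l * T0) + g0 * (l * T1') = l * lam / 2 by rewrite -mulrA -en; ring.
have omp : - f1 * (l * T0) + f0 * (l * T1') = - (l * lam / 2) by rewrite -mulrA -mulrN -epn; ring.
rewrite om' omp; split; [exact: lam0|reflexivity|reflexivity|reflexivity|split].
  by rewrite !exprMn -mulrDr TT mulr1.
move=> q0 q1; rewrite -(opprB g0) n0 -(opprB g1) n1; field; exact: lt0r_neq0.
Qed.

Lemma smooth0_pos f : smooth I E 0 (flat f) ->
  (forall a0, I a0 -> exists2 c : R, 0 < c & forall t, D t -> c <= f t a0) -> fibre_pos I E (flat f).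
Proof.
move=> sf h a0 Ia0; have [c c0 hc] := h _ Ia0; have c2 : 0 < c / 2 by rewrite divr_gt0.
have [d d0 hd] := smooth_near Ia0 c2 sf.
exists (c / 2) => //; apply/(near_pairsP I D a0 (fun t a _ => c / 2 <= f t a)); exists d => // t a _ Dt Ia _ ad _.
have := hd t a0 a Dt Ia0 Ia; rewrite subrr normr0 => /(_ d0 ad); have := hc t Dt.
by rewrite ler_norml; clr; lra.
Qed.

Lemma fibre_pos_shift (sh : code -> code) f : (forall t, D t -> D (sh t)) -> fibre_pos I E (flat f) ->
  fibre_pos I E (flat (fun t => f (sh t))).
Proof.
move=> Dsh h a0 Ia0; have [c c0 [d d0 hd]] := h _ Ia0; exists c => //; exists d => //.
by move=> t s a s' a' [Dt Ia Es] [_ Ia' Es']; apply: (hd (sh t) s a s' a'); split=> //; exact: Dsh.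
Qed.

Section class_k.
Variable k : nat.
Hypothesis sk : smooth_mod_cst I E k (flat sl).

Lemma U_smooth j c : (j + k <= N)%N -> smooth I E k (flat (U j c)).
Proof.
move=> jk; have h := unit_param_smooth hI defI hr hr' hK c jk.
by apply: (@smooth_comp _ _ _ _ _ E (fun t : code => t 0) _ _ _ _ h sk) => t s a [].
Qed.

Lemma Ua_smooth j c : (j <= 1)%N -> (j.+1 + k <= N)%N -> smooth I E k (flat (Ua j c)).
Proof.
move=> j1 jk; have h := (ua_strict c j1).2 _ jk.
by apply: (@smooth_comp _ _ _ _ _ E (fun t : code => t 0) _ _ _ _ h sk) => t s a [].
Qed.

Lemma V_smooth c : (k <= N)%N -> smooth I E k (flat (V c)).
Proof. by move=> kN; have h := @U_smooth 0 c kN; exact: (smoothB (smooth_shift Dn h) h). Qed.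

Lemma Q_smooth : (k <= N)%N -> smooth I E k (flat Q).
Proof.
move=> kN; have h0 := V_smooth 0 kN; have h1 := V_smooth 1 kN.
exact: (smoothD (smoothM h0 h0) (smoothM h1 h1)).
Qed.

End class_k.

Lemma sl_equicont : smooth_mod_cst I E 0 (flat sl).
Proof.
split=> //; apply/flat_equicontP => a0 Ia0 e0 e00.
have [d d0 h] := lifts_equicont hI defI hr hr' hK Ia0 e00.
by exists d => // t a a' Dt Ia Ia' ad ad'; apply: (h t (sl t)) => //; exact: hsl.
Qed.

Lemma Q_pos : fibre_pos I E (flat Q).
Proof.
apply: smooth0_pos (Q_smooth sl_equicont (leq0n _)) _ => a0 Ia0.
have [c c0 h] := obst_dist hr hK Ia0; exists (c ^+ 2) => [|t Dt]; first by rewrite exprn_gt0.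
rewrite Q_coded// ler_pXn2r ?nnegrE ?(ltW c0) ?enorm_ge0//.
have XE := coded_point_extremal_seq hI defI hr hr' hK Ia0 Dt.
exact: (h _ _ _ _ (Dt 0) (XE 0).1 (XE 1).1).
Qed.

Section class_k'.
Variable k : nat.
Hypothesis sk : smooth_mod_cst I E k (flat sl).

Lemma il_smooth : (k <= N)%N -> smooth I E k (flat il).
Proof.
move=> kN; have h := smooth_sqrt Q_pos (Q_smooth sk kN); apply: smoothV h => a0 Ia0.
have [c c0 hc] := Q_pos Ia0; exists (Num.sqrt c); first by rewrite sqrtr_gt0.
by apply: filterS hc => y; exact: ler_wsqrtr.
Qed.

Lemma e_smooth c : (k <= N)%N -> smooth I E k (flat (e c)).
Proof. by move=> kN; exact: (smoothM (V_smooth sk c kN) (il_smooth kN)). Qed.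

Lemma om_smooth : (1 + k <= N)%N -> smooth I E k (flat om).
Proof.
move=> kN; have kN' := ltnW kN.
exact: (smoothD (smoothM (smoothN (e_smooth 1 kN')) (U_smooth sk 0 kN)) (smoothM (e_smooth 0 kN') (U_smooth sk 1 kN))).
Qed.

End class_k'.

Lemma om_pos : fibre_pos I E (flat om).
Proof.
apply: smooth0_pos (om_smooth sl_equicont _) _; first by rewrite addn0 (leq_trans _ N2).
move=> a0 Ia0; have [c c0 h] := extremal_turn hI defI hr hr' hK Ia0.
have [l l0 hl] : exists2 l : R, 0 < l & forall i, (fun i l => l <= len K i a0) i l.
  apply: finite_uniform => [i d d' /andP[_ dd] h'|i]; first exact: le_trans dd h'.
  by exists (len K i a0); first exact: (len_gt0 hK i Ia0).
exists (l * c / 2) => [|t Dt]; first by rewrite divr_gt0// mulr_gt0.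
have [lam [lam0 -> lamE _ _]] := reflection_law Dt Ia0.
rewrite ler_wpM2r ?invr_ge0//; apply: ler_pM; [exact: ltW|exact: ltW|exact: hl|].
have XE := coded_point_extremal_seq hI defI hr hr' hK Ia0 Dt.
rewrite lamE; apply: (h _ _ _ _ _ _ (admissible_pred 0 Dt) (Dt 0) (XE (0 - 1)).1 (XE (0 + 1)).1).
by have := XE 0; rewrite sub0r add0r.
Qed.

(** The coefficients and the source of the system delivered by [tridiag_form]. [crv] is the
    curvature term; [P] is the component, across the direction of flight, of the relative motion of
    two consecutive points caused by the deformation. *)
Let crv (t : code) a := (e 0 (prv t) a - e 0 t a) * U 2 0 t a + (e 1 (prv t) a - e 1 t a) * U 2 1 t a.
Let P (t : code) a := - e 1 t a * (Ua 0 0 (nxt t) a - Ua 0 0 t a) + e 0 t a * (Ua 0 1 (nxt t) a - Ua 0 1 t a).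
Let cA (t : code) a := om (prv t) a * om t a * il (prv t) a.
Let cB (t : code) a := om t a * om t a * (il (prv t) a + il t a) + crv t a.
Let cC (t : code) a := om (nxt t) a * om t a * il t a.
Let cE (t : code) a := - (om t a * (il (prv t) a * P (prv t) a + il t a * P t a)) +
  ((e 0 (prv t) a - e 0 t a) * Ua 1 0 t a + (e 1 (prv t) a - e 1 t a) * Ua 1 1 t a).

(** The second derivatives [U 2] and [Ua 1] account for the two orders in the hypothesis. *)
Lemma coef_smooth k : smooth_mod_cst I E k (flat sl) -> (2 + k <= N)%N ->
  [/\ smooth I E k (flat cA), smooth I E k (flat cB), smooth I E k (flat cC) & smooth I E k (flat cE)].
Proof.
move=> sk k2; have k1 : (1 + k <= N)%N := ltnW k2; have k0 : (k <= N)%N := ltnW k1.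
have ho := om_smooth sk k1; have hi := il_smooth sk k0.
have hop := smooth_shift Dp ho; have hon := smooth_shift Dn ho; have hip := smooth_shift Dp hi.
have he c := e_smooth sk c k0; have hep c := smooth_shift Dp (he c).
have hd c : smooth I E k (flat (fun t a => e c (prv t) a - e c t a)) := smoothB (hep c) (he c).
have hU2 c := U_smooth sk c k2.
have hUa0 c := Ua_smooth sk c (leq0n 1) k1; have hUa1 c := Ua_smooth sk c (leqnn 1) k2.
have hUd c : smooth I E k (flat (fun t a => Ua 0 c (nxt t) a - Ua 0 c t a)) := smoothB (smooth_shift Dn (hUa0 c)) (hUa0 c).
have hP : smooth I E k (flat P) := smoothD (smoothM (smoothN (he 1)) (hUd 0)) (smoothM (he 0) (hUd 1)).
have hcrv : smooth I E k (flat crv) := smoothD (smoothM (hd 0) (hU2 0)) (smoothM (hd 1) (hU2 1)).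
split.
- exact: (smoothM (smoothM hop ho) hip).
- exact: (smoothD (smoothM (smoothM ho ho) (smoothD hip hi)) hcrv).
- exact: (smoothM (smoothM hon ho) hi).
- exact: (smoothD (smoothN (smoothM ho (smoothD (smoothM hip (smooth_shift Dp hP)) (smoothM hi hP))))
    (smoothD (smoothM (hd 0) (hUa1 0)) (smoothM (hd 1) (hUa1 1)))).
Qed.

(** Dominance holds with constants uniform over the codes: normal components are bounded below by
    [om_pos], curvature by [curv_gt0], and the boundary length is bounded through the rescaled
    tangent by [M0] and [M1]. *)
Lemma coef_stable : stable I D prv nxt cA cB cC.
Proof.
apply: (dominant_stable Dp Dn (w := fun t a => (om t a)^-1)) => a0 Ia0.
have N2' : (2 + 0 <= N)%N by rewrite addn0.
have N1' : (1 + 0 <= N)%N := ltnW N2'.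
have [_ sB _ _] := coef_smooth sl_equicont N2'.
have bnd f : smooth I E 0 (flat f) -> exists2 M : R, 0 < M & near_pairs I D a0 (fun t a _ => `|f t a| <= M).
  by move=> /smooth_bounded /flat_boundedP; apply.
have [MB MB0 hB] := bnd _ sB; have [Mo Mo0 ho] := bnd _ (om_smooth sl_equicont N1').
have [M0 M00 h0] := bnd _ (U_smooth sl_equicont 0 N1'); have [M1 M10 h1] := bnd _ (U_smooth sl_equicont 1 N1').
have [co co0 /(near_pairsP I D a0 (fun t a _ => co <= om t a)) hco] := om_pos Ia0.
have [ck ck0 hk] := curv_gt0 hI defI hr hr' hK Ia0.
have ck2 : 0 < ck / 2 by rewrite divr_gt0.
have [dk dk0 hdk] := smooth_equicont (curv_smooth hI defI hr hr' hK) Ia0 ck2.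
have L2 : 0 < M0 ^+ 2 + M1 ^+ 2 by rewrite addr_gt0// exprn_gt0.
exists (Mo^-1), (co^-1 + MB), (2 * (ck / 2) / (M0 ^+ 2 + M1 ^+ 2)); split; first by rewrite invr_gt0.
  by rewrite divr_gt0// mulr_gt0.
have mk (P Q : code -> R -> R -> Prop) (p : near_pairs I D a0 P) (q : near_pairs I D a0 Q) := near_pairs2 p q (fun _ _ _ p q => conj p q).
have hop := near_pairs_prv Dp hco; have hon := near_pairs_nxt Dn hco.
have [d1 d10 H1] := mk _ _ (mk _ _ (mk _ _ hB ho) (mk _ _ h0 h1)) (mk _ _ hco (mk _ _ hop hon)).
exists (Num.min d1 dk); first by rewrite lt_min d10.
move=> t a a' Dt Ia Ia'; rewrite !lt_min => /andP[a1 a2] /andP[a1' a2'].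
have [[[b1 b2] [b3 b4]] [w1 [w2 w3]]] := H1 t a a Dt Ia Ia a1 a1.
have omM : om t a <= Mo by apply: le_trans b2; exact: ler_norm.
have Qp t' : D t' -> 0 < il t' a.
  move=> Dt'; rewrite /il invr_gt0 sqrtr_gt0 Q_coded// exprn_gt0//; apply: enorm_sub_gt0.
  have XE := coded_point_extremal_seq hI defI hr hr' hK Ia Dt'.
  exact: (extremal_neq (deformation_table hr hK Ia) Dt' XE 0).
have i1 := Qp _ Dt; have i2 := Qp _ (Dp Dt).
have [lam [_ _ _ _ [lE crvE]]] := reflection_law Dt Ia.
have hc : ck / 2 <= curv K (t 0) (sl t a) a.
  have z (x : R) : `|x - x| < dk by rewrite subrr normr0.
  have h2 : `|curv K (t 0) (sl t a) a - curv K (t 0) (sl t a) a0| <= ck / 2 :=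
    hdk (t 0) (sl t a) a0 (sl t a) a Ia0 Ia (z _) a2 (z _).
  move: h2 (hk (t 0) (sl t a)); move: (curv _ _ _ a) (curv _ _ _ a0) => x y.
  by rewrite ler_norml; clr; lra.
have l20 : 0 < len K (t 0) a ^+ 2 by rewrite exprn_gt0//; exact: (len_gt0 hK _ Ia).
have lL : len K (t 0) a ^+ 2 <= M0 ^+ 2 + M1 ^+ 2.
  rewrite -lE; apply: lerD; rewrite -[X in X <= _]real_normK ?num_real// ler_pXn2r ?nnegrE//; exact: ltW.
have [D1 D2] := dominance co0 ck2 w1 w2 w3 omM MB0 i1 i2 l20 lL hc.
split; [exact: D1|by apply: (le_trans b1); rewrite lerDr invr_ge0 ltW|].
by have -> : cB t a = om t a * om t a * (il (prv t) a + il t a) + 2 * om t a / len K (t 0) a ^+ 2 * curv K (t 0) (sl t a) a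
  by congr (_ + _); exact: crvE.
Qed.

Let dsl (t : code) (y : code * (R * R) * (R * R)) : R := sl t y.2.2 - sl t y.1.2.2.
(** The coordinates are only known to be continuous when the law is linearized, so the error has to
    be measured against the increments of the three consecutive coordinates as well as that of the
    parameter. *)
Let NN (y : code * (R * R) * (R * R)) : R :=
  `|dsl (prv y.1.1) y| + `|dsl y.1.1 y| + `|dsl (nxt y.1.1) y| + `|y.2.2 - y.1.2.2|.

Let NN_small a0 (Ia0 : I a0) (e0 : R) : 0 < e0 -> \forall y \near fibre_near E a0, 0 <= NN y <= e0.
Proof.
move=> e00; have e4 : 0 < e0 / 4 by rewrite divr_gt0.
have h := (flat_equicontP I D sl).1 sl_equicont.1 _ Ia0 _ e4.
have [d d0 hd] := h; have hp := near_pairs_prv Dp h; have hn := near_pairs_nxt Dn h.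
have mk (P Q : code -> R -> R -> Prop) (p : near_pairs I D a0 P) (q : near_pairs I D a0 Q) := near_pairs2 p q (fun _ _ _ p q => conj p q).
have [c c0 hc] := mk _ _ (mk _ _ h hp) hn.
have e8 : 0 < e0 / 8 by rewrite divr_gt0.
exists (Num.min c (e0 / 8)); first by rewrite lt_min c0.
move=> t s a s' a' [Dt Ia _] [_ Ia' _]; rewrite !lt_min => /andP[a1 a2] /andP[b1 b2] _.
have [[h1 h2] h3] := hc t a a' Dt Ia Ia' a1 b1.
have h4 : `|a' - a| <= e0 / 4.
  by rewrite -(subrKA a0) (le_trans (ler_normD _ _))// (distrC a0); move: a2 b2; clr; lra.
rewrite /NN /dsl /= !addr_ge0//=; move: h1 h2 h3 h4.
set x1 := `|_ - sl t a|; set x2 := `|_ - sl (prv t) a|; set x3 := `|_ - sl (nxt t) a|; set x4 := `|a' - a|.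
by clearbody x1 x2 x3 x4; clr; lra.
Qed.

Lemma expansion_U k c (sh : code -> code) a0 : (k <= 1)%N -> I a0 -> (forall t, D t -> D (sh t)) ->
  (forall y, `|dsl (sh y.1.1) y| + `|y.2.2 - y.1.2.2| <= NN y) ->
  expansion (fibre_near E a0) NN (at_new (flat (fun t => U k c (sh t)))) (at_old (flat (fun t => U k c (sh t))))
    (fun y => U k.+1 c (sh y.1.1) y.1.2.2 * dsl (sh y.1.1) y + Ua k c (sh y.1.1) y.1.2.2 * (y.2.2 - y.1.2.2)).
Proof.
move=> k1 Ia0 Dsh hN.
have kN j : (j <= 2)%N -> (j + 0 <= N)%N by rewrite addn0 => /leq_trans; apply.
have bU j : (j <= 2)%N -> fibre_bounded I E (flat (fun t => U j c (sh t))).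
  by move=> j2; exact: (smooth_bounded (smooth_shift Dsh (U_smooth sl_equicont c (kN j j2)))).
have bUa : fibre_bounded I E (flat (fun t => Ua k c (sh t))).
  exact: (smooth_bounded (smooth_shift Dsh (Ua_smooth sl_equicont c k1 (kN k.+1 k1)))).
split.
- exact: (fibre_bounded_new Ia0 (bU k (leqW k1))).
- have [M M0 hM] := bU k.+1 k1 _ Ia0; have [M' M'0 hM'] := bUa _ Ia0.
  exists (M + M'); first by rewrite addr_gt0.
  apply: filterS2 hM hM' => y h1 h2; rewrite (le_trans (ler_normD _ _))// mulrDl lerD//.
    by apply: ler_normM => //; apply: le_trans (hN y); rewrite lerDl.
  by apply: ler_normM => //; apply: le_trans (hN y); rewrite lerDr.
move=> e0 e00.
have Ew : forall t s a, E t s a -> whole I (sh t 0) (flat (fun t => sl (sh t)) t s a) a by move=> t s a [].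
have weq : fibre_equicont I E (flat (fun t => sl (sh t))).
  have hc := (flat_equicontP I D sl).1 sl_equicont.1.
  apply/flat_equicontP => b Ib z z0; have [d d0 hd] := hc b Ib z z0; exists d => // t a a' Dt.
  exact: hd (Dsh t Dt).
have H := fibre_near_comp (tau := fun t => sh t 0) Ew Ia0 weq ((ua_strict c k1).1 _ Ia0 _ e00).
apply: filterS H => y H; apply: (le_trans H).
by rewrite ler_pM2l//; exact: hN.
Qed.

Lemma V_prv c t a : V c (prv t) a = U 0 c t a - U 0 c (prv t) a.
Proof. by rewrite /V nxt_prv. Qed.

(** [Gp] and [G] pair the incoming and the outgoing unit direction with the rescaled tangent. [Gp]
    is written out in terms of [prv] so that it has the form in which it is expanded. *)
Let Gp t a := ((U 0 0 t a - U 0 0 (prv t) a) * U 1 0 t a + (U 0 1 t a - U 0 1 (prv t) a) * U 1 1 t a) *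
  (Num.sqrt ((U 0 0 t a - U 0 0 (prv t) a) * (U 0 0 t a - U 0 0 (prv t) a) +
    (U 0 1 t a - U 0 1 (prv t) a) * (U 0 1 t a - U 0 1 (prv t) a)))^-1.
Let G t a := (V 0 t a * U 1 0 t a + V 1 t a * U 1 1 t a) * il t a.

Lemma GpG t a : D t -> I a -> Gp t a - G t a = 0.
Proof.
move=> Dt Ia; have [lam [_ _ _ _ [_ h]]] := reflection_law Dt Ia.
have := h (U 1 0 t a) (U 1 1 t a).
rewrite (_ : U 1 0 t a * U 1 1 t a - _ = 0) ?mulr0; last by rewrite mulrC subrr.
rewrite /Gp -!V_prv -/(Q (prv t) a) -/(il (prv t) a) /G /e => {}h; rewrite -[RHS]h; ring.
Qed.

Lemma Q_gt0 t a : D t -> I a -> 0 < Q t a.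
Proof.
move=> Dt Ia; rewrite Q_coded// exprn_gt0//; apply: enorm_sub_gt0.
have XE := coded_point_extremal_seq hI defI hr hr' hK Ia Dt.
exact: (extremal_neq (deformation_table hr hK Ia) Dt XE 0).
Qed.

(** [Gp - G] vanishes at [a] and at [a'], so the linear part of its expansion is negligible against
    the gauge; rearranged, this linear part is the tridiagonal operator plus the source. *)
Lemma sl_increment a0 : I a0 -> forall e0 : R, 0 < e0 -> near_pairs I D a0 (fun t a a' =>
  `|tridiag prv nxt cA cB cC a (fun t => sl t a' - sl t a) t + cE t a * (a' - a)| <=
  e0 * (`|sl (prv t) a' - sl (prv t) a| + `|sl t a' - sl t a| + `|sl (nxt t) a' - sl (nxt t) a| + `|a' - a|)).
Proof.
move=> Ia0 e0 e00.
have Did t : D t -> D (id t) by [].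
have gid (y : code * (R * R) * (R * R)) : `|dsl (id y.1.1) y| + `|y.2.2 - y.1.2.2| <= NN y.
  by rewrite /NN lerD2r -addrA addrCA lerDl addr_ge0.
have gp (y : code * (R * R) * (R * R)) : `|dsl (prv y.1.1) y| + `|y.2.2 - y.1.2.2| <= NN y.
  by rewrite /NN lerD2r -addrA lerDl addr_ge0.
have gn (y : code * (R * R) * (R * R)) : `|dsl (nxt y.1.1) y| + `|y.2.2 - y.1.2.2| <= NN y.
  by rewrite /NN lerD2r lerDr addr_ge0.
have Xid c := expansion_U c (leq0n 1) Ia0 Did gid.
have Xp c := expansion_U c (leq0n 1) Ia0 Dp gp.
have Xn c := expansion_U c (leq0n 1) Ia0 Dn gn.
have W c := expansion_U c (leqnn 1) Ia0 Did gid.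
pose proof (fun c => expansionB (NN_small Ia0) (Xid c) (Xp c)) as vp.
pose proof (fun c => expansionB (NN_small Ia0) (Xn c) (Xid c)) as vn.
have [c c0 hc] := fibre_pos_new Ia0 Q_pos.
have [cp cp0 hcp] := fibre_pos_new Ia0 (fibre_pos_shift Dp Q_pos).
pose proof (expansion_unit_dot (fibre_near_filter E a0) (NN_small Ia0) c0 hc (vn 0) (vn 1) (W 0) (W 1)) as Hn.
have hcp' : \forall y \near fibre_near E a0,
   cp <= (U 0 0 y.1.1 y.2.2 - U 0 0 (prv y.1.1) y.2.2) * (U 0 0 y.1.1 y.2.2 - U 0 0 (prv y.1.1) y.2.2) +
     (U 0 1 y.1.1 y.2.2 - U 0 1 (prv y.1.1) y.2.2) * (U 0 1 y.1.1 y.2.2 - U 0 1 (prv y.1.1) y.2.2) /\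
   cp <= (U 0 0 y.1.1 y.1.2.2 - U 0 0 (prv y.1.1) y.1.2.2) * (U 0 0 y.1.1 y.1.2.2 - U 0 0 (prv y.1.1) y.1.2.2) +
     (U 0 1 y.1.1 y.1.2.2 - U 0 1 (prv y.1.1) y.1.2.2) * (U 0 1 y.1.1 y.1.2.2 - U 0 1 (prv y.1.1) y.1.2.2).
  by apply: filterS hcp => y; rewrite -!V_prv.
pose proof (expansion_unit_dot (fibre_near_filter E a0) (NN_small Ia0) cp0 hcp' (vp 0) (vp 1) (W 0) (W 1)) as Hp.
pose proof (expansionB (NN_small Ia0) Hp Hn) as H; case: H => _ _ /(_ e0 e00) [d d0 hd].
exists d => // t a a' Dt Ia Ia' ad ad'.
have z0 : `|(0 : R) - 0| < d by rewrite subrr normr0.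
set x := sl (prv t) a' - sl (prv t) a; set y := sl t a' - sl t a; set z := sl (nxt t) a' - sl (nxt t) a; set w := a' - a.
have H : `|(Gp t a' - G t a') - (Gp t a - G t a) -
  (unit_dot_diff (U 0 0 t a - U 0 0 (prv t) a) (U 0 1 t a - U 0 1 (prv t) a) (U 1 0 t a) (U 1 1 t a)
     (U 1 0 t a * y + Ua 0 0 t a * w - (U 1 0 (prv t) a * x + Ua 0 0 (prv t) a * w))
     (U 1 1 t a * y + Ua 0 1 t a * w - (U 1 1 (prv t) a * x + Ua 0 1 (prv t) a * w))
     (U 2 0 t a * y + Ua 1 0 t a * w) (U 2 1 t a * y + Ua 1 1 t a * w)
   - unit_dot_diff (V 0 t a) (V 1 t a) (U 1 0 t a) (U 1 1 t a)
     (U 1 0 (nxt t) a * z + Ua 0 0 (nxt t) a * w - (U 1 0 t a * y + Ua 0 0 t a * w))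
     (U 1 1 (nxt t) a * z + Ua 0 1 (nxt t) a * w - (U 1 1 t a * y + Ua 0 1 t a * w))
     (U 2 0 t a * y + Ua 1 0 t a * w) (U 2 1 t a * y + Ua 1 1 t a * w))| <= e0 * (`|x| + `|y| + `|z| + `|w|)
  := hd t 0 a 0 a' (And3 Dt Ia erefl) (And3 Dt Ia' erefl) ad ad' z0.
move: H; rewrite !GpG// subrr sub0r normrN -!V_prv.
rewrite !unit_dot_diffE; [|exact: Q_gt0|exact: (Q_gt0 (Dp Dt))].
have [lam [_ _ _ F1 _]] := reflection_law Dt Ia.
have [lam' [_ _ _ F2 _]] := reflection_law (Dn Dt) Ia; rewrite prv_nxt in F2.
have F := tridiag_form (il t a) (il (prv t) a) (Ua 0 0 t a) (Ua 0 1 t a) (Ua 0 0 (prv t) a) (Ua 0 1 (prv t) a)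
  (Ua 0 0 (nxt t) a) (Ua 0 1 (nxt t) a)
  (U 2 0 t a) (U 2 1 t a) (Ua 1 0 t a) (Ua 1 1 t a) x y z w F1
  (erefl : - e 1 t a * U 1 0 t a + e 0 t a * U 1 1 t a = om t a)
  (erefl : - e 1 (prv t) a * U 1 0 (prv t) a + e 0 (prv t) a * U 1 1 (prv t) a = om (prv t) a) F2.
have cong (p q B : R) : p = q -> `|p| <= B -> `|q| <= B by move=> ->.
apply: (cong _ _ _ (etrans F _)).
by rewrite /tridiag /cE /P nxt_prv.
Qed.

(** Lifts of class k give coefficients of class k; the derivative of the lifts solves the system,
    hence is of class k as well. *)
Lemma sl_smooth k : (1 + k <= N)%N -> smooth_mod_cst I E k (flat sl).
Proof.
elim: k => [|k IH] kN; first exact: sl_equicont.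
have sk := IH (ltnW kN).
have N20 : (2 + 0 <= N)%N by rewrite addn0.
have [_ _ _ sE0] := coef_smooth sl_equicont N20.
have [sA sB sC sE] := coef_smooth sk kN.
have acc := I_acc hI defI; have eqc := sl_equicont.1; have bE := smooth_bounded sE0.
split=> //; exists (fun _ _ _ => 0), (flat (fun t => derive_on I (sl t))); split.
- move=> a0 Ia0 e0 e00; apply: near_pairs_strict.
  exact: (increment_strict acc Dp Dn coef_stable eqc bE sl_increment Ia0 e00).
- exact: smooth_cst.
apply: (solution_smooth acc Dp Dn coef_stable sA sB sC sE).
- exact: (increment_bounded acc Dp Dn coef_stable eqc bE sl_increment).
- by move=> t a Dt Ia; exact: (increment_solution acc Dp Dn coef_stable eqc bE sl_increment Dt Ia).
Qed.

End smoothness.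

(** * Derivatives of the coordinates and periodic approximation *)

Lemma smooth_sub (R : realType) (T : Type) (I I' : set R) (E E' : T -> R -> R -> Prop) k f :
  I' `<=` I -> (forall t s a, E' t s a -> E t s a) -> smooth I E k f -> smooth I' E' k f.
Proof.
move=> II EE.
have sub a0 (P : T * (R * R) * (R * R) -> Prop) :
    (\forall y \near fibre_near E a0, P y) -> \forall y \near fibre_near E' a0, P y.
  by move=> [d d0 h]; exists d => // t s a s' a' /EE E1 /EE E2; exact: h.
have base g : fibre_bounded I E g /\ fibre_equicont I E g -> fibre_bounded I' E' g /\ fibre_equicont I' E' g.
  move=> [b c]; split=> [a0 /II /b[M M0 h]|a0 /II Ia0 e e0]; first by exists M => //; exact: sub.
  exact: sub (c _ Ia0 _ e0).
elim: k f => [|k IH] f [h1 h2]; split=> //; try exact: base.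
have [fs [fa [sd h3 h4]]] := h2; exists fs, fa; split; try exact: IH.
by move=> a0 /II Ia0 e e0; exact: sub (sd _ Ia0 _ e0).
Qed.

Section chains.
Variables (R : realType) (I : set R).
Hypothesis I_conv : forall a b c, I a -> I b -> a <= c <= b -> I c.
Hypothesis I_acc : forall a, I a -> forall d : R, 0 < d -> exists y, [/\ I y, y != a & `|y - a| < d].
Variables (T : Type) (D : T -> Prop) (b0 delta : R).
Local Notation I' := (I `&` [set a | `|a - b0| < delta]).

Lemma nearby a : I' a -> exists2 d : R, 0 < d & forall y, I y -> `|y - a| < d -> I' y.
Proof.
move=> [Ia ad]; exists (delta - `|a - b0|); first by rewrite subr_gt0.
by move=> y Iy ya; split=> //=; rewrite -(subrKA a) (le_lt_trans (ler_normD _ _))// -ltrBrDr.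
Qed.

Lemma nearby_conv x y z : I' x -> I' y -> x <= z <= y -> I' z.
Proof.
move=> [Ix xd] [Iy yd] xzy; split; first exact: I_conv xzy.
by move: xd yd xzy; rewrite /= !ltr_norml; clr; lra.
Qed.

Lemma nearby_acc a : I' a -> forall d : R, 0 < d -> exists y, [/\ I' y, y != a & `|y - a| < d].
Proof.
move=> I'a d d0; have [c c0 hc] := nearby I'a.
have m0 : 0 < Num.min c d by rewrite lt_min c0.
have [y [Iy ya]] := I_acc I'a.1 m0; rewrite lt_min => /andP[y1 y2].
by exists y; split=> //; exact: hc.
Qed.

(** Successive derivatives of a family near [b0]. The continuity at each point is uniform in the
    index, which is what lets derivatives pass to limits in the index. *)
Definition deriv_chain (q : nat) (g : nat -> T -> R -> R) : Prop :=
  (forall i t a, (i < q)%N -> D t -> I' a -> has_deriv I' (g i t) a (g i.+1 t a)) /\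
  (forall i a (e : R), (i <= q)%N -> I' a -> 0 < e -> exists2 d : R, 0 < d & forall t a', D t -> I' a' ->
    `|a' - a| < d -> `|g i t a' - g i t a| <= e).

Lemma smooth_chain q f : smooth I' (slice I' D) q (flat f) -> exists2 g, g 0%N = f & deriv_chain q g.
Proof.
have eqc k h : smooth I' (slice I' D) k (flat h) -> forall a (e : R), I' a -> 0 < e ->
    exists2 d : R, 0 < d & forall t a', D t -> I' a' -> `|a' - a| < d -> `|h t a' - h t a| <= e.
  move=> sh a e I'a e0; have [d d0 hd] := smooth_near I'a e0 sh; exists d => // t a' Dt I'a' ad.
  by apply: hd => //; rewrite subrr normr0.
elim: q f => [|q IH] f sf.
  exists (fun _ => f) => //; split=> // i a e _; exact: eqc sf a e.
have [fa sfa hfa] := smooth_flat_split sf; have [g g0 [g1 g2]] := IH _ sfa.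
exists (fun i => if i is i'.+1 then g i' else f) => //; split=> [[|i] t a iq Dt I'a|[|i] a e iq].
- rewrite g0 => e e0; have [d d0 hd] := hfa a I'a e e0; exists d => // y I'y ya.
  by apply: hd => //; rewrite subrr normr0.
- exact: g1.
- exact: eqc sf a e.
- exact: g2.
Qed.

Lemma chain_step q g i t a (v : R -> R) : deriv_chain q g -> (i < q)%N -> D t -> I' a ->
  (forall y, I' y -> v y = g i t y) -> has_deriv I v a (g i.+1 t a).
Proof.
move=> hg iq Dt I'a vg; have [d d0 hd] := nearby I'a.
apply: (has_deriv_local d0 hd); apply: (has_deriv_eq I'a (f := g i t)); last exact: hg.1.
by move=> y /vg.
Qed.

Lemma chain_deriven q g t (u : R -> R) : deriv_chain q g -> D t -> (forall a, I' a -> u a = g 0%N t a) ->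
  forall i, (i <= q)%N -> forall a, I' a -> deriven_on I i u a = g i t a.
Proof.
move=> hg Dt ug; elim=> [|i IH] iq a I'a; first exact: ug.
have h := chain_step hg iq Dt I'a (IH (ltnW iq)).
exact: (has_deriv_derive_on I_acc I'a.1 h).2.
Qed.

Lemma chain_derivable q g t (u : R -> R) : deriv_chain q g -> D t -> (forall a, I' a -> u a = g 0%N t a) ->
  forall i, (i < q)%N -> forall a, I' a -> derivable_on I (deriven_on I i u) a.
Proof.
move=> hg Dt ug i iq a I'a.
have h := chain_step hg iq Dt I'a (chain_deriven hg Dt ug (ltnW iq)).
exact: (has_deriv_derive_on I_acc I'a.1 h).1.
Qed.

Lemma chain_cont q g t (u : R -> R) : deriv_chain q g -> D t -> (forall a, I' a -> u a = g 0%N t a) ->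
  forall i, (i <= q)%N -> forall a, I' a -> forall e : R, 0 < e ->
  exists2 d : R, 0 < d & forall y, I y -> `|y - a| < d -> `|deriven_on I i u y - deriven_on I i u a| <= e.
Proof.
move=> hg Dt ug i iq a I'a e e0; have [d d0 hd] := nearby I'a.
have [c c0 hc] := hg.2 i a e iq I'a e0.
exists (Num.min c d); first by rewrite lt_min c0.
move=> y Iy; rewrite lt_min => /andP[y1 y2]; have I'y := hd y Iy y2.
by rewrite !(chain_deriven hg Dt ug iq)//; exact: hc.
Qed.

Definition conv_along (S : set nat) (f : nat -> R -> R) (h : R -> R) (x : R) : Prop :=
  forall e : R, 0 < e -> exists n0 : nat, forall n, (n0 <= n)%N -> S n -> `|f n x - h x| <= e.

(** By the mean value theorem and uniform continuity of the next derivative, the difference quotient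
    between [x] and one fixed nearby [y] approximates this derivative for all indices at once, and
    for fixed [y] the quotients converge. [S] restricts the sequence to the members on the right
    branch. *)
Lemma chain_conv q g S (tn : nat -> T) t : deriv_chain q g -> (forall n, D (tn n)) -> D t ->
  (forall x, I' x -> conv_along S (fun n => g 0%N (tn n)) (g 0%N t) x) ->
  forall i, (i <= q)%N -> forall x, I' x -> conv_along S (fun n => g i (tn n)) (g i t) x.
Proof.
move=> [hd hc] Dtn Dt h0; elim=> [|i IH] iq x I'x; first exact: h0.
move=> e e0; have e5 : 0 < e / 5 by rewrite divr_gt0.
have [d d0 hdd] := hc i.+1 x _ iq I'x e5.
have [y [I'y yx yd]] := nearby_acc I'x d0.
have yx0 : 0 < `|y - x| by rewrite normr_gt0 subr_eq0.
have e6 : 0 < e / 5 * `|y - x| by rewrite mulr_gt0.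
have [n1 h1] := IH (ltnW iq) x I'x _ e6; have [n2 h2] := IH (ltnW iq) y I'y _ e6.
exists (maxn n1 n2) => n; rewrite geq_max => /andP[nn1 nn2] Sn.
have mv s : D s -> `|g i s y - g i s x - g i.+1 s x * (y - x)| <= e / 5 * `|y - x|.
  move=> Ds; apply: (mvt_on (S := I') (h' := g i.+1 s)) => //.
  - by move=> u v w Iu Iv; exact: nearby_conv.
  - by move=> u I'u; exact: hd.
  move=> u I'u hu; apply: hdd => //; apply: le_lt_trans yd.
  move: hu; rewrite /Num.min /Num.max; case: ltP => xy hu.
    by rewrite !ger0_norm; move: hu xy; clr; lra.
  by rewrite !ler0_norm; move: hu xy; clr; lra.
have {}h1 := h1 n nn1 Sn; have {}h2 := h2 n nn2 Sn.
have m1 := mv _ (Dtn n); have m2 := mv _ Dt.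
rewrite -(ler_pM2r yx0) -normrM.
have -> : (g i.+1 (tn n) x - g i.+1 t x) * (y - x) =
  - (g i (tn n) y - g i (tn n) x - g i.+1 (tn n) x * (y - x))
  + (g i t y - g i t x - g i.+1 t x * (y - x)) + (g i (tn n) y - g i t y) - (g i (tn n) x - g i t x) by ring.
apply: (le_trans (ler_normB _ _)).
rewrite (_ : e * `|y - x| = 4 * (e / 5 * `|y - x|) + e / 5 * `|y - x|); last by field.
have b1 := ler_normD (- (g i (tn n) y - g i (tn n) x - g i.+1 (tn n) x * (y - x))
  + (g i t y - g i t x - g i.+1 t x * (y - x))) (g i (tn n) y - g i t y).
have b2 := ler_normD (- (g i (tn n) y - g i (tn n) x - g i.+1 (tn n) x * (y - x)))
  (g i t y - g i t x - g i.+1 t x * (y - x)).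
rewrite normrN in b2; move: h1 h2 m1 m2 b1 b2.
set X := e / 5 * `|y - x| in e6 *; clearbody X.
by move: e6; clr; lra.
Qed.

End chains.

Lemma third_symbol (m : nat) (x y : 'I_m) : (3 <= m)%N -> exists b, b != x /\ b != y.
Proof.
move=> m3; have : (0 < #|~: [set x; y]|)%N.
  rewrite -subn_gt0 in m3; have := cardsC [set x; y]; rewrite card_ord cards2.
  by case: (x != y) => /=; lia.
by move=> /card_gt0P[b]; rewrite !inE negb_or => /andP[? ?]; exists b.
Qed.

(** Repeat the block of symbols from [- n] to [n] followed by one separating symbol that differs
    from both ends, which exists as there are three obstacles; the period is [2 * n + 2]. *)
Lemma periodic_approx (m : nat) (t : int -> 'I_m) (n : nat) : (3 <= m)%N -> admissible_code t ->
  exists t', [/\ admissible_code t', periodic_code t' & forall i : int, (`|i| <= n)%N -> t' i = t i].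
Proof.
move=> m3 tA; have [b [b1 b2]] := third_symbol (t n%:Z) (t (- n%:Z)) m3.
pose p : int := (2 * n + 2)%N%:Z.
pose t' i := let k := ((i + n%:Z) %% p)%Z in if (k <= (2 * n)%N%:Z)%R then t (k - n%:Z) else b.
have p0 : (0 < p)%R by rewrite /p; lia.
have next j : let k := ((j + n%:Z) %% p)%Z in
    ((j + 1 + n%:Z) %% p)%Z = if (k + 1 < p)%R then k + 1 else 0.
  move=> k; rewrite addrAC -(modzDml (j + n%:Z)) -/k.
  have k0 : (0 <= k)%R by apply: modz_ge0; exact: lt0r_neq0.
  have kp : (k < p)%R by exact: ltz_pmod.
  case: ltP => h; first by apply: modz_small; rewrite h andbT; lia.
  by have -> : k + 1 = p by [lia]; exact: modzz.
exists t'; split.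
- move=> j; rewrite /t' next; set k := ((j + n%:Z) %% p)%Z.
  have k0 : (0 <= k)%R by apply: modz_ge0; exact: lt0r_neq0.
  have kp : (k < p)%R by exact: ltz_pmod.
  case: (leP k) => h1.
    have -> : (k + 1 < p)%R by rewrite /p; lia.
    case: (leP (k + 1)) => h2; first by have -> : k + 1 - n%:Z = k - n%:Z + 1 by [rewrite addrAC]; exact: tA.
    have -> : k - n%:Z = n%:Z by lia.
    by rewrite eq_sym.
  have -> : (k + 1 < p)%R = false by apply/negbTE; rewrite -leNgt /p; lia.
  by rewrite sub0r (_ : (0 <= (2 * n)%N%:Z)%R) //; lia.
- by exists (2 * n + 2)%N; split=> [|j]; [lia|rewrite /t' addrAC modzDr].
move=> i hi; rewrite /t' modz_small; last by rewrite /p; lia.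
have -> : (i + n%:Z <= (2 * n)%N%:Z)%R by lia.
by rewrite addrK.
Qed.

Lemma minn_pred (r r' : nat) : (2 <= r)%N -> (2 <= r')%N -> (1 + minn (r - 1) (r' - 1) <= minn r r')%N.
Proof. lia. Qed.

Lemma smooth_mod_cst_sub (R : realType) (T : Type) (I I' : set R) (E E' : T -> R -> R -> Prop) k f :
  I' `<=` I -> (forall t s a, E' t s a -> E t s a) -> smooth_mod_cst I E k f -> smooth_mod_cst I' E' k f.
Proof.
move=> II EE.
have sub a0 (P : T * (R * R) * (R * R) -> Prop) :
    (\forall y \near fibre_near E a0, P y) -> \forall y \near fibre_near E' a0, P y.
  by move=> [d d0 h]; exists d => // t s a s' a' /EE E1 /EE E2; exact: h.
case: k => [|k] [h1 h2]; split=> //; try by move=> a0 /II Ia0 e e0; exact: sub (h1 _ Ia0 _ e0).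
have [fs [fa [sd h3 h4]]] := h2; exists fs, fa; split; try exact: smooth_sub II EE _.
by move=> a0 /II Ia0 e e0; exact: sub (sd _ Ia0 _ e0).
Qed.

(** * From lifts to arclength coordinates *)

Section coordinates.
Variables (R : realType) (m : nat) (al ar : \bar R).
Hypothesis hI : (al < ar)%E.
Variable I : set R.
Hypothesis defI : I = [set a : R | (al <= a%:E)%E /\ (a%:E <= ar)%E].
Variables (r r' : nat).
Hypothesis hr : (2 <= r)%N.
Hypothesis hr' : (2 <= r')%N.
Variable K : billiard_family R m.
Hypothesis hK : billiard_deformation K r r' I.
Local Notation N := (minn r r').
Local Notation code := (int -> 'I_m).
Local Notation adm := (@admissible_code m).
Local Notation shift j xi := (fun i => xi (i + j)).
Local Notation M := (minn (r - 1) (r' - 1)).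

Let Iconv := I_conv defI.
Let Iacc := I_acc hI defI.

Lemma len_flat_smooth k : (k <= N)%N -> smooth I (slice I adm) k (flat (fun t a => len K (t 0) a)).
Proof.
rewrite leq_min => /andP[kr kr'].
have [f [sc _]] := deformation_jets defI hr hr' hK.
have EI i s a : whole I (T := 'I_m) i s a -> I a by [].
have h := len_smooth sc EI kr kr'.
have w0 : smooth_mod_cst I (slice I adm) k (fun _ _ _ => 0) by apply/smooth_smooth_mod_cst/smooth_cst.
by apply: (@smooth_comp _ _ _ _ _ (slice I adm) (fun t : code => t 0) _ _ _ _ h w0) => t s a [].
Qed.

Lemma len_cont_on i : cont_on I (len K i).
Proof.
have [f [sc _]] := deformation_jets defI hr hr' hK.
have EI i' s a : whole I (T := 'I_m) i' s a -> I a by [].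
have h := len_smooth sc EI (leq0n _) (leq0n _).
move=> a Ia e e0; have [d d0 hd] := smooth_equicont h Ia e0.
by exists d => // b Ib ba; apply: (hd i 0 a 0 b) => //; rewrite subrr normr0.
Qed.

Lemma cont_onM (S : set R) s s' : cont_on S s -> cont_on S s' -> cont_on S (fun x => s x * s' x).
Proof.
move=> /cont_onP/subspace_continuousP h /cont_onP/subspace_continuousP h'.
apply/cont_onP/subspace_continuousP => x Sx; exact: (cvgM (h x Sx) (h' x Sx)).
Qed.

Lemma cont_onV (S : set R) s : (forall x, S x -> s x != 0) -> cont_on S s -> cont_on S (fun x => (s x)^-1).
Proof.
move=> s0 /cont_onP/subspace_continuousP h.
apply/cont_onP/subspace_continuousP => x Sx; exact: (cvgV (s0 x Sx) (h x Sx)).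
Qed.

Lemma coord_of_lift xi j s : adm xi -> lifts I K (shift j xi) s ->
  is_arclength_coord K I xi j (fun a => s a * len K (xi j) a).
Proof.
move=> xiA [cs hs]; split; first by apply/cont_onP/cont_onM => //; exact: len_cont_on.
move=> a Ia; have := hs a Ia; rewrite (coded_point_shift hI defI hr hr' hK 0 j Ia xiA) !add0r; exact.
Qed.

Lemma lift_of_coord xi j u : adm xi -> is_arclength_coord K I xi j u ->
  lifts I K (shift j xi) (fun a => u a / len K (xi j) a).
Proof.
move=> xiA [/cont_onP cu hu].
have l0 a : I a -> len K (xi j) a != 0 by move=> Ia; exact/lt0r_neq0/(len_gt0 hK).
split; first by apply: cont_onM => //; apply: cont_onV => //; exact: len_cont_on.
move=> a Ia; rewrite (coded_point_shift hI defI hr hr' hK 0 j Ia xiA) !add0r -hu//.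
by rewrite /boundary_pt divfK// l0.
Qed.

Lemma lifts_shift xi s (n : int) : lifts I K xi s -> lifts I K xi (fun a => s a + n%:~R).
Proof.
move=> [cs hs]; split=> [a Ia e e0|a Ia]; last by rewrite (pt_periodic hK)// hs.
by have [d d0 hd] := cs a Ia e e0; exists d => // b Ib ba; rewrite opprD addrACA subrr addr0; exact: hd.
Qed.

(** Lifts are smooth up to constants that may be unbounded over the codes. A bound at [a0] makes
    them bounded nearby, so that their product with [len] is smooth. *)
Lemma local_chain a0 B (sl : code -> R -> R) : I a0 -> (forall t, adm t -> lifts I K t (sl t)) ->
  (forall t, adm t -> `|sl t a0| <= B) ->
  exists2 d : R, 0 < d & exists g, [/\ g 0%N = (fun t a => sl t a * len K (t 0) a),
    deriv_chain I adm a0 d M g &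
    forall t a, adm t -> I a -> `|a - a0| < d -> `|sl t a - sl t a0| <= 1 / 8].
Proof.
move=> Ia0 hsl bsl; have [ua hua] := unit_param_strict hI defI hr hr' hK.
have e8 : 0 < (1 : R) / 8 by rewrite divr_gt0.
have [d d0 hd] := lifts_equicont hI defI hr hr' hK Ia0 e8.
have aa : `|a0 - a0| < d by rewrite subrr normr0.
have close t a : adm t -> I a -> `|a - a0| < d -> `|sl t a - sl t a0| <= 1 / 8.
  by move=> tA Ia ad; apply: (hd t (sl t)) => //; exact: hsl.
have M1 : (1 + M <= N)%N by exact: minn_pred.
have sm := sl_smooth hI defI hr hr' hK hua hsl M1.
pose I' := I `&` [set a | `|a - a0| < d].
have II : I' `<=` I by move=> x [].
have EE t s a : slice I' adm t s a -> slice I adm t s a by move=> [tA [Ia _] s0].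
have sm' := smooth_mod_cst_sub II EE sm.
have bd : fibre_bounded I' (slice I' adm) (flat sl).
  apply/flat_boundedP => b _; exists (`|B| + 1 + 1 / 8); first by rewrite addr_gt0// ltr_wpDl.
  exists 1 => // t a _ tA [Ia ad] _ _ _.
  have := close t a tA Ia ad; have := bsl t tA; have := ler_norm B.
  have := ler_normD (sl t a - sl t a0) (sl t a0); rewrite subrK; clr; lra.
have MN : (M <= N)%N by exact: ltnW.
have sv := smoothM (smooth_mod_cst_smooth bd sm') (smooth_sub II EE (len_flat_smooth MN)).
have [g g0 hg] := @smooth_chain R I code adm a0 d M (fun t a => sl t a * len K (t 0) a) sv.
by exists d => //; exists g; split.
Qed.

Lemma lift_family : exists sl : code -> R -> R, forall t, adm t -> lifts I K t (sl t).
Proof.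
have [t|sl hsl] := @choice code (R -> R) (fun t s => adm t -> lifts I K t s); last by exists sl.
have [tA|nA] := pselect (adm t); last by exists (fun=> 0).
by have [s hs] := lifts_exists hI defI hr hr' hK tA; exists s.
Qed.

Lemma lift_family_at a0 : exists sl : code -> R -> R,
  forall t, adm t -> lifts I K t (sl t) /\ 0 <= sl t a0 < 1.
Proof.
have [sl hsl] := lift_family.
exists (fun t a => sl t a + (- Num.floor (sl t a0))%:~R) => t tA; split; first exact/lifts_shift/hsl.
have := floor_itv (sl t a0); rewrite intrD intrN => /andP[h1 h2].
by rewrite subr_ge0 h1 ltrBlDr addrC.
Qed.

Lemma coord_exists xi j : adm xi -> exists u, is_arclength_coord K I xi j u.
Proof.
move=> xiA; have [sl hsl] := lift_family.
eexists; exact: (coord_of_lift xiA (hsl _ (admissible_shift j xiA))).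
Qed.

(** The regularity theory concerns a family of lifts over all codes, so the given coordinate is
    inserted as the member of index [t0]; the others are normalized at [a0] to keep the family
    bounded there. *)
Lemma coord_Cn xi j u : adm xi -> is_arclength_coord K I xi j u -> Cn_on I M u.
Proof.
move=> xiA hu; pose t0 : code := shift j xi.
have t0A : adm t0 := admissible_shift j xiA.
have loc a0 : I a0 -> exists2 d : R, 0 < d & exists g, [/\ deriv_chain I adm a0 d M g &
    forall a, I a -> g 0%N t0 a = u a].
  move=> Ia0; have [sl hsl] := lift_family_at a0.
  pose sl' t := if `[< t = t0 >] then fun a => u a / len K (xi j) a else sl t.
  have h1 t : adm t -> lifts I K t (sl' t).
    rewrite /sl'; case: asboolP => [->|_] tA; first exact: lift_of_coord.
    exact: (hsl t tA).1.
  have h2 t : adm t -> `|sl' t a0| <= `|u a0 / len K (xi j) a0| + 1.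
    rewrite /sl'; case: asboolP => [_|_] tA; first by rewrite lerDl.
    have /andP[p1 p2] := (hsl t tA).2; rewrite ger0_norm//.
    by apply: (le_trans (ltW p2)); rewrite lerDr.
  have [d d0 [g [g0 hg _]]] := local_chain Ia0 h1 h2.
  exists d => //; exists g; split=> // a Ia; rewrite g0 /sl'.
  case: asboolP => [_|/(_ erefl)//]; rewrite /t0 add0r divfK//.
  exact/lt0r_neq0/(len_gt0 hK).
split=> [k x kM Ix|k kM].
  have [d d0 [g [hg gu]]] := loc x Ix.
  apply: (chain_derivable Iacc hg t0A _ kM); last by split=> //=; rewrite subrr normr0.
  by move=> a [Ia _]; rewrite gu.
apply/cont_onP => x Ix; have [d d0 [g [hg gu]]] := loc x Ix.
apply: (chain_cont Iacc hg t0A _ kM); last by split=> //=; rewrite subrr normr0.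
by move=> a [Ia _]; rewrite gu.
Qed.

End coordinates.

(** * Bounds inherited from periodic codes *)

Section bound.
Variables (R : realType) (m : nat) (al ar : \bar R).
Hypothesis hm : (3 <= m)%N.
Hypothesis hI : (al < ar)%E.
Variable I : set R.
Hypothesis defI : I = [set a : R | (al <= a%:E)%E /\ (a%:E <= ar)%E].
Variables (r r' : nat).
Hypothesis hr : (2 <= r)%N.
Hypothesis hr' : (2 <= r')%N.
Variable K : billiard_family R m.
Hypothesis hK : billiard_deformation K r r' I.
Local Notation code := (int -> 'I_m).
Local Notation adm := (@admissible_code m).
Local Notation M := (minn (r - 1) (r' - 1)).
Let Iconv := I_conv defI.
Let Iacc := I_acc hI defI.

Lemma shift_periodic (xi : code) j : periodic_code (fun i => xi (i + j)) -> periodic_code xi.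
Proof.
move=> [n [n0 h]]; exists n; split=> // i.
by have := h (i - j); rewrite addrAC !subrK.
Qed.

Lemma close_mod_int x (e : R) (t0 : code) : I x -> 0 < e -> adm t0 -> exists n1 : nat, forall t s s0,
  adm t -> (forall i : int, (`|i| <= n1)%N -> t i = t0 i) ->
  boundary_pt K (t 0) s x = coded_point K t 0 x -> boundary_pt K (t0 0) s0 x = coded_point K t0 0 x ->
  exists k : int, `|s - s0 - k%:~R| <= e.
Proof.
move=> Ix e0 t0A; have [rho rho0 [d d0 h]] := pt_inverse hI defI hr hr' hK Ix e0.
have [c c0 [n hc]] := coded_point_close hI defI hr hr' hK Ix rho0.
have xx (z : R) : 0 < z -> `|x - x| < z by rewrite subrr normr0.
exists n => t s s0 tA agree E E0.
apply: (h (t0 0) s0 s x x Ix Ix (xx _ d0) (xx _ d0)).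
by rewrite E0 -{1}(agree 0 (leq0n n)) E; exact: (hc x t t0 Ix (xx _ c0) tA t0A agree).
Qed.

(** For a code that is not periodic, the branch has to be a limit of the branches which the
    hypothesis supplies for approximating periodic codes; these may oscillate between the two ends
    of the period, so a constant integer offset is extracted first. *)
Lemma coord_bound xi j q a c : adm xi -> (1 <= q <= M)%N -> I a ->
  (forall eta i, adm eta -> periodic_code eta -> coord_derive_le K I eta i q a c) ->
  coord_derive_le K I xi j q a c.
Proof.
move=> xiA /andP[_ qM] Ia hper.
have [xiP|xiN] := pselect (periodic_code xi); first exact: hper.
pose t0 : code := fun i => xi (i + j).
have t0A : adm t0 := admissible_shift j xiA.
have t0N : ~ periodic_code t0 by move=> /shift_periodic.
have [tn htn] := choice (fun n => periodic_approx n hm t0A).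
have tnA n : adm (tn n) by have [] := htn n.
have tnP n : periodic_code (tn n) by have [] := htn n.
have agree n p : (p <= n)%N -> forall i : int, (`|i| <= p)%N -> tn n i = t0 i.
  by move=> pn i hi; have [_ _ h] := htn n; apply: h; exact: leq_trans pn.
have tn0 n : tn n 0 = t0 0 by exact: (agree n 0 (leq0n n) 0).
have lenN0 t b : I b -> len K (t : 'I_m) b != 0 by move=> Ib; exact/lt0r_neq0/(len_gt0 hK).
have [sl hsl] := lift_family_at hI defI hr hr' hK a.
have [U hU] : exists U : code -> R -> R, forall t, adm t -> periodic_code t ->
    [/\ is_arclength_coord K I t 0 (U t), 0 <= U t a <= len K (t 0) a & `|deriven_on I q (U t) a| <= c].
  have [t|U hU] := @choice code (R -> R) (fun t u => adm t -> periodic_code t ->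
    [/\ is_arclength_coord K I t 0 u, 0 <= u a <= len K (t 0) a & `|deriven_on I q u a| <= c]); last by exists U.
  have [[tA tP]|no] := pselect (adm t /\ periodic_code t); last by exists (fun=> 0) => tA tP; case: no.
  by have [u hu] := hper t 0 tA tP; exists u.
(* Periodic codes carry the branch supplied by the hypothesis, all others any lift with value in
   [[0, 1]] at [a]. *)
pose sp t := if `[< periodic_code t >] then fun b => U t b / len K (t 0) b else sl t.
have sp_lift t : adm t -> lifts I K t (sp t).
  rewrite /sp => tA; case: asboolP => [tP|_]; last exact: (hsl t tA).1.
  have [hu _ _] := hU t tA tP; have := lift_of_coord hI defI hr hr' hK tA hu.
  by rewrite (_ : (fun i => t (i + 0)) = t)//; apply/funext => i; rewrite addr0.
have sp01 t : adm t -> 0 <= sp t a <= 1.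
  rewrite /sp => tA; case: asboolP => [tP|_]; last first.
    by have /andP[h1 h2] := (hsl t tA).2; rewrite h1 ltW.
  have [_ /andP[h1 h2] _] := hU t tA tP; have l0 := len_gt0 hK (t 0) Ia.
  by rewrite divr_ge0 ?(ltW l0)//= ler_pdivrMr// mul1r.
have e8 : 0 < (1 : R) / 8 by rewrite divr_gt0.
(* Both values at [a] lie in [[0, 1]], so for late [n] the offset is -1, 0 or 1, and one of these
   occurs infinitely often. *)
have [k hk] : exists k : int, forall n0 : nat, exists n, (n0 <= n)%N /\ `|sp (tn n) a - (sp t0 a + k%:~R)| <= 1 / 8.
  apply/not_existsP => no.
  have late (k : int) : exists n0 : nat, forall n, (n0 <= n)%N -> ~ `|sp (tn n) a - (sp t0 a + k%:~R)| <= 1 / 8.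
    have /existsNP[n0 hn0] := no k; exists n0 => n nn0 h; apply: hn0; by exists n.
  have [n1 h1] := late (-1); have [n2 h2] := late 0; have [n3 h3] := late 1.
  have [n4 h4] := close_mod_int Ia e8 t0A.
  pose n := maxn (maxn n1 n2) (maxn n3 n4).
  have [l1 l2 l3 l4] : [/\ (n1 <= n)%N, (n2 <= n)%N, (n3 <= n)%N & (n4 <= n)%N].
    by rewrite /n !leq_max !leqnn !orbT.
  have [k hk] := h4 _ _ _ (tnA n) (agree n n4 l4) ((sp_lift _ (tnA n)).2 a Ia) ((sp_lift _ t0A).2 a Ia).
  have s1 := sp01 _ (tnA n); have s2 := sp01 _ t0A.
  have [k1 k2] : (k < 2)%R /\ (-2 < k)%R.
    move: hk s1 s2; rewrite -!(ltr_int R) ler_norml; clear; move: (sp _ a) (sp t0 a) => x y.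
    by rewrite mulrNz; move=> *; split; lra.
  rewrite -addrA -opprD in hk.
  have [E|[E|E]] : k = -1 \/ k = 0 \/ k = 1 by move: k1 k2; clear; lia.
  - by apply: (h1 n l1); rewrite -E.
  - by apply: (h2 n l2); rewrite -E.
  - by apply: (h3 n l3); rewrite -E.
(* The lift at [t0] is moved by the recurrent offset. As [t0] is not periodic, the approximating
   codes keep the branches of the hypothesis. *)
pose sf t := if `[< t = t0 >] then fun b => sp t0 b + k%:~R else sp t.
have sf_lift t : adm t -> lifts I K t (sf t).
  rewrite /sf => tA; case: asboolP => [->|_]; last exact: sp_lift.
  exact/(lifts_shift hK)/sp_lift.
have sf_t0 b : sf t0 b = sp t0 b + k%:~R by rewrite /sf asboolT.
have sf_tn n : sf (tn n) = sp (tn n).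
  by rewrite /sf asboolF// => E; apply: t0N; rewrite -E.
pose S n := `|sf (tn n) a - sf t0 a| <= 1 / 8.
have S_inf n0 : exists n, (n0 <= n)%N /\ S n by have [n [h1 h2]] := hk n0; exists n; rewrite /S sf_tn sf_t0.
have sf2 t : adm t -> `|sf t a| <= 2.
  rewrite /sf => tA; case: asboolP => [_|_]; last first.
    by have /andP[h1 h2] := sp01 t tA; rewrite ger0_norm// (le_trans h2)// ler1n.
  have [n [_ h]] := hk 0%N; have := sp01 _ (tnA n); move: h; rewrite !ler_norml.
  by move: (sp _ a) (sp t0 a + _) => x y; clr; lra.
have [d d0 [g [g0 hg close]]] := local_chain hI defI hr hr' hK Ia sf_lift sf2.
pose I' := I `&` [set b | `|b - a| < d].
have I'a : I' a by split=> //=; rewrite subrr normr0.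
have sf_conv x : I' x -> conv_along S (fun n => sf (tn n)) (sf t0) x.
  move=> [Ix xd] e e0; have m0 : 0 < Num.min e (1 / 8) by rewrite lt_min e0.
  have [m1 m2] : Num.min e (1 / 8) <= e /\ Num.min e (1 / 8) <= 1 / 8 by rewrite !ge_min !lexx orbT.
  have [n1 h1] := close_mod_int Ix m0 t0A.
  exists n1 => n nn1 Sn.
  have [k' hk'] := h1 _ _ _ (tnA n) (agree n n1 nn1) ((sf_lift _ (tnA n)).2 x Ix) ((sf_lift _ t0A).2 x Ix).
  have c1 := close _ _ (tnA n) Ix xd; have c2 := close _ _ t0A Ix xd.
  (* At [a] the two lifts differ by at most 1/8, and each moves by at most 1/8 between [a] and [x];
     the sum 3/8 is below one half, so the offset at [x] is 0. *)
  have k0 : 0 = k'.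
    apply: (@near_int_unique _ _ _ (sf (tn n) x - sf t0 x)); last first.
      by apply: (le_trans hk'); apply: (le_trans m2); lra.
    rewrite (_ : _ - _ = (sf (tn n) x - sf (tn n) a) + (sf (tn n) a - sf t0 a) - (sf t0 x - sf t0 a)); last by ring.
    apply: le_lt_trans (ler_normB _ _) _; apply: le_lt_trans (lerD (ler_normD _ _) (lexx _)) _.
    by move: c1 c2 Sn; rewrite /S; clr; lra.
  by move: hk'; rewrite -k0 subr0 => hk'; exact: le_trans hk' m1.
have g_conv x : I' x -> conv_along S (fun n => g 0%N (tn n)) (g 0%N t0) x.
  move=> I'x e e0; have l0 := len_gt0 hK (t0 0) I'x.1.
  have [n0 hn0] := sf_conv x I'x _ (divr_gt0 e0 l0).
  exists n0 => n nn0 Sn; rewrite g0 tn0 -mulrBl normrM (gtr0_norm l0) -ler_pdivlMr//; exact: hn0.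
have gq_conv := chain_conv Iconv Iacc hg tnA t0A g_conv qM I'a.
pose u b := sf t0 b * len K (xi j) b.
have t00 : t0 0 = xi j by rewrite /t0 add0r.
exists u; split.
- exact: (coord_of_lift hI defI hr hr' hK xiA (sf_lift _ t0A)).
- have l0 := len_gt0 hK (xi j) Ia.
  (* The limit branch is a limit of values in the closed interval [[0, 1]], so it may end up at
     either end but not outside. *)
  have lim (e : R) : 0 < e -> exists2 x : R, 0 <= x <= 1 & `|x - sf t0 a| <= e.
    move=> e0; have [n0 hn0] := sf_conv a I'a e e0; have [n [nn0 Sn]] := S_inf n0.
    by exists (sf (tn n) a); [rewrite sf_tn sp01|exact: hn0].
  have s0 : 0 <= sf t0 a.
    apply/ler_addgt0Pr => e /lim[x hx]; rewrite ler_norml => h; move: hx h; clr; lra.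
  have s1 : sf t0 a <= 1.
    apply/ler_addgt0Pr => e /lim[x hx]; rewrite ler_norml => h; move: hx h; clr; lra.
  by rewrite /u mulr_ge0 ?(ltW l0)//= -[X in _ <= X]mul1r ler_pM2r.
have -> : deriven_on I q u a = g q t0 a.
  by apply: (chain_deriven Iacc hg t0A _ qM I'a) => b _; rewrite g0 t00.
apply/ler_addgt0Pr => e e0; have [n0 hn0] := gq_conv e e0; have [n [nn0 Sn]] := S_inf n0.
have [_ _ hc] := hU _ (tnA n) (tnP n).
have E : deriven_on I q (U (tn n)) a = g q (tn n) a.
  apply: (chain_deriven Iacc hg (tnA n) _ qM I'a) => b [Ib _].
  by rewrite g0 sf_tn /sp asboolT// divfK// lenN0.
rewrite E in hc; have := hn0 n nn0 Sn; rewrite distrC => h.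
by have := ler_normD (g q t0 a - g q (tn n) a) (g q (tn n) a); rewrite subrK; move: hc h; clr; lra.
Qed.

End bound.

Theorem corollary6p4 (R : realType) (m : nat) (hm : (3 <= m)%N)
    (al ar : \bar R) (hI : (al < ar)%E) (I : set R)
    (defI : I = [set a : R | (al <= a%:E)%E /\ (a%:E <= ar)%E])
    (r r' : nat) (hr : (2 <= r)%N) (hr' : (2 <= r')%N)
    (K : billiard_family R m) (hK : billiard_deformation K r r' I)
    (xi : int -> 'I_m) (hxi : admissible_code xi) (j : int) :
  [/\ exists u : R -> R, is_arclength_coord K I xi j u,
      forall u : R -> R, is_arclength_coord K I xi j u ->
        Cn_on I (minn (r - 1) (r' - 1)) u
    & forall (q : nat) (a c : R),
        (1 <= q <= minn (r - 1) (r' - 1))%N -> I a ->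
        (forall (eta : int -> 'I_m) (i : int),
          admissible_code eta -> periodic_code eta ->
          coord_derive_le K I eta i q a c) ->
        coord_derive_le K I xi j q a c].
Proof.
split.
- exact: (coord_exists hI defI hr hr' hK j hxi).
- by move=> u; exact: (coord_Cn hI defI hr hr' hK hxi).
- by move=> q a c; exact: (coord_bound hm hI defI hr hr' hK j hxi).
Qed.
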